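(* Let $\beta$, $W$, $(\theta_N)$ satisfy the standing assumptions (1)--(3) of the context, and let $A_N$ and $\boldsymbol\sigma=(\sigma_1,\ldots,\sigma_N)$ be the random graph adjacency matrix and Ising spins defined there. Let $k\ge 1$ and let $f_1,\ldots,f_k:[0,1]\to\mathbb R$ be Riemann integrable. Then the conditional law of $$\big(\sigma_N(f_1),\ldots,\sigma_N(f_k)\big)$$ given $A_N$, viewed as a random probability measure on $\mathbb R^k$, converges weakly in probability, as $N\to\infty$, to the Gaussian law $\mathcal N_k(\boldsymbol 0,\Sigma)$, where $$\Sigma_{ij}=\left\langle f_i,(I-\beta T_W)^{-1}f_j\right\rangle ,\qquad 1\le i,j\le k .$$ In particular, $\big(\sigma_N(f_1),\ldots,\sigma_N(f_k)\big)\to\mathcal N_k(\boldsymbol 0,\Sigma)$ in distribution (unconditionally).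
   Context: A graphon is a symmetric measurable function $W:[0,1]^2\to[0,1]$; $T_W:L^2[0,1]\to L^2[0,1]$ is $(T_Wf)(x)=\int_0^1W(x,y)f(y)\,dy$, and $\|W\|_{\mathrm{op}}:=\|T_W\|_{\mathrm{op}}$ is its $L^2\to L^2$ operator norm. $\langle f,g\rangle=\int_0^1 f(x)g(x)\,dx$. Random graph: for $N\ge1$ and $\theta_N\in(0,1]$, $A_N=(A_N(i,j))_{1\le i,j\le N}$ is a symmetric $\{0,1\}$-valued random matrix whose entries $A_N(i,j)$, $1\le i\le j\le N$, are independent with $A_N(i,j)\sim\mathrm{Bernoulli}\big(\theta_N W(\tfrac iN,\tfrac jN)\big)$ (diagonal included). The matrices $A_N$, $N\ge1$, are defined on a common probability space. Ising model: conditional on $A_N$, $\boldsymbol\sigma=(\sigma_1,\ldots,\sigma_N)\in\{-1,1\}^N$ has law with probability mass function proportional to $\boldsymbol\sigma\mapsto\exp\big\{\frac{\beta}{2N\theta_N}\sum_{i,j=1}^NA_N(i,j)\sigma_i\sigma_j\big\}$. Standing assumptions: (1) $0<\beta<1/\|W\|_{\mathrm{op}}$. (2) $W$ and the diagonal map $x\mapsto W(x,x)$ are Riemann integrable, and $\int_{[0,1]^2}W>0$. (3) There is $c>0$ with $N^{2/3}\theta_N\ge c$ for all sufficiently large $N$, and $\theta_N\to\theta$ for some $\theta\in[0,1]$. Linear statistic: $\sigma_N(f)=\frac1{\sqrt N}\sum_{i=1}^N f(\tfrac iN)\sigma_i$. Weak convergence in probability: for a Polish space $\mathcal S$, random elements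 $\mu_N$ of $\mathcal P(\mathcal S)$ (Borel probability measures with the topology of weak convergence) converge weakly in probability to a deterministic $\mu\in\mathcal P(\mathcal S)$ if $\mathbb P(\mu_N\in U)\to1$ for every open $U\subset\mathcal P(\mathcal S)$ containing $\mu$; equivalently $d(\mu_N,\mu)\to0$ in probability for any metric $d$ metrizing weak convergence. *)

(* Defs.v *)
From HB Require Import structures.
From mathcomp Require Import all_boot all_order all_algebra.
From mathcomp Require Import all_classical all_reals all_analysis.

Set Implicit Arguments.
Unset Strict Implicit.
Unset Printing Implicit Defensive.

Import Order.TTheory GRing.Theory Num.Theory.
Import numFieldNormedType.Exports.

Local Open Scope classical_set_scope.
Local Open Scope ring_scope.

(* Functions on [0,1] and [0,1]^2 are total functions on the line and the plane
   of which only the values on [0,1] and [0,1]^2 are ever used. *)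

Section riemann.
Context {R : realType}.

(* For a partition 0 < s_0 < ... < s_n = 1 in the sense of [itv_partition]
   (the left end point is not listed), the k-th cell and its length. *)
Definition cell (s : seq R) (k : nat) : set R :=
  `[nth 0 (0 :: s) k, nth 0 s k].
Definition cell_length (s : seq R) (k : nat) : R :=
  nth 0 s k - nth 0 (0 :: s) k.

(* The sum is the upper minus the lower Darboux sum of f along s. *)
Definition riemann_integrable (f : R -> R) : Prop :=
  (exists M, forall x, `[0, 1]%classic x -> `|f x| <= M) /\
  forall e, 0 < e -> exists2 s, itv_partition 0 1 s &
    \sum_(k < size s)
      (sup (f @` cell s k) - inf (f @` cell s k)) * cell_length s k < e.

Definition riemann_integrable2 (W : R -> R -> R) : Prop :=
  (exists M, forall x y, `[0, 1]%classic x -> `[0, 1]%classic y ->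
     `|W x y| <= M) /\
  forall e, 0 < e -> exists s t, [/\ itv_partition 0 1 s, itv_partition 0 1 t &
    \sum_(k < size s) \sum_(l < size t)
      (sup [set W x y | x in cell s k & y in cell t l] -
       inf [set W x y | x in cell s k & y in cell t l]) *
      (cell_length s k * cell_length t l) < e].

End riemann.

Section graphon_operator.
Context {R : realType}.
Local Notation mu := (@lebesgue_measure R).
Local Notation I01 := (`[0%R, 1%R]%classic : set R).

Definition graphon (W : R -> R -> R) : Prop :=
  [/\ measurable_fun (I01 `*` I01) (fun z : R * R => W z.1 z.2),
      forall x y, `[0, 1]%classic x -> `[0, 1]%classic y -> 0 <= W x y <= 1 &
      forall x y, `[0, 1]%classic x -> `[0, 1]%classic y -> W x y = W y x].

Definition graphon_integral (W : R -> R -> R) : \bar R :=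
  (\int[mu \x mu]_(z in I01 `*` I01) (W z.1 z.2)%:E)%E.

Definition L2 (f : R -> R) : Prop := f \_ `[0, 1] \in Lfun mu 2%:E.
Definition norm2 (f : R -> R) : R := fine 'N[mu]_2%:E[EFin \o (f \_ `[0, 1])].
Definition dotp (f g : R -> R) : R := \int[mu]_(x in `[0, 1]) (f x * g x).

Definition TW (W : R -> R -> R) (f : R -> R) : R -> R :=
  fun x => \int[mu]_(y in `[0, 1]) (W x y * f y).

Definition opnorm (W : R -> R -> R) : R :=
  sup [set norm2 (TW W f) | f in [set f | L2 f /\ norm2 f <= 1]].

(* (I - beta T_W)^-1 f: a representative g of the class in L^2[0,1] such that
   (I - beta T_W) g = f in L^2[0,1], i.e. almost everywhere. When
   0 < beta < 1 / opnorm W this class exists and is unique. Here f need not be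
   Borel: a Riemann integrable f is only almost everywhere equal to a Borel
   function. *)
Definition resolvent (beta : R) (W : R -> R -> R) (f : R -> R) : R -> R :=
  xget (cst 0) [set g | L2 g /\
    {ae mu, forall x, `[0, 1]%classic x -> g x - beta * TW W g x = f x}].

Definition limit_cov (beta : R) (W : R -> R -> R) (k : nat)
    (f : 'I_k -> R -> R) : 'M[R]_k :=
  \matrix_(i, j) dotp (f i) (resolvent beta W (f j)).

End graphon_operator.

Section weak_topology.
Context (R : realType) (S : ptopologicalType).

Definition borelType := g_sigma_algebraType (@open S).

Definition bcont := {h : S -> R | continuous h /\ bounded_fun h}.

Definition integral_bcont (m : probability borelType R) : {ptws bcont -> R} :=
  fun h => \int[m]_x (sval h x).

(* P(S) with the coarsest topology making m |-> \int h dm continuous for every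
   bounded continuous h. *)
Definition wprob := initial_topology integral_bcont.

Definition cvg_weakly_in_probability d (T : measurableType d)
    (P : probability T R) (m : nat -> T -> wprob) (m0 : wprob) : Prop :=
  forall U : set wprob, open U -> U m0 ->
    (fun N => P [set w | U (m N w)]) @ \oo --> 1%E.

End weak_topology.

Section gaussian.
Context {R : realType} {k : nat}.

(* The law N(m, v) on the line; [normal_prob] takes the standard deviation and
   does not cover the degenerate case. *)
Definition normal1 (m v : R) (B : set R) : \bar R :=
  if v == 0 then \d_m B else normal_prob m (Num.sqrt v) B.

(* The law N_k(m, Sigma), possibly degenerate: every linear form t has law
   N(<m, t>, t Sigma t^T). *)
Definition is_gaussian (m : 'rV[R]_k) (Sigma : 'M[R]_k)
    (g : probability (borelType 'rV[R]_k) R) : Prop :=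
  Sigma^T = Sigma /\
  forall t : 'rV[R]_k, 0 <= (t *m Sigma *m t^T) 0 0 /\
    forall B : set R, measurable B ->
      g [set x : 'rV[R]_k | B ((x *m t^T) 0 0)] =
      normal1 ((m *m t^T) 0 0) ((t *m Sigma *m t^T) 0 0) B.

End gaussian.

Section probability_preliminaries.
Context {d : measure_display} {T : measurableType d} {R : realType}.

Definition independent_family (P : probability T R) (I : finType)
    d' (E : measurableType d') (X : I -> {RV P >-> E}) : Prop :=
  forall (J : {set I}) (B : I -> set E), (forall i, measurable (B i)) ->
    P (\bigcap_(i in [set` J]) (X i @^-1` B i)) =
    (\prod_(i in J) P (X i @^-1` B i))%E.

(* Elementary conditional probability P( . | E); it is P when P E = 0. *)
Definition cond_prob (P : probability T R) (E : set T) (mE : measurable E) :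
  probability T R := mnormalize (mrestr P mE) P.

Lemma measurable_level (I : finType) (X : I -> {mfun T >-> bool})
    (a : I -> bool) : measurable [set w | forall i, X i w = a i].
Proof.
have -> : [set w | forall i, X i w = a i] =
    \bigcap_(i in [set: I]) (X i @^-1` [set a i]).
  by apply/seteqP; split=> w /= h i; [move=> _; exact: h|exact: h].
apply: fin_bigcap_measurable => [|i _]; first exact: finite_finset.
by rewrite -[X in measurable X]setTI; exact: measurable_funP.
Qed.

Lemma measurable_finite_comp (I : finType) (X : I -> {mfun T >-> bool})
    d' (E : measurableType d') (F : {ffun I -> bool} -> E) :
  measurable_fun setT (fun w => F [ffun i => X i w]).
Proof.
move=> _ B _; rewrite setTI.
have -> : (fun w => F [ffun i => X i w]) @^-1` B =
    \bigcup_(s in [set s : {ffun I -> bool} | B (F s)])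
      [set w | forall i, X i w = s i].
  apply/seteqP; split=> [w /= Bw|w [s /= Bs Xs]].
    by exists [ffun i => X i w] => // i; rewrite ffunE.
  by rewrite /= (_ : [ffun i => X i w] = s)//; apply/ffunP => i; rewrite ffunE.
apply: fin_bigcup_measurable => [|s _]; first exact: finite_finset.
exact: measurable_level.
Qed.

End probability_preliminaries.

Section ising.
Context {d : measure_display} {T : measurableType d} {R : realType}.
Context (P : probability T R).

(* The vertex i : 'I_N, numbered from 0, sits at (i + 1) / N. *)
Definition site (N : nat) (i : 'I_N) : R := i.+1%:R / N%:R.

(* Spins in {-1, 1} are encoded by booleans. *)
Definition spin (b : bool) : R := if b then 1 else -1.

Definition random_graph (W : R -> R -> R) (theta : R) (N : nat)
    (A : 'I_N -> 'I_N -> {RV P >-> bool}) : Prop :=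
  [/\ forall i j w, A i j w = A j i w,
      independent_family
        (fun p : {p : 'I_N * 'I_N | (p.1 <= p.2)%N} => A (val p).1 (val p).2) &
      forall (i j : 'I_N) (B : set bool), (i <= j)%N ->
        distribution P (A i j) B =
        bernoulli_prob (theta * W (site i) (site j)) B].

Definition gibbs_weight (beta theta : R) (N : nat) (a : 'M[bool]_N)
    (s : {ffun 'I_N -> bool}) : R :=
  expR (beta / (2 * N%:R * theta) *
        \sum_(i < N) \sum_(j < N) (a i j)%:R * spin (s i) * spin (s j)).

Definition gibbs (beta theta : R) (N : nat) (a : 'M[bool]_N)
    (s : {ffun 'I_N -> bool}) : R :=
  gibbs_weight beta theta a s / \sum_t gibbs_weight beta theta a t.

Definition graph_event (N : nat) (A : 'I_N -> 'I_N -> {RV P >-> bool})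
    (a : 'M[bool]_N) : set T :=
  [set w | forall p : 'I_N * 'I_N, A p.1 p.2 w = a p.1 p.2].

Lemma measurable_graph_event (N : nat) (A : 'I_N -> 'I_N -> {RV P >-> bool})
    (a : 'M[bool]_N) : measurable (graph_event A a).
Proof.
exact: (measurable_level (fun p : 'I_N * 'I_N => A p.1 p.2)
                         (fun p => a p.1 p.2)).
Qed.

(* The conditional probability given A_N = a. *)
Definition given_graph (N : nat) (A : 'I_N -> 'I_N -> {RV P >-> bool})
    (a : 'M[bool]_N) : probability T R :=
  cond_prob P (measurable_graph_event A a).

Definition ising_spins (beta theta : R) (N : nat)
    (A : 'I_N -> 'I_N -> {RV P >-> bool}) (sigma : 'I_N -> {RV P >-> bool}) :
    Prop :=
  forall a : 'M[bool]_N, P (graph_event A a) != 0%E ->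
  forall s : {ffun 'I_N -> bool},
    given_graph A a [set w | forall i, sigma i w = s i] =
    (gibbs beta theta a s)%:E.

(* (sigma_N(f_1), ..., sigma_N(f_k)) at the configuration s. *)
Definition stat_vector (k : nat) (f : 'I_k -> R -> R) (N : nat)
    (s : {ffun 'I_N -> bool}) : borelType 'rV[R]_k :=
  \row_(j < k) ((Num.sqrt N%:R)^-1 * \sum_(i < N) f j (site i) * spin (s i)).

Definition linear_stats (k : nat) (f : 'I_k -> R -> R) (N : nat)
    (sigma : 'I_N -> {RV P >-> bool}) : T -> borelType 'rV[R]_k :=
  fun w => stat_vector f [ffun i => sigma i w].

HB.instance Definition _ (k : nat) (f : 'I_k -> R -> R) (N : nat)
    (sigma : 'I_N -> {RV P >-> bool}) :=
  isMeasurableFun.Build _ _ _ _ (linear_stats f sigma)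
    (measurable_finite_comp sigma (@stat_vector k f N)).

Definition stats_law (k : nat) (f : 'I_k -> R -> R) (N : nat)
    (sigma : 'I_N -> {RV P >-> bool}) : wprob R 'rV[R]_k :=
  distribution P (linear_stats f sigma).

(* The conditional law of the linear statistics given A_N, a random element
   of P(R^k). *)
Definition stats_law_given_graph (k : nat) (f : 'I_k -> R -> R) (N : nat)
    (A : 'I_N -> 'I_N -> {RV P >-> bool}) (sigma : 'I_N -> {RV P >-> bool})
    (w : T) : wprob R 'rV[R]_k :=
  distribution (given_graph A (\matrix_(i, j) A i j w)) (linear_stats f sigma).

End ising.

(* Main.v *)
(** Let y = beta / (N theta) and t = tanh y. Since exp (y a s) is proportional to
    1 + t a s for a in {0, 1} and s = +-1, a Gibbs average given A is a ratio
    Z(h) / Z(1), where Z(h) is the average of h * prod_(i < j) (1 + t A_ij s_i s_j)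
    over uniform spins. The mean of Z(h) over the graph is, up to a constant, the
    average of h * exp (s C s / 2), with C_ij close to beta W(i/N, j/N) / N off the
    diagonal. In the second moment of Z(h), two replicas s and s' are coupled by
    exp (sum_(i < j) r_ij (s_i s'_i) (s_j s'_j)) with r_ij = O(y / N); as y -> 0,
    this factor is close to 1 in mean, so that Z(h) concentrates.

    All averages of exponentials of quadratic forms are bounded by integrating out
    the spins one at a time, using cosh x <= exp (x^2 / 2); the form s C s is at
    most rho |s|^2 with rho < 1 because beta ||W|| < 1. Under the weight
    exp (s C s / 2), flipping one spin gives an approximate integration by parts,
    whence u |-> E cos (u <F, s>) satisfies phi' = - u v phi up to O(N^(-1/2)), with
    v = <F, (1 - C)^-1 F>. Riemann integrability turns v into
    <f, (1 - beta T_W)^-1 f>, and trigonometric polynomials together with a second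
    moment bound pass from characteristic functions to weak convergence. *)

Require Import Defs.
From HB Require Import structures.
From mathcomp Require Import all_boot all_order all_algebra.
From mathcomp Require Import all_classical all_reals all_analysis.
From mathcomp Require Import measurable_realfun.
From mathcomp Require Import ring lra.

Set Implicit Arguments.
Unset Strict Implicit.
Unset Printing Implicit Defensive.

Import Order.TTheory GRing.Theory Num.Theory.
Import numFieldNormedType.Exports.

Local Open Scope classical_set_scope.
Local Open Scope ring_scope.

(** * Elementary inequalities for hyperbolic and trigonometric functions *)

Section calculus.
Context {R : realType}.

(** The delicate step is the second moment: under two Gibbs weights the product s s' of the replicas
    is not uniform, and uniform bounds hold only for powers of the weights slightly above one,
    within the gap [1 - beta * opnorm W]. A Young inequality adapted to this gap separates a raised
    power of the weights from a high power of the replica error; the latter is averaged over uniform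
    replicas, whose product is uniform. The error involves a form with entries O(y / N); any fixed
    multiple of it is eventually at high temperature, so Bernoulli's inequality brings its
    exponential mean down to 1. Numerator and partition function are rescaled by one deterministic
    constant, after which the latter has mean at least 1 by Jensen, so that their ratio is stable. A
    Riemann integrable function may fail to be Borel; it is replaced by a Borel version, and
    integrals are compared off a null set at the level of simple functions. The approximating
    trigonometric polynomials are Bernstein polynomials in sines of the coordinates: they keep the
    supremum bound on the whole space, so tightness controls the error outside a cube. *)

Lemma ger0_of_derive (f df : R -> R) (x : R) : 0 <= x -> 0 <= f 0 ->
  (forall y : R, is_derive y (1 : R) f (df y)) -> (forall y, 0 <= y -> 0 <= df y) -> 0 <= f x.
Proof.
rewrite le_eqVlt => /predU1P[<-//|x0] f0 dfE df0.
have cf : {within `[0, x], continuous f}.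
  apply: derivable_within_continuous => y _; exact: (@ex_derive _ _ _ _ _ _ _ (dfE y)).
have [c + e] := MVT x0 (fun y _ => dfE y) cf.
rewrite in_itv/= => /andP[c0 cx].
rewrite -(subrK (f 0) (f x)) e addr_ge0// mulr_ge0 ?df0 ?(ltW c0)//.
by rewrite subr0 ltW.
Qed.

Definition ch (x : R) := (expR x + expR (- x)) / 2.
Definition sh (x : R) := (expR x - expR (- x)) / 2.

Lemma is_derive_ch (x : R) : is_derive x 1 ch (sh x).
Proof. by rewrite /ch; apply: is_derive_eq; rewrite /sh /GRing.scale/=; field. Qed.

Lemma is_derive_sh (x : R) : is_derive x 1 sh (ch x).
Proof. by rewrite /sh; apply: is_derive_eq; rewrite /ch /GRing.scale/=; field. Qed.

#[local] Existing Instance is_derive_ch.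
#[local] Existing Instance is_derive_sh.

Lemma ch_ge1 (x : R) : 1 <= ch x.
Proof. by rewrite /ch; have := expR_ge1Dx x; have := expR_ge1Dx (- x); lra. Qed.

Lemma sh0 : sh 0 = 0. Proof. by rewrite /sh oppr0 subrr mul0r. Qed.
Lemma ch0 : ch 0 = 1. Proof. by rewrite /ch oppr0 expR0; field. Qed.
Lemma shN (x : R) : sh (- x) = - sh x. Proof. by rewrite /sh opprK; field. Qed.
Lemma chN (x : R) : ch (- x) = ch x. Proof. by rewrite /ch opprK addrC. Qed.

Lemma sh_ge (x : R) : 0 <= x -> x <= sh x.
Proof.
move=> x0; rewrite -subr_ge0.
apply: (@ger0_of_derive (fun x : R => sh x - x) (fun x : R => ch x - 1)) => //.
- by rewrite sh0 subr0.
- by move=> y _; rewrite subr_ge0 ch_ge1.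
Qed.

Lemma sh_le (x : R) : 0 <= x -> sh x <= x * ch x.
Proof.
move=> x0; rewrite -subr_ge0.
apply: (@ger0_of_derive (fun x : R => x * ch x - sh x) (fun x : R => x * sh x)) => //.
- by rewrite sh0 mul0r subr0.
- by move=> y; apply: is_derive_eq; rewrite /GRing.scale/=; ring.
- by move=> y y0; rewrite mulr_ge0// (le_trans y0)// sh_ge.
Qed.

(** The function [exp (- x^2 / 2) * ch x] decreases on [x >= 0]: its derivative is a positive
    multiple of [sh x - x * ch x]. *)
Lemma ch_le_gauss_pos (x : R) : 0 <= x -> ch x <= expR (x ^+ 2 / 2).
Proof.
move=> x0.
suff : 0 <= 1 - expR (- (x ^+ 2 / 2)) * ch x.
  rewrite subr_ge0 expRN -ler_pdivlMl ?invr_gt0 ?expR_gt0// invrK.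
  by rewrite mulr1.
apply: (@ger0_of_derive (fun x => 1 - expR (- (x ^+ 2 / 2)) * ch x)
  (fun x => expR (- (x ^+ 2 / 2)) * (x * ch x - sh x))) => //.
- by rewrite ch0 mulr1 expr0n/= mul0r oppr0 expR0 subrr.
- by move=> y; apply: is_derive_eq; rewrite /GRing.scale/=; field.
- by move=> y y0; rewrite mulr_ge0 ?expR_ge0// subr_ge0 sh_le.
Qed.

Lemma ch_le_gauss (x : R) : ch x <= expR (x ^+ 2 / 2).
Proof.
case: (leP 0 x) => x0; first exact: ch_le_gauss_pos.
by rewrite -chN -sqrrN ch_le_gauss_pos// oppr_ge0 ltW.
Qed.

(** For [m >= 0] the difference is at most [m * ch m] and at most [m * (ch m - 1)]. The first
    suffices when [2 m >= 1]; otherwise [ch m <= exp (2 m) <= 1 / (1 - 2 m)] makes the second small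
    enough. *)
Lemma sh_approx (m : R) : `|sh m - m * ch m| <= 2 * m ^+ 2 * ch m.
Proof.
wlog m0 : m / 0 <= m.
  move=> H; case: (leP 0 m) => m0; first exact: H.
  have := H (- m); rewrite oppr_ge0 ltW// shN chN sqrrN -normrN => /(_ isT).
  by rewrite (_ : - (- sh m - - m * ch m) = sh m - m * ch m)//; ring.
have c1 := ch_ge1 m; have s1 := sh_ge m0; have s2 := sh_le m0.
rewrite ler0_norm ?subr_le0// opprB.
have [m1|m1] := leP 1 (2 * m).
  apply: (@le_trans _ _ (m * ch m)); first by rewrite gerBl (le_trans m0).
  rewrite ler_wpM2r ?(le_trans _ c1)//.
  by rewrite expr2 mulrA -{1}(mul1r m) ler_wpM2r.
have e1 : ch m * (1 - 2 * m) <= 1.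
  have h1 : ch m <= expR (2 * m).
    rewrite /ch ler_pdivrMr// mulr2n mulrDl mul1r expRD -/(expR m).
    have := expR_ge1Dx m; have : expR (- m) <= 1 by rewrite expR_le1 oppr_le0.
    move=> a b. nra.
  have h2 : 1 - 2 * m <= expR (- (2 * m)) by have := expR_ge1Dx (- (2 * m)); lra.
  rewrite -[leRHS](expRxMexpNx_1 (2 * m)).
  by apply: ler_pM; rewrite // ?(le_trans ler01 c1)// subr_ge0 ltW.
have : m * (ch m * (1 - 2 * m)) <= m * 1 by rewrite ler_wpM2l.
lra.
Qed.

Lemma abs_sh_le (m : R) : `|sh m| <= `|m| * ch m.
Proof.
wlog m0 : m / 0 <= m.
  move=> H; case: (leP 0 m) => m0; first exact: H.
  by have := H (- m); rewrite oppr_ge0 ltW// shN chN !normrN; exact.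
by rewrite !ger0_norm ?sh_le// (le_trans m0)// sh_ge.
Qed.

Lemma abs_sh_le_ch (m : R) : `|sh m| <= ch m.
Proof. by rewrite ler_norml /sh /ch; have := expR_gt0 m; have := expR_gt0 (- m); lra. Qed.

Lemma abs_sin_le (x : R) : `|sin x| <= `|x|.
Proof.
wlog x0 : x / 0 <= x.
  move=> H; case: (leP 0 x) => x0; first exact: H.
  by have := H (- x); rewrite oppr_ge0 ltW// sinN !normrN; exact.
rewrite (ger0_norm x0) ler_norml -!(subr_ge0 _ x) -(subr_ge0 (- x)) opprK.
apply/andP; split.
  apply: (@ger0_of_derive (fun x : R => sin x + x) (fun x : R => cos x + 1));
    [by []|by rewrite sin0 addr0|].
  by move=> y _; rewrite -lerBlDr sub0r cos_geN1.
apply: (@ger0_of_derive (fun x : R => x - sin x) (fun x : R => 1 - cos x));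
  [by []|by rewrite sin0 subrr|].
by move=> y _; rewrite subr_ge0 cos_le1.
Qed.

Lemma sin_sub_xcos (x : R) : `|sin x - x * cos x| <= x ^+ 2.
Proof.
wlog x0 : x / 0 <= x.
  move=> H; case: (leP 0 x) => x0; first exact: H.
  have := H (- x); rewrite oppr_ge0 ltW// sinN cosN sqrrN -normrN => /(_ isT).
  by rewrite (_ : - (- sin x - - x * cos x) = sin x - x * cos x)//; ring.
rewrite ler_norml -!(subr_ge0 _ (x ^+ 2)) -(subr_ge0 (- x ^+ 2)) opprK.
apply/andP; split.
  apply: (@ger0_of_derive (fun x : R => sin x - x * cos x + x ^+ 2)
    (fun x : R => 2 * x + x * sin x)) => //.
  - by rewrite sin0 mul0r expr0n/= subrr addr0.
  - by move=> y; apply: is_derive_eq; rewrite /GRing.scale/=; ring.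
  - by move=> y y0; have := sin_geN1 y; nra.
apply: (@ger0_of_derive (fun x : R => x ^+ 2 - (sin x - x * cos x))
    (fun x : R => 2 * x - x * sin x)) => //.
- by rewrite sin0 mul0r expr0n/= !subrr.
- by move=> y; apply: is_derive_eq; rewrite /GRing.scale/=; ring.
- by move=> y y0; have := sin_le1 y; nra.
Qed.

(* The two configurations that differ by the spin at one site, where m is the
   local field there and k its coefficient in the argument of sin. *)
Lemma stein_pair (m x k : R) :
  `|(1 - m) * (sin (x + k) * expR m) + (-1 - m) * (sin (x - k) * expR (- m)) -
    k * (cos (x + k) * expR m + cos (x - k) * expR (- m))| <=
  3 * (m ^+ 2 + k ^+ 2) * (expR m + expR (- m)).
Proof.
have eE : expR m = ch m + sh m by rewrite /ch /sh; field.
have eNE : expR (- m) = ch m - sh m by rewrite /ch /sh; field.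
rewrite eE eNE sinB sinD cosB cosD.
set e := (X in `|X|).
(* The addition formulas leave four terms, each of second order in [(m, k)]; the first two contain
   the Taylor errors [sin k - k * cos k] and [sh m - m * ch m]. *)
have -> : e = 2 * (ch m * (cos x * (sin k - k * cos k))) +
    2 * (sin x * cos k * (sh m - m * ch m)) +
    2 * (- (cos x * (m * sh m * sin k))) + 2 * (sin x * (k * sh m * sin k)).
  by rewrite /e; ring.
have c1 := le_trans ler01 (ch_ge1 m).
have bnd (a b c : R) : `|a| <= 1 -> `|b| <= c -> `|2 * (a * b)| <= 2 * c.
  move=> a1 bc; rewrite normrM (@ger0_norm _ 2)// ler_pM2l// normrM.
  by rewrite -(mul1r c) ler_pM.
have h1 : `|2 * (ch m * (cos x * (sin k - k * cos k)))| <= 2 * (k ^+ 2 * ch m).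
  rewrite [X in `|X|](_ : _ = 2 * (cos x * (ch m * (sin k - k * cos k)))); last by ring.
  apply: bnd; first exact: cos_max.
  by rewrite normrM (ger0_norm c1) mulrC ler_wpM2r// sin_sub_xcos.
have h2 : `|2 * (sin x * cos k * (sh m - m * ch m))| <= 2 * (2 * m ^+ 2 * ch m).
  apply: bnd; last exact: sh_approx.
  by rewrite normrM -(mul1r 1) ler_pM ?sin_max ?cos_max.
have h3 : `|2 * (- (cos x * (m * sh m * sin k)))| <= 2 * (m ^+ 2 * ch m).
  rewrite mulrN normrN; apply: bnd; first exact: cos_max.
  rewrite normrM -[leRHS]mulr1 ler_pM ?sin_max// normrM.
  by rewrite -(real_normK (num_real m)) expr2 -mulrA ler_wpM2l// abs_sh_le.
have h4 : `|2 * (sin x * (k * sh m * sin k))| <= 2 * (k ^+ 2 * ch m).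
  apply: bnd; first exact: sin_max.
  rewrite -(real_normK (num_real k)) expr2 (normrM _ (sin k)) (normrM k).
  rewrite -!mulrA ler_wpM2l// mulrC.
  by apply: ler_pM; rewrite ?abs_sin_le ?abs_sh_le_ch.
apply: (le_trans (ler_normD _ _)).
apply: (@le_trans _ _ (2 * (k ^+ 2 * ch m) + 2 * (2 * m ^+ 2 * ch m) +
   2 * (m ^+ 2 * ch m) + 2 * (k ^+ 2 * ch m))).
  apply: lerD h4; apply: (le_trans (ler_normD _ _)).
  by apply: lerD h3; apply: (le_trans (ler_normD _ _)); exact: lerD.
have := mulr_ge0 (sqr_ge0 k) c1; lra.
Qed.

Lemma sum_cauchy_schwarz I (r : seq I) (a b : I -> R) :
  (\sum_(i <- r) a i * b i) ^+ 2 <=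
  (\sum_(i <- r) a i ^+ 2) * (\sum_(i <- r) b i ^+ 2).
Proof.
elim: r => [|i r IH]; first by rewrite !big_nil expr0n mul0r.
rewrite !big_cons; set x := \sum_(_ <- _) _ * _ in IH *.
set p := \sum_(_ <- _) a _ ^+ 2 in IH *; set q := \sum_(_ <- _) b _ ^+ 2 in IH *.
have p0 : 0 <= p by apply: sumr_ge0 => j _; exact: sqr_ge0.
have q0 : 0 <= q by apply: sumr_ge0 => j _; exact: sqr_ge0.
suff : 2 * (a i * b i) * x <= a i ^+ 2 * q + b i ^+ 2 * p by nra.
have [pE|p1] := eqVneq p 0.
  have : x ^+ 2 = 0 by apply/eqP; rewrite eq_le sqr_ge0 andbT; move: IH; rewrite pE mul0r.
  move=> /eqP; rewrite sqrf_eq0 => /eqP ->.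
  by rewrite mulr0 pE mulr0 addr0 mulr_ge0// sqr_ge0.
have p2 : 0 < p by rewrite lt_neqAle eq_sym p1.
rewrite -(ler_pM2l p2).
have := sqr_ge0 (b i * p - a i * x).
have : a i ^+ 2 * x ^+ 2 <= a i ^+ 2 * (p * q) by rewrite ler_wpM2l ?sqr_ge0.
lra.
Qed.

Lemma is_derive_bigsum I (r : seq I) (f : I -> R -> R) (df : I -> R) (x : R) :
  (forall i, is_derive x (1 : R) (f i) (df i)) ->
  is_derive x (1 : R) (fun y : R => \sum_(i <- r) f i y) (\sum_(i <- r) df i).
Proof.
move=> fi; elim: r => [|i r IH].
  rewrite big_nil (_ : (fun _ => _) = cst 0); first exact: is_derive_cst.
  by apply/funext => y; rewrite big_nil.
rewrite big_cons (_ : (fun _ => _) = fun y => f i y + \sum_(i <- r) f i y); last first.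
  by apply/funext => y; rewrite big_cons.
exact: is_deriveD.
Qed.

End calculus.

(** * Averages over spins with quadratic weights *)

Section spin_average.
Context {R : realType}.
Implicit Types (N : nat).

Definition avg N (h : {ffun 'I_N -> bool} -> R) : R := (2 ^+ N)^-1 * \sum_s h s.

Lemma eq_avg N (g h : {ffun 'I_N -> bool} -> R) : g =1 h -> avg g = avg h.
Proof. by move=> e; congr (_ * _); apply: eq_bigr => s _; rewrite e. Qed.

Lemma avgD N (g h : {ffun 'I_N -> bool} -> R) :
  avg (fun s => g s + h s) = avg g + avg h.
Proof. by rewrite /avg big_split mulrDr. Qed.

Lemma avgZ N c (h : {ffun 'I_N -> bool} -> R) :
  avg (fun s => c * h s) = c * avg h.
Proof. by rewrite /avg -mulr_sumr mulrCA. Qed.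

Lemma avgB N (g h : {ffun 'I_N -> bool} -> R) :
  avg (fun s => g s - h s) = avg g - avg h.
Proof. by rewrite /avg big_split sumrN mulrBr. Qed.

Lemma avg_sum N I (r : seq I) (P : pred I) (h : I -> {ffun 'I_N -> bool} -> R) :
  avg (fun s => \sum_(i <- r | P i) h i s) = \sum_(i <- r | P i) avg (h i).
Proof. by rewrite /avg exchange_big/= mulr_sumr. Qed.

Lemma avg_cst N c : avg (fun _ : {ffun 'I_N -> bool} => c) = c.
Proof.
rewrite /avg sumr_const card_ffun card_bool card_ord -[c *+ _]mulr_natl natrX mulrA.
by rewrite mulVf ?mul1r// expf_neq0.
Qed.

Lemma ler_avg N (g h : {ffun 'I_N -> bool} -> R) :
  (forall s, g s <= h s) -> avg g <= avg h.
Proof. by move=> gh; rewrite ler_wpM2l ?invr_ge0 ?exprn_ge0// ler_sum. Qed.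

Lemma avg_ge0 N (h : {ffun 'I_N -> bool} -> R) :
  (forall s, 0 <= h s) -> 0 <= avg h.
Proof. by move=> h0; rewrite mulr_ge0 ?invr_ge0 ?exprn_ge0 ?sumr_ge0. Qed.

Lemma ler_norm_avg N (h : {ffun 'I_N -> bool} -> R) :
  `|avg h| <= avg (fun s => `|h s|).
Proof.
rewrite /avg normrM ger0_norm ?invr_ge0 ?exprn_ge0//.
by rewrite ler_wpM2l ?invr_ge0 ?exprn_ge0// ler_norm_sum.
Qed.

Lemma avg_bij N (g : {ffun 'I_N -> bool} -> {ffun 'I_N -> bool})
    (h : {ffun 'I_N -> bool} -> R) : injective g ->
  avg (fun s => h (g s)) = avg h.
Proof.
by move=> gi; congr (_ * _); rewrite [RHS](reindex_inj gi).
Qed.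

Definition cons_spin N (b : bool) (s : {ffun 'I_N -> bool}) :
    {ffun 'I_N.+1 -> bool} :=
  [ffun i => if unlift ord0 i is Some j then s j else b].

Lemma avg_recl N (h : {ffun 'I_N.+1 -> bool} -> R) :
  avg h = 2^-1 * (avg (fun s => h (cons_spin true s)) +
                  avg (fun s => h (cons_spin false s))).
Proof.
rewrite /avg exprS invfM -mulrA; congr (_ * _); rewrite -mulrDr; congr (_ * _).
rewrite (reindex (fun p : bool * {ffun 'I_N -> bool} => cons_spin p.1 p.2))/=.
  rewrite -(pair_bigA _ (fun b s => h (cons_spin b s)))/=.
  by rewrite big_bool.
exists (fun s => (s ord0, [ffun i => s (lift ord0 i)])) => [[b s] _|s _]/=.
  congr pair; first by rewrite ffunE unlift_none.
  by apply/ffunP => i; rewrite !ffunE liftK.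
apply/ffunP => i; rewrite ffunE.
by case: unliftP => [j ->|->]//; rewrite ffunE.
Qed.

Definition qform N (C : 'M[R]_N) (x : 'I_N -> R) : R :=
  \sum_(i < N) \sum_(j < N) C i j * x i * x j.

Definition sqnorm N (x : 'I_N -> R) : R := \sum_(i < N) x i ^+ 2.

Definition frob N (C : 'M[R]_N) : R := \sum_(i < N) \sum_(j < N) C i j ^+ 2.

Definition spins N (s : {ffun 'I_N -> bool}) : 'I_N -> R := fun i => spin (s i).

Lemma sqnorm_ge0 N (x : 'I_N -> R) : 0 <= sqnorm x.
Proof. by apply: sumr_ge0 => i _; exact: sqr_ge0. Qed.

Lemma frob_ge0 N (C : 'M[R]_N) : 0 <= frob C.
Proof. by apply: sumr_ge0 => i _; apply: sumr_ge0 => j _; exact: sqr_ge0. Qed.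

Lemma qform_recl N (C : 'M[R]_N.+1) (x : 'I_N.+1 -> R) :
  (forall i j, C i j = C j i) ->
  qform C x = C ord0 ord0 * x ord0 ^+ 2 +
    2 * x ord0 * (\sum_(i < N) C ord0 (lift ord0 i) * x (lift ord0 i)) +
    qform (\matrix_(i, j) C (lift ord0 i) (lift ord0 j)) (fun i => x (lift ord0 i)).
Proof.
move=> sC; rewrite /qform big_ord_recl big_ord_recl.
under [X in _ + X]eq_bigr do rewrite big_ord_recl.
rewrite big_split/=.
have -> : \sum_(i < N) C (lift ord0 i) ord0 * x (lift ord0 i) * x ord0 =
    x ord0 * \sum_(i < N) C ord0 (lift ord0 i) * x (lift ord0 i).
  by rewrite mulr_sumr; apply: eq_bigr => i _; rewrite sC mulrC.
have -> : \sum_(i < N) C ord0 (lift ord0 i) * x ord0 * x (lift ord0 i) =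
    x ord0 * \sum_(i < N) C ord0 (lift ord0 i) * x (lift ord0 i).
  by rewrite mulr_sumr; apply: eq_bigr => i _; rewrite mulrA (mulrC (x _)).
under [X in _ = _ + X]eq_bigr do under eq_bigr do rewrite mxE.
ring.
Qed.

Lemma qformD N (C D : 'M[R]_N) x : qform (C + D) x = qform C x + qform D x.
Proof.
rewrite /qform -big_split; apply: eq_bigr => i _.
rewrite -big_split; apply: eq_bigr => j _/=.
by rewrite mxE !mulrDl.
Qed.

Lemma qform_dyad N (b x : 'I_N -> R) :
  qform (\matrix_(i, j) (b i * b j)) x = (\sum_i b i * x i) ^+ 2.
Proof.
rewrite expr2 mulr_suml; apply: eq_bigr => i _.
rewrite mulr_sumr; apply: eq_bigr => j _; rewrite mxE; ring.
Qed.

Lemma frob_dyadD N (C : 'M[R]_N) (b : 'I_N -> R) :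
  frob (C + \matrix_(i, j) (b i * b j)) =
    frob C + 2 * qform C b + sqnorm b ^+ 2.
Proof.
rewrite /frob /qform /sqnorm mulr_sumr expr2 mulr_suml -!big_split.
apply: eq_bigr => i _/=; rewrite !mulr_sumr -!big_split.
by apply: eq_bigr => j _ /=; rewrite !mxE; ring.
Qed.

Lemma frob_recl N (C : 'M[R]_N.+1) :
  (forall i j, C i j = C j i) ->
  frob C = C ord0 ord0 ^+ 2 + 2 * sqnorm (fun i => C ord0 (lift ord0 i)) +
    frob (\matrix_(i, j) C (lift ord0 i) (lift ord0 j)).
Proof.
move=> sC; rewrite /frob big_ord_recl big_ord_recl.
under [X in _ + X]eq_bigr do rewrite big_ord_recl sC.
under [X in _ = _ + X]eq_bigr do under eq_bigr do rewrite mxE.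
by rewrite big_split/= /sqnorm; ring.
Qed.

Lemma spins_cons0 N b (s : {ffun 'I_N -> bool}) :
  spins (cons_spin b s) ord0 = spin b.
Proof. by rewrite /spins ffunE unlift_none. Qed.

Lemma spins_consS N b (s : {ffun 'I_N -> bool}) :
  (fun i => spins (cons_spin b s) (lift ord0 i)) = spins s.
Proof. by apply/funext => i; rewrite /spins ffunE liftK. Qed.

(* Integrating out one spin replaces the remaining couplings C' by C' + b b^T,
   where b is the removed row; this keeps the upper bound rho on the form and
   the right-hand side does not increase. *)
Lemma avg_exp_qform N (C : 'M[R]_N) (rho : R) :
  (forall i j, C i j = C j i) -> (forall i, 0 <= C i i) -> 0 <= rho < 1 ->
  (forall x, qform C x <= rho * sqnorm x) ->
  avg (fun s => expR (2^-1 * qform C (spins s))) <=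
    expR (2^-1 * \sum_i C i i + frob C / (4 * (1 - rho))).
Proof.
move=> sC dC /andP[r0 r1].
elim: N C sC dC => [|N IH] C sC dC bC.
  rewrite (eq_avg (h := fun=> expR 0)); last first.
    by move=> s; rewrite /qform big_ord0 mulr0.
  rewrite avg_cst ler_expR big_ord0 mulr0 add0r divr_ge0 ?frob_ge0//.
  by rewrite mulr_ge0// subr_ge0 ltW.
set c := C ord0 ord0; set b := fun i : 'I_N => C ord0 (lift ord0 i).
set C' := \matrix_(i < N, j < N) C (lift ord0 i) (lift ord0 j).
set C2 := C' + \matrix_(i, j) (b i * b j).
have bC2 x : qform C2 x <= rho * sqnorm x.
  rewrite qformD qform_dyad.
  set t := \sum_i b i * x i.
  (* The removed site receives the value [t], the scalar product of [b] and [x]. The form then gains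
     [2 t^2] but its bound only [rho t^2], which leaves the [t^2] of the dyad. *)
  have := bC (fun i => if unlift ord0 i is Some j then x j else t).
  rewrite qform_recl//.
  rewrite /sqnorm big_ord_recl unlift_none.
  under eq_bigr do rewrite liftK.
  under [X in _ + qform _ X <= _]eq_fun do rewrite liftK.
  under [X in _ <= _ * (_ + X)]eq_bigr do rewrite liftK.
  rewrite -/C' -/(sqnorm _) -/c -/t.
  move=> H.
  have c0 : 0 <= c * t ^+ 2 by rewrite mulr_ge0 ?sqr_ge0 ?dC.
  have : 0 <= (1 - rho) * t ^+ 2 by rewrite mulr_ge0 ?sqr_ge0// subr_ge0 ltW.
  nra.
have sC2 i j : C2 i j = C2 j i by rewrite !mxE sC (mulrC (b i)).
have dC2 i : 0 <= C2 i i by rewrite !mxE addr_ge0 ?dC// -expr2 sqr_ge0.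
have {}IH := IH C2 sC2 dC2 bC2.
have step : avg (fun s => expR (2^-1 * qform C (spins s))) <=
    expR (c / 2) * avg (fun s => expR (2^-1 * qform C2 (spins s))).
  rewrite avg_recl -avgD -!avgZ; apply: ler_avg => s.
  rewrite !qform_recl// !spins_cons0 !spins_consS /spin -/C' -/c.
  rewrite qformD qform_dyad.
  under eq_bigr do rewrite (congr1 (fun f => f _) (spins_consS _ _)).
  under [X in expR _ + expR (2^-1 * (_ + _ * X + _))]eq_bigr do
    rewrite (congr1 (fun f => f _) (spins_consS _ _)).
  rewrite -/b; set m := \sum_(i < N) _.
  have -> : 2^-1 * (c * 1 ^+ 2 + 2 * 1 * m + qform C' (spins s)) =
     (c / 2 + qform C' (spins s) / 2) + m by field.
  have -> : 2^-1 * (c * (-1) ^+ 2 + 2 * -1 * m + qform C' (spins s)) =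
     (c / 2 + qform C' (spins s) / 2) + - m by field.
  rewrite !(expRD (c / 2 + _)) -mulrDr mulrCA.
  rewrite -expRD.
  have -> : c / 2 + 2^-1 * (qform C' (spins s) + m ^+ 2) =
    (c / 2 + qform C' (spins s) / 2) + m ^+ 2 / 2 by field.
  rewrite [leRHS]expRD ler_wpM2l ?expR_ge0//.
  by rewrite mulrC ch_le_gauss.
apply: (le_trans step).
apply: (@le_trans _ _ (expR (c / 2) * expR (2^-1 * (\sum_i C2 i i) + frob C2 / (4 * (1 - rho))))).
  by rewrite ler_wpM2l ?expR_ge0.
rewrite -expRD ler_expR big_ord_recl -/c frob_dyadD frob_recl// -/c -/b -/C'.
have -> : \sum_i C2 i i = \sum_(i < N) C (lift ord0 i) (lift ord0 i) + sqnorm b.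
  by rewrite -big_split; apply: eq_bigr => i _; rewrite !mxE expr2.
have := bC2 b; rewrite qformD qform_dyad.
have -> : \sum_i b i * b i = sqnorm b by apply: eq_bigr => i _; rewrite expr2.
set q := qform C' b; set n := sqnorm b; set T := \sum_(i < N) _; set f := frob C'.
move=> H.
have r1' : 0 < 1 - rho by rewrite subr_gt0.
have K0 : 0 < (4 * (1 - rho))^-1 by rewrite invr_gt0 mulr_gt0.
(* The trace grows by [n], while in the Frobenius norm [2 n] is replaced by [2 q + n^2], which is at
   most [2 rho n]. The factor [4 * (1 - rho)] is exactly what balances [n / 2] against
   [2 (1 - rho) n]. *)
set K := (4 * (1 - rho))^-1 in K0 *.
have HK : K * (4 * (1 - rho)) = 1 by rewrite mulVf// gt_eqF// mulr_gt0.
have n0 : 0 <= n by exact: sqnorm_ge0.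
have H1 : K * (2 * q + n ^+ 2) <= K * (2 * (rho * n)).
  rewrite ler_wpM2l ?(ltW K0)//; have : 0 <= n ^+ 2 by exact: sqr_ge0.
  lra.
have H2 : 0 <= K * c ^+ 2 by rewrite mulr_ge0 ?sqr_ge0 ?ltW.
have H3 : n = n * (K * (4 * (1 - rho))) by rewrite HK mulr1.
lra.
Qed.

Definition lin N (F : 'I_N -> R) (s : {ffun 'I_N -> bool}) : R :=
  \sum_(i < N) F i * spins s i.

Definition weight N (C : 'M[R]_N) (s : {ffun 'I_N -> bool}) : R :=
  expR (2^-1 * qform C (spins s)).

Lemma weight_ge0 N (C : 'M[R]_N) s : 0 <= weight C s.
Proof. exact: expR_ge0. Qed.

(** Here [a] is half of the gap [1 - rho]: a rank-one perturbation of size [a] leaves the gap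
    [1 - (rho + a) = a], whence the [4 * a] in the exponent, and [2 / a] undoes the scaling of the
    linear form. *)
Definition mom_const (rho K : R) : R :=
  let a := (1 - rho) / 2 in
  2 / a * expR (2^-1 * a + (K + 2 * a * rho + a ^+ 2) / (4 * a)).

Lemma mom_const_ge0 (rho K : R) : rho < 1 -> 0 <= mom_const rho K.
Proof.
move=> r1; rewrite /mom_const mulr_ge0 ?expR_ge0// divr_ge0// divr_ge0//.
by rewrite subr_ge0 ltW.
Qed.

(** As [x <= exp x], a small multiple of the squared linear form can be absorbed into the weight as
    a rank-one coupling; [avg_exp_qform] then applies with [rho + a < 1] in place of [rho]. *)
Lemma avg_lin_sqr N (C : 'M[R]_N) (rho K B : R) (g : 'I_N -> R) :
  (forall i j, C i j = C j i) -> (forall i, C i i = 0) -> 0 <= rho < 1 ->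
  (forall x, qform C x <= rho * sqnorm x) -> frob C <= K ->
  0 < B -> sqnorm g <= B ->
  avg (fun s => lin g s ^+ 2 * weight C s) <= mom_const rho K * B.
Proof.
move=> sC dC /andP[r0 r1] bC CK B0 gB.
set a := (1 - rho) / 2.
have a0 : 0 < a by rewrite divr_gt0// subr_gt0.
pose b := fun i => Num.sqrt (a / B) * g i.
have d0 : 0 < a / B by rewrite divr_gt0.
have sb : sqnorm b <= a.
  have -> : sqnorm b = a / B * sqnorm g.
    rewrite /sqnorm mulr_sumr; apply: eq_bigr => i _.
    by rewrite exprMn sqr_sqrtr// ltW.
  by rewrite mulrAC ler_pdivrMr// ler_pM2l.
have sb0 := sqnorm_ge0 b.
have lb s : (\sum_i b i * spins s i) ^+ 2 = a / B * lin g s ^+ 2.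
  rewrite -[in RHS](sqr_sqrtr (ltW d0)) -exprMn /lin mulr_sumr; congr (_ ^+ 2).
  by apply: eq_bigr => i _; rewrite mulrA.
have sCb : (forall i j, (C + \matrix_(i, j) (b i * b j)) i j =
   (C + \matrix_(i, j) (b i * b j)) j i).
  by move=> i j; rewrite !mxE sC (mulrC (b i)).
have dCb : (forall i, 0 <= (C + \matrix_(i, j) (b i * b j)) i i).
  by move=> i; rewrite !mxE dC add0r -expr2 sqr_ge0.
have ra : 1 - (rho + a) = a by rewrite /a; field.
have r01 : 0 <= rho + a < 1.
  by rewrite addr_ge0 ?(ltW a0)//= -subr_gt0 ra.
have bCb : (forall x, qform (C + \matrix_(i, j) (b i * b j)) x <= (rho + a) * sqnorm x).
  move=> x; rewrite qformD qform_dyad mulrDl lerD//.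
  have CS : (\sum_i b i * x i) ^+ 2 <= sqnorm b * sqnorm x.
    exact: sum_cauchy_schwarz.
  by rewrite (le_trans CS)// ler_wpM2r// sqnorm_ge0.
have := avg_exp_qform sCb dCb r01 bCb; rewrite ra => H.
have Hm : avg (fun s => a / (2 * B) * (lin g s ^+ 2 * weight C s)) <=
    expR (2^-1 * a + (K + 2 * a * rho + a ^+ 2) / (4 * a)).
  apply: (le_trans (y := _) _ (le_trans H _)).
    apply: ler_avg => s; rewrite qformD qform_dyad lb mulrDr expRD mulrC -mulrA mulrC.
    rewrite -/(weight C s).
    rewrite [leLHS](_ : _ = weight C s * (lin g s ^+ 2 * (a / (2 * B)))); last by ring.
    rewrite ler_wpM2l ?weight_ge0//.
    rewrite (le_trans _ (expR_ge1Dx _))//.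
    rewrite (_ : lin g s ^+ 2 * (a / (2 * B)) = 2^-1 * (a * (B^-1 * lin g s ^+ 2))).
      by rewrite lerDr.
    by field; rewrite gt_eqF.
  rewrite ler_expR; apply: lerD.
    rewrite ler_pM2l ?invr_gt0//.
    under eq_bigr do rewrite !mxE dC add0r -expr2; exact: sb.
  rewrite ler_wpM2r//; first by rewrite invr_ge0 mulr_ge0// ltW.
  rewrite frob_dyadD.
  have qb := bC b.
  have : rho * sqnorm b <= rho * a by rewrite ler_wpM2l.
  have : sqnorm b ^+ 2 <= a ^+ 2 by rewrite ler_sqr ?nnegrE ?(ltW a0).
  lra.
move: Hm; rewrite avgZ => Hm.
rewrite /mom_const -/a.
set E := expR _ in Hm *.
have -> : 2 / a * E * B = (a / (2 * B))^-1 * E.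
  by field; rewrite !gt_eqF.
by rewrite ler_pdivlMl// divr_gt0// mulr_gt0.
Qed.

Lemma qform_site N (C : 'M[R]_N) (x : 'I_N -> R) (i : 'I_N) :
  (forall i j, C i j = C j i) -> (forall i, C i i = 0) ->
  qform C x = 2 * (x i * \sum_j C i j * x j) +
    \sum_(a | a != i) \sum_(b | b != i) C a b * x a * x b.
Proof.
move=> sC dC; rewrite /qform (bigD1 i)//=.
have -> : \sum_(a | a != i) \sum_b C a b * x a * x b =
    \sum_(a | a != i) (C a i * x a * x i + \sum_(b | b != i) C a b * x a * x b).
  by apply: eq_bigr => a _; rewrite (bigD1 i).
rewrite big_split/= addrA; congr (_ + _).
have -> : \sum_j C i j * x i * x j = x i * \sum_j C i j * x j.
  by rewrite mulr_sumr; apply: eq_bigr => j _; rewrite mulrA (mulrC (x i)).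
have -> : \sum_(a | a != i) C a i * x a * x i = x i * \sum_j C i j * x j.
  rewrite [in RHS](bigD1 i)//= dC mul0r add0r mulr_sumr; apply: eq_bigr => j _.
  by rewrite sC mulrC.
by rewrite mulr2n mulrDl mul1r.
Qed.

Definition flip_spin N (i : 'I_N) (s : {ffun 'I_N -> bool}) :=
  [ffun j => if j == i then ~~ s j else s j].

Lemma flip_spinK N (i : 'I_N) : involutive (flip_spin i).
Proof. by move=> s; apply/ffunP => j; rewrite !ffunE; case: eqP => // _; rewrite negbK. Qed.

Lemma avg_flip N (i : 'I_N) (h : {ffun 'I_N -> bool} -> R) :
  avg h = 2^-1 * avg (fun s => h s + h (flip_spin i s)).
Proof.
rewrite avgD (avg_bij h (can_inj (flip_spinK i))).
by field.
Qed.

Lemma spins_flip N (i : 'I_N) s : spins (flip_spin i s) i = - spins s i.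
Proof. by rewrite /spins ffunE eqxx; case: (s i); rewrite /spin ?opprK. Qed.

Lemma spins_flipN N (i j : 'I_N) s : j != i -> spins (flip_spin i s) j = spins s j.
Proof. by rewrite /spins ffunE => /negbTE ->. Qed.

Lemma linE N (k : 'I_N -> R) (i : 'I_N) s :
  lin k s = k i * spins s i + \sum_(j | j != i) k j * spins s j.
Proof. by rewrite /lin (bigD1 i). Qed.

(** Configurations are paired with their flip at [i]. Since [C i i = 0], both have the same local
    field [m], their weights are a common factor times [exp m] and [exp (- m)], and [stein_pair]
    bounds the sum. *)
Lemma stein_site N (C : 'M[R]_N) (k : 'I_N -> R) (i : 'I_N) :
  (forall i j, C i j = C j i) -> (forall i, C i i = 0) ->
  `|avg (fun s => (spins s i - lin (C i) s) * (sin (lin k s) * weight C s)) -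
    k i * avg (fun s => cos (lin k s) * weight C s)| <=
  3 * avg (fun s => (lin (C i) s ^+ 2 + k i ^+ 2) * weight C s).
Proof.
move=> sC dC; rewrite -avgZ -avgB.
rewrite (avg_flip i) [in leRHS](avg_flip i) [leRHS]mulrCA.
rewrite (normrM 2^-1) ger0_norm ?invr_ge0// ler_pM2l ?invr_gt0// -avgZ.
apply: (le_trans (ler_norm_avg _)); apply: ler_avg => s.
set m := lin (C i) s.
have mE : lin (C i) (flip_spin i s) = m.
  rewrite /m /lin; apply: eq_bigr => j _; have [->|ji] := eqVneq j i.
    by rewrite dC !mul0r.
  by rewrite spins_flipN.
rewrite mE.
set y := \sum_(j | j != i) k j * spins s j.
have yE : lin k s = k i * spins s i + y by exact: linE.
have yFE : lin k (flip_spin i s) = - (k i * spins s i) + y.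
  rewrite (linE _ i) spins_flip mulrN; congr (_ + _).
  by apply: eq_bigr => j ji; rewrite spins_flipN.
set q := \sum_(a | a != i) \sum_(b | b != i) C a b * spins s a * spins s b.
have wE : weight C s = expR (2^-1 * q) * expR (spins s i * m).
  rewrite /weight (qform_site _ i)// -/(lin (C i) s) -/m -/q -expRD.
  by congr expR; field.
have wFE : weight C (flip_spin i s) = expR (2^-1 * q) * expR (- (spins s i * m)).
  rewrite /weight (qform_site _ i)// -/(lin (C i) (flip_spin i s)) mE spins_flip.
  rewrite (_ : \sum_(a | a != i) _ = q); last first.
    by apply: eq_bigr => a ai; apply: eq_bigr => b bi; rewrite !spins_flipN.
  by rewrite -expRD; congr expR; field.
rewrite yE yFE wE wFE spins_flip.
set E := expR (2^-1 * q).
have E0 : 0 <= E by exact: expR_ge0.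
have [->|->] : spins s i = 1 \/ spins s i = -1.
  by rewrite /spins /spin; case: (s i); [left|right].
- rewrite !mulr1 !mul1r !(addrC _ y).
  rewrite [X in `|X|](_ : _ = E * ((1 - m) * (sin (y + k i) * expR m) +
     (-1 - m) * (sin (y - k i) * expR (- m)) -
     k i * (cos (y + k i) * expR m + cos (y - k i) * expR (- m)))); last by ring.
  rewrite normrM (ger0_norm E0) [leRHS](_ : _ = E *
    (3 * (m ^+ 2 + k i ^+ 2) * (expR m + expR (- m)))); last by ring.
  by rewrite ler_wpM2l// stein_pair.
rewrite !mulrN !mulr1 !mulNr !mul1r !opprK !(addrC _ y).
rewrite [X in `|X|](_ : _ = E * ((1 - m) * (sin (y + k i) * expR m) +
     (-1 - m) * (sin (y - k i) * expR (- m)) -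
     k i * (cos (y + k i) * expR m + cos (y - k i) * expR (- m)))); last by ring.
rewrite normrM (ger0_norm E0) [leRHS](_ : _ = E *
    (3 * (m ^+ 2 + k i ^+ 2) * (expR m + expR (- m)))); last by ring.
by rewrite ler_wpM2l// stein_pair.
Qed.

Lemma linB N (g h : 'I_N -> R) s : lin (fun i => g i - h i) s = lin g s - lin h s.
Proof. by rewrite /lin -sumrB; apply: eq_bigr => i _; rewrite mulrBl. Qed.

Lemma linZ N (c : R) (g : 'I_N -> R) s : lin (fun i => c * g i) s = c * lin g s.
Proof. by rewrite /lin mulr_sumr; apply: eq_bigr => i _; rewrite mulrA. Qed.

(** The site estimates are summed with coefficients [g i]; the symmetry of [C] moves [1 - C] from
    the spins onto [g]. *)
Lemma stein_lin N (C : 'M[R]_N) (k g : 'I_N -> R) :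
  (forall i j, C i j = C j i) -> (forall i, C i i = 0) ->
  `|avg (fun s => lin (fun i => g i - \sum_j C i j * g j) s *
                  (sin (lin k s) * weight C s)) -
    (\sum_i g i * k i) * avg (fun s => cos (lin k s) * weight C s)| <=
  \sum_i `|g i| *
    (3 * avg (fun s => (lin (C i) s ^+ 2 + k i ^+ 2) * weight C s)).
Proof.
move=> sC dC.
have -> : avg (fun s => lin (fun i => g i - \sum_j C i j * g j) s *
                  (sin (lin k s) * weight C s)) =
   \sum_i g i * avg (fun s => (spins s i - lin (C i) s) * (sin (lin k s) * weight C s)).
  under [RHS]eq_bigr do rewrite -avgZ.
  rewrite -avg_sum; apply: eq_avg => s.
  under [RHS]eq_bigr do rewrite mulrA.
  rewrite -mulr_suml; congr (_ * _).
  under [RHS]eq_bigr do rewrite mulrBr.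
  rewrite linB sumrB; congr (_ - _).
  rewrite /lin; under eq_bigr do rewrite mulr_suml.
  under [RHS]eq_bigr do rewrite mulr_sumr.
  rewrite exchange_big/=; apply: eq_bigr => i _; apply: eq_bigr => j _.
  by rewrite sC mulrA (mulrC (g i)).
rewrite mulr_suml -sumrB; apply: (le_trans (ler_norm_sum _ _ _)).
apply: ler_sum => i _; rewrite -mulrA -mulrBr normrM ler_wpM2l//.
exact: stein_site.
Qed.

(** With [g] solving [(1 - C) g = F], the Stein estimate becomes a differential inequality for the
    cosine transform. Each site contributes an error O(1/N) and the absolute values of [g] sum to
    O(sqrt N), whence the rate. *)
Lemma avg_cos_gauss N (C : 'M[R]_N) (rho K b M K0 : R) (F g : 'I_N -> R) :
  (0 < N)%N ->
  (forall i j, C i j = C j i) -> (forall i, C i i = 0) -> 0 <= rho < 1 ->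
  (forall x, qform C x <= rho * sqnorm x) -> frob C <= K ->
  0 < b -> (forall i j, `|C i j| <= b / N%:R) ->
  avg (weight C) <= K0 ->
  0 <= M -> (forall i, `|F i| <= M / Num.sqrt N%:R) ->
  (forall i, g i - \sum_j C i j * g j = F i) ->
  `|avg (fun s => cos (lin F s) * weight C s) -
    expR (- ((\sum_i g i * F i) / 2)) * avg (weight C)| <=
  3 * (mom_const rho K * b ^+ 2 + M ^+ 2 * K0) * (M / (1 - rho)) / Num.sqrt N%:R.
Proof.
move=> N0 sC dC r01 bC CK b0 Cb wK M0 FM gE.
set E1 := leRHS; set v := \sum_i g i * F i.
have /andP[r0 r1] := r01.
have r1' : 0 < 1 - rho by rewrite subr_gt0.
have n0 : 0 < N%:R :> R by rewrite ltr0n.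
have sn0 : 0 < Num.sqrt N%:R :> R by rewrite sqrtr_gt0.
have sqn : Num.sqrt N%:R ^+ 2 = N%:R :> R by rewrite sqr_sqrtr// ltW.
have K00 : 0 <= K0 by apply: le_trans wK; apply: avg_ge0 => s; exact: weight_ge0.
have sF : sqnorm F <= M ^+ 2.
  have -> : M ^+ 2 = \sum_(i < N) (M / Num.sqrt N%:R) ^+ 2.
    rewrite sumr_const card_ord -[RHS]mulr_natl expr_div_n sqn.
    by field; rewrite gt_eqF.
  apply: ler_sum => i _; rewrite -(real_normK (num_real (F i))).
  by rewrite ler_sqr ?nnegrE ?divr_ge0 ?(ltW sn0).
have vE : v = sqnorm g - qform C g.
  rewrite /v /sqnorm /qform -sumrB; apply: eq_bigr => i _.
  rewrite -gE mulrBr expr2; congr (_ - _); rewrite mulr_sumr.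
  by apply: eq_bigr => j _; rewrite mulrA (mulrC (g i)).
have vg : (1 - rho) * sqnorm g <= v by rewrite vE; have := bC g; lra.
have v0 : 0 <= v by apply: le_trans vg; rewrite mulr_ge0 ?sqnorm_ge0// ltW.
(* Obtained from [(1 - rho) |g|^2 <= v] and the Cauchy-Schwarz bound [v <= |g| |F|], in squared
   form. *)
have sg : sqnorm g <= (M / (1 - rho)) ^+ 2.
  have [->|/eqP g0] := eqVneq (sqnorm g) 0; first exact: sqr_ge0.
  have g1 : 0 < sqnorm g by rewrite lt_neqAle sqnorm_ge0 eq_sym; apply/andP; split; [exact/eqP|].
  have CS : v ^+ 2 <= sqnorm g * sqnorm F by exact: sum_cauchy_schwarz.
  have h1 : ((1 - rho) * sqnorm g) ^+ 2 <= sqnorm g * M ^+ 2.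
    apply: (@le_trans _ _ (v ^+ 2)).
      by rewrite ler_sqr ?nnegrE// mulr_ge0 ?(ltW g1)// ltW.
    by apply: (le_trans CS); rewrite ler_wpM2l// ltW.
  rewrite expr_div_n ler_pdivlMr ?exprn_gt0//.
  rewrite -(ler_pM2l g1); apply: le_trans h1.
  by rewrite exprMn; lra.
have sum1g : \sum_i `|g i| <= Num.sqrt N%:R * (M / (1 - rho)).
  rewrite -ler_sqr ?nnegrE; last 2 first.
  - by apply: sumr_ge0.
  - by rewrite mulr_ge0 ?divr_ge0// ltW.
  have := sum_cauchy_schwarz (index_enum 'I_N) (fun i => `|g i|) (fun=> 1).
  under eq_bigr do rewrite mulr1.
  move=> /le_trans; apply.
  rewrite exprMn sqn mulrC.
  apply: ler_pM => //.
  - by apply: sumr_ge0 => i _; exact: sqr_ge0.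
  - by apply: sumr_ge0 => i _; exact: sqr_ge0.
  - by under eq_bigr do rewrite expr1n; rewrite sumr_const card_ord.
  - by under eq_bigr do rewrite real_normK ?num_real//.
pose phi (t : R) := avg (fun s => cos (t * lin F s) * weight C s).
pose dphi (t : R) := - avg (fun s => lin F s * (sin (t * lin F s) * weight C s)).
have dphiP (t : R) : is_derive t (1 : R) phi (dphi t).
  rewrite /phi /avg.
  have h := @is_derive_bigsum R _ (index_enum {ffun 'I_N -> bool})
    (fun s (t : R) => cos (t * lin F s) * weight C s)
    (fun s => - (lin F s * (sin (t * lin F s) * weight C s))) t.
    have {}h : is_derive t (1 : R) (fun y : R => \sum_s cos (y * lin F s) * weight C s)
      (\sum_s - (lin F s * (sin (t * lin F s) * weight C s))).
    by apply: h => s; apply: is_derive_eq; rewrite /GRing.scale/=; ring.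
  have := @is_deriveZ R R R _ (2 ^+ N)^-1 t 1 _ h.
  by rewrite /dphi /avg -mulrN sumrN.
have E10 : 0 <= E1.
  rewrite /E1 divr_ge0 ?(ltW sn0)// mulr_ge0 ?divr_ge0 ?(ltW r1')// mulr_ge0//.
  by rewrite addr_ge0// mulr_ge0 ?sqr_ge0 ?mom_const_ge0.
have main (t : R) : 0 <= t <= 1 -> `|dphi t + t * v * phi t| <= E1.
  move=> /andP[t0 t1].
  have := stein_lin (fun i => t * F i) g sC dC.
  have -> : avg (fun s => lin (fun i => g i - \sum_j C i j * g j) s *
     (sin (lin (fun i => t * F i) s) * weight C s)) = - dphi t.
    rewrite /dphi opprK; apply: eq_avg => s; rewrite linZ; congr (_ * _).
    by apply: eq_bigr => i _; rewrite gE.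
  have -> : \sum_i g i * (t * F i) = t * v.
    by rewrite /v mulr_sumr; apply: eq_bigr => i _; rewrite mulrCA.
  rewrite -/(phi t) (_ : avg _ = phi t); last by apply: eq_avg => s; rewrite linZ.
  rewrite -opprD normrN => /le_trans; apply.
  have site i : 3 * avg (fun s => (lin (C i) s ^+ 2 + (t * F i) ^+ 2) * weight C s) <=
     3 * (mom_const rho K * b ^+ 2 + M ^+ 2 * K0) / N%:R.
    rewrite -mulrA ler_pM2l// mulrDl.
    rewrite (eq_avg (h := fun s => lin (C i) s ^+ 2 * weight C s + (t * F i) ^+ 2 * weight C s)); last first.
      by move=> s; rewrite mulrDl.
    rewrite avgD avgZ; apply: lerD.
      rewrite -mulrA; apply: avg_lin_sqr => //.
        by rewrite divr_gt0// exprn_gt0.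
      have -> : b ^+ 2 / N%:R = \sum_(j < N) (b / N%:R) ^+ 2.
        rewrite sumr_const card_ord -[RHS]mulr_natl; field; by rewrite gt_eqF.
      apply: ler_sum => j _; rewrite -(real_normK (num_real (C i j))).
      by rewrite ler_sqr ?nnegrE ?divr_ge0 ?(ltW b0) ?(ltW n0).
    rewrite [leRHS]mulrAC; apply: ler_pM; rewrite ?sqr_ge0//.
      by apply: avg_ge0 => s; exact: weight_ge0.
    rewrite exprMn -[leRHS]mul1r -sqn -expr_div_n; apply: ler_pM; rewrite ?sqr_ge0//.
      by rewrite -(expr1n _ 2) ler_sqr ?nnegrE.
    by rewrite -(real_normK (num_real (F i))) ler_sqr ?nnegrE ?divr_ge0 ?(ltW sn0).
  apply: (@le_trans _ _ (\sum_i `|g i| * (3 * (mom_const rho K * b ^+ 2 + M ^+ 2 * K0) / N%:R))).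
    by apply: ler_sum => i _; rewrite ler_wpM2l.
  rewrite -mulr_suml.
  set A := 3 * _.
  have A0 : 0 <= A.
    by rewrite mulr_ge0// addr_ge0// mulr_ge0 ?sqr_ge0 ?mom_const_ge0.
  apply: (@le_trans _ _ (Num.sqrt N%:R * (M / (1 - rho)) * (A / N%:R))).
    by rewrite ler_wpM2r// divr_ge0// ltW.
  rewrite /E1 -/A -[X in A / X]sqn le_eqVlt; apply/orP; left; apply/eqP.
  by field; rewrite !gt_eqF.
(* The factor [exp (t^2 v / 2)] integrates [phi' = - t v phi]. At the intermediate point [c < 1] it
   is at most [exp (v / 2)], because [v >= 0]. *)
pose psi (t : R) := phi t * expR (t ^+ 2 * v / 2).
have dpsi (t : R) : is_derive t (1 : R) psi ((dphi t + t * v * phi t) * expR (t ^+ 2 * v / 2)).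
  by rewrite /psi; apply: is_derive_eq; rewrite /GRing.scale/=; field.
have cpsi : {within `[0, 1], continuous psi}.
  by apply: derivable_within_continuous => y _; exact: (@ex_derive _ _ _ _ _ _ _ (dpsi y)).
have [c + e] := MVT (@ltr01 R) (fun y _ => dpsi y) cpsi.
rewrite in_itv/= => /andP[c0 c1].
have phi0 : phi 0 = avg (weight C).
  by apply: eq_avg => s; rewrite mul0r cos0 mul1r.
have phi1 : phi 1 = avg (fun s => cos (lin F s) * weight C s).
  by apply: eq_avg => s; rewrite mul1r.
rewrite -phi1 -phi0.
have -> : phi 1 - expR (- (v / 2)) * phi 0 = expR (- (v / 2)) * (psi 1 - psi 0).
  rewrite /psi expr1n expr0n/= !mul0r mul1r expR0 mulr1 mulrBr; congr (_ - _).
  by rewrite mulrCA (mulrC (expR _)) expRxMexpNx_1 mulr1.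
rewrite e subr0 mulr1 normrM (ger0_norm (expR_ge0 _)) normrM (ger0_norm (expR_ge0 _)).
rewrite mulrCA -expRD -[leRHS]mulr1; apply: ler_pM; rewrite ?expR_ge0//.
  by apply: main; rewrite !ltW.
rewrite expR_le1.
have : c ^+ 2 * v <= 1 * v by rewrite ler_wpM2r// -(expr1n _ 2) ler_sqr ?nnegrE ?ltW.
lra.
Qed.

End spin_average.

(** * Concentration by two replicas *)

Section bernoulli_product.
Context {R : realType} {I : finType}.
Variable pr : I -> R.
Hypothesis pr01 : forall i, 0 <= pr i <= 1.

Definition bern_mass (b : {ffun I -> bool}) : R :=
  \prod_i (if b i then pr i else 1 - pr i).

Definition bexp (f : {ffun I -> bool} -> R) : R := \sum_b bern_mass b * f b.

Lemma bern_mass_ge0 b : 0 <= bern_mass b.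
Proof.
apply: prodr_ge0 => i _; have /andP[p0 p1] := pr01 i.
by case: (b i); rewrite ?subr_ge0.
Qed.

Lemma bexp_prod (g : I -> bool -> R) :
  bexp (fun b => \prod_i g i (b i)) = \prod_i (pr i * g i true + (1 - pr i) * g i false).
Proof.
under [RHS]eq_bigr => i _.
  rewrite (_ : _ + _ = \sum_(c : bool) (if c then pr i else 1 - pr i) * g i c); last first.
    by rewrite big_bool.
  over.
rewrite bigA_distr_bigA; apply: eq_bigr => b _.
by rewrite /bern_mass -big_split.
Qed.

Lemma eq_bexp f g : f =1 g -> bexp f = bexp g.
Proof. by move=> fg; apply: eq_bigr => b _; rewrite fg. Qed.

Lemma bexp_cst c : bexp (fun=> c) = c.
Proof.
have : bexp (fun=> 1) = 1.
  transitivity (bexp (fun b => \prod_i (fun _ _ => 1) i (b i))).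
    by apply: eq_bexp => b; rewrite big1.
  by rewrite (bexp_prod (fun _ _ => 1)) big1// => i _; rewrite !mulr1 addrC subrK.
by rewrite /bexp -!mulr_suml mulr1 => ->; rewrite mul1r.
Qed.

Lemma bexpZ c f : bexp (fun b => c * f b) = c * bexp f.
Proof. by rewrite /bexp mulr_sumr; apply: eq_bigr => b _; rewrite mulrCA. Qed.

Lemma bexpD f g : bexp (fun b => f b + g b) = bexp f + bexp g.
Proof. by rewrite /bexp -big_split; apply: eq_bigr => b _; rewrite mulrDr. Qed.

Lemma ler_bexp f g : (forall b, f b <= g b) -> bexp f <= bexp g.
Proof. by move=> fg; apply: ler_sum => b _; rewrite ler_wpM2l ?bern_mass_ge0. Qed.

Lemma bexp_avg N (f : {ffun 'I_N -> bool} -> {ffun I -> bool} -> R) :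
  bexp (fun b => avg (f^~ b)) = avg (fun s => bexp (f s)).
Proof.
rewrite /bexp /avg exchange_big/= mulr_sumr; apply: eq_bigr => b _.
by rewrite mulrCA mulr_sumr.
Qed.

Lemma bexp_sqr_dist f m :
  bexp (fun b => (f b - m) ^+ 2) = bexp (fun b => f b ^+ 2) - 2 * m * bexp f + m ^+ 2.
Proof.
rewrite -bexpZ -(bexp_cst (m ^+ 2)) -(mulN1r (bexp _)) -bexpZ -!bexpD.
by apply: eq_bexp => b; ring.
Qed.

Lemma bexp_chebyshev (f : {ffun I -> bool} -> R) m e : 0 < e ->
  \sum_(b | e <= `|f b - m|) bern_mass b <= bexp (fun b => (f b - m) ^+ 2) / e ^+ 2.
Proof.
move=> e0; rewrite ler_pdivlMr ?exprn_gt0// mulr_suml /bexp.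
rewrite [leRHS](bigID (fun b => e <= `|f b - m|))/= -[leLHS]addr0 lerD//.
  apply: ler_sum => b eb; rewrite ler_wpM2l ?bern_mass_ge0//.
  rewrite -(real_normK (num_real (f b - m))) ler_sqr ?nnegrE//.
  exact: ltW.
by apply: sumr_ge0 => b _; rewrite mulr_ge0 ?bern_mass_ge0 ?sqr_ge0.
Qed.

Lemma bexp_markov (f : {ffun I -> bool} -> R) e : 0 < e -> (forall b, 0 <= f b) ->
  \sum_(b | e <= f b) bern_mass b <= bexp f / e.
Proof.
move=> e0 f0; rewrite ler_pdivlMr// mulr_suml /bexp.
rewrite [leRHS](bigID (fun b => e <= f b))/= -[leLHS]addr0 lerD//.
  by apply: ler_sum => b eb; rewrite ler_wpM2l ?bern_mass_ge0.
by apply: sumr_ge0 => b _; rewrite mulr_ge0 ?bern_mass_ge0.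
Qed.

End bernoulli_product.

Section pairs.
Context {R : realType} {N : nat}.

(** Loops are included because the diagonal entries of the graph are random too; the couplings
    summed over these pairs vanish on the diagonal. *)
Definition pair_le := {p : 'I_N * 'I_N | (p.1 <= p.2)%N}.

Lemma sum_pair_le (F : 'I_N -> 'I_N -> R) :
  (forall i j, F i j = F j i) -> (forall i, F i i = 0) ->
  \sum_(p : pair_le) F (val p).1 (val p).2 = 2^-1 * \sum_i \sum_j F i j.
Proof.
move=> sF dF.
rewrite -(@big_sub _ _ _ _ [pred p : 'I_N * 'I_N | (p.1 <= p.2)%N] (fun p => F p.1 p.2)).
rewrite pair_bigA/=.
rewrite [in RHS](bigID (fun p : 'I_N * 'I_N => (p.1 <= p.2)%N))/=.
have -> : \sum_(p : 'I_N * 'I_N | ~~ (p.1 <= p.2)%N) F p.1 p.2 =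
    \sum_(p : 'I_N * 'I_N | (p.1 <= p.2)%N) F p.1 p.2.
  rewrite [RHS](bigID (fun p : 'I_N * 'I_N => p.1 == p.2))/= [X in _ = X + _]big1; last first.
    by move=> p /andP[_ /eqP ->].
  rewrite add0r (reindex (fun p : 'I_N * 'I_N => (p.2, p.1)))/=; last first.
    by exists (fun p : 'I_N * 'I_N => (p.2, p.1)) => -[].
  apply: eq_big => [[i j]|[i j] _]/=; last exact: sF.
  by rewrite -ltnNge ltn_neqAle andbC -(inj_eq val_inj).
rewrite [LHS](_ : _ = \sum_(p : 'I_N * 'I_N | (p.1 <= p.2)%N) F p.1 p.2)//.
by field.
Qed.

Definition bond (s : {ffun 'I_N -> bool}) (p : pair_le) : R :=
  spins s (val p).1 * spins s (val p).2.

Lemma sum_bond (C : 'M[R]_N) s : (forall i j, C i j = C j i) -> (forall i, C i i = 0) ->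
  \sum_(p : pair_le) C (val p).1 (val p).2 * bond s p = 2^-1 * qform C (spins s).
Proof.
move=> sC dC; rewrite -(@sum_pair_le (fun i j => C i j * spins s i * spins s j)).
- by apply: eq_bigr => p _; rewrite mulrA.
- by move=> i j; rewrite sC mulrAC.
- by move=> i; rewrite dC !mul0r.
Qed.

Lemma bond_pm s p : bond s p = 1 \/ bond s p = -1.
Proof.
by rewrite /bond /spins /spin; case: (s _); case: (s _);
  rewrite ?mulr1 ?mul1r ?mulN1r ?opprK; by [left|right].
Qed.

(** In the boolean encoding of signs, equality is multiplication. *)
Definition spin_mul (s t : {ffun 'I_N -> bool}) : {ffun 'I_N -> bool} :=
  [ffun i => ~~ (s i (+) t i)].

Lemma bond_spin_mul s t p : bond (spin_mul s t) p = bond s p * bond t p.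
Proof.
rewrite /bond /spins /spin !ffunE.
by case: (s _); case: (t _); case: (s _); case: (t _) => /=; ring.
Qed.

Lemma spin_mulI s : injective (spin_mul s).
Proof.
move=> t u /ffunP h; apply/ffunP => i; move: (h i); rewrite !ffunE.
by case: (s i); case: (t i); case: (u i).
Qed.

(** For fixed [s], the product with a uniform configuration is again uniform. *)
Lemma avg_spin_mul (h : {ffun 'I_N -> bool} -> R) s : avg (fun t => h (spin_mul s t)) = avg h.
Proof. exact: avg_bij (@spin_mulI s). Qed.

End pairs.

Section two_replicas.
Context {R : realType} {N : nat}.
Local Notation I := (@pair_le N).

Definition graph_weight (t : I -> R) (b : {ffun I -> bool}) (s : {ffun 'I_N -> bool}) : R :=
  \prod_p (1 + t p * (b p)%:R * bond s p).

Definition mean_weight (u : I -> R) (s : {ffun 'I_N -> bool}) : R :=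
  \prod_p (1 + u p * bond s p).

Variables (pr t : I -> R).
Hypothesis pr01 : forall p, 0 <= pr p <= 1.
Hypothesis t0 : forall p, 0 <= t p.

Let u p := t p * pr p.

Lemma bexp_graph_weight h :
  bexp pr (fun b => avg (fun s => h s * graph_weight t b s)) =
  avg (fun s => h s * mean_weight u s).
Proof.
rewrite bexp_avg; apply: eq_avg => s; rewrite bexpZ; congr (_ * _).
rewrite (bexp_prod _ (fun p (c : bool) => 1 + t p * c%:R * bond s p)).
by apply: eq_bigr => p _; rewrite /u (_ : true%:R = 1)// (_ : false%:R = 0)//; ring.
Qed.

(** Mean of the product of the graph weights of two replicas. An edge variable equals its square, so
    the product of bonds carries [t^2 pr] instead of [(t pr)^2]; the difference is the variance of
    [t] times the edge variable. *)
Definition pair_weight (s s' : {ffun 'I_N -> bool}) : R :=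
  \prod_p (1 + u p * (bond s p + bond s' p) + t p ^+ 2 * pr p * (bond s p * bond s' p)).

Lemma bexp_graph_weight_sqr h :
  bexp pr (fun b => (avg (fun s => h s * graph_weight t b s)) ^+ 2) =
  avg (fun s => avg (fun s' => h s * h s' * pair_weight s s')).
Proof.
transitivity (bexp pr (fun b => avg (fun s => avg (fun s' =>
    h s * h s' * (graph_weight t b s * graph_weight t b s'))))).
  apply: eq_bexp => b; rewrite expr2 -avgZ; apply: eq_avg => s.
  by rewrite mulrC -avgZ; apply: eq_avg => s'; ring.
rewrite bexp_avg; apply: eq_avg => s; rewrite bexp_avg; apply: eq_avg => s'.
rewrite bexpZ; congr (_ * _).
transitivity (bexp pr (fun b => \prod_p (fun p (c : bool) => (1 + t p * c%:R * bond s p) *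
   (1 + t p * c%:R * bond s' p)) p (b p))).
  by apply: eq_bexp => b; rewrite /graph_weight -big_split.
rewrite (bexp_prod _ (fun p (c : bool) => (1 + t p * c%:R * bond s p) *
   (1 + t p * c%:R * bond s' p))).
by apply: eq_bigr => p _; rewrite /u (_ : true%:R = 1)// (_ : false%:R = 0)//; ring.
Qed.

(** The square is an average over two replicas, and [|h| <= 1] removes the observable, so that one
    estimate serves both the numerator and the partition function. *)
Lemma bexp_graph_weight_var (h : {ffun 'I_N -> bool} -> R) : (forall s, `|h s| <= 1) ->
  bexp pr (fun b => (avg (fun s => h s * graph_weight t b s) -
     avg (fun s => h s * mean_weight u s)) ^+ 2) <=
  avg (fun s => avg (fun s' => `|pair_weight s s' - mean_weight u s * mean_weight u s'|)).
Proof.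
move=> h1; rewrite bexp_sqr_dist bexp_graph_weight bexp_graph_weight_sqr.
set m := avg (fun s => h s * mean_weight u s).
set m1 := (X in X - _ + _).
have -> : m1 - 2 * m * m + m ^+ 2 = m1 - m * m by ring.
have -> : m * m = avg (fun s => avg (fun s' => h s * h s' * (mean_weight u s * mean_weight u s'))).
  rewrite {1}/m mulrC -avgZ; apply: eq_avg => s.
  by rewrite mulrC -avgZ; apply: eq_avg => s'; ring.
rewrite -avgB; apply: (le_trans (ler_norm _)); apply: (le_trans (ler_norm_avg _)).
apply: ler_avg => s; rewrite -avgB; apply: (le_trans (ler_norm_avg _)).
apply: ler_avg => s'; rewrite -mulrBr normrM -[leRHS]mul1r ler_wpM2r// normrM.
by rewrite -[leRHS]mul1r ler_pM.
Qed.

End two_replicas.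

(** * Comparison of the two-replica weight with a product weight *)

Section pair_ratio.
Context {R : realType}.

(** Reciprocal form of [1 + z <= exp z] at [z = - y / (1 + y)]. *)
Lemma expR_ge_1D_frac (y : R) : -1 < y -> expR (y / (1 + y)) <= 1 + y.
Proof.
move=> y1; have y0 : 0 < 1 + y by rewrite -ltrBlDl sub0r.
rewrite -[expR _]invrK -expRN -[leRHS]invrK lef_pV2 ?posrE ?invr_gt0 ?expR_gt0//.
rewrite (le_trans _ (expR_ge1Dx _))// le_eqVlt; apply/orP; left; apply/eqP.
by field; rewrite gt_eqF.
Qed.

(* For a, b in {-1, 1} one has
   1 + u(a+b) + v ab = (1+ua)(1+ub)(1+y) with y = (v-u^2) ab/((1+ua)(1+ub)). *)
Lemma pair_ratio_bounds (u r a b : R) : (a = 1 \/ a = -1) -> (b = 1 \/ b = -1) ->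
  0 <= u <= 4^-1 -> 0 <= r <= 8^-1 ->
  exists y, [/\ 1 + u * (a + b) + (r + u ^+ 2) * (a * b) =
                  (1 + u * a) * (1 + u * b) * (1 + y),
    expR (r * (a * b) - (4 * u * r + 7 * r ^+ 2)) <= 1 + y &
    1 + y <= expR (r * (a * b) + (4 * u * r + 7 * r ^+ 2))].
Proof.
move=> ha hb /andP[u0 u1] /andP[r0 r1].
have [a1 a2] : -1 <= a /\ a <= 1 by case: ha => ->; split; lra.
have [b1 b2] : -1 <= b /\ b <= 1 by case: hb => ->; split; lra.
have ab : (a * b) ^+ 2 = 1 by case: ha => ->; case: hb => ->; ring.
have ab1 : `|a * b| = 1 by case: ha => ->; case: hb => ->; rewrite ?mul1r ?mulN1r ?opprK ?normrN normr1.
have pa : 3 / 4 <= 1 + u * a by nra.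
have pb : 3 / 4 <= 1 + u * b by nra.
set d := (1 + u * a) * (1 + u * b).
have d0 : 9 / 16 <= d by rewrite /d; nra.
have d00 : 0 < d by lra.
have dn0 : d != 0 by rewrite gt_eqF.
(* The bound [d >= 9 / 16] comes from [u <= 1 / 4]. It gives [|c - 1| <= 4 u], the source of
   [4 u r], and [|y| <= 16 r / 9], so that [7 r^2] covers the second-order term of the logarithm. *)
set c := d^-1.
have c0 : 0 < c by rewrite invr_gt0.
have c1 : c <= 16 / 9.
  by rewrite /c -[leRHS]invrK lef_pV2 ?posrE ?invr_gt0 ?divr_gt0// invf_div.
have cd : c * d = 1 by rewrite mulVf.
have cu : `|c - 1| <= 4 * u.
  have -> : c - 1 = c * (- (u * a + u * b + u ^+ 2 * (a * b))).
    by rewrite -[X in c - X]cd /d; ring.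
  rewrite normrM (gtr0_norm c0) normrN.
  have h : `|u * a + u * b + u ^+ 2 * (a * b)| <= 9 / 4 * u.
    rewrite ler_norml; apply/andP; split; case: ha => ->; case: hb => ->; nra.
  apply: (@le_trans _ _ (16 / 9 * (9 / 4 * u))); last by lra.
  by apply: ler_pM => //; rewrite ltW.
pose y := r * (a * b) * c.
have yE : y - r * (a * b) = r * (a * b) * (c - 1) by rewrite /y; ring.
have y1 : `|y - r * (a * b)| <= 4 * u * r.
  rewrite yE normrM normrM ab1 mulr1 (ger0_norm r0) mulrC.
  by rewrite ler_wpM2r.
have yb : `|y| <= 16 / 9 * r.
  by rewrite /y normrM normrM ab1 mulr1 (ger0_norm r0) (gtr0_norm c0) mulrC ler_wpM2r.
have y2 : `|y| <= 2 / 9 by lra.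
move: y2; rewrite ler_norml => /andP[y2 y3].
have y4 : 7 / 9 <= 1 + y by lra.
have y40 : 1 + y != 0 by rewrite gt_eqF//; lra.
exists y; split.
- rewrite -/d; have -> : d * (1 + y) = d + r * (a * b) * (c * d) by rewrite /y; ring.
  by rewrite cd /d; ring.
- apply: le_trans (expR_ge_1D_frac _); last by lra.
  rewrite ler_expR.
  have -> : y / (1 + y) = y - y ^+ 2 / (1 + y) by field.
  move: y1; rewrite ler_norml => /andP[y5 y6].
  have h : y ^+ 2 / (1 + y) <= 7 * r ^+ 2.
    rewrite ler_pdivrMr; last by lra.
    have : y ^+ 2 <= (16 / 9 * r) ^+ 2.
      rewrite -(real_normK (num_real y)) ler_sqr ?nnegrE//.
      by rewrite mulr_ge0.
    have : 7 * r ^+ 2 * (7 / 9) <= 7 * r ^+ 2 * (1 + y).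
      by rewrite ler_wpM2l// mulr_ge0// sqr_ge0.
    have := sqr_ge0 r; rewrite !expr2; lra.
  lra.
- apply: (le_trans (expR_ge1Dx _)); rewrite ler_expR.
  move: y1; rewrite ler_norml => /andP[y5 y6].
  have := sqr_ge0 r; lra.
Qed.

Lemma exp_dist_bound (x A : R) : expR (- A) <= x -> x <= expR A ->
  `|x - 1| <= expR A - 1.
Proof.
move=> h1 h2; rewrite ler_norml; apply/andP; split; last by lra.
have := expRxMexpNx_1 A; have := expR_gt0 A; have := expR_gt0 (- A).
have := sqr_ge0 (expR A - 1).
move: h1 h2; set e := expR A; set f := expR (- A) => h1 h2 q f0 e0 ef.
have : 2 <= e + f by nra.
lra.
Qed.

End pair_ratio.

Section replica_bound.
Context {R : realType} {N : nat}.
Local Notation I := (@pair_le N).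
Variables (pr t : I -> R) (rr : 'M[R]_N) (dlt : R).
Hypothesis t0 : forall p, 0 <= t p.
Hypothesis pr01 : forall p, 0 <= pr p <= 1.
Let u p := t p * pr p.
Hypothesis u4 : forall p, u p <= 4^-1.
Hypothesis rrE : forall p : I, rr (val p).1 (val p).2 = t p ^+ 2 * pr p - u p ^+ 2.
Hypothesis rr8 : forall p : I, rr (val p).1 (val p).2 <= 8^-1.
Hypothesis rrS : forall i j, rr i j = rr j i.
Hypothesis rr0 : forall i, rr i i = 0.
Hypothesis dltP : \sum_p (4 * u p * rr (val p).1 (val p).2 +
   7 * rr (val p).1 (val p).2 ^+ 2) <= dlt.

Lemma mean_weight_ge0 s : 0 <= mean_weight u s.
Proof.
apply: prodr_ge0 => p _; have /andP[p0 p1] := pr01 p.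
have uu : 0 <= u p by rewrite mulr_ge0.
by have := u4 p; case: (bond_pm (R := R) s p) => ->; lra.
Qed.

(** The pairwise ratios multiply to an exponential whose main part is a quadratic form in the
    product of the two replicas alone; all other contributions are collected in [dlt]. *)
Lemma pair_weight_dist s s' :
  `|pair_weight pr t s s' - mean_weight u s * mean_weight u s'| <=
  mean_weight u s * mean_weight u s' *
  (expR (`|2^-1 * qform rr (spins (spin_mul s s'))| + dlt) - 1).
Proof.
have ex p : exists y, [/\ 1 + u p * (bond s p + bond s' p) +
     t p ^+ 2 * pr p * (bond s p * bond s' p) =
       (1 + u p * bond s p) * (1 + u p * bond s' p) * (1 + y),
    expR (rr (val p).1 (val p).2 * (bond s p * bond s' p) -
     (4 * u p * rr (val p).1 (val p).2 + 7 * rr (val p).1 (val p).2 ^+ 2)) <= 1 + y &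
    1 + y <= expR (rr (val p).1 (val p).2 * (bond s p * bond s' p) +
     (4 * u p * rr (val p).1 (val p).2 + 7 * rr (val p).1 (val p).2 ^+ 2))].
  have /andP[p0 p1] := pr01 p.
  have uu : 0 <= u p <= 4^-1 by rewrite u4 mulr_ge0.
  have rp : 0 <= rr (val p).1 (val p).2 <= 8^-1.
    rewrite rr8 rrE /u exprMn -mulrBr mulr_ge0 ?sqr_ge0// expr2.
    by rewrite subr_ge0 -{3}(mulr1 (pr p)) ler_wpM2l.
  have [y [y1 y2 y3]] := pair_ratio_bounds (bond_pm s p) (bond_pm s' p) uu rp.
  by exists y; split=> //; rewrite -y1 rrE subrK.
have [y yP] := choice ex.
have -> : pair_weight pr t s s' = mean_weight u s * mean_weight u s' * \prod_p (1 + y p).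
  rewrite /pair_weight /mean_weight -!big_split; apply: eq_bigr => p _.
  by have [-> _ _] := yP p.
rewrite -{2}(mulr1 (_ * mean_weight u s')) -mulrBr normrM ger0_norm ?mulr_ge0 ?mean_weight_ge0//.
rewrite ler_wpM2l ?mulr_ge0 ?mean_weight_ge0//.
set Q := 2^-1 * _.
have QE : Q = \sum_p rr (val p).1 (val p).2 * (bond s p * bond s' p).
  by rewrite /Q -sum_bond//; apply: eq_bigr => p _; rewrite bond_spin_mul.
have := dltP; set D := \sum_p (4 * u p * rr (val p).1 (val p).2 +
   7 * rr (val p).1 (val p).2 ^+ 2) => Dd.
apply: exp_dist_bound.
  apply: (@le_trans _ _ (expR (Q - D))).
    by rewrite ler_expR; have := ler_norm (- Q); rewrite normrN; lra.
  rewrite QE -sumrB expR_sum; apply: ler_prod => p _.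
  by rewrite expR_ge0/=; have [] := yP p.
apply: (@le_trans _ _ (expR (Q + D))); last first.
  by rewrite ler_expR lerD// ler_norm.
rewrite QE -big_split expR_sum; apply: ler_prod => p _.
have [_ h1 h2] := yP p; rewrite h2 andbT.
by apply: le_trans h1; exact: expR_ge0.
Qed.

End replica_bound.

Section matrix_entries.
Context {R : realType} {N : nat}.
Implicit Types (C : 'M[R]_N) (b : R).

Lemma qform_entry_bound C b (x : 'I_N -> R) : (forall i j, `|C i j| <= b / N%:R) ->
  qform C x <= b * sqnorm x.
Proof.
case: N C x => [|n] C x Cb; first by rewrite /qform /sqnorm !big_ord0 mulr0.
have b0 : 0 <= b / n.+1%:R := le_trans (normr_ge0 _) (Cb ord0 ord0).
apply: (@le_trans _ _ (b / n.+1%:R * (\sum_i `|x i|) ^+ 2)).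
  rewrite expr2 mulr_suml mulr_sumr; apply: ler_sum => i _; rewrite !mulr_sumr.
  apply: ler_sum => j _; apply: (le_trans (ler_norm _)).
  by rewrite !normrM -mulrA ler_wpM2r// mulr_ge0.
have -> : b * sqnorm x = b / n.+1%:R * (n.+1%:R * sqnorm x).
  by rewrite mulrA divfK// pnatr_eq0.
rewrite ler_wpM2l//.
have := sum_cauchy_schwarz (index_enum 'I_n.+1) (fun i => `|x i|) (fun=> 1).
under eq_bigr do rewrite mulr1.
move=> /le_trans; apply.
rewrite mulrC; apply: ler_pM => //.
- by apply: sumr_ge0 => i _; exact: sqr_ge0.
- by apply: sumr_ge0 => i _; exact: sqr_ge0.
- by under eq_bigr do rewrite expr1n; rewrite sumr_const card_ord.
- by under eq_bigr do rewrite real_normK ?num_real//.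
Qed.

Lemma frob_entry_bound C b : (forall i j, `|C i j| <= b / N%:R) -> frob C <= b ^+ 2.
Proof.
case: N C => [|n] C Cb; first by rewrite /frob big_ord0 sqr_ge0.
apply: (@le_trans _ _ (\sum_(i < n.+1) \sum_(j < n.+1) (b / n.+1%:R) ^+ 2)).
  apply: ler_sum => i _; apply: ler_sum => j _.
  rewrite -(real_normK (num_real (C i j))) ler_sqr ?nnegrE//.
  exact: le_trans (Cb i j).
rewrite !sumr_const card_ord -[X in X *+ _]mulr_natr -[leLHS]mulr_natr expr_div_n.
by rewrite le_eqVlt; apply/orP; left; apply/eqP; field; rewrite ?pnatr_eq0.
Qed.

Lemma qformZ C c (x : 'I_N -> R) : qform (c *: C) x = c * qform C x.
Proof.
rewrite /qform mulr_sumr; apply: eq_bigr => i _; rewrite mulr_sumr.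
by apply: eq_bigr => j _; rewrite mxE !mulrA.
Qed.

Lemma frobZ C c : frob (c *: C) = c ^+ 2 * frob C.
Proof.
rewrite /frob mulr_sumr; apply: eq_bigr => i _; rewrite mulr_sumr.
by apply: eq_bigr => j _; rewrite mxE exprMn.
Qed.

(** Such entries bound the form by half of the squared norm and [frob C] by 1/4, so that
    [avg_exp_qform] applies with [rho = 1 / 2]. *)
Lemma avg_weight_small C : (forall i j, C i j = C j i) -> (forall i, C i i = 0) ->
  (forall i j, `|C i j| <= 2^-1 / N%:R) -> avg (weight C) <= expR 1.
Proof.
move=> sC dC Cb.
have r01 : 0 <= (2^-1 : R) < 1 by lra.
apply: (le_trans (avg_exp_qform sC _ r01 (fun x => qform_entry_bound x Cb))).
  by move=> i; rewrite dC.
rewrite ler_expR big1 ?mulr0 ?add0r; last by move=> i _; rewrite dC.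
have := frob_entry_bound Cb.
rewrite ler_pdivrMr; last by lra.
lra.
Qed.

(** Jensen: [exp x >= 1 + x], and products of distinct spins average to zero. This keeps the
    denominators of Gibbs averages away from zero. *)
Lemma avg_weight_ge1 C : (forall i j, C i j = C j i) -> (forall i, C i i = 0) ->
  1 <= avg (weight C).
Proof.
move=> sC dC.
apply: (@le_trans _ _ (avg (fun s => 1 + 2^-1 * qform C (spins s)))); last first.
  by apply: ler_avg => s; exact: expR_ge1Dx.
rewrite avgD avg_cst avgZ.
have -> : avg (fun s => qform C (spins s)) = 0; last by rewrite mulr0 addr0.
rewrite avg_sum big1// => i _; rewrite avg_sum big1// => j _.
have [<-|ij] := eqVneq i j; first by rewrite (eq_avg (h := fun=> 0)) ?avg_cst// => s; rewrite dC !mul0r.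
rewrite (avg_flip i) (eq_avg (h := fun=> 0)) ?avg_cst ?mulr0// => s.
by rewrite spins_flip spins_flipN 1?eq_sym// mulrN mulNr subrr.
Qed.

End matrix_entries.

Section power_inequalities.
Context {R : realType}.

Lemma bernoulli_inequality (z : R) n : 1 <= z -> 1 + n%:R * (z - 1) <= z ^+ n.
Proof.
move=> z1; elim: n => [|n IH]; first by rewrite mul0r addr0 expr0.
have z0 : 0 <= z by rewrite (le_trans ler01).
rewrite exprS; apply: (@le_trans _ _ (z * (1 + n%:R * (z - 1)))); last by rewrite ler_wpM2l.
rewrite -natr1; have : 0 <= n%:R :> R by rewrite ler0n.
have := sqr_ge0 (z - 1); set m := n%:R => q m0.
have : 0 <= m * (z - 1) ^+ 2 by rewrite mulr_ge0.
nra.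
Qed.

(** Turns a power of [exp Q - 1] into [exp (n Q) - 1], whose average is an exponential moment. *)
Lemma exprB1_le (a : R) n : 1 <= a -> (a - 1) ^+ n.+1 <= a ^+ n.+1 - 1.
Proof.
move=> a1; elim: n => [|n IH]; first by rewrite !expr1.
rewrite exprS; apply: (@le_trans _ _ ((a - 1) * (a ^+ n.+1 - 1))).
  by rewrite ler_wpM2l// subr_ge0.
have : 1 <= a ^+ n.+1 by rewrite exprn_ege1.
rewrite (exprS _ n.+1); set b := a ^+ n.+1; nra.
Qed.

(** Either [y <= e * exp (S / (n + 1))], which gives the first term, or [exp S] is less than
    [(y / e)^(n + 1)], which gives the second. The weight is separated from [y] at the price of a
    slightly larger exponent. *)
Lemma exp_young (S y e : R) n : 0 < e -> 0 <= y ->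
  expR S * y <= e * expR ((1 + n.+1%:R^-1) * S) + y ^+ n.+2 / e ^+ n.+1.
Proof.
move=> e0 y0.
have n0 : n.+1%:R != 0 :> R by rewrite pnatr_eq0.
have SE : expR S = expR (n.+1%:R^-1 * S) ^+ n.+1.
  by rewrite -expRM_natl mulrA mulfV// mul1r.
have [h|h] := leP y (e * expR (n.+1%:R^-1 * S)).
  rewrite -[leLHS]addr0 lerD//; last by rewrite divr_ge0// exprn_ge0// ltW.
  rewrite mulrDl mul1r expRD mulrCA ler_wpM2l// expR_ge0//.
rewrite -[leLHS]add0r lerD//; first by rewrite mulr_ge0 ?expR_ge0// ltW.
rewrite exprSr mulrAC ler_wpM2r// -expr_div_n SE.
rewrite ler_pXn2r ?nnegrE ?expR_ge0//; last by rewrite divr_ge0// ltW.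
by rewrite ler_pdivlMr// mulrC ltW.
Qed.

End power_inequalities.

Section mean_weight_ising.
Context {R : realType} {N : nat}.
Variable U : 'M[R]_N.
Hypothesis Usym : forall i j, U i j = U j i.
Hypothesis Udiag : forall i, U i i = 0.
Hypothesis U01 : forall i j, 0 <= U i j <= 2^-1.

(** The inverse hyperbolic tangent of [U i j]: for a sign c, [1 + u c = sqrt (1 - u^2) exp (c artanh
    u)]. The square roots are collected in [ising_const]. *)
Definition ising_coupling : 'M[R]_N :=
  \matrix_(i, j) (2^-1 * (ln (1 + U i j) - ln (1 - U i j))).

Definition ising_const : R :=
  expR (\sum_(p : pair_le) 2^-1 * (ln (1 + U (val p).1 (val p).2) +
    ln (1 - U (val p).1 (val p).2))).

Lemma ising_coupling_sym i j : ising_coupling i j = ising_coupling j i.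
Proof. by rewrite !mxE Usym. Qed.

Lemma ising_coupling_diag i : ising_coupling i i = 0.
Proof. by rewrite !mxE Udiag addr0 subr0 ln1 subrr mulr0. Qed.

(** The inequality [ln (1 + x) <= x] is applied to [1 + u], [1 - u] and their reciprocals. *)
Lemma ising_coupling_bound i j : `|ising_coupling i j - U i j| <= 2 * U i j ^+ 2.
Proof.
rewrite !mxE; have /andP[u0 u1] := U01 i j; set u := U i j in u0 u1 *.
have p0 : 0 < 1 + u by lra.
have m0 : 0 < 1 - u by lra.
have h1 : ln (1 + u) <= u by apply: le_ln1Dx; lra.
have h2 : ln (1 - u) <= - u by rewrite le_ln1Dx//; lra.
have h3 : - ln (1 + u) <= - u + u ^+ 2.
  rewrite -lnV ?posrE//.
  have -> : (1 + u)^-1 = 1 + (- (u / (1 + u))) by field; rewrite gt_eqF.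
  apply: (le_trans (le_ln1Dx _)).
    by rewrite ltrN2 ltr_pdivrMr// mul1r; lra.
  rewrite -subr_ge0.
  have -> : - u + u ^+ 2 - - (u / (1 + u)) = u ^+ 3 / (1 + u) by field; rewrite gt_eqF.
  by rewrite divr_ge0 ?exprn_ge0// ltW.
have h4 : - ln (1 - u) <= u + 2 * u ^+ 2.
  rewrite -lnV ?posrE//.
  have -> : (1 - u)^-1 = 1 + u / (1 - u) by field; rewrite gt_eqF.
  have q0 : 0 <= u / (1 - u) by rewrite (divr_ge0 u0 (ltW m0)).
  apply: (le_trans (le_ln1Dx _)); first by lra.
  rewrite ler_pdivrMr//.
  have : 0 <= u ^+ 2 * (1 - 2 * u) by rewrite mulr_ge0 ?sqr_ge0//; lra.
  lra.
have := sqr_ge0 u.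
rewrite ler_norml; lra.
Qed.

Lemma mean_weightE s :
  mean_weight (fun p => U (val p).1 (val p).2) s = ising_const * weight ising_coupling s.
Proof.
rewrite /weight -(sum_bond _ ising_coupling_sym ising_coupling_diag) /ising_const -expRD.
rewrite -big_split expR_sum; apply: eq_bigr => p _ /=; rewrite mxE.
have /andP[u0 u1] := U01 (val p).1 (val p).2; set u := U _ _ in u0 u1 *.
have p0 : 0 < 1 + u by lra.
have m0 : 0 < 1 - u by lra.
case: (bond_pm (R := R) s p) => ->.
  by rewrite mulr1 -[LHS]lnK ?posrE//; congr expR; field.
by rewrite mulrN1 -[LHS]lnK ?posrE//; congr expR; field.
Qed.

End mean_weight_ising.

Section replica_variance.
Context {R : realType} {N : nat}.
Local Notation I := (@pair_le N).
Variables (pr t : I -> R) (U rr : 'M[R]_N) (dlt : R).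
Hypothesis t0 : forall p, 0 <= t p.
Hypothesis pr01 : forall p, 0 <= pr p <= 1.
Hypothesis Usym : forall i j, U i j = U j i.
Hypothesis Udiag : forall i, U i i = 0.
Hypothesis U01 : forall i j, 0 <= U i j <= 4^-1.
Hypothesis UE : forall p, U (val p).1 (val p).2 = t p * pr p.
Hypothesis rrE : forall p : I, rr (val p).1 (val p).2 = t p ^+ 2 * pr p - (t p * pr p) ^+ 2.
Hypothesis rr8 : forall p : I, rr (val p).1 (val p).2 <= 8^-1.
Hypothesis rrS : forall i j, rr i j = rr j i.
Hypothesis rr0 : forall i, rr i i = 0.
Hypothesis dltP : \sum_p (4 * (t p * pr p) * rr (val p).1 (val p).2 +
   7 * rr (val p).1 (val p).2 ^+ 2) <= dlt.

(** Here [e] and [n] are the parameters of [exp_young], and [L] is a multiple at which [rr] is still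
    at high temperature. The first term sees the weights at a raised inverse temperature, the second
    only uniform replicas. *)
Lemma replica_variance (h : {ffun 'I_N -> bool} -> R) (e M1 : R) (n L : nat) :
  (forall s, `|h s| <= 1) -> 0 < e ->
  avg (weight ((1 + n.+1%:R^-1) *: ising_coupling U)) <= M1 ->
  (0 < L)%N -> (forall i j, n.+2%:R * L%:R * `|rr i j| <= 2^-1 / N%:R) ->
  bexp pr (fun b => ((ising_const U)^-1 * avg (fun s => h s * graph_weight t b s) -
     avg (fun s => h s * weight (ising_coupling U) s)) ^+ 2) <=
  e * M1 ^+ 2 +
  (expR (n.+2%:R * dlt) * (1 + 2 * expR 1 / L%:R) - 1) / e ^+ n.+1.
Proof.
move=> h1 e0 wM L0 rrL.
have U12 i j : 0 <= U i j <= 2^-1 by have := U01 i j; lra.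
set K := ising_const U; set C := ising_coupling U.
have K0 : 0 < K by exact: expR_gt0.
have u4 p : t p * pr p <= 4^-1 by rewrite -UE; have /andP[] := U01 (val p).1 (val p).2.
have mwE s : mean_weight (fun p => t p * pr p) s = K * weight C s.
  by rewrite -mean_weightE//; apply: eq_bigr => p _; rewrite UE.
have V := bexp_graph_weight_var pr t h1.
have {V} : bexp pr (fun b => (K^-1 * avg (fun s => h s * graph_weight t b s) -
     avg (fun s => h s * weight C s)) ^+ 2) <=
   (K ^+ 2)^-1 * avg (fun s => avg (fun s' => `|pair_weight pr t s s' -
       mean_weight (fun p => t p * pr p) s * mean_weight (fun p => t p * pr p) s'|)).
  apply: le_trans (ler_wpM2l _ V); last by rewrite invr_ge0 sqr_ge0.
  rewrite -bexpZ le_eqVlt; apply/orP; left; apply/eqP; apply: eq_bexp => b.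
  have -> : avg (fun s => h s * mean_weight (fun p => t p * pr p) s) =
       K * avg (fun s => h s * weight C s).
    by rewrite -avgZ; apply: eq_avg => s; rewrite mwE mulrCA.
  by rewrite -exprVn -exprMn; congr (_ ^+ 2); rewrite mulrBr mulKf// gt_eqF.
move=> /le_trans; apply.
pose Q (r : {ffun 'I_N -> bool}) : R := `|2^-1 * qform rr (spins r)|.
pose y r : R := expR (Q r + dlt) - 1.
have Q0 r : 0 <= Q r by exact: normr_ge0.
have d0 : 0 <= dlt.
  apply: le_trans dltP; apply: sumr_ge0 => p _.
  have /andP[p0 p1] := pr01 p.
  have tp : 0 <= t p * pr p by rewrite mulr_ge0.
  rewrite addr_ge0//; last by rewrite mulr_ge0// sqr_ge0.
  rewrite mulr_ge0 ?mulr_ge0// rrE exprMn -mulrBr mulr_ge0 ?sqr_ge0// expr2.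
  by rewrite subr_ge0 -{3}(mulr1 (pr p)) ler_wpM2l.
have y0 r : 0 <= y r by rewrite /y subr_ge0 -{1}(@expR0 R) ler_expR addr_ge0.
(* [exp_young] with [S] the sum of both Ising exponents and [y] the replica error. *)
have ptw s s' : (K ^+ 2)^-1 * `|pair_weight pr t s s' -
       mean_weight (fun p => t p * pr p) s * mean_weight (fun p => t p * pr p) s'| <=
   e * (weight ((1 + n.+1%:R^-1) *: C) s * weight ((1 + n.+1%:R^-1) *: C) s') +
   (e ^+ n.+1)^-1 * y (spin_mul s s') ^+ n.+2.
  have := pair_weight_dist t0 pr01 u4 rrE rr8 rrS rr0 dltP s s'.
  rewrite -/(Q _) -/(y _) !mwE => h2.
  apply: (@le_trans _ _ (weight C s * weight C s' * y (spin_mul s s'))).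
    rewrite ler_pdivrMl ?exprn_gt0//; apply: (le_trans h2).
    by rewrite le_eqVlt; apply/orP; left; apply/eqP; ring.
  rewrite /weight -expRD; apply: (le_trans (exp_young _ n e0 (y0 _))).
  rewrite mulrC (mulrC (e ^+ _)^-1) lerD// mulrC -expRD !qformZ.
  by rewrite le_eqVlt; apply/orP; left; apply/eqP; congr (_ * expR _); ring.
rewrite -avgZ; apply: (@le_trans _ _ (avg (fun s => avg (fun s' =>
   e * (weight ((1 + n.+1%:R^-1) *: C) s * weight ((1 + n.+1%:R^-1) *: C) s') +
   (e ^+ n.+1)^-1 * y (spin_mul s s') ^+ n.+2)))).
  by apply: ler_avg => s; rewrite -avgZ; apply: ler_avg => s'; exact: ptw.
(* The raised weights factor over the replicas, and the error depends only on [spin_mul s s'], which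
   is uniform. *)
have -> : avg (fun s => avg (fun s' =>
   e * (weight ((1 + n.+1%:R^-1) *: C) s * weight ((1 + n.+1%:R^-1) *: C) s') +
   (e ^+ n.+1)^-1 * y (spin_mul s s') ^+ n.+2)) =
   e * avg (weight ((1 + n.+1%:R^-1) *: C)) ^+ 2 + avg (fun r => y r ^+ n.+2) / e ^+ n.+1.
  rewrite (eq_avg (h := fun s => e * avg (weight ((1 + n.+1%:R^-1) *: C)) *
     weight ((1 + n.+1%:R^-1) *: C) s + avg (fun r => y r ^+ n.+2) / e ^+ n.+1)).
    by rewrite avgD avg_cst avgZ expr2 mulrA.
  move=> s; rewrite avgD avgZ; congr (_ + _).
    by rewrite avgZ; ring.
  by rewrite avgZ mulrC; congr (_ * _); rewrite (avg_spin_mul (fun r => y r ^+ n.+2)).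
have w0 : 0 <= avg (weight ((1 + n.+1%:R^-1) *: C)) by apply: avg_ge0 => s; exact: weight_ge0.
apply: lerD.
  by rewrite ler_wpM2l ?(ltW e0)// ler_sqr ?nnegrE// (le_trans w0).
rewrite ler_wpM2r ?invr_ge0 ?exprn_ge0 ?(ltW e0)//.
(* For [z = exp ((n + 2) Q)] Bernoulli's inequality gives [z <= 1 + z^L / L], so a bounded moment of
   [z^L] yields a mean [1 + O(1 / L)]. The two weights account for both signs inside the absolute
   value. *)
have qb r : y r ^+ n.+2 <= expR (n.+2%:R * dlt) * (1 + (L%:R)^-1 *
    (weight ((n.+2%:R * L%:R) *: rr) r + weight (- (n.+2%:R * L%:R) *: rr) r)) - 1.
  rewrite /y; apply: (le_trans (exprB1_le _ _)).
    by rewrite -{1}(@expR0 R) ler_expR addr_ge0.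
  rewrite lerD2r -expRM_natl mulrDr expRD mulrC ler_wpM2l ?expR_ge0//.
  have L0' : 0 < L%:R :> R by rewrite ltr0n.
  have q1 : 1 <= expR (n.+2%:R * Q r) by rewrite -{1}(@expR0 R) ler_expR mulr_ge0.
  have := bernoulli_inequality L q1; rewrite -expRM_natl => bern.
  apply: (@le_trans _ _ (1 + L%:R^-1 * expR (L%:R * (n.+2%:R * Q r)))).
    rewrite -lerBlDl ler_pdivlMl//; lra.
  rewrite lerD2l ler_wpM2l ?invr_ge0 ?(ltW L0')// /weight !qformZ /Q.
  case: (leP 0 (2^-1 * qform rr (spins r))) => q0.
    rewrite -[leLHS]addr0 lerD ?expR_ge0// (ger0_norm q0).
    by rewrite ler_expR le_eqVlt; apply/orP; left; apply/eqP; ring.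
  rewrite -[leLHS]add0r lerD ?expR_ge0// (ltr0_norm q0).
  by rewrite ler_expR le_eqVlt; apply/orP; left; apply/eqP; ring.
apply: (le_trans (ler_avg qb)).
rewrite avgB avg_cst lerD2r avgZ ler_wpM2l ?expR_ge0// avgD avg_cst lerD2l avgZ avgD.
rewrite mulrC ler_wpM2r ?invr_ge0//.
have small c : `|c| = n.+2%:R * L%:R :> R -> avg (weight (c *: rr)) <= expR 1.
  move=> cE; apply: avg_weight_small => [i j|i|i j]; rewrite !mxE.
  - by rewrite rrS.
  - by rewrite rr0 mulr0.
  - by rewrite normrM cE.
have c0 : 0 <= n.+2%:R * L%:R :> R by rewrite mulr_ge0.
have := small (n.+2%:R * L%:R) (ger0_norm c0).
have : `|- (n.+2%:R * L%:R)| = n.+2%:R * L%:R :> R by rewrite normrN ger0_norm.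
move=> /small; lra.
Qed.

End replica_variance.

(** * Graphon operators and their resolvents *)

Section square_integrable.
Context {R : realType}.
Local Notation mu := (@lebesgue_measure R).
Local Notation I01 := (`[0%R, 1%R]%classic : set (measurableTypeR R)).
Implicit Types (f g h : R -> R).

Definition integ f := mu.-integrable I01 (EFin \o f).
(** Working form of [L2], with functions instead of classes and measurability on the interval only;
    [L2P] identifies the two. *)
Definition sqi f := measurable_fun I01 f /\ integ (fun x => f x ^+ 2).
Definition nrm f : R := Num.sqrt (dotp f f).

Lemma mI01 : measurable I01. Proof. exact: measurable_itv. Qed.
Hint Resolve mI01 : core.

Lemma mu_I01 : mu I01 = 1%E.
Proof. by rewrite lebesgue_measure_itv/= lte_fin ltr01 oppr0 adde0. Qed.

Lemma mu_I01_lty : (mu I01 < +oo)%E. Proof. by rewrite mu_I01 ltry. Qed.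

Lemma integ_measurable f : integ f -> measurable_fun I01 f.
Proof. by move=> /measurable_int/measurable_EFinP. Qed.

Lemma eq_integ f g : (forall x, I01 x -> f x = g x) -> integ f -> integ g.
Proof.
by move=> fg; apply: eq_integrable => // x /set_mem xI; rewrite /= fg.
Qed.

Lemma integ_bounded f (M : R) : measurable_fun I01 f ->
  (forall x, I01 x -> `|f x| <= M) -> integ f.
Proof.
move=> mf fM; apply: measurable_bounded_integrable => //; first exact: mu_I01_lty.
exists M; split; first exact: num_real.
by move=> B MB x xI; apply: (le_trans (fM _ xI)); exact: ltW.
Qed.

Lemma integ_cst (c : R) : integ (cst c).
Proof. by apply: (@integ_bounded _ `|c|) => //; exact: measurable_cst. Qed.

Lemma integ_le f g : measurable_fun I01 f -> integ g ->
  (forall x, I01 x -> `|f x| <= g x) -> integ f.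
Proof.
move=> mf ig fg; apply: (le_integrable mI01 _ _ ig); first exact/measurable_EFinP.
by move=> x xI; rewrite /= lee_fin (le_trans (fg _ xI))// ler_norm.
Qed.

Lemma integD f g : integ f -> integ g -> integ (fun x => f x + g x).
Proof.
move=> fi gi; have := integrableD mI01 fi gi; apply: eq_integrable => // x _.
Qed.

Lemma integZ (c : R) f : integ f -> integ (fun x => c * f x).
Proof.
move=> fi; have := integrableZl mI01 c fi; apply: eq_integrable => // x _.
Qed.

Lemma integ_norm f : integ f -> integ (fun x => `|f x|).
Proof. exact: integrable_norm. Qed.

Lemma sqi_bounded f (M : R) : measurable_fun I01 f ->
  (forall x, I01 x -> `|f x| <= M) -> sqi f.
Proof.
move=> mf fM; split=> //; apply: (@integ_bounded _ (M ^+ 2)).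
  exact: measurable_funX.
move=> x xI; rewrite normrX lerXn2r ?nnegrE ?fM//.
exact: le_trans (fM _ xI).
Qed.

Lemma sqiM f g : sqi f -> sqi g -> integ (fun x => f x * g x).
Proof.
move=> [mf fi] [mg gi]; apply: (integ_le _ (integD fi gi)).
  exact: measurable_funM.
move=> x _; rewrite normrM -(real_normK (num_real (f x))) -(real_normK (num_real (g x))).
have := sqr_ge0 (`|f x| - `|g x|).
have := sqr_ge0 (`|f x|); have := sqr_ge0 (`|g x|); nra.
Qed.

Lemma sqi_cst c : sqi (cst c).
Proof. by apply: (@sqi_bounded _ `|c|) => //; exact: measurable_cst. Qed.

Lemma sqi_integ f : sqi f -> integ f.
Proof.
by move=> sf; apply: eq_integ (sqiM sf (sqi_cst 1)) => x _; rewrite /= mulr1.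
Qed.

Lemma sqiZ c f : sqi f -> sqi (fun x => c * f x).
Proof.
move=> [mf fi]; split.
  by apply: measurable_funM => //; exact: measurable_cst.
by apply: eq_integ (integZ (c ^+ 2) fi) => x _; rewrite exprMn.
Qed.

Lemma sqiD f g : sqi f -> sqi g -> sqi (fun x => f x + g x).
Proof.
move=> sf sg; have fg := sqiM sf sg; case: sf sg => [mf fi] [mg gi]; split.
  exact: measurable_funD.
by apply: eq_integ (integD (integD fi gi) (integZ 2 fg)) => x _; ring.
Qed.

Lemma sqiB f g : sqi f -> sqi g -> sqi (fun x => f x - g x).
Proof.
move=> sf sg; have [mfg fgi] := sqiD sf (sqiZ (-1) sg); split.
  by apply: eq_measurable_fun mfg => x _; rewrite mulN1r.
by apply: eq_integ fgi => x _; rewrite mulN1r.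
Qed.

Lemma eq_sqi f g : (forall x, I01 x -> f x = g x) -> sqi f -> sqi g.
Proof.
move=> fg [mf fi]; split.
  by apply: eq_measurable_fun mf => x /set_mem xI; rewrite fg.
by apply: eq_integ fi => x xI; rewrite fg.
Qed.

Lemma eq_dotp f g f' g' : (forall x, I01 x -> f x = f' x) ->
  (forall x, I01 x -> g x = g' x) -> dotp f g = dotp f' g'.
Proof. by move=> ff gg; apply: eq_Rintegral => x /set_mem xI; rewrite ff ?gg. Qed.

Lemma dotpC f g : dotp f g = dotp g f.
Proof. by apply: eq_Rintegral => x _; rewrite mulrC. Qed.

Lemma dotpDl f g h : sqi f -> sqi g -> sqi h ->
  dotp (fun x => f x + g x) h = dotp f h + dotp g h.
Proof.
move=> sf sg sh; rewrite /dotp -RintegralD//; [|exact: sqiM|exact: sqiM].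
by apply: eq_Rintegral => x _; rewrite mulrDl.
Qed.

Lemma dotpZl c f h : sqi f -> sqi h -> dotp (fun x => c * f x) h = c * dotp f h.
Proof.
move=> sf sh; rewrite /dotp -RintegralZl//; last exact: sqiM.
by apply: eq_Rintegral => x _; rewrite mulrA.
Qed.

Lemma dotpBl f g h : sqi f -> sqi g -> sqi h ->
  dotp (fun x => f x - g x) h = dotp f h - dotp g h.
Proof.
move=> sf sg sh; rewrite /dotp -RintegralB//; [|exact: sqiM|exact: sqiM].
by apply: eq_Rintegral => x _; rewrite mulrBl.
Qed.

Lemma dotpDr f g h : sqi f -> sqi g -> sqi h ->
  dotp h (fun x => f x + g x) = dotp h f + dotp h g.
Proof. by move=> sf sg sh; rewrite dotpC dotpDl// !(dotpC h). Qed.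

Lemma dotpZr c f h : sqi f -> sqi h -> dotp h (fun x => c * f x) = c * dotp h f.
Proof. by move=> sf sh; rewrite dotpC dotpZl// (dotpC h). Qed.

Lemma dotpBr f g h : sqi f -> sqi g -> sqi h ->
  dotp h (fun x => f x - g x) = dotp h f - dotp h g.
Proof. by move=> sf sg sh; rewrite dotpC dotpBl// !(dotpC h). Qed.

Lemma dotp_ge0 f : 0 <= dotp f f.
Proof. by apply: Rintegral_ge0 => x _; rewrite -expr2 sqr_ge0. Qed.

Lemma dotp_cauchy_schwarz f g : sqi f -> sqi g -> dotp f g ^+ 2 <= dotp f f * dotp g g.
Proof.
move=> sf sg.
have q (c : R) : 0 <= dotp f f - 2 * c * dotp f g + c ^+ 2 * dotp g g.
  have scg := sqiZ c sg; have sb := sqiB sf scg.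
  have := dotp_ge0 (fun x => f x - c * g x).
  rewrite dotpBl// !dotpBr// !dotpZl// !dotpZr// (dotpC g f); lra.
(* In the degenerate case the quadratic is affine in [c]; a suitable [c] would make it negative
   unless its slope vanishes. *)
have [g0|g0] := eqVneq (dotp g g) 0.
  rewrite g0 mulr0; have [->|fg0] := eqVneq (dotp f g) 0; first by rewrite expr0n.
  have := q ((dotp f f + 1) / (2 * dotp f g)).
  rewrite g0 mulr0 addr0.
  have -> : 2 * ((dotp f f + 1) / (2 * dotp f g)) * dotp f g = dotp f f + 1 by field.
  lra.
have gp : 0 < dotp g g by rewrite lt_neqAle eq_sym g0 dotp_ge0.
have := q (dotp f g / dotp g g).
have -> : dotp f f - 2 * (dotp f g / dotp g g) * dotp f g +
    (dotp f g / dotp g g) ^+ 2 * dotp g g = dotp f f - dotp f g ^+ 2 / dotp g g by field.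
by rewrite subr_ge0 ler_pdivrMr.
Qed.

Lemma nrm_ge0 f : 0 <= nrm f. Proof. exact: sqrtr_ge0. Qed.

Lemma nrm_sqr f : nrm f ^+ 2 = dotp f f.
Proof. by rewrite sqr_sqrtr// dotp_ge0. Qed.

Lemma abs_dotp_le f g : sqi f -> sqi g -> `|dotp f g| <= nrm f * nrm g.
Proof.
move=> sf sg; rewrite -ler_sqr ?nnegrE ?mulr_ge0 ?nrm_ge0//.
by rewrite real_normK ?num_real// exprMn !nrm_sqr dotp_cauchy_schwarz.
Qed.

Lemma nrmD f g : sqi f -> sqi g -> nrm (fun x => f x + g x) <= nrm f + nrm g.
Proof.
move=> sf sg; rewrite -ler_sqr ?nnegrE ?addr_ge0 ?nrm_ge0//.
have sfg := sqiD sf sg.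
rewrite sqrrD !nrm_sqr dotpDl// !dotpDr// (dotpC g f).
have := abs_dotp_le sf sg; have := ler_norm (dotp f g); lra.
Qed.

Lemma nrmZ c f : sqi f -> nrm (fun x => c * f x) = `|c| * nrm f.
Proof.
move=> sf; have scf := sqiZ c sf.
by rewrite /nrm dotpZl// dotpZr// mulrA -expr2 sqrtrM ?sqr_ge0// sqrtr_sqr.
Qed.

Lemma nrm_le f g : sqi f -> sqi g -> (forall x, I01 x -> `|f x| <= `|g x|) ->
  nrm f <= nrm g.
Proof.
move=> sf sg fg; rewrite ler_wsqrtr//; apply: le_Rintegral => //; [exact: sqiM|exact: sqiM|].
move=> x xI; rewrite -!expr2 -(real_normK (num_real (f x))) -(real_normK (num_real (g x))).
by rewrite ler_sqr ?nnegrE// fg.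
Qed.

Lemma nrm_cst c : nrm (cst c) = `|c|.
Proof.
have e : dotp (cst c) (cst c) = c * c * fine (mu I01) := Rintegral_cst mu mI01 (c * c).
by rewrite /nrm e mu_I01/= mulr1 -expr2 sqrtr_sqr.
Qed.

Lemma eq_nrm f g : (forall x, I01 x -> f x = g x) -> nrm f = nrm g.
Proof. by move=> fg; rewrite /nrm (@eq_dotp f f g g). Qed.

Lemma nrm_le_cst f c : sqi f -> 0 <= c -> (forall x, I01 x -> `|f x| <= c) -> nrm f <= c.
Proof.
move=> sf c0 fc; rewrite -[leRHS](ger0_norm c0) -nrm_cst; apply: nrm_le => //.
  exact: sqi_cst.
by move=> x xI; rewrite /= (ger0_norm c0) fc.
Qed.

Lemma int_norm_le_nrm f : sqi f -> \int[mu]_(x in I01) `|f x| <= nrm f.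
Proof.
move=> sf; have saf : sqi (fun x => `|f x|).
  case: sf => mf fi; split; first exact: measurableT_comp.
  by apply: eq_integ fi => x _; rewrite real_normK ?num_real.
have := abs_dotp_le saf (sqi_cst 1); rewrite nrm_cst normr1 mulr1.
have -> : dotp (fun x => `|f x|) (cst 1) = \int[mu]_(x in I01) `|f x|.
  by apply: eq_Rintegral => x _; rewrite /= mulr1.
have -> : nrm (fun x => `|f x|) = nrm f.
  rewrite /nrm /dotp; congr Num.sqrt; apply: eq_Rintegral => x _.
  by rewrite -!expr2 real_normK ?num_real.
by apply: le_trans; exact: ler_norm.
Qed.

Lemma integralE_dotp f : sqi f ->
  (\int[mu]_x (`|(EFin \o (f \_ I01)) x| `^ 2) = (dotp f f)%:E)%E.
Proof.
move=> sf; rewrite /dotp /Rintegral fineK; last first.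
  by apply: integrable_fin_num => //; exact: sqiM.
rewrite [RHS]integral_mkcond; apply: eq_integral => x _ /=.
rewrite !patchE; case: ifPn => _ /=.
  by rewrite powR_mulrn// real_normK ?num_real// expr2.
by rewrite normr0 powR0 ?pnatr_eq0.
Qed.

Lemma norm2E f : sqi f -> norm2 f = nrm f.
Proof.
move=> sf; rewrite /norm2 unlock integralE_dotp//.
by rewrite poweR_EFin/= powR12_sqrt ?dotp_ge0.
Qed.

Lemma L2P f : L2 f <-> sqi f.
Proof.
split.
  move=> Lf; move: (Lf); rewrite /L2 inE => /andP[]; rewrite inE/= => mf _.
  split; first exact/measurable_restrictT.
  have := Lfun2_integrable_sqr Lf => /=.
  move=> h.
  apply: (proj2 (@integrable_mkcond _ (measurableTypeR R) R mu I01 (fun x => (f x ^+ 2)%:E) mI01)).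
  apply: eq_integrable h => // x _ /=.
  by rewrite !patchE; case: ifPn => //= _; rewrite expr0n.
move=> sf; rewrite /L2 inE; apply/andP; split; rewrite inE/=.
  by apply/(measurable_restrictT _ mI01); case: sf.
by rewrite /finite_norm unlock integralE_dotp// poweR_EFin ltry.
Qed.

End square_integrable.
#[export] Hint Resolve mI01 : core.

Section graphon_operator_norm.
Context {R : realType}.
Local Notation mu := (@lebesgue_measure R).
Local Notation RM := (measurableTypeR R).
Local Notation I01 := (`[0%R, 1%R]%classic : set (measurableTypeR R)).
Variable W : R -> R -> R.
Hypothesis gW : graphon W.
Implicit Types (f g : R -> R).

Let W0 x y : I01 x -> I01 y -> 0 <= W x y.
Proof. by case: gW => _ W01 _ xI yI; have /andP[] := W01 x y xI yI. Qed.

Let W1 x y : I01 x -> I01 y -> W x y <= 1.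
Proof. by case: gW => _ W01 _ xI yI; have /andP[] := W01 x y xI yI. Qed.

Let absW x y : I01 x -> I01 y -> `|W x y| <= 1.
Proof. by move=> xI yI; rewrite ger0_norm ?W0 ?W1. Qed.

Let WT : RM * RM -> R := (fun z => W z.1 z.2) \_ (I01 `*` I01).

Let mWT : measurable_fun setT WT.
Proof.
have mD : measurable (I01 `*` I01) := measurableX mI01 mI01.
by apply/(measurable_restrictT _ mD); case: gW.
Qed.

Lemma graphon_section_measurable x : I01 x -> measurable_fun I01 (W x).
Proof.
move=> xI; have /= m := measurable_fun_pair2 x mWT.
apply: (@eq_measurable_fun _ _ _ _ _ (fun y => WT (x, y))); last first.
  exact: measurable_funTS.
by move=> y /set_mem yI; rewrite /WT patchE mem_set.
Qed.

Lemma sqi_graphon_section x : I01 x -> sqi (W x).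
Proof.
move=> xI; apply: (@sqi_bounded _ _ 1); first exact: graphon_section_measurable.
by move=> y yI; exact: absW.
Qed.

Lemma integ_graphonM x f : I01 x -> integ f -> integ (fun y => W x y * f y).
Proof.
move=> xI fi; apply: (integ_le _ (integ_norm fi)).
  apply: measurable_funM; first exact: graphon_section_measurable.
  exact: integ_measurable.
by move=> y yI; rewrite normrM -[leRHS]mul1r ler_wpM2r// absW.
Qed.

Lemma TW_le f x : integ f -> I01 x -> `|TW W f x| <= \int[mu]_(y in I01) `|f y|.
Proof.
move=> fi xI; have h := integ_graphonM xI fi.
apply: (le_trans (le_normr_Rintegral mI01 h)).
apply: le_Rintegral => //; [exact: integ_norm|exact: integ_norm|].
by move=> y yI; rewrite normrM -[leRHS]mul1r ler_wpM2r// absW.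
Qed.

(** Fubini for the kernel extended by zero to the plane; the inner integrals are dominated by the
    integral of [|f|], on an interval of length 1. *)
Lemma TW_measurable f : integ f -> measurable_fun I01 (TW W f).
Proof.
move=> fi.
pose F (z : RM * RM) : \bar R := (WT z * (f \_ I01) z.2)%:E.
have mf : measurable_fun setT (f \_ I01 : RM -> R).
  by apply/(measurable_restrictT _ mI01); exact: integ_measurable.
have mF : measurable_fun setT F.
  apply/measurable_EFinP; apply: measurable_funM; first exact: mWT.
  by apply: (measurableT_comp mf); exact: measurable_snd.
pose K := \int[mu]_(y in I01) `|f y|.
have KE : (\int[mu]_y `|(f \_ I01) y|%:E = K%:E)%E.
  rewrite /K /Rintegral fineK; last first.
    by apply: integrable_fin_num => //; exact: integ_norm.
  rewrite [RHS]integral_mkcond; apply: eq_integral => y _.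
  by rewrite !patchE; case: ifPn => // _; rewrite normr0.
have iF : (mu \x mu)%E.-integrable setT F.
  apply/(integrable12ltyP mu mu mF).
  apply: (@le_lt_trans _ _ (\int[mu]_x (cst K%:E \_ I01) x)%E).
    apply: ge0_le_integral => //.
    - by move=> x _; apply: integral_ge0.
    - have mA : measurable_fun setT (abse \o F) by apply: measurableT_comp.
      exact: (@measurable_fun_fubini_tonelli_F _ _ _ _ _ mu (abse \o F) mA (fun z => abse_ge0 _)).
    - by apply/(measurable_restrictT _ mI01); exact: measurable_cst.
    - move=> x _; rewrite patchE; case: ifPn => [/set_mem xI|xI].
        rewrite -KE; apply: ge0_le_integral => //.
        + apply: measurableT_comp => //.
          exact: (measurable_fun_pair2 x mF).
        + by apply/measurable_EFinP; apply: measurableT_comp.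
        + move=> y _; rewrite /F /WT !patchE /=; case: ifPn => [|_]; last by rewrite mul0r normr0 lee_fin.
          rewrite in_setX/= => /andP[_ /set_mem yI].
          by rewrite lee_fin normrM -[leRHS]mul1r ler_wpM2r// absW.
      rewrite (eq_integral (cst 0%E)) ?integral0// => y _.
      by rewrite /F /WT patchE in_setX/= (negbTE xI)/= mul0r normr0.
  rewrite -integral_mkcond.
  have -> : (\int[mu]_(x in I01) (cst K%:E) x = K%:E * mu I01)%E by exact: integral_cst.
  by rewrite mu_I01 mule1 ltry.
have m := measurable_fubini_F iF.
apply: (@eq_measurable_fun _ _ _ _ _ (fun x => fine (fubini_F mu F x))); last first.
  by apply: measurable_funTS; apply: measurableT_comp m; exact: fine_measurable.
move=> x /set_mem xI; rewrite /TW /Rintegral; congr fine.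
rewrite [RHS]integral_mkcond; apply: eq_integral => y _.
rewrite /F /WT !patchE/= in_setX/= (mem_set xI)/=.
by case: ifPn => //= _; rewrite mul0r.
Qed.

Lemma sqi_TW f : integ f -> sqi (TW W f).
Proof.
move=> fi; apply: (sqi_bounded (TW_measurable fi)) => x xI.
exact: TW_le.
Qed.

Lemma TW_le_nrm f x : sqi f -> I01 x -> `|TW W f x| <= nrm f.
Proof.
move=> sf xI; apply: (le_trans (TW_le (sqi_integ sf) xI)).
exact: int_norm_le_nrm.
Qed.

Lemma eq_TW f g x : (forall y, I01 y -> f y = g y) -> TW W f x = TW W g x.
Proof. by move=> fg; apply: eq_Rintegral => y /set_mem yI; rewrite fg. Qed.

Lemma TWD f g x : integ f -> integ g -> I01 x ->
  TW W (fun y => f y + g y) x = TW W f x + TW W g x.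
Proof.
move=> fi gi xI; rewrite /TW -RintegralD//; [|exact: integ_graphonM|exact: integ_graphonM].
by apply: eq_Rintegral => y _; rewrite mulrDr.
Qed.

Lemma TWZ c f x : integ f -> I01 x -> TW W (fun y => c * f y) x = c * TW W f x.
Proof.
move=> fi xI; rewrite /TW -RintegralZl//; last exact: integ_graphonM.
by apply: eq_Rintegral => y _; rewrite mulrCA.
Qed.

Lemma TWB f g x : integ f -> integ g -> I01 x ->
  TW W (fun y => f y - g y) x = TW W f x - TW W g x.
Proof.
move=> fi gi xI; rewrite /TW -RintegralB//; [|exact: integ_graphonM|exact: integ_graphonM].
by apply: eq_Rintegral => y _; rewrite mulrBr.
Qed.

(** As [opnorm] is a real supremum, its set must be shown bounded: [0 <= W <= 1] gives the bound 1.
    When [nrm f = 0] normalization is impossible, but then [TW W f] vanishes on the interval. *)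
Lemma nrm_TW_le_opnorm f : sqi f -> nrm (TW W f) <= opnorm W * nrm f.
Proof.
move=> sf.
have ub : has_ubound [set norm2 (TW W f) | f in [set f | L2 f /\ norm2 f <= 1]].
  exists 1 => _ [g [/L2P sg g1] <-].
  have ig := sqi_integ sg.
  rewrite norm2E; last exact: sqi_TW.
  apply: nrm_le_cst => //; first exact: sqi_TW.
  move=> x xI; apply: (le_trans (TW_le_nrm sg xI)).
  by rewrite -norm2E.
have [f0|f0] := eqVneq (nrm f) 0.
  rewrite f0 mulr0; apply: nrm_le_cst => //; first exact/sqi_TW/sqi_integ.
  by move=> x xI; rewrite -f0; exact: TW_le_nrm.
have fp : 0 < nrm f by rewrite lt_neqAle eq_sym f0 nrm_ge0.
pose g y := (nrm f)^-1 * f y.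
have sg : sqi g by exact: sqiZ.
have ng : nrm g = 1 by rewrite nrmZ// ger0_norm ?invr_ge0 ?nrm_ge0// mulVf.
have : norm2 (TW W g) <= opnorm W.
  by apply: ub_le_sup => //; exists g => //; split; [exact/L2P|rewrite norm2E// ng].
rewrite norm2E; last exact/sqi_TW/sqi_integ.
have -> : nrm (TW W g) = (nrm f)^-1 * nrm (TW W f).
  rewrite -[X in X * _](ger0_norm (x := (nrm f)^-1)) ?invr_ge0 ?nrm_ge0//.
  rewrite -nrmZ; last exact/sqi_TW/sqi_integ.
  by apply: eq_nrm => x xI; rewrite TWZ//; exact: sqi_integ.
by rewrite ler_pdivrMl// mulrC.
Qed.

End graphon_operator_norm.

(** * Darboux sums along uniform grids *)

Section grid_counting.
Context {R : realType}.

Lemma itv_partition_nth01 (s : seq R) k : itv_partition 0 1 s -> (k < size s)%N ->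
  [/\ 0 <= nth 0 (0 :: s) k, nth 0 (0 :: s) k < nth 0 s k & nth 0 s k <= 1].
Proof.
move=> ps ks; split.
- case: k ks => [//|k ks] /=.
  rewrite (set_nth_default 1) ?(ltnW ks)//.
  by have := itv_partition_nth_ge (m := k.+1) (ltnW ks) ps.
- have [ps1 _] := ps; have /(pathP (0 : R)) h := ps1.
  by have := h k ks.
- rewrite (set_nth_default 1)//.
  by have := itv_partition_nth_le (m := k.+1) ks ps.
Qed.

Definition clamp (a b x : R) : R := Num.max a (Num.min b x).

Lemma sum_const_ord N (c : R) : \sum_(j < N) c = N%:R * c.
Proof. by rewrite sumr_const card_ord mulr_natl. Qed.

(** A grid cell inside [[a, b]] is detected by the increment of [clamp a b] over it, and these
    increments telescope. *)
Lemma sum_cells_inside (a b : R) N : (0 < N)%N -> a <= b ->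
  \sum_(i < N) ((a <= i%:R / N%:R) && (i.+1%:R / N%:R <= b))%:R <= N%:R * (b - a).
Proof.
move=> N0 ab; have n0 : 0 < N%:R :> R by rewrite ltr0n.
rewrite -(big_mkord xpredT (fun i : nat => ((a <= i%:R / N%:R) && (i.+1%:R / N%:R <= b))%:R)).
apply: (@le_trans _ _ (\sum_(0 <= i < N) N%:R * (clamp a b (i.+1%:R / N%:R) - clamp a b (i%:R / N%:R)))).
  apply: ler_sum => i _.
  have ii : i%:R / N%:R <= i.+1%:R / N%:R :> R by rewrite ler_pM2r ?invr_gt0// ler_nat.
  have mono : clamp a b (i%:R / N%:R) <= clamp a b (i.+1%:R / N%:R).
    rewrite /clamp; have [] := leP b (i%:R / N%:R); have [] := leP b (i.+1%:R / N%:R);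
    case: (leP a b) => //; rewrite /Num.max; do ?case: ifP; lra.
  case: (boolP (_ && _)) => [/andP[ai ib]|_] /=; last by rewrite mulr_ge0 ?subr_ge0// ltW.
  rewrite /clamp (min_idPr ib) (min_idPr (le_trans ii ib)) (max_idPr ai).
  rewrite (max_idPr (le_trans ai ii)) le_eqVlt; apply/orP; left; apply/eqP.
  by rewrite -natr1; field; rewrite gt_eqF.
rewrite -mulr_sumr telescope_sumr// ler_wpM2l ?(ltW n0)//.
rewrite /clamp; case: (leP a (Num.min b (N%:R / N%:R))) => h1; case: (leP a (Num.min b (0%:R / N%:R))) => h2.
- have : Num.min b (N%:R / N%:R) <= b by rewrite ge_min lexx.
  lra.
- have : Num.min b (N%:R / N%:R) <= b by rewrite ge_min lexx.
  lra.
- lra.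
- lra.
Qed.

(** The indicator of [c < x] changes at most once along the grid; its increments telescope. *)
Lemma sum_cells_crossing (c : R) N : (0 < N)%N ->
  (\sum_(i < N) ((i%:R / N%:R < c) && (c < i.+1%:R / N%:R))%:R : R) <= 1.
Proof.
move=> N0; have n0 : 0 < N%:R :> R by rewrite ltr0n.
rewrite -(big_mkord xpredT (fun i : nat => ((i%:R / N%:R < c) && (c < i.+1%:R / N%:R))%:R)).
have S (i : nat) : ((i%:R / N%:R < c) && (c < i.+1%:R / N%:R))%:R <=
    (c < i.+1%:R / N%:R)%R%:R - (c < i%:R / N%:R)%R%:R :> R.
  have ii : i%:R / N%:R <= i.+1%:R / N%:R :> R by rewrite ler_pM2r ?invr_gt0// ler_nat.
  case: (ltP c (i%:R / N%:R)) => h1; case: (ltP c (i.+1%:R / N%:R)) => h2; rewrite ?andbT ?andbF ?subrr ?subr0//.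
  - by rewrite ltNge (ltW h1).
  - by have := lt_le_trans h1 (le_trans ii h2); rewrite ltxx.
  - by case: (_ < _).
apply: (le_trans (ler_sum _ (fun i _ => S i))).
rewrite telescope_sumr//.
have h0 := ler0n R (c < 0%:R / N%:R)%R.
have h1 : (c < N%:R / N%:R)%R%:R <= 1 :> R by case: (_ < _).
lra.
Qed.

Definition grid_cell N (i : nat) : set R := `[i%:R / N%:R, i.+1%:R / N%:R]%classic.

End grid_counting.

Section darboux_grid.
Context {R : realType}.

Lemma osc_bound (A : set R) M x y : (forall z, A z -> `|z| <= M) -> A x -> A y ->
  `|x - y| <= sup A - inf A.
Proof.
move=> AM Ax Ay.
have ub : has_ubound A by exists M => z /AM; exact/le_trans/ler_norm.
have lb : has_lbound A by exists (- M) => z /AM; rewrite ler_norml => /andP[].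
have := ub_le_sup ub Ax; have := ub_le_sup ub Ay.
have := ge_inf lb Ax; have := ge_inf lb Ay.
rewrite ler_norml; lra.
Qed.

(** A grid cell inside a rectangle of the Darboux partition inherits its oscillation; one that
    crosses a partition line is charged [2 * M]. Each line crosses at most one row or column, so the
    latter number O(N) out of [N^2]. That [B] is chosen before [e] is what later allows sums of
    squares. *)
Lemma riemann_grid (W : R -> R -> R) : riemann_integrable2 W ->
  exists2 B, 0 <= B & forall e : R, 0 < e -> exists N0, forall N, (N0 <= N)%N -> (0 < N)%N ->
  exists o : 'I_N -> 'I_N -> R, [/\ forall i j, 0 <= o i j <= B,
    forall (i j : 'I_N) x y x' y', grid_cell N i x -> grid_cell N j y ->
      grid_cell N i x' -> grid_cell N j y' -> `|W x y - W x' y'| <= o i j &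
    \sum_i \sum_j o i j <= e * N%:R ^+ 2].
Proof.
move=> [[M WM] intW].
have M0 : 0 <= M.
  by apply: le_trans (WM 0 0 _ _); rewrite ?normr_ge0//= in_itv/= lexx ler01.
exists (2 * M); first by rewrite mulr_ge0.
move=> e e0.
have [s [t [ps pt]]] := intW (e / 2) (divr_gt0 e0 (ltr0n _ 2)).
pose A k l := [set W x y | x in cell s k & y in cell t l].
pose osc k l := sup (A k l) - inf (A k l).
rewrite -/(osc _ _) => oscS.
have incell01 (r : seq R) k x : itv_partition 0 1 r -> (k < size r)%N -> cell r k x -> `[0, 1]%classic x.
  move=> pr kr; rewrite /cell/= !in_itv/= => /andP[h1 h2].
  have [h3 h4 h5] := itv_partition_nth01 pr kr.
  by rewrite (le_trans h3 h1) (le_trans h2 h5).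
have AM k l z : (k < size s)%N -> (l < size t)%N -> A k l z -> `|z| <= M.
  move=> ks lt [x xk [y yl <-]]; apply: WM.
    exact: incell01 ps ks xk.
  exact: incell01 pt lt yl.
have osc0 k l : (k < size s)%N -> (l < size t)%N -> 0 <= osc k l.
  move=> ks lt; have [h1 h2 h3] := itv_partition_nth01 ps ks; have [h4 h5 h6] := itv_partition_nth01 pt lt.
  have a : A k l (W (nth 0 s k) (nth 0 t l)).
    exists (nth 0 s k); first by rewrite /cell/= in_itv/= lexx ltW.
    by exists (nth 0 t l) => //; rewrite /cell/= in_itv/= lexx ltW.
  by apply: le_trans (osc_bound (AM k l ^~ ks ^~ lt) a a).
pose ins N (r : seq R) k (i : nat) : R :=
  ((nth 0 (0 :: r) k <= i%:R / N%:R) && (i.+1%:R / N%:R <= nth 0 r k))%:R.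
pose crs N (r : seq R) k (i : nat) : R :=
  ((i%:R / N%:R < nth 0 r k) && (nth 0 r k < i.+1%:R / N%:R))%:R.
pose o N (i j : 'I_N) := \sum_(k < size s) \sum_(l < size t) osc k l * (ins N s k i * ins N t l j)
  + 2 * M * \sum_(k < size s) crs N s k i + 2 * M * \sum_(l < size t) crs N t l j.
have ins0 N r k i : 0 <= ins N r k i by exact: ler0n.
have crs0 N r k i : 0 <= crs N r k i by exact: ler0n.
have t1 N (i j : 'I_N) : 0 <= \sum_(k < size s) \sum_(l < size t) osc k l * (ins N s k i * ins N t l j).
  by apply: sumr_ge0 => k _; apply: sumr_ge0 => l _; rewrite mulr_ge0 ?osc0 ?mulr_ge0.
have t2 N r i : 0 <= 2 * M * \sum_(k < size r) crs N r k i.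
  by rewrite !mulr_ge0// sumr_ge0.
have o0 N i j : 0 <= o N i j by rewrite /o !addr_ge0.
(* Finds the partition interval of a left end point: [find] returns the first partition point
   strictly to its right. *)
have idx N (r : seq R) (i : 'I_N) : itv_partition 0 1 r -> (0 < N)%N ->
    exists2 k : 'I_(size r), nth 0 (0 :: r) k <= i%:R / N%:R &
      i%:R / N%:R < nth 0 r k.
  move=> pr N0; have n0 : 0 < N%:R :> R by rewrite ltr0n.
  pose P (z : R) := i%:R / N%:R < z.
  have hP : has P r.
    have [_ /eqP lr] := pr.
    case: r pr lr => [|z r] pr lr; first by move: lr => /= /eqP; rewrite eq_sym oner_eq0.
    apply/hasP; exists 1; first by rewrite -lr /= mem_last.
    by rewrite /P ltr_pdivrMr// mul1r ltr_nat.
  have fs : (find P r < size r)%N by rewrite -has_find.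
  exists (Ordinal fs) => /=; last exact: (nth_find 0 hP).
  case E : (find P r) => [|k] /=; first by rewrite divr_ge0.
  rewrite leNgt; apply/negP => h.
  by have := @before_find _ 0 P r k; rewrite E ltnSn => /(_ isT); rewrite /P h.
have main N (i j : 'I_N) x y x' y' : (0 < N)%N -> grid_cell N i x -> grid_cell N j y ->
      grid_cell N i x' -> grid_cell N j y' ->
    `|W x y - W x' y'| <= 2 * M /\ `|W x y - W x' y'| <= o N i j.
  move=> N0; have n0 : 0 < N%:R :> R by rewrite ltr0n.
  have in01 (a : 'I_N) (z : R) : grid_cell N a z -> `[0, 1]%classic z.
    rewrite /grid_cell/= !in_itv/= => /andP[h1 h2].
    rewrite (le_trans _ h1) ?divr_ge0//= (le_trans h2)// ler_pdivrMr// mul1r ler_nat//.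
  move=> ix jy ix' jy'.
  have W2 : `|W x y - W x' y'| <= 2 * M.
    rewrite (le_trans (ler_normB _ _))// mulr2n mulrDl mul1r lerD// WM//; by [exact: in01 ix|exact: in01 jy|exact: in01 ix'|exact: in01 jy'].
  split=> //.
  have [k k1 k2] := idx N s i ps N0; have [l l1 l2] := idx N t j pt N0.
  have [ck|ck] := leP (i.+1%:R / N%:R) (nth 0 s k); last first.
    apply: (le_trans W2); rewrite /o -[leLHS]add0r -[leLHS]addr0 lerD// lerD//.
    rewrite -{1}(mulr1 (2 * M)) ler_wpM2l ?mulr_ge0//.
    by rewrite (bigD1 k)//= /crs k2 ck/= lerDl sumr_ge0.
  have [cl|cl] := leP (j.+1%:R / N%:R) (nth 0 t l); last first.
    apply: (le_trans W2); rewrite /o -[leLHS]add0r lerD ?addr_ge0//.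
    rewrite -{1}(mulr1 (2 * M)) ler_wpM2l ?mulr_ge0//.
    by rewrite (bigD1 l)//= /crs l2 cl/= lerDl sumr_ge0.
  rewrite /o -addrA -[leLHS]addr0 lerD ?addr_ge0//.
  rewrite (bigD1 k)//= (bigD1 l)//= /ins k1 ck l1 cl/= !mulr1 -addrA -[leLHS]addr0 lerD//.
    have sub (r : seq R) (a : 'I_(size r)) (b : 'I_N) z : nth 0 (0 :: r) a <= b%:R / N%:R ->
        b.+1%:R / N%:R <= nth 0 r a -> grid_cell N b z -> cell r a z.
      move=> h1 h2; rewrite /grid_cell /cell/= !in_itv/= => /andP[h3 h4].
      by rewrite (le_trans h1 h3) (le_trans h4 h2).
    apply: (osc_bound (AM k l ^~ (ltn_ord k) ^~ (ltn_ord l))).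
      by exists x; [exact: sub ix|exists y => //; exact: sub jy].
    by exists x'; [exact: sub ix'|exists y' => //; exact: sub jy'].
  rewrite addr_ge0//.
    by apply: sumr_ge0 => l' _; rewrite mulr_ge0 ?osc0 ?mulr_ge0 ?ler0n.
  by apply: sumr_ge0 => k' _; apply: sumr_ge0 => l' _; rewrite mulr_ge0 ?osc0 ?mulr_ge0 ?ler0n.
pose c := 2 * M * ((size s)%:R + (size t)%:R).
have c0 : 0 <= c by rewrite !mulr_ge0// addr_ge0.
exists (Num.truncn (2 * c / e)).+1 => N NN N0.
have n0 : 0 < N%:R :> R by rewrite ltr0n.
(* Truncation at [2 * M] keeps the oscillations bounded independently of the partition. *)
exists (fun i j => Num.min (2 * M) (o N i j)); split.
- by move=> i j; rewrite ge_min lexx le_min o0 mulr_ge0.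
- move=> i j x y x' y' ix jy ix' jy'; have [h1 h2] := main N i j x y x' y' N0 ix jy ix' jy'.
  by rewrite le_min h1 h2.
apply: (@le_trans _ _ (\sum_i \sum_j o N i j)).
  by apply: ler_sum => i _; apply: ler_sum => j _; rewrite ge_min lexx orbT.
have cN : c <= e / 2 * N%:R.
  have : 2 * c / e <= N%:R.
    apply: ltW; apply: (lt_le_trans (truncnS_gt _)).
    by rewrite ler_nat.
  rewrite ler_pdivrMr//; lra.
have S3 : \sum_(i < N) \sum_(j < N) 2 * M * (\sum_(k < size s) crs N s k i) <= 2 * M * (size s)%:R * N%:R.
  under eq_bigr do rewrite sum_const_ord mulrCA.
  rewrite -mulr_sumr -[leRHS]mulrA ler_wpM2l ?mulr_ge0// -mulr_sumr [leRHS]mulrC ler_wpM2l//.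
  rewrite exchange_big/=; apply: (@le_trans _ _ (\sum_(k < size s) 1)).
    by apply: ler_sum => k _; exact: sum_cells_crossing.
  by rewrite sum_const_ord mulr1.
have S4 : \sum_(i < N) \sum_(j < N) 2 * M * (\sum_(l < size t) crs N t l j) <= 2 * M * (size t)%:R * N%:R.
  rewrite exchange_big/=.
  under eq_bigr do rewrite sum_const_ord mulrCA.
  rewrite -mulr_sumr -[leRHS]mulrA ler_wpM2l ?mulr_ge0// -mulr_sumr [leRHS]mulrC ler_wpM2l//.
  rewrite exchange_big/=; apply: (@le_trans _ _ (\sum_(k < size t) 1)).
    by apply: ler_sum => k _; exact: sum_cells_crossing.
  by rewrite sum_const_ord mulr1.
have S1 : \sum_(i < N) \sum_(j < N) \sum_(k < size s) \sum_(l < size t) osc k l * (ins N s k i * ins N t l j)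
    <= N%:R ^+ 2 * (e / 2).
  have -> : \sum_(i < N) \sum_(j < N) \sum_(k < size s) \sum_(l < size t) osc k l * (ins N s k i * ins N t l j) =
     \sum_(k < size s) \sum_(l < size t) osc k l * ((\sum_(i < N) ins N s k i) * (\sum_(j < N) ins N t l j)).
    under eq_bigr do rewrite exchange_big/=.
    rewrite exchange_big/=; apply: eq_bigr => k _.
    under eq_bigr do rewrite exchange_big/=.
    rewrite exchange_big/=; apply: eq_bigr => l _.
    rewrite mulr_suml mulr_sumr; apply: eq_bigr => i _.
    by rewrite -mulr_sumr; congr (_ * _); rewrite mulr_sumr.
  apply: (@le_trans _ _ (N%:R ^+ 2 * \sum_(k < size s) \sum_(l < size t)
     osc k l * (cell_length s k * cell_length t l))); last first.
    by rewrite ler_wpM2l ?sqr_ge0// ltW.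
  rewrite mulr_sumr; apply: ler_sum => k _; rewrite mulr_sumr; apply: ler_sum => l _.
  have [h1 h2 h3] := itv_partition_nth01 ps (ltn_ord k); have [h4 h5 h6] := itv_partition_nth01 pt (ltn_ord l).
  rewrite [leRHS]mulrCA ler_wpM2l ?osc0// expr2 mulrACA; apply: ler_pM.
  - by apply: sumr_ge0 => i _.
  - by apply: sumr_ge0 => i _.
  - by apply: sum_cells_inside => //; exact: ltW.
  - by apply: sum_cells_inside => //; exact: ltW.
rewrite /o; under eq_bigr do rewrite !big_split/=.
rewrite !big_split/=.
have : c * N%:R <= e / 2 * N%:R * N%:R by rewrite ler_wpM2r// ltW.
rewrite /c; set n := N%:R in S1 S3 S4 *.
move: S1 S3 S4; set x1 := \sum_(i < N) _; set x2 := \sum_(i < N) _; set x3 := \sum_(i < N) _.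
rewrite expr2; lra.
Qed.

(** [f] is viewed as a function of two variables, with the trivial partition in the second;
    averaging over the second index returns to one variable. *)
Lemma riemann_grid1 (f : R -> R) : riemann_integrable f ->
  exists2 B, 0 <= B & forall e : R, 0 < e -> exists N0, forall N, (N0 <= N)%N -> (0 < N)%N ->
  exists o : 'I_N -> R, [/\ forall i, 0 <= o i <= B,
    forall (i : 'I_N) x x', grid_cell N i x -> grid_cell N i x' -> `|f x - f x'| <= o i &
    \sum_i o i <= e * N%:R].
Proof.
move=> [[M fM] intf].
have : riemann_integrable2 (fun x _ => f x).
  split; first by exists M => x y xI _; exact: fM.
  move=> e e0; have [s ps sE] := intf e e0.
  exists s, [:: 1]; split=> //; first by split => //=; rewrite ltr01.
  apply: le_lt_trans sE; apply: ler_sum => k _; rewrite big_ord1.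
  have -> : [set f x | x in cell s k & y in cell ([:: 1] : seq R) 0] = f @` cell s k.
    apply/seteqP; split=> [_ [x xk [y yk <-]]|_ [x xk <-]]; first by exists x.
    by exists x => //; exists 0 => //; rewrite /cell/= in_itv/= lexx ler01.
  by rewrite /cell_length/= subr0 mulr1.
move=> /riemann_grid[B B0 H]; exists B => // e e0.
have [N0 HN] := H e e0; exists N0 => N NN Npos.
have n0 : 0 < N%:R :> R by rewrite ltr0n.
have [om [oB oW oS]] := HN N NN Npos.
exists (fun i => (\sum_j om i j) / N%:R); split.
- move=> i; rewrite divr_ge0 ?(ltW n0)//=; last by apply: sumr_ge0 => j _; have /andP[] := oB i j.
  rewrite ler_pdivrMr// mulrC -sum_const_ord; apply: ler_sum => j _; by have /andP[] := oB i j.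
- move=> i x x' ix ix'; rewrite ler_pdivlMr// mulrC -sum_const_ord; apply: ler_sum => j _.
  apply: (oW i j x (j%:R / N%:R) x' (j%:R / N%:R)) => //.
    by rewrite /grid_cell/= in_itv/= lexx/= ler_pM2r ?invr_gt0// ler_nat.
  by rewrite /grid_cell/= in_itv/= lexx/= ler_pM2r ?invr_gt0// ler_nat.
- by rewrite -mulr_suml ler_pdivrMr// -mulrA -expr2.
Qed.

End darboux_grid.

(** * Null sets and integrands that may fail to be measurable *)

Section null_sets.
Import HBNNSimple.
Context {R : realType}.
Local Notation mu := (@lebesgue_measure R).
Local Notation RM := (measurableTypeR R).
Local Notation I01 := (`[0%R, 1%R]%classic : set (measurableTypeR R)).

(** The integral of a nonnegative function, measurable or not. Riemann integrable functions may fail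
    to be Borel, so invariance under changes on a null set is proved at this level. *)
Definition nnint (f : RM -> \bar R) : \bar R := ereal_sup [set sintegral mu h |
  h in [set h : {nnsfun RM >-> R} | forall x : RM, ((h x)%:E <= f x)%E]].

(** A simple function below [f], set to zero on [Z], lies below [g] and keeps its integral. *)
Lemma le_nnint_null (Z : set RM) (f g : RM -> \bar R) : measurable Z -> mu Z = 0%E ->
  (forall x, (0 <= g x)%E) -> (forall x, ~ Z x -> f x = g x) -> (nnint f <= nnint g)%E.
Proof.
move=> mZ Z0 g0 fg; apply: ge_ereal_sup => _ [h /= hf <-].
have mZC : measurable (~` Z) by exact: measurableC.
pose h' : {nnsfun RM >-> R} := mul_nnsfun h (indic_nnsfun R mZC).
have -> : sintegral mu h = sintegral mu h'.
  rewrite -!integralT_nnsfun; apply: ge0_ae_eq_integral => //.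
  - exact/measurable_EFinP.
  - exact/measurable_EFinP.
  - by move=> x _; rewrite lee_fin.
  - by move=> x _; rewrite lee_fin.
  exists Z; split=> // x /= H; apply: contrapT => nZ; apply: H => _.
  by rewrite /h' /= /mindic indicE mem_set// mulr1.
apply: ereal_sup_ubound; exists h' => //= x.
rewrite /h' /= /mindic indicE; case: (boolP (x \in ~` Z)) => xZ.
  by rewrite mulr1 -fg; [exact: hf|exact: set_mem].
by rewrite mulr0.
Qed.

Lemma nnint_null (Z : set RM) (f g : RM -> \bar R) : measurable Z -> mu Z = 0%E ->
  (forall x, (0 <= f x)%E) -> (forall x, (0 <= g x)%E) ->
  (forall x, ~ Z x -> f x = g x) -> nnint f = nnint g.
Proof.
move=> mZ Z0 f0 g0 fg; apply/eqP; rewrite eq_le; apply/andP; split.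
  exact: le_nnint_null mZ Z0 g0 fg.
by apply: (le_nnint_null mZ Z0 f0) => x xZ; rewrite fg.
Qed.

Lemma eq_Rintegral_null (Z : set RM) (f g : R -> R) : measurable Z -> mu Z = 0%E ->
  (forall x, I01 x -> ~ Z x -> f x = g x) ->
  \int[mu]_(x in I01) f x = \int[mu]_(x in I01) g x.
Proof.
move=> mZ Z0 fg; rewrite /Rintegral; congr fine.
have fgI x : ~ Z x -> ((EFin \o f) \_ I01) x = ((EFin \o g) \_ I01) x.
  by move=> xZ; rewrite !patchE; case: ifPn => // /set_mem xI; rewrite /= fg.
rewrite integralE [RHS]integralE !ge0_integralE; do ?by move=> x _; exact: funepos_ge0.
- rewrite -!funepos_restrict -!funeneg_restrict.
  congr (_ - _)%E.
    apply: (nnint_null mZ Z0); [exact: funepos_ge0|exact: funepos_ge0|].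
    by move=> x xZ; rewrite ?funeposE; move: (fgI x xZ) => /= ->.
  apply: (nnint_null mZ Z0); [exact: funeneg_ge0|exact: funeneg_ge0|].
  by move=> x xZ; rewrite ?funenegE; move: (fgI x xZ) => /= ->.
all: by move=> x _; exact: funeneg_ge0.
Qed.

Lemma nrm_le_null (Z : set RM) (f g : R -> R) : measurable Z -> mu Z = 0%E ->
  sqi f -> sqi g -> (forall x, I01 x -> ~ Z x -> `|f x| <= `|g x|) -> nrm f <= nrm g.
Proof.
move=> mZ Z0 sf sg fg.
pose f' x := f x * \1_(~` Z) x.
have mZC : measurable (~` Z : set RM) by exact: measurableC.
have mf' : measurable_fun I01 f'.
  by apply: measurable_funM; [case: sf|exact: measurable_indic].
have sf' : sqi f'.
  split=> //; apply: (integ_le _ sf.2); first exact: measurable_funX.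
  move=> x xI; rewrite /f' indicE exprMn normrM; case: (_ \in _).
    by rewrite expr1n normr1 mulr1 ger0_norm ?sqr_ge0.
  by rewrite expr0n normr0 mulr0 sqr_ge0.
have -> : nrm f = nrm f'.
  rewrite /nrm /dotp; congr Num.sqrt; apply: (eq_Rintegral_null mZ Z0) => x xI xZ.
  by rewrite /f' indicE mem_set// mulr1.
apply: nrm_le => // x xI; rewrite /f' indicE.
case: (boolP (x \in ~` Z)) => [/set_mem xZ|_]; last by rewrite mulr0 normr0.
by rewrite mulr1 fg.
Qed.

End null_sets.

Section step_functions.
Context {R : realType} {N : nat}.
Hypothesis N0 : (0 < N)%N.
Local Notation mu := (@lebesgue_measure R).
Local Notation RM := (measurableTypeR R).
Local Notation I01 := (`[0%R, 1%R]%classic : set (measurableTypeR R)).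

(** Half-open cells are disjoint, have their site as right end point and cover the interval except
    for 0, which is why [[set 0]] joins the null sets of later comparisons. *)
Definition hcell (i : nat) : set RM := `]i%:R / N%:R, i.+1%:R / N%:R]%classic.
Definition cellf (i : nat) : R -> R := \1_(hcell i).
Definition step (a : 'I_N -> R) (x : R) : R := \sum_(i < N) a i * cellf i x.

Let n0 : 0 < N%:R :> R. Proof. by rewrite ltr0n. Qed.

Lemma hcell_sub (i : 'I_N) x : hcell i x -> I01 x.
Proof.
rewrite /hcell /= !in_itv/= => /andP[h1 h2].
rewrite (le_trans _ (ltW h1)) ?divr_ge0//=; apply: (le_trans h2).
by rewrite ler_pdivrMr// mul1r ler_nat.
Qed.

Lemma hcell_grid (i : 'I_N) x : hcell i x -> grid_cell N i x.
Proof. by rewrite /hcell /grid_cell/= !in_itv/= => /andP[h1 ->]; rewrite ltW. Qed.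

Lemma site_grid (i : 'I_N) : grid_cell N i (site i : R).
Proof. by rewrite /grid_cell /site /= in_itv/= lexx andbT ler_pM2r ?invr_gt0// ler_nat. Qed.

Lemma cellfE (i : nat) x : hcell i x -> cellf i x = 1.
Proof. by move=> xi; rewrite /cellf indicE mem_set. Qed.

Lemma hcell_uniq (i j : nat) x : hcell i x -> hcell j x -> i = j.
Proof.
rewrite /hcell/= !in_itv/= => /andP[a b] /andP[c d].
have h1 := lt_le_trans a d; have h2 := lt_le_trans c b.
move: h1 h2; rewrite !ltr_pM2r ?invr_gt0// !ltr_nat !ltnS => ij ji.
by apply/eqP; rewrite eqn_leq ij ji.
Qed.

Lemma cellf_other (i j : nat) x : hcell i x -> j != i -> cellf j x = 0.
Proof.
move=> xi ji; rewrite /cellf indicE memNset// => xj.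
by move: ji; rewrite (hcell_uniq xj xi) eqxx.
Qed.

Lemma stepE a (i : 'I_N) x : hcell i x -> step a x = a i.
Proof.
move=> xi; rewrite /step (bigD1 i)//= cellfE// mulr1 big1 ?addr0// => j ji.
by rewrite (cellf_other xi) ?mulr0.
Qed.

Lemma hcell_cover x : I01 x -> x != 0 -> exists i : 'I_N, hcell i x.
Proof.
rewrite /= in_itv/= => /andP[x0 x1] xn0.
have xp : 0 < x by rewrite lt_neqAle eq_sym xn0.
have xN : 0 < x * N%:R by rewrite mulr_gt0.
pose P (k : nat) := x * N%:R <= k%:R.
have exP : exists k, P k by exists N; rewrite /P -[leRHS]mul1r ler_pM2r.
case: (ex_minnP exP) => -[|k]; first by rewrite /P leNgt xN.
move=> Pk kmin.
have kN : (k < N)%N by apply: kmin; rewrite /P -[leRHS]mul1r ler_pM2r.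
exists (Ordinal kN); rewrite /hcell/= in_itv/=; apply/andP; split; last by rewrite ler_pdivlMr.
rewrite ltr_pdivrMr// ltNge; apply/negP => h.
by have := kmin k h; rewrite ltnn.
Qed.

Lemma cellf_ge0 i x : 0 <= cellf i x.
Proof. by rewrite /cellf indicE. Qed.

Lemma cellf_le1 i x : cellf i x <= 1.
Proof. by rewrite /cellf indicE; case: (_ \in _). Qed.

Lemma cellf_measurable i : measurable_fun I01 (cellf i).
Proof. by apply: measurable_indic; exact: measurable_itv. Qed.

Lemma sqi_cellf i : sqi (cellf i).
Proof.
apply: (@sqi_bounded _ _ 1); first exact: cellf_measurable.
by move=> x _; rewrite ger0_norm ?cellf_ge0 ?cellf_le1.
Qed.

Lemma int_cellf (i : 'I_N) : \int[mu]_(x in I01) cellf i x = N%:R^-1.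
Proof.
rewrite /Rintegral integral_indic//; last exact: measurable_itv.
rewrite (_ : _ `&` _ = hcell i); last first.
  by apply/seteqP; split=> x [] // xi; split=> //; exact: hcell_sub xi.
have cE : mu (hcell i) = (i.+1%:R / N%:R - i%:R / N%:R : R)%:E.
  apply: (etrans (lebesgue_measure_itv `]i%:R / N%:R, i.+1%:R / N%:R])) => /=.
  by rewrite lte_fin ltr_pM2r ?invr_gt0// ltr_nat ltnSn.
apply: (etrans (congr1 fine cE)) => /=.
by rewrite -natr1; field; rewrite gt_eqF.
Qed.

Lemma sqi_step a : sqi (step a).
Proof.
apply: (@sqi_bounded _ _ (\sum_i `|a i|)).
  rewrite /step; apply: measurable_sum => i.
  by apply: measurable_funM; [exact: measurable_cst|exact: cellf_measurable].
move=> x _; apply: (le_trans (ler_norm_sum _ _ _)); apply: ler_sum => i _.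
by rewrite normrM ler_piMr// ger0_norm ?cellf_ge0 ?cellf_le1.
Qed.

Lemma sqi_sum (I : eqType) (r : seq I) (h : I -> R -> R) : (forall i, sqi (h i)) ->
  sqi (fun x => \sum_(i <- r) h i x).
Proof.
move=> sh; elim: r => [|i r IH].
  by apply: eq_sqi (sqi_cst 0) => x _; rewrite big_nil.
by apply: eq_sqi (sqiD (sh i) IH) => x _; rewrite big_cons.
Qed.

Lemma dotp_suml (I : eqType) (r : seq I) (h : I -> R -> R) g : (forall i, sqi (h i)) -> sqi g ->
  dotp (fun x => \sum_(i <- r) h i x) g = \sum_(i <- r) dotp (h i) g.
Proof.
move=> sh sg; elim: r => [|i r IH].
  rewrite big_nil (eq_dotp (f' := fun x => 0 * cst 0 x) (g' := g))//; last by move=> x _; rewrite big_nil mul0r.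
  by rewrite dotpZl ?mul0r//; exact: sqi_cst.
rewrite big_cons -IH -dotpDl//; last exact: sqi_sum.
by apply: eq_dotp => // x _; rewrite big_cons.
Qed.

Lemma dotp_step a g : sqi g -> dotp (step a) g = \sum_i a i * dotp (cellf i) g.
Proof.
move=> sg; rewrite /step dotp_suml//; last by move=> i; apply: sqiZ; exact: sqi_cellf.
by apply: eq_bigr => i _; rewrite dotpZl//; exact: sqi_cellf.
Qed.

Lemma dotp_cellf_le (i : 'I_N) g h c : sqi g -> sqi h ->
  (forall x, hcell i x -> `|g x - h x| <= c) ->
  `|dotp (cellf i) g - dotp (cellf i) h| <= c / N%:R.
Proof.
move=> sg sh ghc; have sc := sqi_cellf i.
rewrite -dotpBr//; have sgh := sqiB sg sh.
apply: (le_trans (le_normr_Rintegral mI01 (sqiM sc sgh))).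
rewrite -(int_cellf i) -RintegralZl//; last exact: sqi_integ.
apply: le_Rintegral => //.
- by apply: integrable_norm; exact: sqiM.
- by apply: integZ; exact: sqi_integ.
move=> x xI; rewrite normrM (ger0_norm (cellf_ge0 _ _)).
case: (boolP (x \in hcell i)) => [/set_mem xi|xi].
  by rewrite cellfE// mul1r mulr1 ghc.
by rewrite /cellf indicE (negbTE xi) mul0r mulr0.
Qed.

Lemma dotp_cellf_cst (i : 'I_N) c : dotp (cellf i) (cst c) = c / N%:R.
Proof.
rewrite -(int_cellf i) -RintegralZl//; last exact/sqi_integ/sqi_cellf.
by apply: eq_Rintegral => x _; rewrite mulrC.
Qed.

Lemma dotp_step_step a b : dotp (step a) (step b) = (\sum_i a i * b i) / N%:R.
Proof.
rewrite dotp_step; last exact: sqi_step.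
rewrite mulr_suml; apply: eq_bigr => i _; rewrite -mulrA; congr (_ * _).
apply/eqP; rewrite -subr_eq0 -normr_le0 -(dotp_cellf_cst i).
rewrite -(mul0r (N%:R^-1 : R)); apply: dotp_cellf_le.
- exact: sqi_step.
- exact: sqi_cst.
- by move=> x xi; rewrite (stepE b xi)/= subrr normr0.
Qed.

Lemma nrm_step_sqr a : nrm (step a) ^+ 2 = sqnorm a / N%:R.
Proof.
by rewrite nrm_sqr dotp_step_step; congr (_ / _); apply: eq_bigr => i _; rewrite expr2.
Qed.

End step_functions.

Section grid_oscillation.
Context {R : realType}.

(** Oscillations bounded by [B] satisfy [o^2 <= (B + 1) o]. Sums of squares are the form in which
    Hilbert-Schmidt and L2 errors arise. *)
Lemma riemann_grid_sqr (W : R -> R -> R) (eta : R) : riemann_integrable2 W -> 0 < eta ->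
  exists N0, forall N, (N0 <= N)%N -> (0 < N)%N ->
  exists o : 'I_N -> 'I_N -> R, [/\ forall i j, 0 <= o i j,
    forall (i j : 'I_N) x y x' y', grid_cell N i x -> grid_cell N j y ->
      grid_cell N i x' -> grid_cell N j y' -> `|W x y - W x' y'| <= o i j &
    \sum_i \sum_j o i j ^+ 2 <= eta ^+ 2 * N%:R ^+ 2].
Proof.
move=> /riemann_grid[B B0 H] eta0.
have B1 : 0 < B + 1 by rewrite ltr_wpDl.
have [N0 HN] := H (eta ^+ 2 / (B + 1)) (divr_gt0 (exprn_gt0 _ eta0) B1).
exists N0 => N NN Np; have [om [oB oW oS]] := HN N NN Np.
exists om; split=> //; first by move=> i j; have /andP[] := oB i j.
apply: (@le_trans _ _ ((B + 1) * \sum_i \sum_j om i j)).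
  rewrite mulr_sumr; apply: ler_sum => i _; rewrite mulr_sumr; apply: ler_sum => j _.
  have /andP[a b] := oB i j; rewrite expr2 ler_wpM2r//; lra.
apply: (le_trans (ler_wpM2l (ltW B1) oS)).
by rewrite mulrA [(B + 1) * _]mulrC divfK// gt_eqF.
Qed.

Lemma riemann_grid1_sqr (f : R -> R) (eta : R) : riemann_integrable f -> 0 < eta ->
  exists N0, forall N, (N0 <= N)%N -> (0 < N)%N ->
  exists o : 'I_N -> R, [/\ forall i, 0 <= o i,
    forall (i : 'I_N) x x', grid_cell N i x -> grid_cell N i x' -> `|f x - f x'| <= o i &
    \sum_i o i ^+ 2 <= eta ^+ 2 * N%:R].
Proof.
move=> /riemann_grid1[B B0 H] eta0.
have B1 : 0 < B + 1 by rewrite ltr_wpDl.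
have [N0 HN] := H (eta ^+ 2 / (B + 1)) (divr_gt0 (exprn_gt0 _ eta0) B1).
exists N0 => N NN Np; have [om [oB oW oS]] := HN N NN Np.
exists om; split=> //; first by move=> i; have /andP[] := oB i.
apply: (@le_trans _ _ ((B + 1) * \sum_i om i)).
  rewrite mulr_sumr; apply: ler_sum => i _.
  have /andP[a b] := oB i; rewrite expr2 ler_wpM2r//; lra.
apply: (le_trans (ler_wpM2l (ltW B1) oS)).
by rewrite mulrA [(B + 1) * _]mulrC divfK// gt_eqF.
Qed.

End grid_oscillation.

Section borel_version.
Context {R : realType}.
Local Notation mu := (@lebesgue_measure R).
Local Notation RM := (measurableTypeR R).
Local Notation I01 := (`[0%R, 1%R]%classic : set (measurableTypeR R)).

Lemma null_setU1 (Z : set RM) (x : RM) : measurable Z -> mu Z = 0%E -> mu (Z `|` [set x]) = 0%E.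
Proof.
move=> mZ Z0; have m1 : measurable ([set x] : set RM) by exact: measurable_set1.
rewrite measureU0//; exact: lebesgue_measure_set1.
Qed.

Lemma step_measurable N (a : 'I_N -> R) : measurable_fun I01 (step a).
Proof.
rewrite /step; apply: measurable_sum => i.
by apply: measurable_funM; [exact: measurable_cst|exact: cellf_measurable].
Qed.

Lemma step_le N (a : 'I_N -> R) (M : R) x : (0 < N)%N -> 0 <= M -> I01 x ->
  (forall i, `|a i| <= M) -> `|step a x| <= M.
Proof.
move=> N0 M0 xI aM; have [->|x0] := eqVneq x 0; last first.
  have [i xi] := hcell_cover N0 xI x0; by rewrite (stepE N0 _ xi).
rewrite /step big1 ?normr0// => i _.
by rewrite /cellf indicE memNset ?mulr0// /hcell/= in_itv/= ltNge divr_ge0.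
Qed.

Lemma int_step N (a : 'I_N -> R) : (0 < N)%N ->
  \int[mu]_(x in I01) step a x = (\sum_i a i) / N%:R.
Proof.
move=> N0; have e : dotp (step a) (step (fun _ : 'I_N => 1)) = (\sum_i a i) / N%:R.
  by rewrite dotp_step_step//; congr (_ / _); apply: eq_bigr => i _; rewrite mulr1.
rewrite -e; apply: (eq_Rintegral_null (Z := [set 0])).
- exact: measurable_set1.
- exact: lebesgue_measure_set1.
- move=> x xI /eqP x0; have [i xi] := hcell_cover N0 xI x0.
  by rewrite !(stepE N0 _ xi) mulr1.
Qed.

(* The Borel version is the supremum of the lower step functions of finer and
   finer grids. *)
Lemma borel_version (f : R -> R) : riemann_integrable f ->
  exists (F : R -> R) (M : R) (Z : set RM), [/\ measurable_fun I01 F,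
    forall x, I01 x -> `|F x| <= M, measurable Z, mu Z = 0%E &
    forall x, I01 x -> ~ Z x -> F x = f x].
Proof.
move=> rf; have [[M fM] _] := rf; have [B B0 H] := riemann_grid1 rf.
have M0 : 0 <= M by apply: le_trans (fM 0 _); rewrite ?normr_ge0//= in_itv/= lexx ler01.
(* For each [n], a grid whose mean oscillation is at most [1 / (n + 1)]; the number of its cells is
   part of the choice. *)
have /choice[p pP] : forall n, exists p : {N & 'I_N -> R}, [/\ (0 < tag p)%N,
    forall i, 0 <= tagged p i <= B,
    forall (i : 'I_(tag p)) x x', grid_cell (tag p) i x -> grid_cell (tag p) i x' -> `|f x - f x'| <= tagged p i &
    \sum_i tagged p i <= n.+1%:R^-1 * (tag p)%:R].
  move=> n; have n0 : 0 < n.+1%:R^-1 :> R by rewrite invr_gt0.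
  have [N0 HN] := H _ n0; have [om [h1 h2 h3]] := HN N0.+1 (leqnSn _) (ltn0Sn _).
  by exists (existT (fun N => 'I_N -> R) N0.+1 om).
pose N n := tag (p n); pose o n : 'I_(N n) -> R := tagged (p n).
have N0 n : (0 < N n)%N by have [] := pP n.
have oB n i : 0 <= o n i <= B by have [_ h _ _] := pP n; exact: h.
have of_ n (i : 'I_(N n)) x x' : grid_cell (N n) i x -> grid_cell (N n) i x' -> `|f x - f x'| <= o n i.
  by have [_ _ h _] := pP n; exact: h.
have oS n : \sum_i o n i <= n.+1%:R^-1 * (N n)%:R by have [] := pP n.
pose L n := step (fun i : 'I_(N n) => f (site i) - o n i).
pose D n := step (o n).
have site01 n (i : 'I_(N n)) : `[0, 1]%classic (site i : R).
  by rewrite /= in_itv/= /site divr_ge0//= ler_pdivrMr ?ltr0n// mul1r ler_nat.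
have LM n x : I01 x -> `|L n x| <= M + B.
  move=> xI; apply: step_le => //; first exact: addr_ge0.
  move=> i; apply: (le_trans (ler_normB _ _)); apply: lerD; first exact: fM.
  by have /andP[h0 hB] := oB n i; rewrite ger0_norm.
have D0 n x : 0 <= D n x.
  rewrite /D /step sumr_ge0// => i _; rewrite mulr_ge0 ?cellf_ge0//.
  by have /andP[] := oB n i.
have ubL x : I01 x -> has_ubound (range (L ^~ x)).
  by move=> xI; exists (M + B) => _ [n _ <-]; exact: le_trans (ler_norm _) (LM n x xI).
have lbD x : has_lbound (range (D ^~ x)).
  by exists 0 => _ [n _ <-].
have Lf n x : I01 x -> x != 0 -> L n x <= f x <= L n x + 2 * D n x.
  move=> xI x0; have [i xi] := hcell_cover (N0 n) xI x0.
  rewrite /L /D !(stepE (N0 n) _ xi).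
  have := of_ n i x (site i) (hcell_grid xi) (site_grid (N0 n) i); rewrite ler_norml => /andP[]; lra.
(* Since [L n <= f <= L n + 2 D n] away from 0, [F] equals [f] wherever [G] vanishes, and [G] is a
   nonnegative function of integral zero. *)
pose F x := sups (L ^~ x) 0; pose G x := infs (D ^~ x) 0.
have supsE (u : R^nat) : sups u 0 = sup (range u).
  by rewrite /sups/=; congr sup; apply/seteqP; split=> [_ [m _ <-]|_ [m _ <-]]; exists m.
have infsE (u : R^nat) : infs u 0 = inf (range u).
  by rewrite /infs/=; congr inf; apply/seteqP; split=> [_ [m _ <-]|_ [m _ <-]]; exists m.
have mF : measurable_fun I01 F.
  by apply: measurable_fun_sups => // m; exact: step_measurable.
have mG : measurable_fun I01 G.
  by apply: measurable_fun_infs => // m; exact: step_measurable.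
have LF n x : I01 x -> L n x <= F x.
  by move=> xI; rewrite /F supsE; apply: ub_le_sup; [exact: ubL|exists n].
have GD n x : G x <= D n x.
  by rewrite /G infsE; apply: ge_inf; [exact: lbD|exists n].
have G0 x : 0 <= G x.
  rewrite /G infsE; apply: lb_le_inf; first by exists (D 0%N x); exists 0%N.
  by move=> _ [n _ <-].
have FM x : I01 x -> `|F x| <= M + B.
  move=> xI; rewrite ler_norml; apply/andP; split.
    by apply: le_trans (LF 0%N x xI); have := LM 0%N x xI; rewrite ler_norml => /andP[].
  rewrite /F supsE; apply: ge_sup; first by exists (L 0%N x); exists 0%N.
  by move=> _ [n _ <-]; exact: le_trans (ler_norm _) (LM n x xI).
have DB n x : I01 x -> D n x <= B.
  move=> xI; apply: (le_trans (ler_norm _)); apply: step_le => // i.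
  by have /andP[h0 hB] := oB n i; rewrite ger0_norm.
have sG : sqi G.
  apply: (sqi_bounded mG (M := B)) => x xI.
  by rewrite ger0_norm// (le_trans (GD 0%N x))// DB.
have iG := sqi_integ sG.
have G_int : \int[mu]_(x in I01) G x = 0.
  apply/eqP; rewrite eq_le; apply/andP; split; last by apply: Rintegral_ge0.
  apply/ler_addgt0Pr => e e0; rewrite add0r.
  pose n := Num.truncn e^-1.
  apply: (@le_trans _ _ (\int[mu]_(x in I01) D n x)).
    apply: le_Rintegral => //; exact/sqi_integ/sqi_step.
  rewrite int_step// ler_pdivrMr ?ltr0n//; apply: (le_trans (oS n)).
  rewrite ler_wpM2r//; rewrite -[leRHS]invrK lef_pV2 ?posrE ?invr_gt0//.
  exact/ltW/truncnS_gt.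
have : ae_eq mu I01 (EFin \o G) (cst 0%E).
  apply/ae_eq_integral_abs => //; first exact/measurable_EFinP.
  have -> : (\int[mu]_(x in I01) `|(EFin \o G) x| = \int[mu]_(x in I01) (G x)%:E)%E.
    by apply: eq_integral => x _; rewrite /= ger0_norm.
  have fin : (\int[mu]_(x in I01) (G x)%:E)%E \is a fin_num by apply: integrable_fin_num.
  by rewrite -[LHS](fineK fin) -/(Rintegral mu I01 G) G_int.
move=> [Z0 [mZ0 Z00 Z0sub]].
exists F, (M + B), (Z0 `|` [set 0]); split=> //.
- by apply: measurableU => //; exact: measurable_set1.
- exact: null_setU1.
- move=> x xI /not_orP[xZ0 /eqP x0].
  have Gx : G x = 0.
    apply: contrapT => Gx; apply: xZ0; apply: Z0sub => /= h.
    by apply: Gx; have := h xI => -[].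
  apply/eqP; rewrite eq_le; apply/andP; split.
    rewrite /F supsE; apply: ge_sup; first by exists (L 0%N x); exists 0%N.
    by move=> _ [n _ <-]; have /andP[] := Lf n x xI x0.
  apply/ler_addgt0Pr => e e0.
  have e2 : 0 < e / 2 by rewrite divr_gt0.
  have [_ [n _ <-]] : exists2 y, range (D ^~ x) y & y < inf (range (D ^~ x)) + e / 2.
    by apply: inf_adherent => //; split; [exists (D 0%N x); exists 0%N|exact: lbD].
  rewrite -infsE -/(G x) Gx add0r => Dn.
  have /andP[_ h] := Lf n x xI x0; have := LF n x xI; lra.
Qed.

End borel_version.

Section geometric.
Context {R : realType}.

Lemma le0_geometric (x D q : R) : 0 <= q < 1 -> (forall n, x <= D * q ^+ n) -> x <= 0.
Proof.
move=> /andP[q0 q1] h.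
have q1' : `|q| < 1 by rewrite ger0_norm.
have c := @cvg_geometric R D q q1'.
have <- : limn (geometric D q) = 0 by apply/cvg_lim.
by apply: limr_ge; [apply/cvg_ex; exists 0|apply: nearW].
Qed.

(** With [r n] the geometric tail, every [S m - r m] lies below every [S n + r n]; the supremum of
    the former is the limit and comes with its rate. *)
Lemma geometric_series_bound (h : nat -> R) (D q : R) : 0 <= q < 1 -> (forall k, `|h k| <= D * q ^+ k) ->
  exists l, forall n, `|l - \sum_(0 <= k < n) h k| <= D / (1 - q) * q ^+ n.
Proof.
move=> /andP[q0 q1] hD.
have q1' : 1 - q != 0 by rewrite subr_eq0 gt_eqF.
have D0 : 0 <= D by have := le_trans (normr_ge0 _) (hD 0%N); rewrite expr0 mulr1.
pose r n := D / (1 - q) * q ^+ n.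
have r0 n : 0 <= r n by rewrite /r !mulr_ge0 ?exprn_ge0// invr_ge0 subr_ge0 ltW.
have rS n : r n = D * q ^+ n + r n.+1 by rewrite /r exprS; field.
pose S n := \sum_(0 <= k < n) h k.
have step1 n : `|S n.+1 - S n| <= r n - r n.+1.
  rewrite /S big_nat_recr//= addrAC subrr add0r (rS n) addrK; exact: hD.
have mono m n : (m <= n)%N -> `|S n - S m| <= r m - r n.
  elim: n => [|n IH]; first by rewrite leqn0 => /eqP ->; rewrite !subrr normr0.
  rewrite leq_eqVlt => /orP[/eqP->|]; first by rewrite !subrr normr0.
  rewrite ltnS => /IH h1; have h2 := step1 n.
  by have := ler_distD (S n) (S n.+1) (S m); lra.
have SS m n : S m - r m <= S n + r n.
  have [mn|nm] := leqP m n.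
    have := mono _ _ mn; rewrite ler_norml => /andP[]; have := r0 n; lra.
  have := mono _ _ (ltnW nm); rewrite ler_norml => /andP[]; have := r0 m; lra.
pose A := range (fun n => S n - r n).
exists (sup A) => n; rewrite -/(S n) -/(r n).
have h1 : S n - r n <= sup A.
  by apply: ub_le_sup; [exists (S 0%N + r 0%N) => _ [m _ <-]|exists n].
have h2 : sup A <= S n + r n.
  by apply: ge_sup => [|_ [m _ <-]]; first by exists (S 0%N - r 0%N); exists 0%N.
by rewrite ler_norml; apply/andP; split; lra.
Qed.

End geometric.

(** * The resolvent by its Neumann series *)

Section resolvent.
Context {R : realType}.
Local Notation mu := (@lebesgue_measure R).
Local Notation RM := (measurableTypeR R).
Local Notation I01 := (`[0%R, 1%R]%classic : set (measurableTypeR R)).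
Variables (W : R -> R -> R) (beta : R).
Hypotheses (gW : graphon W) (b0 : 0 < beta) (q1 : beta * opnorm W < 1).

Local Notation q := (beta * opnorm W).

Lemma opnorm_ge0 : 0 <= opnorm W.
Proof.
have := nrm_TW_le_opnorm gW (sqi_cst 1); rewrite nrm_cst normr1 mulr1.
exact/le_trans/nrm_ge0.
Qed.

Let q0 : 0 <= q. Proof. by rewrite mulr_ge0 ?opnorm_ge0// ltW. Qed.

Fixpoint neumann (F : R -> R) n : R -> R :=
  if n is n'.+1 then fun x => beta * TW W (neumann F n') x else F.

Lemma nrm_neumann F n : sqi F ->
  sqi (neumann F n) /\ nrm (neumann F n) <= nrm F * q ^+ n.
Proof.
move=> sF; elim: n => [|n [sn IH]] /=; first by rewrite expr0 mulr1.
have sT := sqi_TW gW (sqi_integ sn).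
split; first exact: sqiZ.
rewrite nrmZ// (ger0_norm (ltW b0)) exprS mulrCA -mulrA ler_wpM2l ?(ltW b0)//.
by apply: (le_trans (nrm_TW_le_opnorm gW sn)); rewrite ler_wpM2l ?opnorm_ge0.
Qed.

Lemma TW_sum (h : nat -> R -> R) n x : (forall k, sqi (h k)) -> I01 x ->
  TW W (fun y => \sum_(0 <= k < n) h k y) x = \sum_(0 <= k < n) TW W (h k) x.
Proof.
move=> sh xI; elim: n => [|n IH].
  rewrite big_nil (@eq_TW _ _ _ (fun y => 0 * cst 0 y)); last by move=> y _; rewrite big_nil mul0r.
  by rewrite TWZ ?mul0r//; exact: integ_cst.
rewrite big_nat_recr//= -IH -TWD//; [|exact/sqi_integ/sqi_sum|exact: sqi_integ].
by apply: eq_TW => y _; rewrite big_nat_recr.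
Qed.

(** Every Neumann term but the first is an image under [TW W], hence bounded at each point by an L2
    norm. The series therefore converges uniformly, and the resolvent equation holds at every point
    of the interval. *)
Lemma resolvent_exists (F : R -> R) (M : R) : measurable_fun I01 F -> (forall x, I01 x -> `|F x| <= M) ->
  exists (G : R -> R) (M' : R), [/\ measurable_fun I01 G, forall x, I01 x -> `|G x| <= M' &
    forall x, I01 x -> G x - beta * TW W G x = F x].
Proof.
move=> mF FM; have sF := sqi_bounded mF FM.
have sn n : sqi (neumann F n) by have [] := nrm_neumann n sF.
have qq : 0 <= q < 1 by rewrite q0.
pose D := beta * nrm F; pose E := D / (1 - q).
have D0 : 0 <= D by rewrite mulr_ge0 ?nrm_ge0 ?(ltW b0).
have E0 : 0 <= E by rewrite divr_ge0// subr_ge0 ltW.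
have hD x k : I01 x -> `|neumann F k.+1 x| <= D * q ^+ k.
  move=> xI; rewrite /= normrM (ger0_norm (ltW b0)) /D -mulrA ler_wpM2l ?(ltW b0)//.
  apply: (le_trans (TW_le_nrm gW (sn k) xI)); by have [] := nrm_neumann k sF.
have /choice[l lP] : forall x, exists l, I01 x -> forall n, `|l - \sum_(0 <= k < n) neumann F k.+1 x| <= E * q ^+ n.
  move=> x; have [xI|xI] := pselect (I01 x); last by exists 0.
  by have [l lP] := geometric_series_bound qq (hD x ^~ xI); exists l.
pose S n x := \sum_(0 <= k < n) neumann F k x.
pose u n x := \sum_(0 <= k < n) neumann F k.+1 x.
have sS n : sqi (S n) by exact: sqi_sum.
have su n : sqi (u n) by apply: sqi_sum => k; exact: (sn k.+1).
have SuE n x : S n.+1 x = F x + u n x by rewrite /S big_nat_recl.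
have uE n x : I01 x -> u n x = beta * TW W (S n) x.
  by move=> xI; rewrite /S TW_sum// mulr_sumr.
have ml : measurable_fun I01 l.
  apply: (@measurable_fun_cvg _ _ _ _ u) => [m|x xI]; first by case: (su m).
  apply/cvgrPdist_le => e e0.
  have := @cvg_geometric R E q; rewrite (ger0_norm q0) => /(_ q1)/cvgrPdist_le /(_ e e0).
  apply: filterS => n; rewrite sub0r normrN ger0_norm ?(mulr_ge0 E0) ?exprn_ge0//.
  exact/le_trans/lP.
pose G x := F x + l x.
have GM x : I01 x -> `|G x| <= M + E.
  move=> xI; apply: (le_trans (ler_normD _ _)); apply: lerD; first exact: FM.
  by have := lP x xI 0%N; rewrite big_nil subr0 expr0 mulr1.
have mG : measurable_fun I01 G by exact: measurable_funD.
have sG := sqi_bounded mG GM.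
exists G, (M + E); split=> // x xI.
apply/eqP; rewrite -subr_eq0 -normr_le0.
apply: (@le0_geometric _ _ (E + beta * E) q qq) => n.
(* The L2 error of the partial sums, sent through [TW W], bounds the defect of the equation at each
   point. *)
have SG : nrm (fun y => S n.+1 y - G y) <= E * q ^+ n.
  apply: nrm_le_cst; [exact: sqiB|by rewrite mulr_ge0 ?exprn_ge0|] => y yI.
  rewrite SuE /G opprD addrACA subrr add0r distrC; exact: lP.
have e : G x - beta * TW W G x - F x = (l x - u n.+1 x) + beta * TW W (fun y => S n.+1 y - G y) x.
  rewrite uE// TWB//; [|exact: sqi_integ|exact: sqi_integ].
  rewrite /G; ring.
rewrite e mulrDl (le_trans (ler_normD _ _))// lerD//.
  apply: (le_trans (lP x xI n.+1)); rewrite exprS ler_wpM2l// ler_piMl ?exprn_ge0//; exact: ltW.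
rewrite normrM (ger0_norm (ltW b0)) -mulrA ler_wpM2l ?(ltW b0)//.
exact: le_trans (TW_le_nrm gW (sqiB (sS n.+1) sG) xI) SG.
Qed.

(* The resolvent is unique in L^2 because 1 - beta T_W expands norms by at least 1 - q. *)
Lemma nrm_resolvent_le psi : sqi psi ->
  (1 - q) * nrm psi <= nrm (fun x => psi x - beta * TW W psi x).
Proof.
move=> sp; have sT := sqi_TW gW (sqi_integ sp); have sbT := sqiZ beta sT.
have := nrmD (sqiB sp sbT) sbT; rewrite (@eq_nrm _ _ psi); last by move=> x _; rewrite subrK.
rewrite nrmZ// (ger0_norm (ltW b0)).
have : beta * nrm (TW W psi) <= q * nrm psi.
  by rewrite -mulrA ler_wpM2l ?(ltW b0)//; exact: nrm_TW_le_opnorm.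
lra.
Qed.

End resolvent.

(** * Site matrices against the graphon operator *)

Section form_bound.
Context {R : realType}.
Local Notation mu := (@lebesgue_measure R).
Local Notation RM := (measurableTypeR R).
Local Notation I01 := (`[0%R, 1%R]%classic : set (measurableTypeR R)).
Variables (W : R -> R -> R).
Hypotheses (gW : graphon W).

Definition site_mx N : 'M[R]_N := \matrix_(i, j) W (site i) (site j).

Section fixed_N.
Variables (N : nat) (N0 : (0 < N)%N) (om : 'I_N -> 'I_N -> R) (eta : R).
Hypotheses (om0 : forall i j, 0 <= om i j) (eta0 : 0 < eta).
Hypothesis omW : forall (i j : 'I_N) x y x' y', grid_cell N i x -> grid_cell N j y ->
      grid_cell N i x' -> grid_cell N j y' -> `|W x y - W x' y'| <= om i j.
Hypothesis omS : \sum_i \sum_j om i j ^+ 2 <= eta ^+ 2 * N%:R ^+ 2.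

Let n0 : 0 < N%:R :> R. Proof. by rewrite ltr0n. Qed.

Lemma TW_step (a : 'I_N -> R) x : I01 x ->
  TW W (step a) x = \sum_i a i * TW W (@cellf R N i) x.
Proof.
move=> xI; have sW := sqi_graphon_section gW xI.
transitivity (dotp (step a) (W x)); first by rewrite dotpC.
by rewrite dotp_step//; apply: eq_bigr => i _; rewrite dotpC.
Qed.

Lemma TW_cellf_dist (i j : 'I_N) x : @hcell R N i x ->
  `|TW W (@cellf R N j) x - site_mx N i j / N%:R| <= om i j / N%:R.
Proof.
move=> xi; have xI := hcell_sub N0 xi.
have sW := sqi_graphon_section gW xI.
have -> : TW W (@cellf R N j) x = dotp (@cellf R N j) (W x) by rewrite dotpC.
rewrite -(dotp_cellf_cst N0 j); apply: dotp_cellf_le => //; first exact: sqi_cst.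
move=> y yj; rewrite /= mxE; apply: omW; [exact: hcell_grid|exact: hcell_grid|exact: site_grid|exact: site_grid].
Qed.

Lemma TW_step_dist (a : 'I_N -> R) (i : 'I_N) x : @hcell R N i x ->
  `|TW W (step a) x - (\sum_j site_mx N i j * a j) / N%:R| <= (\sum_j om i j * `|a j|) / N%:R.
Proof.
move=> xi; rewrite TW_step; last exact: hcell_sub xi.
rewrite mulr_suml [leRHS]mulr_suml -sumrB.
apply: (le_trans (ler_norm_sum _ _ _)); apply: ler_sum => j _.
rewrite mulrAC [_ * a j]mulrC -mulrBr normrM [leRHS]mulrAC [leRHS]mulrC ler_wpM2l//.
exact: TW_cellf_dist.
Qed.

(** Hilbert-Schmidt bound, by Cauchy-Schwarz in each row. *)
Lemma sum_osc_sqr (a : 'I_N -> R) :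
  \sum_i (\sum_j om i j * `|a j|) ^+ 2 <= eta ^+ 2 * N%:R ^+ 2 * sqnorm a.
Proof.
apply: (@le_trans _ _ (\sum_i (\sum_j om i j ^+ 2) * sqnorm a)).
  apply: ler_sum => i _; apply: (le_trans (sum_cauchy_schwarz _ _ _)).
  rewrite ler_wpM2l ?sumr_ge0//; first by move=> j _; exact: sqr_ge0.
  by rewrite /sqnorm; apply: ler_sum => j _; rewrite real_normK ?num_real.
by rewrite -mulr_suml ler_wpM2r ?sqnorm_ge0.
Qed.

(** On step functions, [W] and its matrix of site values differ by an operator of Hilbert-Schmidt
    norm at most [eta]; so the matrix divided by [N] inherits the form bound [opnorm W + eta]. *)
Lemma qform_site_mx (a : 'I_N -> R) :
  qform (site_mx N) a <= N%:R * (opnorm W + eta) * sqnorm a.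
Proof.
have sa := sqi_step a; have sT := sqi_TW gW (sqi_integ sa).
pose t i := (\sum_j site_mx N i j * a j) / N%:R.
pose b i := (\sum_j om i j * `|a j|) / N%:R.
have h1 : dotp (step a) (TW W (step a)) <= opnorm W * (sqnorm a / N%:R).
  apply: (le_trans (ler_norm _)); apply: (le_trans (abs_dotp_le sa sT)).
  rewrite -nrm_step_sqr// expr2 mulrCA ler_wpM2l ?nrm_ge0//; exact: nrm_TW_le_opnorm.
have h2 : dotp (step a) (step t) = qform (site_mx N) a / N%:R ^+ 2.
  rewrite dotp_step_step// expr2 invfM mulrA; congr (_ / _).
  rewrite /qform mulr_suml; apply: eq_bigr => i _; rewrite /t mulrA; congr (_ / _).
  by rewrite mulr_sumr; apply: eq_bigr => j _; rewrite mulrCA mulrA.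
have h3 : `|dotp (step a) (TW W (step a)) - dotp (step a) (step t)| <= eta * (sqnorm a / N%:R).
  rewrite -dotpBr//; last exact: sqi_step.
  have sB : sqi (fun x => TW W (step a) x - step t x) by apply: sqiB => //; exact: sqi_step.
  apply: (le_trans (abs_dotp_le sa sB)).
  have nb : nrm (fun x => TW W (step a) x - step t x) <= nrm (step b).
    apply: (nrm_le_null (Z := [set 0])) => //.
    - exact: lebesgue_measure_set1.
    - exact: sqi_step.
    - move=> x xI /eqP x0; have [i xi] := hcell_cover N0 xI x0.
      rewrite !(stepE N0 _ xi) (ger0_norm (x := b i)); first exact: TW_step_dist.
      by rewrite /b divr_ge0// sumr_ge0// => j _; rewrite mulr_ge0.
  have nb2 : nrm (step b) <= eta * nrm (step a).
    rewrite -(ler_pXn2r (n := 2)) ?nnegrE ?nrm_ge0 ?mulr_ge0 ?nrm_ge0 ?(ltW eta0)//.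
    rewrite exprMn !nrm_step_sqr// mulrA ler_pM2r ?invr_gt0// /b /sqnorm.
    under eq_bigr do rewrite expr_div_n.
    by rewrite -mulr_suml ler_pdivrMr ?exprn_gt0// mulrAC; exact: sum_osc_sqr.
  rewrite -nrm_step_sqr// expr2 mulrCA ler_wpM2l ?nrm_ge0//; exact: le_trans nb nb2.
move: h3; rewrite h2 ler_norml => /andP[h3 _].
have n2 : 0 < N%:R ^+ 2 :> R by rewrite exprn_gt0.
have : qform (site_mx N) a / N%:R ^+ 2 <= (opnorm W + eta) * (sqnorm a / N%:R) by lra.
rewrite ler_pdivrMr// => /le_trans; apply; rewrite le_eqVlt; apply/orP; left; apply/eqP.
by field; rewrite gt_eqF.
Qed.


Section variance_limit.
Variables (beta : R) (b0 : 0 < beta) (q1 : beta * opnorm W < 1).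
Variables (C : 'M[R]_N) (rho zeta : R).
Hypotheses (rho1 : 0 <= rho < 1) (zeta0 : 0 <= zeta).
Hypothesis Crho : forall x, qform C x <= rho * sqnorm x.
Hypothesis Cdist : frob (C - (beta / N%:R) *: site_mx N) <= zeta ^+ 2.
Variables (f F G : R -> R) (M eta1 : R) (of1 : 'I_N -> R) (Z : set RM).
Hypotheses (sF : sqi F) (sG : sqi G) (mZ : measurable Z) (Z0 : mu Z = 0%E).
Hypothesis (FZ : forall x, I01 x -> ~ Z x -> F x = f x).
Hypothesis FG : forall x, I01 x -> G x - beta * TW W G x = F x.
Hypothesis fM : forall x, I01 x -> `|f x| <= M.
Hypothesis ofP : forall (i : 'I_N) x x', grid_cell N i x -> grid_cell N i x' -> `|f x - f x'| <= of1 i.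
Hypotheses (of0 : forall i, 0 <= of1 i) (eta10 : 0 <= eta1) (ofS : \sum_i of1 i ^+ 2 <= eta1 ^+ 2 * N%:R).
Variable g : 'I_N -> R.
Hypothesis gf : forall i, g i - \sum_j C i j * g j = f (site i).

Lemma site_in01 (i : 'I_N) : `[0, 1]%classic (site i : R).
Proof. by rewrite /= in_itv/= /site divr_ge0//= ler_pdivrMr ?ltr0n// mul1r ler_nat. Qed.

(** Energy estimate: the discrete equation is tested against its own solution. *)
Lemma nrm_step_solution : nrm (step g) <= M / (1 - rho).
Proof.
have /andP[r0 r1] := rho1.
have h1 : (1 - rho) * sqnorm g <= \sum_i g i * f (site i).
  have -> : \sum_i g i * f (site i) = sqnorm g - qform C g.
    rewrite /sqnorm /qform -sumrB; apply: eq_bigr => i _.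
    rewrite -gf mulrBr -expr2 mulr_sumr; congr (_ - _); apply: eq_bigr => j _; ring.
  by have := Crho g; lra.
have M0 : 0 <= M by apply: le_trans (fM (x := 0) _); rewrite ?normr_ge0//= in_itv/= lexx ler01.
have h2 : nrm (step (fun i : 'I_N => f (site i))) <= M.
  apply: nrm_le_cst => //; first exact: sqi_step.
  by move=> x xI; apply: step_le => // i; apply: fM; exact: site_in01.
have h3 : (1 - rho) * nrm (step g) ^+ 2 <= nrm (step g) * M.
  rewrite nrm_step_sqr// mulrA; apply: (@le_trans _ _ (dotp (step g) (step (fun i : 'I_N => f (site i))))).
    by rewrite dotp_step_step// ler_pM2r ?invr_gt0.
  apply: (le_trans (ler_norm _)); apply: (le_trans (abs_dotp_le _ _)); [exact: sqi_step|exact: sqi_step|].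
  by rewrite ler_wpM2l ?nrm_ge0.
have [g0|g0] := eqVneq (nrm (step g)) 0.
  by rewrite g0 divr_ge0// subr_ge0 ltW.
have gp : 0 < nrm (step g) by rewrite lt_neqAle eq_sym g0 nrm_ge0.
rewrite ler_pdivlMr ?subr_gt0// -(ler_pM2l gp) mulrA mulrC -expr2; exact: h3.
Qed.

(** [1 - beta T_W] expands the difference of the discrete and continuous solutions by at least
    [1 - beta * opnorm W], and the residual has three sources: [C] against [beta W / N] ([zeta]),
    the oscillation of [W] ([eta]) and that of [f] ([eta1]). *)
Lemma nrm_step_resolvent :
  (1 - beta * opnorm W) * nrm (fun x => step g x - G x) <=
  (zeta + beta * eta) * (M / (1 - rho)) + eta1.
Proof.
have sg := sqi_step g; have sp := sqiB sg sG.
have sTg := sqi_TW gW (sqi_integ sg).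
have sTp := sqi_TW gW (sqi_integ sp).
apply: (le_trans (nrm_resolvent_le gW b0 sp)).
pose b1 i := `|\sum_j (C - (beta / N%:R) *: site_mx N) i j * g j|.
pose b2 i := (\sum_j om i j * `|g j|) / N%:R.
have s1 : sqi (step b1) by exact: sqi_step.
have s2 : sqi (fun x => beta * step b2 x) by apply: sqiZ; exact: sqi_step.
have s3 : sqi (step of1) by exact: sqi_step.
have b20 i : 0 <= b2 i by rewrite /b2 divr_ge0// sumr_ge0// => j _; rewrite mulr_ge0.
have n1 : nrm (step b1) <= zeta * nrm (step g).
  rewrite -(ler_pXn2r (n := 2)) ?nnegrE ?nrm_ge0 ?mulr_ge0 ?nrm_ge0//.
  rewrite exprMn !nrm_step_sqr// mulrA ler_pM2r ?invr_gt0//.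
  apply: (@le_trans _ _ (frob (C - (beta / N%:R) *: site_mx N) * sqnorm g)); last by rewrite ler_wpM2r ?sqnorm_ge0.
  rewrite /frob /sqnorm mulr_suml; apply: ler_sum => i _; rewrite /b1 real_normK ?num_real//.
  exact: sum_cauchy_schwarz.
have n2 : nrm (fun x => beta * step b2 x) <= beta * eta * nrm (step g).
  rewrite nrmZ; last exact: sqi_step.
  rewrite (ger0_norm (ltW b0)) -mulrA ler_wpM2l ?(ltW b0)//.
  rewrite -(ler_pXn2r (n := 2)) ?nnegrE ?nrm_ge0 ?mulr_ge0 ?nrm_ge0 ?(ltW eta0)//.
  rewrite exprMn !nrm_step_sqr// mulrA ler_pM2r ?invr_gt0// /b2 /sqnorm.
  under eq_bigr do rewrite expr_div_n.
  by rewrite -mulr_suml ler_pdivrMr ?exprn_gt0// mulrAC; exact: sum_osc_sqr.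
have n3 : nrm (step of1) <= eta1.
  rewrite -(ler_pXn2r (n := 2)) ?nnegrE ?nrm_ge0//.
  by rewrite nrm_step_sqr// ler_pdivrMr.
have n12 := nrmD s1 s2; have n123 := nrmD (sqiD s1 s2) s3.
have main : nrm (fun x => (step g x - G x) - beta * TW W (fun x => step g x - G x) x) <=
    nrm (fun x => (step b1 x + beta * step b2 x) + step of1 x).
  apply: (nrm_le_null (Z := Z `|` [set 0])).
  - by apply: measurableU => //; exact: measurable_set1.
  - exact: null_setU1.
  - exact/sqiB/sqiZ.
  - exact: sqiD (sqiD s1 s2) s3.
  move=> x xI /not_orP[xZ /eqP x0]; have [i xi] := hcell_cover N0 xI x0.
  rewrite TWB//; [|exact: sqi_integ|exact: sqi_integ].
  rewrite (ger0_norm (x := _ + step of1 x)); last first.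
    by rewrite !(stepE N0 _ xi) !addr_ge0// ?normr_ge0// mulr_ge0 ?(ltW b0).
  have -> : step g x - G x - beta * (TW W (step g) x - TW W G x) =
     step g x - beta * TW W (step g) x - F x by rewrite -FG//; ring.
  rewrite !(stepE N0 _ xi) FZ//.
  have -> : g i - beta * TW W (step g) x - f x =
     \sum_j (C - (beta / N%:R) *: site_mx N) i j * g j
     - beta * (TW W (step g) x - (\sum_j site_mx N i j * g j) / N%:R)
     + (f (site i) - f x).
    have -> : \sum_j (C - (beta / N%:R) *: site_mx N) i j * g j =
        \sum_j C i j * g j - beta * ((\sum_j site_mx N i j * g j) / N%:R).
      rewrite mulr_suml mulr_sumr -sumrB; apply: eq_bigr => j _; rewrite !mxE; ring.
    rewrite -gf; ring.
  apply: (le_trans (ler_normD _ _)); apply: lerD; last by apply: ofP; [exact: site_grid|exact: hcell_grid].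
  apply: (le_trans (ler_normB _ _)); apply: lerD => //.
  by rewrite normrM (ger0_norm (ltW b0)) ler_wpM2l ?(ltW b0)//; exact: TW_step_dist.
apply: (le_trans main); apply: (le_trans n123).
have h : (zeta + beta * eta) * nrm (step g) <= (zeta + beta * eta) * (M / (1 - rho)).
  by rewrite ler_wpM2l ?nrm_step_solution// addr_ge0// mulr_ge0 ?(ltW b0) ?(ltW eta0).
lra.
Qed.

(** Two errors: passing from the site values of [f'] to [F'], paired with the discrete solution, and
    from the discrete to the continuous solution, paired with [F']. *)
Lemma resolvent_dist (f' F' : R -> R) (of' : 'I_N -> R) (Z' : set RM) : sqi F' -> measurable Z' -> mu Z' = 0%E ->
  (forall x, I01 x -> ~ Z' x -> F' x = f' x) ->
  (forall (i : 'I_N) x x', grid_cell N i x -> grid_cell N i x' -> `|f' x - f' x'| <= of' i) ->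
  (forall i, 0 <= of' i) -> \sum_i of' i ^+ 2 <= eta1 ^+ 2 * N%:R ->
  `|(\sum_i f' (site i) * g i) / N%:R - dotp F' G| <=
  eta1 * (M / (1 - rho)) +
  nrm F' * (((zeta + beta * eta) * (M / (1 - rho)) + eta1) / (1 - beta * opnorm W)).
Proof.
move=> sF' mZ' Z'0 FZ' ofP' of0' ofS'.
have sg := sqi_step g; have sp := sqiB sg sG.
have sf' : sqi (step (fun i : 'I_N => f' (site i))) by exact: sqi_step.
have sd := sqiB sf' sF'.
rewrite -(dotp_step_step N0 (fun i : 'I_N => f' (site i)) g).
have -> : dotp (step (fun i : 'I_N => f' (site i))) (step g) - dotp F' G =
   dotp (fun x => step (fun i : 'I_N => f' (site i)) x - F' x) (step g) + dotp F' (fun x => step g x - G x).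
  by rewrite dotpBl// dotpBr//; ring.
apply: (le_trans (ler_normD _ _)); apply: lerD.
  apply: (le_trans (abs_dotp_le sd sg)); apply: ler_pM; rewrite ?nrm_ge0 ?nrm_step_solution//.
  have s3 : sqi (step of') by exact: sqi_step.
  apply: (@le_trans _ _ (nrm (step of'))).
    apply: (nrm_le_null (Z := Z' `|` [set 0])) => //.
    - by apply: measurableU => //; exact: measurable_set1.
    - exact: null_setU1.
    move=> x xI /not_orP[xZ /eqP x0]; have [i xi] := hcell_cover N0 xI x0.
    rewrite !(stepE N0 _ xi) FZ'// (ger0_norm (x := of' i))//.
    by apply: ofP'; [exact: site_grid|exact: hcell_grid].
  rewrite -(ler_pXn2r (n := 2)) ?nnegrE ?nrm_ge0//.
  by rewrite nrm_step_sqr// ler_pdivrMr.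
apply: (le_trans (abs_dotp_le sF' sp)); rewrite ler_wpM2l ?nrm_ge0//.
by rewrite ler_pdivlMr ?subr_gt0// mulrC; exact: nrm_step_resolvent.
Qed.

End variance_limit.

End fixed_N.

End form_bound.

Section covariance_limit.
Context {R : realType}.
Local Notation mu := (@lebesgue_measure R).
Local Notation RM := (measurableTypeR R).
Local Notation I01 := (`[0%R, 1%R]%classic : set (measurableTypeR R)).
Variables (W : R -> R -> R) (beta : R).
Hypotheses (gW : graphon W) (rW : riemann_integrable2 W).
Hypotheses (b0 : 0 < beta) (q1 : beta * opnorm W < 1).

Lemma qform_frob N (D : 'M[R]_N) z x : 0 <= z -> frob D <= z ^+ 2 -> qform D x <= z * sqnorm x.
Proof.
move=> z0 Dz; have s0 := sqnorm_ge0 x.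
have e : qform D x = \sum_i x i * (\sum_j D i j * x j).
  by apply: eq_bigr => i _; rewrite mulr_sumr; apply: eq_bigr => j _; ring.
have h : qform D x ^+ 2 <= (z * sqnorm x) ^+ 2.
  rewrite e; apply: (le_trans (sum_cauchy_schwarz _ _ _)).
  rewrite exprMn -/(sqnorm x) mulrC expr2 mulrA ler_wpM2r//.
  apply: (@le_trans _ _ (frob D * sqnorm x)); last by rewrite ler_wpM2r.
  rewrite /frob mulr_suml; apply: ler_sum => i _; exact: sum_cauchy_schwarz.
rewrite leNgt; apply/negP => lt.
by move: h; rewrite leNgt ltr_pXn2r ?nnegrE ?mulr_ge0 ?lt// (le_trans _ (ltW lt))// mulr_ge0.
Qed.

Variable C : forall N : nat, 'M[R]_N.
Hypothesis Cdist : forall zeta : R, 0 < zeta ->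
  \forall N \near \oo, frob (C N - (beta / N%:R) *: site_mx W N) <= zeta ^+ 2.

Lemma qform_coupling_limit : exists2 rho : R, 0 <= rho < 1 &
  \forall N \near \oo, forall x, qform (C N) x <= rho * sqnorm x.
Proof.
have q0 : 0 <= beta * opnorm W by rewrite mulr_ge0 ?opnorm_ge0 ?(ltW b0).
pose q := beta * opnorm W; rewrite -/q in q0; have q1' : q < 1 := q1.
(* A quarter of the gap [1 - q] pays for the distance from [C N] to the matrix of [W], a quarter for
   the oscillation of [W]; half of it remains. *)
exists ((1 + q) / 2); first by apply/andP; split; lra.
have z0 : 0 < (1 - q) / 4 by lra.
have e0 : 0 < (1 - q) / 4 / beta by rewrite divr_gt0.
have [N0 HN] := riemann_grid_sqr rW e0.
near=> N => x.
have Np : (0 < N)%N by near: N; exists 1%N.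
have [|om [om0 omW omS]] := HN N _ Np; first by near: N; exists N0.
have h1 := qform_site_mx gW Np om0 e0 omW omS x.
have h2 : qform (C N - (beta / N%:R) *: site_mx W N) x <= (1 - q) / 4 * sqnorm x.
  by apply: qform_frob; [exact: ltW|near: N; exact: Cdist].
have -> : C N = (C N - (beta / N%:R) *: site_mx W N) + (beta / N%:R) *: site_mx W N by rewrite subrK.
rewrite qformD qformZ.
have n0 : 0 < N%:R :> R by rewrite ltr0n.
have : beta / N%:R * qform (site_mx W N) x <= (q + (1 - q) / 4) * sqnorm x.
  apply: (@le_trans _ _ (beta / N%:R * (N%:R * (opnorm W + (1 - q) / 4 / beta) * sqnorm x))).
    by rewrite ler_wpM2l// divr_ge0// ltW.
  rewrite le_eqVlt; apply/orP; left; apply/eqP; rewrite /q; field.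
  by rewrite !gt_eqF.
lra.
Unshelve. all: by end_near.
Qed.

(** [resolvent] chooses some solution. [G] shows that there is one, and the lower norm bound for
    [1 - beta T_W] shows that every choice agrees with [G] in L2. *)
Lemma resolvent_spec (f F G : R -> R) (Z : set RM) : sqi F -> sqi G -> measurable Z -> mu Z = 0%E ->
  (forall x, I01 x -> ~ Z x -> F x = f x) -> (forall x, I01 x -> G x - beta * TW W G x = F x) ->
  sqi (resolvent beta W f) /\ nrm (fun x => resolvent beta W f x - G x) = 0.
Proof.
move=> sF sG mZ Z0 FZ FG.
have : [set g | L2 g /\ {ae mu, forall x, `[0, 1]%classic x -> g x - beta * TW W g x = f x}] (resolvent beta W f).
  apply: (xgetPex (cst 0)); exists G; split; first exact/L2P.
  exists Z; split=> // x /= h; apply: contrapT => xZ; apply: h => xI.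
  by rewrite FG// FZ.
set r := resolvent beta W f => -[/L2P sr [Z1 [mZ1 Z10 Z1P]]]; split=> //.
have sp := sqiB sr sG.
have := nrm_resolvent_le gW b0 sp.
have -> : nrm (fun x => r x - G x - beta * TW W (fun y => r y - G y) x) = 0.
  apply/eqP; rewrite eq_le nrm_ge0 andbT.
  apply: (@le_trans _ _ (nrm (cst (0 : R)))); last by rewrite nrm_cst normr0.
  apply: (nrm_le_null (Z := Z `|` Z1)).
  - exact: measurableU.
  - by apply: (etrans (measureU0 mZ mZ1 Z10)).
  - by apply: sqiB => //; apply: sqiZ; apply: sqi_TW => //; exact: sqi_integ.
  - exact: sqi_cst.
  move=> x xI /not_orP[xZ xZ1].
  rewrite TWB//; [|exact: sqi_integ|exact: sqi_integ].
  have e : r x - beta * TW W r x = f x.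
    by apply: contrapT => h; apply: xZ1; apply: Z1P => /= h1; exact/h/h1.
  have -> : r x - G x - beta * (TW W r x - TW W G x) =
    (r x - beta * TW W r x) - (G x - beta * TW W G x) by ring.
  by rewrite e FG// FZ// subrr.
have q' : 0 < 1 - beta * opnorm W by rewrite subr_gt0.
by rewrite pmulr_rle0// => h; apply/eqP; rewrite eq_le h nrm_ge0.
Qed.

Lemma resolvent_form_limit (f f' : R -> R) (rho e : R) : 0 <= rho < 1 -> 0 < e ->
  riemann_integrable f -> riemann_integrable f' ->
  (\forall N \near \oo, forall x, qform (C N) x <= rho * sqnorm x) ->
  \forall N \near \oo, forall g : 'I_N -> R,
    (forall i, g i - \sum_j C N i j * g j = f (site i)) ->
    `|(\sum_i f' (site i) * g i) / N%:R - dotp f' (resolvent beta W f)| <= e.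
Proof.
move=> rho1 e0 rf rf' Crho.
have [F [MF [Z [mF FM mZ Z0 FZ]]]] := borel_version rf.
have [F' [MF' [Z' [mF' FM' mZ' Z'0 FZ']]]] := borel_version rf'.
have [G [MG [mG GM FG]]] := resolvent_exists gW b0 q1 mF FM.
have sF := sqi_bounded mF FM; have sF' := sqi_bounded mF' FM'; have sG := sqi_bounded mG GM.
have [sr r0] := resolvent_spec sF sG mZ Z0 FZ FG.
have -> : dotp f' (resolvent beta W f) = dotp F' G.
  transitivity (dotp F' (resolvent beta W f)).
    by apply: (eq_Rintegral_null mZ' Z'0) => x xI xZ; rewrite FZ'.
  have sp := sqiB sr sG; apply/eqP; rewrite -subr_eq0 -dotpBr// -normr_le0.
  by apply: (le_trans (abs_dotp_le sF' sp)); rewrite r0 mulr0.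
have [[M fM] _] := rf.
have M0 : 0 <= M by apply: le_trans (fM 0 _); rewrite ?normr_ge0//= in_itv/= lexx ler01.
have /andP[rho0 rho1'] := rho1.
have q' : 0 < 1 - beta * opnorm W by rewrite subr_gt0.
pose m := M / (1 - rho).
have m0 : 0 <= m by rewrite divr_ge0// subr_ge0 ltW.
(* With all small parameters of [resolvent_dist] equal to [de], its bound is [de * K]. *)
pose K := m + nrm F' * (((1 + beta) * m + 1) / (1 - beta * opnorm W)).
have K0 : 0 <= K.
  rewrite addr_ge0// mulr_ge0 ?nrm_ge0// divr_ge0 ?(ltW q')// addr_ge0// mulr_ge0//.
  by rewrite addr_ge0// ltW.
have K1 : 0 < K + 1 by rewrite ltr_wpDl.
pose de := e / (K + 1).
have de0 : 0 < de by rewrite divr_gt0.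
have [N0 HN] := riemann_grid_sqr rW de0.
have [N1 HN1] := riemann_grid1_sqr rf de0.
have [N2 HN2] := riemann_grid1_sqr rf' de0.
near=> N => g gf.
have Np : (0 < N)%N by near: N; exists 1%N.
have [|om [om0 omW omS]] := HN N _ Np; first by near: N; exists N0.
have [|p1 [h10 o1P o1S]] := HN1 N _ Np; first by near: N; exists N1.
have [|p2 [h20 o2P o2S]] := HN2 N _ Np; first by near: N; exists N2.
have CN : forall x, qform (C N) x <= rho * sqnorm x by near: N.
have CD : frob (C N - (beta / N%:R) *: site_mx W N) <= de ^+ 2 by near: N; exact: Cdist.
have := resolvent_dist gW Np om0 de0 omW omS b0 q1 rho1 (ltW de0) CN CD sG mZ Z0 FZ FG fM
  o1P h10 (ltW de0) o1S gf sF' mZ' Z'0 FZ' o2P h20 o2S.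
move=> /le_trans; apply.
apply: (@le_trans _ _ (de * K)).
  rewrite le_eqVlt; apply/orP; left; apply/eqP; rewrite /K -/m; field.
  by rewrite gt_eqF.
rewrite /de -mulrA [_ * K]mulrC ler_piMr ?(ltW e0)//.
by rewrite ler_pdivrMr// mul1r; lra.
Unshelve. all: by end_near.
Qed.

End covariance_limit.

Section solve.
Context {R : realType}.

Lemma coupling_inj N (C : 'M[R]_N) (rho : R) (x : 'I_N -> R) : rho < 1 ->
  (forall x, qform C x <= rho * sqnorm x) ->
  (forall i, x i - \sum_j C i j * x j = 0) -> forall i, x i = 0.
Proof.
move=> rho1 Crho xE.
have h : sqnorm x = qform C x.
  rewrite /sqnorm /qform; apply: eq_bigr => i _.
  have /eqP := xE i; rewrite subr_eq0 => /eqP xi; rewrite expr2 {2}xi mulr_sumr.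
  by apply: eq_bigr => j _; ring.
have x0 : sqnorm x = 0.
  by apply/eqP; rewrite eq_le sqnorm_ge0 andbT; have := Crho x; rewrite -h; have := sqnorm_ge0 x; nra.
move=> i; have /eqP := x0; rewrite /sqnorm psumr_eq0; last by move=> j _; exact: sqr_ge0.
by move=> /allP /(_ i (mem_index_enum _)); rewrite sqrf_eq0 => /eqP.
Qed.

Lemma coupling_mulmx N (C : 'M[R]_N) (v : 'cV[R]_N) i :
  ((1%:M - C) *m v) i 0 = v i 0 - \sum_j C i j * v j 0.
Proof. by rewrite mulmxBl mul1mx !mxE. Qed.

(** The bound [rho < 1] makes [1 - C] injective, hence invertible. *)
Lemma solve_coupling N (C : 'M[R]_N) (rho : R) (F : 'I_N -> R) : rho < 1 ->
  (forall x, qform C x <= rho * sqnorm x) ->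
  exists g : 'I_N -> R, forall i, g i - \sum_j C i j * g j = F i.
Proof.
move=> rho1 Crho.
have U : (1%:M - C) \in unitmx.
  rewrite -unitmx_tr -row_free_unit -kermx_eq0; apply/eqP/row_matrixP => k.
  rewrite row0; set v := row k _.
  have vK : v *m (1%:M - C)^T = 0 by apply/sub_kermxP; exact: row_sub.
  have xE i : v^T i 0 - \sum_j C i j * v^T j 0 = 0.
    by rewrite -coupling_mulmx -(trmxK (1%:M - C)) -trmx_mul vK !mxE.
  apply/rowP => i; rewrite [RHS]mxE.
  by have := coupling_inj rho1 Crho xE i; rewrite mxE.
pose v : 'cV[R]_N := invmx (1%:M - C) *m \col_i F i.
exists (fun i => v i 0) => i.
have : (1%:M - C) *m v = \col_i F i by rewrite mulKVmx.
move=> /(congr1 (fun A : 'cV[R]_N => A i 0)); rewrite [RHS]mxE => <-.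
by rewrite coupling_mulmx.
Qed.

End solve.

Section linear_combinations.
Context {R : realType}.
Variables (W : R -> R -> R) (beta : R).
Hypotheses (gW : graphon W) (rW : riemann_integrable2 W).
Hypotheses (b0 : 0 < beta) (q1 : beta * opnorm W < 1).
Variable C : forall N : nat, 'M[R]_N.
Hypothesis Cdist : forall zeta : R, 0 < zeta ->
  \forall N \near \oo, frob (C N - (beta / N%:R) *: site_mx W N) <= zeta ^+ 2.
Variables (k : nat) (f : 'I_k -> R -> R).
Hypothesis rf : forall j, riemann_integrable (f j).

Lemma row_formE (t : 'rV[R]_k) (S : 'M[R]_k) :
  (t *m S *m t^T) 0 0 = \sum_a \sum_b t 0 a * t 0 b * S a b.
Proof.
rewrite mxE exchange_big/=; apply: eq_bigr => b _; rewrite !mxE mulr_suml.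
by apply: eq_bigr => a _; ring.
Qed.

(** By uniqueness the discrete solution is linear in its right-hand side, so the entrywise limits
    combine bilinearly. *)
Lemma limit_cov_form (rho e : R) (t : 'rV[R]_k) : 0 <= rho < 1 -> 0 < e ->
  (\forall N \near \oo, forall x, qform (C N) x <= rho * sqnorm x) ->
  \forall N \near \oo, forall g : 'I_N -> R,
    (forall i, g i - \sum_j C N i j * g j = \sum_a t 0 a * f a (site i)) ->
    `|(\sum_i (\sum_a t 0 a * f a (site i)) * g i) / N%:R
      - (t *m limit_cov beta W f *m t^T) 0 0| <= e.
Proof.
move=> rho1 e0 Crho; have /andP[_ rho1'] := rho1.
pose K := \sum_a \sum_b `|t 0 a * t 0 b|.
have K0 : 0 <= K by apply: sumr_ge0 => a _; apply: sumr_ge0.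
have K1 : 0 < K + 1 by rewrite ltr_wpDl.
pose de := e / (K + 1).
have de0 : 0 < de by rewrite divr_gt0.
have H : \forall N \near \oo, forall a b, forall g : 'I_N -> R,
    (forall i, g i - \sum_j C N i j * g j = f b (site i)) ->
    `|(\sum_i f a (site i) * g i) / N%:R - dotp (f a) (resolvent beta W (f b))| <= de.
  apply: filter_forall => a; apply: filter_forall => b.
  exact: (resolvent_form_limit gW rW b0 q1 Cdist rho1 de0 (rf b) (rf a) Crho).
near=> N => g gE.
have HN : forall a b, forall g : 'I_N -> R,
    (forall i, g i - \sum_j C N i j * g j = f b (site i)) ->
    `|(\sum_i f a (site i) * g i) / N%:R - dotp (f a) (resolvent beta W (f b))| <= de by near: N.
have CN : forall x, qform (C N) x <= rho * sqnorm x by near: N.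
have /choice[h hE] b := solve_coupling (fun l => f b (site l)) rho1' CN.
have gh i : g i = \sum_b t 0 b * h b i.
  apply/eqP; rewrite -subr_eq0; apply/eqP.
  apply: (coupling_inj (x := fun i => g i - \sum_b t 0 b * h b i) rho1' CN) => l.
  have -> : \sum_j C N l j * (g j - \sum_b t 0 b * h b j) =
      \sum_j C N l j * g j - \sum_j \sum_b C N l j * (t 0 b * h b j).
    by rewrite -sumrB; apply: eq_bigr => j _; rewrite mulrBr mulr_sumr.
  have -> : g l - \sum_b t 0 b * h b l - (\sum_j C N l j * g j - \sum_j \sum_b C N l j * (t 0 b * h b j)) =
    (g l - \sum_j C N l j * g j) - (\sum_b t 0 b * h b l - \sum_j \sum_b C N l j * (t 0 b * h b j)) by ring.
  rewrite gE exchange_big -sumrB -sumrB big1// => b _; rewrite -hE.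
  rewrite mulrBr mulr_sumr.
  apply/eqP; rewrite subr_eq0; apply/eqP; congr (_ - _).
  by apply: eq_bigr => j _; ring.
have -> : (\sum_i (\sum_a t 0 a * f a (site i)) * g i) / N%:R =
    \sum_a \sum_b t 0 a * t 0 b * ((\sum_i f a (site i) * h b i) / N%:R).
  rewrite mulr_suml.
  transitivity (\sum_(i < N) \sum_a \sum_b t 0 a * t 0 b * (f a (site i) * h b i / N%:R)).
    apply: eq_bigr => i _; rewrite gh !mulr_suml; apply: eq_bigr => a _.
    by rewrite mulr_sumr mulr_suml; apply: eq_bigr => b _; ring.
  rewrite exchange_big/=; apply: eq_bigr => a _; rewrite exchange_big/=; apply: eq_bigr => b _.
  by rewrite -mulr_sumr mulr_suml.
rewrite row_formE -sumrB.
apply: (@le_trans _ _ (K * de)); last first.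
  by rewrite /de mulrC -mulrA ler_piMr ?(ltW e0)// mulrC ler_pdivrMr// mul1r; lra.
rewrite /K mulr_suml; apply: (le_trans (ler_norm_sum _ _ _)); apply: ler_sum => a _.
rewrite -sumrB mulr_suml; apply: (le_trans (ler_norm_sum _ _ _)); apply: ler_sum => b _.
rewrite -mulrBr normrM ler_wpM2l// mxE; exact: HN.
Unshelve. all: by end_near.
Qed.

End linear_combinations.

Section limit_covariance.
Context {R : realType}.
Variables (W : R -> R -> R) (beta : R) (k : nat) (f : 'I_k -> R -> R).
Hypotheses (gW : graphon W) (rW : riemann_integrable2 W).
Hypotheses (b0 : 0 < beta) (q1 : beta * opnorm W < 1).
Hypothesis rf : forall j, riemann_integrable (f j).

(** Symmetry and positivity of the limit are inherited from finite matrices; this choice of coupling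
    has distance zero to [beta W / N]. *)
Let C N : 'M[R]_N := (beta / N%:R) *: site_mx W N.

Let Cdist (zeta : R) : 0 < zeta ->
  \forall N \near \oo, frob (C N - (beta / N%:R) *: site_mx W N) <= zeta ^+ 2.
Proof.
move=> _; near=> N; rewrite subrr /frob big1 ?sqr_ge0// => i _.
by rewrite big1// => j _; rewrite mxE expr0n.
Unshelve. all: by end_near.
Qed.

Let Csym N i j : C N i j = C N j i.
Proof.
rewrite !mxE; case: gW => _ _ ->//; case: N i j => [[]//|N] i j; exact: site_in01.
Qed.

Lemma solution_sym N (D : 'M[R]_N) (F1 F2 g1 g2 : 'I_N -> R) : (forall i j, D i j = D j i) ->
  (forall i, g1 i - \sum_j D i j * g1 j = F1 i) -> (forall i, g2 i - \sum_j D i j * g2 j = F2 i) ->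
  \sum_i F1 i * g2 i = \sum_i F2 i * g1 i.
Proof.
move=> Ds h1 h2.
under eq_bigr do rewrite -h1 mulrBl mulr_suml.
under [RHS]eq_bigr do rewrite -h2 mulrBl mulr_suml.
rewrite !sumrB; congr (_ - _); first by apply: eq_bigr => i _; rewrite mulrC.
rewrite exchange_big/=; apply: eq_bigr => i _; apply: eq_bigr => j _.
by rewrite Ds mulrAC.
Qed.

(** For a symmetric coupling the discrete form is symmetric, and both orders of its arguments
    converge. *)
Lemma limit_cov_sym : (limit_cov beta W f)^T = limit_cov beta W f.
Proof.
have [rho rho1 Crho] := qform_coupling_limit gW rW b0 q1 Cdist.
have /andP[_ rho1'] := rho1.
apply/matrixP => i j; rewrite !mxE; apply/eqP; rewrite -subr_eq0 -normr_le0.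
apply/ler_addgt0Pr => e e0; rewrite add0r.
have e2 : 0 < e / 2 by rewrite divr_gt0.
have h1 := resolvent_form_limit gW rW b0 q1 Cdist rho1 e2 (rf i) (rf j) Crho.
have h2 := resolvent_form_limit gW rW b0 q1 Cdist rho1 e2 (rf j) (rf i) Crho.
have [N [CN [h1N h2N]]] : exists N, (forall x, qform (C N) x <= rho * sqnorm x) /\
   (forall g : 'I_N -> R, (forall l, g l - \sum_m C N l m * g m = f i (site l)) ->
    `|(\sum_l f j (site l) * g l) / N%:R - dotp (f j) (resolvent beta W (f i))| <= e / 2) /\
   (forall g : 'I_N -> R, (forall l, g l - \sum_m C N l m * g m = f j (site l)) ->
    `|(\sum_l f i (site l) * g l) / N%:R - dotp (f i) (resolvent beta W (f j))| <= e / 2).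
  have : \forall N \near \oo, (forall x, qform (C N) x <= rho * sqnorm x) /\
   (forall g : 'I_N -> R, (forall l, g l - \sum_m C N l m * g m = f i (site l)) ->
    `|(\sum_l f j (site l) * g l) / N%:R - dotp (f j) (resolvent beta W (f i))| <= e / 2) /\
   (forall g : 'I_N -> R, (forall l, g l - \sum_m C N l m * g m = f j (site l)) ->
    `|(\sum_l f i (site l) * g l) / N%:R - dotp (f i) (resolvent beta W (f j))| <= e / 2).
    by near=> N; split; [near: N|split; near: N].
  by move=> /filter_ex[N HN]; exists N.
have [g1 g1P] := solve_coupling (fun l => f i (site l)) rho1' CN.
have [g2 g2P] := solve_coupling (fun l => f j (site l)) rho1' CN.
have := h1N g1 g1P; have := h2N g2 g2P.
rewrite (solution_sym (@Csym N) g1P g2P) => H1 H2.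
by have := ler_distD ((\sum_l f j (site l) * g1 l) / N%:R) (dotp (f j) (resolvent beta W (f i))) (dotp (f i) (resolvent beta W (f j))); have := distrC (dotp (f j) (resolvent beta W (f i))) ((\sum_l f j (site l) * g1 l) / N%:R); lra.
Unshelve. all: by end_near.
Qed.


(** The discrete form is [sqnorm g - qform C g], which is nonnegative as [rho < 1]. *)
Lemma limit_cov_psd (t : 'rV[R]_k) : 0 <= (t *m limit_cov beta W f *m t^T) 0 0.
Proof.
have [rho rho1 Crho] := qform_coupling_limit gW rW b0 q1 Cdist.
have /andP[_ rho1'] := rho1.
apply/ler_addgt0Pr => e e0.
have h1 := limit_cov_form gW rW b0 q1 Cdist rf t rho1 e0 Crho.
have [N [CN h1N]] : exists N, (forall x, qform (C N) x <= rho * sqnorm x) /\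
   forall g : 'I_N -> R,
    (forall i, g i - \sum_j C N i j * g j = \sum_a t 0 a * f a (site i)) ->
    `|(\sum_i (\sum_a t 0 a * f a (site i)) * g i) / N%:R
      - (t *m limit_cov beta W f *m t^T) 0 0| <= e.
  suff /filter_ex[N HN] : \forall N \near \oo, (forall x, qform (C N) x <= rho * sqnorm x) /\
   forall g : 'I_N -> R,
    (forall i, g i - \sum_j C N i j * g j = \sum_a t 0 a * f a (site i)) ->
    `|(\sum_i (\sum_a t 0 a * f a (site i)) * g i) / N%:R
      - (t *m limit_cov beta W f *m t^T) 0 0| <= e by exists N.
  by near=> N; split; near: N.
have [g gP] := solve_coupling (fun l => \sum_a t 0 a * f a (site l)) rho1' CN.
have := h1N g gP; rewrite ler_norml => /andP[_ h].
suff : 0 <= (\sum_i (\sum_a t 0 a * f a (site i)) * g i) / N%:R by lra.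
rewrite divr_ge0//.
have -> : \sum_i (\sum_a t 0 a * f a (site i)) * g i = sqnorm g - qform (C N) g.
  rewrite /sqnorm /qform -sumrB; apply: eq_bigr => i _; rewrite -gP mulrBl expr2 mulr_suml.
  by congr (_ - _); apply: eq_bigr => j _; ring.
have := CN g; have := sqnorm_ge0 g; nra.
Unshelve. all: by end_near.
Qed.

End limit_covariance.

(** * Gaussian laws and weak convergence *)

Section normal_transform.
Context {R : realType}.
Local Notation mu := (@lebesgue_measure R).
Local Notation RM := (measurableTypeR R).

(** Over symmetric intervals the integral is a boundary term, small by the decay of [F]; dominated
    convergence removes the truncation. *)
Lemma Rintegral_derivative_eq0 (F f : R -> R) (g : RM -> R) (B : R) :
  (forall x : R, is_derive x 1 F (f x)) -> continuous f ->
  mu.-integrable setT (EFin \o g) -> (forall x, `|f x| <= g x) ->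
  (forall x, `|x| * `|F x| <= B) -> \int[mu]_x f x = 0.
Proof.
move=> Ff cf ig fg FB.
have mf : measurable_fun setT (f : RM -> R) by exact: continuous_measurable_fun.
pose D n : set RM := `[- n.+1%:R, n.+1%:R]%classic.
pose fn n (x : RM) : \bar R := (f x * \1_(D n) x)%:E.
have mD n : measurable (D n) by exact: measurable_itv.
have intD n : (\int[mu]_x fn n x)%E = (F n.+1%:R - F (- n.+1%:R))%:E.
  transitivity (\int[mu]_(x in D n) (f x)%:E)%E.
    rewrite [RHS]integral_mkcond; apply: eq_integral => x _.
    rewrite patchE /fn indicE; case: ifPn => xD; rewrite ?mulr1 ?mulr0//.
  rewrite (@continuous_FTC2 _ f F)//.
  - by apply: (@lt_trans _ _ 0); rewrite ?oppr_lt0 ?ltr0n.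
  - exact: continuous_subspaceT.
  - split.
    + by move=> x _; exact: (@ex_derive _ _ _ _ _ _ _ (Ff x)).
    + apply: cvg_at_right_filter; apply: differentiable_continuous.
      exact/derivable1_diffP/(@ex_derive _ _ _ _ _ _ _ (Ff _)).
    + apply: cvg_at_left_filter; apply: differentiable_continuous.
      exact/derivable1_diffP/(@ex_derive _ _ _ _ _ _ _ (Ff _)).
  - by move=> x _; rewrite derive1E (@derive_val _ _ _ _ _ _ _ (Ff x)).
have [||||ifn _ cvfn] := @dominated_convergence _ _ _ mu setT measurableT fn (EFin \o f) (EFin \o g) _ _ _ ig.
- move=> n; apply/measurable_EFinP; apply: measurable_funM => //; exact: measurable_indic.
- exact/measurable_EFinP.
- apply: aeW => x _; apply: cvg_near_cst.
  near=> n; suff xD : D n x by rewrite /fn indicE mem_set ?mulr1.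
  rewrite /D /= in_itv/= -ler_norml.
  near: n; exists (Num.truncn `|x|) => // n /= xn.
  by apply: ltW; apply: (lt_le_trans (truncnS_gt _)); rewrite ler_nat ltnS.
- apply: aeW => x n _; rewrite /fn lee_fin normrM; apply: le_trans (fg x).
  by rewrite ler_piMr// indicE ger0_norm//; case: (_ \in _).
have B0 : 0 <= B by apply: le_trans (FB 0); rewrite normr0 mul0r.
have c0 : ((fun n => \int[mu]_x fn n x) @ \oo --> 0)%E.
  under eq_fun do rewrite intD.
  apply: cvg_EFin; first exact: nearW.
  apply/cvgrPdist_le => e e0; near=> n.
  rewrite /= sub0r normrN; apply: (@le_trans _ _ (2 * B / n.+1%:R)).
    rewrite ler_pdivlMr// mulrC; apply: (@le_trans _ _ (n.+1%:R * (`|F n.+1%:R| + `|F (- n.+1%:R)|))).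
      by rewrite ler_wpM2l// ler_normB.
    have := FB n.+1%:R; have := FB (- n.+1%:R); rewrite normrN normr_nat; lra.
  rewrite ler_pdivrMr// -ler_pdivrMl//.
  near: n; exists (Num.truncn (e^-1 * (2 * B))) => // n /= xn.
  by apply: ltW; apply: (lt_le_trans (truncnS_gt _)); rewrite ler_nat ltnS.
rewrite /Rintegral.
have -> : (\int[mu]_x (f x)%:E = 0)%E by apply: (cvg_unique _ cvfn c0).
by [].
Unshelve. all: by end_near.
Qed.


Section fixed_variance.
Variable s : R.
Hypothesis s0 : s != 0.
Local Notation p := (normal_pdf 0 s).

Let s2 : 0 < s ^+ 2. Proof. by rewrite exprn_even_gt0. Qed.

Lemma normal_pdf0E x : p x = normal_peak s * expR (- x ^+ 2 / (2 * s ^+ 2)).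
Proof. by rewrite normal_pdfE// /normal_fun subr0 mulr_natl. Qed.

(** Doubling the standard deviation leaves a factor [exp (- 3 x^2 / (8 s^2))] to spare, which
    absorbs the linear growth. *)
Lemma normal_pdf0_linear_bound : exists2 K, 0 <= K &
  forall x, (1 + `|x|) * p x <= K * normal_pdf 0 (2 * s) x.
Proof.
have t0 : 2 * s != 0 by rewrite mulf_neq0.
have pk1 := normal_peak_gt0 s0; have pk2 := normal_peak_gt0 t0.
pose c := 2 * (1 + 8 * s ^+ 2).
exists (c * normal_peak s / normal_peak (2 * s)).
  by rewrite divr_ge0 ?(ltW pk2)// mulr_ge0 ?(ltW pk1)// /c; nra.
move=> x; rewrite normal_pdf0E normal_pdfE//.
have -> : c * normal_peak s / normal_peak (2 * s) * (normal_peak (2 * s) * normal_fun 0 (2 * s) x) =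
    normal_peak s * (c * normal_fun 0 (2 * s) x) by field; rewrite gt_eqF.
rewrite mulrCA ler_wpM2l ?(ltW pk1)//.
rewrite /normal_fun subr0.
have -> : - x ^+ 2 / (2 * s ^+ 2) = - (3 * x ^+ 2 / (8 * s ^+ 2)) + - x ^+ 2 / ((2 * s) ^+ 2 *+ 2).
  by rewrite mulr2n; field.
rewrite expRD mulrA ler_wpM2r ?expR_ge0// expRN ler_pdivrMr ?expR_gt0//.
set z := 3 * x ^+ 2 / _.
have z0 : 0 <= z by apply: divr_ge0; apply: mulr_ge0; rewrite ?sqr_ge0.
apply: (@le_trans _ _ (c * (1 + z))); last first.
  by rewrite ler_wpM2l ?expR_ge1Dx// /c; nra.
have zE : 8 * s ^+ 2 * z = 3 * x ^+ 2 by rewrite /z; field.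
have h : `|x| <= 1 + x ^+ 2.
  rewrite -[x ^+ 2]real_normK ?num_real//; have := sqr_ge0 (`|x| - 1); nra.
rewrite /c; have := sqr_ge0 x; nra.
Qed.

Lemma normal_pdf0_decay : exists B, forall x, `|x| * p x <= B.
Proof.
have [K K0 H] := normal_pdf0_linear_bound.
have t0 : 2 * s != 0 by rewrite mulf_neq0.
exists (K * normal_peak (2 * s)) => x.
apply: le_trans (le_trans (H x) _).
  by rewrite ler_wpM2r ?normal_pdf_ge0// lerDr.
by rewrite ler_wpM2l// normal_pdf_ub.
Qed.

Lemma is_derive_normal_pdf0 (x : R) : is_derive x 1 p (- x / s ^+ 2 * p x).
Proof.
have -> : p = fun x : R => normal_peak s * expR (- x ^+ 2 / (2 * s ^+ 2)).
  by apply/funext => y; exact: normal_pdf0E.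
apply: is_derive_eq; rewrite /GRing.scale/=.
by field.
Qed.

(** After multiplication by [exp (w^2 s^2 / 2)], the derivative of the integrand in [w] is the
    derivative in [x] of [exp (w^2 s^2 / 2) s^2 sin (w x + c) p x]. Its integral vanishes, so the
    integral is constant in [w], with value [cos c] at 0. *)
Lemma Rintegral_cos_normal_pdf (u c : R) :
  \int[mu]_x (cos (u * x + c) * p x) = cos c * expR (- (u ^+ 2 * s ^+ 2) / 2).
Proof.
have [K K0 HK] := normal_pdf0_linear_bound.
have [B HB] := normal_pdf0_decay.
have p0 x : 0 <= p x by exact: normal_pdf_ge0.
pose G (x : RM) := (1 + `|x|) * p x.
have G0 x : 0 <= G x by rewrite mulr_ge0// addr_ge0.
have mp : measurable_fun setT (p : RM -> R) by exact: measurable_normal_pdf.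
have mG : measurable_fun setT G.
  apply: measurable_funM => //; apply: measurable_funD => //; exact: measurableT_comp.
have iG : mu.-integrable setT (EFin \o G).
  apply: (@le_integrable _ _ _ mu setT measurableT _ (fun x => K%:E * (normal_pdf 0 (2 * s) x)%:E)%E).
  - exact/measurable_EFinP.
  - move=> x _; rewrite -EFinM !abse_EFin lee_fin ger0_norm// ger0_norm ?mulr_ge0 ?normal_pdf_ge0//.
    exact: HK.
  - by apply: integrableZl => //; exact: integrable_normal_pdf.
pose f (w : R) (x : RM) := expR (w ^+ 2 * s ^+ 2 / 2) * (cos (w * x + c) * p x).
pose df (w : R) (x : R) := expR (w ^+ 2 * s ^+ 2 / 2) * ((w * s ^+ 2 * cos (w * x + c) - x * sin (w * x + c)) * p x).
have fd (w x : R) : is_derive w (1 : R) (f ^~ x : R -> R) (df w x).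
  apply: is_derive_eq; rewrite /GRing.scale/= /df.
  by field.
have dfE w x : partial1of2 f w x = df w x.
  by rewrite partial1of2E (@derive_val _ _ _ _ _ _ _ (fd w x)).
have cosc w : continuous (fun x : R => cos (w * x + c)).
  move=> x; apply: (@continuous_comp _ _ _ (fun x => w * x + c) (@cos R)); last exact: continuous_cos.
  by apply: cvgD; [apply: cvgM; [exact: cvg_cst|exact: cvg_id]|exact: cvg_cst].
have sinc w : continuous (fun x : R => sin (w * x + c)).
  move=> x; apply: (@continuous_comp _ _ _ (fun x => w * x + c) (@sin R)); last exact: continuous_sin.
  by apply: cvgD; [apply: cvgM; [exact: cvg_cst|exact: cvg_id]|exact: cvg_cst].
have mf w : measurable_fun setT (f w).
  apply: measurable_funM => //; apply: measurable_funM => //.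
  exact: (continuous_measurable_fun (cosc w)).
have intf w : mu.-integrable setT (EFin \o f w).
  apply: (@le_integrable _ _ _ mu setT measurableT _ (fun x => (expR (w ^+ 2 * s ^+ 2 / 2))%:E * (p x)%:E)%E).
  - exact/measurable_EFinP.
  - move=> x _; rewrite -EFinM !abse_EFin lee_fin /f normrM (ger0_norm (expR_ge0 _)).
    rewrite normrM (ger0_norm (expR_ge0 _)) ler_wpM2l ?expR_ge0//.
    by rewrite normrM ler_piMl// cos_max.
  - by apply: integrableZl => //; exact: integrable_normal_pdf.
have tb (w x : R) : `|w * s ^+ 2 * cos (w * x + c) - x * sin (w * x + c)| <= (`|w| * s ^+ 2 + 1) * (1 + `|x|).
  apply: (le_trans (ler_normB _ _)).
  rewrite (normrM (w * s ^+ 2)) (normrM w) (normrM x) (ger0_norm (ltW s2)).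
  have hw : 0 <= `|w| * s ^+ 2 by rewrite mulr_ge0 // ltW.
  have h1 : `|w| * s ^+ 2 * `|cos (w * x + c)| <= `|w| * s ^+ 2 by rewrite ler_piMr// cos_max.
  have h2 : `|x| * `|sin (w * x + c)| <= `|x| by rewrite ler_piMr// sin_max.
  by have hx := normr_ge0 x; nra.
have df0 w : \int[mu]_x df w x = 0.
  pose F (x : R) := expR (w ^+ 2 * s ^+ 2 / 2) * s ^+ 2 * (sin (w * x + c) * p x).
  pose L := expR (w ^+ 2 * s ^+ 2 / 2) * (`|w| * s ^+ 2 + 1).
  pose LG (x : RM) := L * G x; pose BB := expR (w ^+ 2 * s ^+ 2 / 2) * s ^+ 2 * B.
  apply: (@Rintegral_derivative_eq0 F (df w) LG BB).
  - move=> x; have hp := is_derive_normal_pdf0 x.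
    apply: is_derive_eq; rewrite /GRing.scale/= /df.
    by field.
  - move=> x; apply: cvgM; first exact: cvg_cst.
    apply: cvgM; last exact: continuous_normal_pdf.
    apply: cvgB; apply: cvgM; [exact: cvg_cst|exact: cosc|exact: cvg_id|exact: sinc].
  - have := integrableZl measurableT L iG.
    by apply: eq_integrable.
  - move=> x; rewrite /LG /df /L /G normrM (ger0_norm (expR_ge0 _)) -[leRHS]mulrA ler_wpM2l ?expR_ge0//.
    rewrite [leRHS]mulrA normrM (ger0_norm (p0 x)) ler_wpM2r//.
  - move=> x; rewrite /F /BB normrM (ger0_norm (mulr_ge0 (expR_ge0 _) (ltW s2))) mulrCA ler_wpM2l ?(mulr_ge0 (expR_ge0 _) (ltW s2))//.
    rewrite normrM (ger0_norm (p0 x)); apply: le_trans (HB x).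
    by rewrite ler_wpM2l// ler_piMl// sin_max.
pose H w := \int[mu]_x f w x.
have dH (w : R) : is_derive w 1 H 0.
  pose a : R := w.
  have Ia : `]a - 1, a + 1[%classic a by rewrite /= in_itv/= ltrBlDr ltrDl ltr01.
  pose L := expR ((`|a| + 1) ^+ 2 * s ^+ 2 / 2) * ((`|a| + 1) * s ^+ 2 + 1).
  have L0 : 0 <= L.
    by rewrite mulr_ge0 ?expR_ge0// addr_ge0// mulr_ge0 ?(ltW s2)// addr_ge0.
  have iL : mu.-integrable setT (EFin \o (fun x => L * G x)).
    by have := integrableZl measurableT L iG; apply: eq_integrable.
  have LG0 y : 0 <= L * G y by rewrite mulr_ge0.
  have ub x y : `]a - 1, a + 1[%classic x -> setT y -> `|partial1of2 f x y| <= L * G y.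
    rewrite /= in_itv/= => /andP[x1 x2] _.
    have xa : `|x| <= `|a| + 1.
      have := ler_norm a; have := ler_norm (- a); rewrite normrN ler_norml => *.
      apply/andP; split; lra.
    rewrite dfE /df /L /G normrM (ger0_norm (expR_ge0 _)) -[leRHS]mulrA; apply: ler_pM => //.
      rewrite ler_expR ler_pM2r// ler_wpM2r ?(ltW s2)//.
      by rewrite -(real_normK (num_real x)) ler_sqr ?nnegrE// addr_ge0.
    rewrite [leRHS]mulrA normrM (ger0_norm (p0 y)) ler_wpM2r//.
    apply: (le_trans (tb x y)); rewrite ler_wpM2r ?addr_ge0// lerD2r ler_wpM2r//.
    exact: ltW.
  have der x y : `]a - 1, a + 1[%classic x -> setT y -> derivable (f ^~ y) x 1.
    by move=> _ _; exact: (@ex_derive _ _ _ _ _ _ _ (fd x y)).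
  have h1 := @derivable_under_integral R _ RM mu f setT measurableT a (a - 1) (a + 1) Ia (fun x _ => intf x) der _ LG0 iL ub.
  have h2 := @differentiation_under_integral R _ RM mu f setT measurableT a (a - 1) (a + 1) Ia (fun x _ => intf x) der _ LG0 iL ub.
  apply: DeriveDef => //; rewrite -derive1E h2.
  by rewrite -(df0 a); apply: eq_Rintegral => x _; rewrite dfE.
have := is_derive_0_is_cst u 0 dH; rewrite /H.
have -> : \int[mu]_x f 0 x = cos c.
  transitivity (\int[mu]_x (cos c * p x)).
    by apply: eq_Rintegral => x _; rewrite /f mul0r add0r expr0n !mul0r expR0 mul1r.
  rewrite RintegralZl//; last exact: integrable_normal_pdf.
  by rewrite /Rintegral integral_normal_pdf mulr1.
pose e := expR (u ^+ 2 * s ^+ 2 / 2); pose e' := expR (- (u ^+ 2 * s ^+ 2) / 2).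
have ee : e' * e = 1 by rewrite /e /e' -expRD mulNr addNr expR0.
rewrite /f RintegralZl//; last first.
  have := integrableZl measurableT e' (intf u); apply: eq_integrable => // x _.
  apply: (congr1 EFin (_ : e' * f u x = cos (u * x + c) * p x)).
  by rewrite /f mulrA ee mul1r.
by move=> <-; rewrite -/e -/e' mulrAC [e * _]mulrC ee mul1r.
Qed.

End fixed_variance.

End normal_transform.

Section bernoulli_mean.
Context {R : realType} {I : finType}.
Variable pr : I -> R.
Hypothesis pr01 : forall i, 0 <= pr i <= 1.

Let X (b : {ffun I -> bool}) i : R := (b i)%:R - pr i.

Lemma bexp_centered i : bexp pr (fun b => X b i ^+ 2) <= 1.
Proof.
rewrite -[leRHS](bexp_cst pr); apply: ler_bexp => // b.
have /andP[p0 p1] := pr01 i; rewrite /X; case: (b i) => /=; nra.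
Qed.

Lemma bexp_centered_cov i j : i != j -> bexp pr (fun b => X b i * X b j) = 0.
Proof.
move=> ij.
pose g l (c : bool) : R := if l == i then c%:R - pr i else if l == j then c%:R - pr j else 1.
have -> : (fun b => X b i * X b j) = fun b => \prod_l g l (b l).
  apply/funext => b; rewrite (bigD1 i)//= /g eqxx (bigD1 j)/=; last by rewrite eq_sym.
  rewrite eq_sym (negbTE ij) eqxx big1 ?mulr1// => l /andP[li lj].
  by rewrite (negbTE li) (negbTE lj).
rewrite bexp_prod (bigD1 i)//= /g eqxx.
by rewrite (_ : pr i * _ + _ = 0) ?mul0r//= ; ring.
Qed.

(** Variance of an empirical mean of independent variables; this is the estimate behind Bernstein
    polynomials. *)
Lemma bexp_mean_sqr n (e : 'I_n -> I) : (0 < n)%N -> injective e ->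
  bexp pr (fun b => ((\sum_l X b (e l)) / n%:R) ^+ 2) <= n%:R^-1.
Proof.
move=> n0 inj; have nr : 0 < n%:R :> R by rewrite ltr0n.
have -> : (fun b => ((\sum_l X b (e l)) / n%:R) ^+ 2) =
   (fun b => n%:R^-2 * \sum_l \sum_m X b (e l) * X b (e m)).
  apply/funext => b; rewrite expr_div_n mulrC; congr (_ * _).
  by rewrite expr2 mulr_suml; apply: eq_bigr => l _; rewrite mulr_sumr.
rewrite bexpZ.
have -> : bexp pr (fun b => \sum_l \sum_m X b (e l) * X b (e m)) =
   \sum_l bexp pr (fun b => X b (e l) ^+ 2).
  transitivity (\sum_l \sum_m bexp pr (fun b => X b (e l) * X b (e m))).
    rewrite /bexp; under eq_bigr do rewrite mulr_sumr.
    rewrite exchange_big/=; apply: eq_bigr => l _.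
    by under eq_bigr do rewrite mulr_sumr; rewrite exchange_big.
  apply: eq_bigr => l _; rewrite (bigD1 l)//= big1 ?addr0// => m ml.
  by rewrite bexp_centered_cov// (inj_eq inj) eq_sym.
apply: (@le_trans _ _ (n%:R^-2 * n%:R)).
  rewrite ler_wpM2l ?invr_ge0 ?exprn_ge0//.
  rewrite -[leRHS]mulr1 -[n in leRHS]card_ord -sum1_card natr_sum mulr_suml.
  by apply: ler_sum => l _; rewrite mul1r bexp_centered.
by rewrite expr2 invfM -mulrA mulVf ?mulr1// gt_eqF.
Qed.

End bernoulli_mean.

(** * Trigonometric polynomials and approximation on cubes *)

Section trigonometric_class.
Context {R : realType} {k : nat}.

(** The phase [c] brings sines into the class and makes it closed under products, by the
    product-to-sum formulas. *)
Inductive trig : ('rV[R]_k -> R) -> Prop :=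
| trig_cos (xi : 'rV[R]_k) (c : R) : trig (fun x => cos ((x *m xi^T) 0 0 + c))
| trig_add p q : trig p -> trig q -> trig (fun x => p x + q x)
| trig_scale (a : R) p : trig p -> trig (fun x => a * p x).

Lemma trig_ext p q : p =1 q -> trig p -> trig q.
Proof. by move=> /funext ->. Qed.

Lemma trig_cst c : trig (fun=> c).
Proof.
apply: (trig_ext _ (trig_scale c (trig_cos 0 0))) => x.
by rewrite trmx0 mulmx0 mxE addr0 cos0 mulr1.
Qed.

Lemma trig_mul p q : trig p -> trig q -> trig (fun x => p x * q x).
Proof.
move=> tp tq; elim: tp => {p} [xi c|p p' _ IH _ IH'|a p _ IH].
- elim: tq => {q} [xi' c'|q q' _ IH _ IH'|a q _ IH].
  + apply: (trig_ext _ (trig_scale 2^-1 (trig_add (trig_cos (xi + xi') (c + c')) (trig_cos (xi - xi') (c - c'))))) => x.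
    rewrite !linearD/= !linearN/= !mxE.
    set a := \sum_j _; set b := \sum_j _.
    have -> : a + b + (c + c') = (a + c) + (b + c') by ring.
    have -> : a - b + (c - c') = (a + c) - (b + c') by ring.
    by rewrite cosD cosB; field.
  + by apply: (trig_ext _ (trig_add IH IH')) => x; ring.
  + by apply: (trig_ext _ (trig_scale a IH)) => x; ring.
- by apply: (trig_ext _ (trig_add IH IH')) => x; ring.
- by apply: (trig_ext _ (trig_scale a IH)) => x; ring.
Qed.

Lemma trig_sum (I : Type) (r : seq I) (p : I -> 'rV[R]_k -> R) : (forall i, trig (p i)) ->
  trig (fun x => \sum_(i <- r) p i x).
Proof.
move=> tp; elim: r => [|i r IH].
  by apply: (trig_ext _ (trig_cst 0)) => x; rewrite big_nil.
by apply: (trig_ext _ (trig_add (tp i) IH)) => x; rewrite big_cons.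
Qed.

Lemma trig_prod (I : Type) (r : seq I) (p : I -> 'rV[R]_k -> R) : (forall i, trig (p i)) ->
  trig (fun x => \prod_(i <- r) p i x).
Proof.
move=> tp; elim: r => [|i r IH].
  by apply: (trig_ext _ (trig_cst 1)) => x; rewrite big_nil.
by apply: (trig_ext _ (trig_mul (tp i) IH)) => x; rewrite big_cons.
Qed.

Lemma trig_sin_coord (j : 'I_k) (L : R) : trig (fun x => sin (x 0 j / L)).
Proof.
apply: (trig_ext _ (trig_cos (L^-1 *: delta_mx 0 j) (- (pi / 2)))) => x.
rewrite linearZ/= -scalemxAr trmx_delta mxE -cosBpihalf; congr (cos (_ - _)).
by rewrite -colE mxE mulrC.
Qed.

End trigonometric_class.

Section arcsine_modulus.
Context {R : realType}.

(** For [u >= v] the claim reads [(1 - u) (1 + v) <= cos a * cos b]. The square of the right side is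
    [(1 - u) (1 + v) (1 + u) (1 - v)], where the last two factors dominate the first two. *)
Lemma one_sub_cos_le (a b : R) : 0 <= cos a -> 0 <= cos b ->
  1 - cos (a - b) <= `|sin a - sin b|.
Proof.
wlog ab : a b / sin b <= sin a.
  move=> H ca cb; have [h|/ltW h] := leP (sin b) (sin a); first exact: H.
  by rewrite distrC -cosN opprB; exact: H.
move=> ca cb; rewrite ger0_norm ?subr_ge0// cosB.
have := cos2Dsin2 a; have := cos2Dsin2 b.
have := sin_max a; have := sin_max b; rewrite !ler_norml.
set x := cos a in ca *; set y := cos b in cb *; set u := sin a in ab *; set v := sin b in ab *.
move=> /andP[v1 v2] /andP[u1 u2] hb ha.
have h : (1 - u) * (1 + v) <= x * y.
  rewrite -(ler_pXn2r (n := 2)) ?nnegrE ?mulr_ge0//; [|lra|lra].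
  have -> : (x * y) ^+ 2 = (1 - u) * (1 + v) * ((1 + u) * (1 - v)).
    by rewrite exprMn -[x ^+ 2](addrK (u ^+ 2)) ha -[y ^+ 2](addrK (v ^+ 2)) hb; ring.
  by rewrite expr2 ler_wpM2l ?mulr_ge0//; [lra|lra|nra].
by nra.
Qed.

Lemma asin_dist (a q de : R) : -1 <= a <= 1 -> -1 <= q <= 1 -> 0 < de <= 1 ->
  `|sin a - q| < 1 - cos de -> `|a - asin q| < de.
Proof.
move=> /andP[a1 a2] q1 /andP[d0 d1] h.
have pih := @pihalf_ge1 R.
have ca : 0 <= cos a by apply: cos_ge0_pihalf; apply/andP; split; lra.
have [/andP[s1 s2] sq] := asin_def q1.
have cb : 0 <= cos (asin q) by apply: cos_ge0_pihalf; rewrite s1.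
have := one_sub_cos_le ca cb; rewrite sq => /le_lt_trans/(_ h).
rewrite ltrD2l ltrN2 -[cos (a - _)]cos_norm => hc.
rewrite -ltr_cos//; last by rewrite in_itv/=; apply/andP; split; lra.
rewrite in_itv/= normr_ge0/= ler_norml; apply/andP; split; lra.
Qed.

End arcsine_modulus.

Section trigonometric_approximation.
Context {R : realType} {k : nat}.
Variables (h : 'rV[R]_k -> R) (M : R).
Hypothesis ch : continuous h.
Hypothesis hM : forall x, `|h x| <= M.

(** Only [x] is confined to the cube, because the nodes of the later approximation may lie outside
    of it. *)
Lemma unif_continuous_cube (L e : R) : 0 < e -> exists2 de : R, 0 < de &
  forall x y : 'rV[R]_k, (forall j, `|x 0 j| <= L) -> (forall j, `|x 0 j - y 0 j| < de) -> `|h x - h y| <= e.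
Proof.
move=> e0.
pose K := [set v : 'rV[R]_k | forall j, `[(- L), L]%classic (v ord0 j)].
have cK : compact K by apply: (@rV_compact R k (fun=> `[(- L), L]%classic)) => j; exact: segment_compact.
pose P (de : R) (x : 'rV[R]_k) := forall y : 'rV[R]_k, (forall j, `|x 0 j - y 0 j| < de) -> `|h x - h y| <= e.
have : \forall de \near 0^'+, K `<=` P de.
  move/compact_near_coveringP: cK; apply => x Kx.
  have e2 : 0 < e / 2 by rewrite divr_gt0.
  have /cvgrPdist_lt /(_ _ e2) /nbhs_ballP[r /= r0 rP] := @ch x.
  exists (ball x (r / 2), [set de | de < r / 2]); first split => /=.
  - by apply: nbhsx_ballx; rewrite divr_gt0.
  - by apply: nbhs_right_lt; rewrite divr_gt0.
  move=> [x' de] /= [bx dr] y xy.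
  have b2 : ball x (r / 2) x'.
    exact: bx.
  have h1 : `|h x - h x'| < e / 2.
    by apply: rP; apply: le_ball bx; rewrite ler_pdivrMr//; lra.
  have h2 : `|h x - h y| < e / 2.
    apply: rP; rewrite [X in ball _ X](splitr r); apply: ball_triangle bx _; split=> [|i j].
      by rewrite divr_gt0.
    rewrite /ball/= (ord1 i); exact: lt_trans (xy j) dr.
  by have := ler_distD (h x) (h x') (h y); rewrite [X in _ <= X + _]distrC; lra.
move=> H; have /filter_ex[de [de0 Kde]] : \forall de \near 0^'+, 0 < de /\ K `<=` P de.
  by near=> de; split; [near: de; exact: nbhs_right_gt|near: de].
exists de => // x y xL xy; apply: Kde => // j.
by rewrite /= in_itv/= -ler_norml.
Unshelve. all: by end_near.
Qed.

(** This is the Bernstein polynomial of [h] in the variables [(1 + sin (x_j / L)) / 2]. On the cube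
    [|x_j / L| <= 1 <= pi / 2], so [asin] recovers the point from the sines. Being an expectation of
    values of [h], the polynomial is bounded by [M] everywhere. *)
Lemma trig_approx (L e : R) : 0 < L -> 0 < e ->
  exists p, [/\ trig p, forall x, `|p x| <= M &
    forall x : 'rV[R]_k, (forall j, `|x 0 j| <= L) -> `|h x - p x| <= e].
Proof.
move=> L0 e0; have M0 : 0 <= M := le_trans (normr_ge0 _) (hM 0).
have e2 : 0 < e / 2 by rewrite divr_gt0.
have [de de0 Hde] := unif_continuous_cube L e2.
pose d0 := Num.min 1 (de / L).
have d01 : 0 < d0 <= 1 by rewrite lt_min ltr01 divr_gt0//= ge_min lexx.
have pih := @pihalf_ge1 R.
(* An error below [eta] in a frequency moves the sine by less than [1 - cos d0], hence the angle by
   less than [d0]. *)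
pose eta := (1 - cos d0) / 4.
have eta0 : 0 < eta.
  rewrite divr_gt0// subr_gt0 -cos0 ltr_cos; [by case/andP: d01| |]; rewrite in_itv/= ?lexx ?pi_ge0//.
  by have /andP[] := d01; move=> *; apply/andP; split; lra.
pose B := 2 * M * k%:R / eta ^+ 2.
have B0 : 0 <= B by rewrite divr_ge0 ?exprn_ge0 ?(ltW eta0)// !mulr_ge0.
pose n := (Num.truncn (B / (e / 2))).+1.
have nB : B / n%:R <= e / 2.
  by rewrite ler_pdivrMr ?ltr0n// mulrC -ler_pdivrMr//; apply/ltW/truncnS_gt.
have nr : 0 < n%:R :> R by rewrite ltr0n.
pose u (j : 'I_k) (x : 'rV[R]_k) : R := (1 + sin (x 0 j / L)) / 2.
pose pr x (i : 'I_k * 'I_n) := u i.1 x.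
have pr01 x i : 0 <= pr x i <= 1.
  rewrite /pr /u; have := sin_max (x 0 i.1 / L); rewrite ler_norml => /andP[*]; apply/andP; split; lra.
pose qm (b : {ffun 'I_k * 'I_n -> bool}) j : R := (\sum_l (b (j, l))%:R) / n%:R.
have q01 b j : 0 <= qm b j <= 1.
  rewrite /qm divr_ge0 ?sumr_ge0//= ler_pdivrMr// mul1r.
  rewrite -[n in leRHS]card_ord -sum1_card natr_sum; apply: ler_sum => l _.
  by case: (b _).
pose H (b : {ffun 'I_k * 'I_n -> bool}) : R := h (\row_j (L * asin (2 * qm b j - 1))).
exists (fun x => bexp (pr x) H); split.
- apply: trig_sum => b; apply: trig_mul; last exact: trig_cst.
  apply: trig_prod => i.
  have tu : trig (u i.1).
    by apply: (trig_ext _ (trig_scale 2^-1 (trig_add (trig_cst 1) (trig_sin_coord i.1 L)))) => x; rewrite mulrC.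
  case: (b i) => //.
  by apply: (trig_ext _ (trig_add (trig_cst 1) (trig_scale (-1) tu))) => x; rewrite mulN1r.
- move=> x; rewrite -(bexp_cst (pr x) M) ler_norml.
  have -> : - bexp (pr x) (fun=> M) = bexp (pr x) (fun=> - M) by rewrite !bexp_cst.
  by apply/andP; split; apply: ler_bexp => // b; have := hM (\row_j (L * asin (2 * qm b j - 1))); rewrite ler_norml => /andP[].
move=> x xL.
(* Good samples use uniform continuity. On the others some coordinate is off by at least [eta], and
   [2 * M] is charged to its square, as in Chebyshev's inequality. *)
have key b : `|h x - H b| <= e / 2 + \sum_j (2 * M / eta ^+ 2) * (qm b j - u j x) ^+ 2.
  have t0 : 0 <= \sum_j (2 * M / eta ^+ 2) * (qm b j - u j x) ^+ 2.
    by apply: sumr_ge0 => j _; rewrite mulr_ge0 ?sqr_ge0// divr_ge0 ?exprn_ge0 ?(ltW eta0)// mulr_ge0.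
  have [/forallP good|] := boolP [forall j, `|qm b j - u j x| < eta].
    rewrite -[leLHS]addr0 lerD//; apply: Hde => // j; rewrite mxE.
    have xj : x 0 j = L * (x 0 j / L) by rewrite mulrC divfK// gt_eqF.
    rewrite {1}xj -mulrBr normrM (gtr0_norm L0) -ltr_pdivlMl//.
    apply: (@lt_le_trans _ _ d0); last by rewrite ge_min mulrC lexx orbT.
    apply: asin_dist => //.
    - have := xL j; rewrite -ler_norml normrM normfV (gtr0_norm L0) ler_pdivrMr// mul1r//.
    - by have /andP[h1 h2] := q01 b j; apply/andP; split; lra.
    - have -> : sin (x 0 j / L) - (2 * qm b j - 1) = 2 * (u j x - qm b j) by rewrite /u; field.
      rewrite normrM ger0_norm//; have := good j; rewrite distrC => g; have := eta0; move: g; rewrite /eta; lra.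
  rewrite negb_forall => /existsP[j]; rewrite -leNgt => bad.
  have h2 : `|h x - H b| <= 2 * M.
    by rewrite (le_trans (ler_normB _ _))// mulr2n mulrDl mul1r lerD// ?hM// /H hM.
  apply: (le_trans h2); rewrite -[leLHS]add0r lerD ?(ltW e2)//.
  rewrite (bigD1 j)//= -[leLHS]addr0 lerD//; last first.
    by apply: sumr_ge0 => l _; rewrite mulr_ge0 ?sqr_ge0// divr_ge0 ?exprn_ge0 ?(ltW eta0)// mulr_ge0.
  rewrite mulrAC ler_pdivlMr ?exprn_gt0// ler_wpM2l ?mulr_ge0//.
  by rewrite -(real_normK (num_real (qm b j - _))) ler_sqr ?nnegrE ?(ltW eta0).
have -> : h x - bexp (pr x) H = bexp (pr x) (fun b => h x - H b).
  have -> : (fun b => h x - H b) = (fun b => h x + -1 * H b) by apply/funext => b; rewrite mulN1r.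
  by rewrite bexpD bexpZ bexp_cst mulN1r.
apply: (@le_trans _ _ (bexp (pr x) (fun b => e / 2 + \sum_j (2 * M / eta ^+ 2) * (qm b j - u j x) ^+ 2))).
  rewrite ler_norml.
  have -> : - bexp (pr x) (fun b => e / 2 + \sum_j (2 * M / eta ^+ 2) * (qm b j - u j x) ^+ 2) =
     bexp (pr x) (fun b => -1 * (e / 2 + \sum_j (2 * M / eta ^+ 2) * (qm b j - u j x) ^+ 2)).
    by rewrite bexpZ mulN1r.
  by apply/andP; split; apply: ler_bexp => // b; have := key b; rewrite ler_norml ?mulN1r => /andP[].
rewrite bexpD bexp_cst.
have -> : bexp (pr x) (fun b => \sum_j (2 * M / eta ^+ 2) * (qm b j - u j x) ^+ 2) =
  \sum_j (2 * M / eta ^+ 2) * bexp (pr x) (fun b => (qm b j - u j x) ^+ 2).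
  rewrite /bexp; under eq_bigr do rewrite mulr_sumr.
  rewrite exchange_big/=; apply: eq_bigr => j _.
  by rewrite mulr_sumr; apply: eq_bigr => b _; rewrite mulrCA.
rewrite [leRHS]splitr lerD2l; apply: le_trans nB.
rewrite /B mulrAC -[leRHS]mulrA mulrAC -[leRHS]mulrA.
apply: (@le_trans _ _ (\sum_(j < k) 2 * M / eta ^+ 2 * n%:R^-1)); last first.
  rewrite sumr_const card_ord -mulr_natl le_eqVlt; apply/orP; left; apply/eqP.
  by field; rewrite !gt_eqF.
apply: ler_sum => j _; rewrite ler_wpM2l ?divr_ge0 ?exprn_ge0 ?(ltW eta0) ?mulr_ge0//.
have inj : injective (fun l : 'I_n => (j, l)) by move=> l m [].
have n0 : (0 < n)%N by [].
have S : \sum_(l < n) pr x (j, l) = n%:R * u j x by rewrite /pr/= sumr_const card_ord mulr_natl.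
have := bexp_mean_sqr (pr01 x) n0 inj.
move=> /(le_trans _); apply.
rewrite le_eqVlt; apply/orP; left; apply/eqP; apply: eq_bigr => b _; congr (_ * _ ^+ 2).
by rewrite sumrB S mulrBl [n%:R * _]mulrC mulfK ?gt_eqF.
Qed.

End trigonometric_approximation.

Section bounded_integrals.
Context {d} {T : measurableType d} {R : realType} (m : probability T R).

Lemma bounded_integrable (f : T -> R) (M : R) : measurable_fun setT f ->
  (forall x, `|f x| <= M) -> m.-integrable setT (EFin \o f).
Proof.
move=> mf fM; apply: measurable_bounded_integrable => //.
  by apply: le_lt_trans (probability_le1 m measurableT) _; rewrite ltry.
exists M; split; first exact: num_real.
by move=> B MB x _; apply: (le_trans (fM _)); exact: ltW.
Qed.

Lemma norm_Rintegral_le (f : T -> R) (M : R) : measurable_fun setT f ->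
  (forall x, `|f x| <= M) -> `|\int[m]_x f x| <= M.
Proof.
move=> mf fM; have fi := bounded_integrable mf fM.
apply: (le_trans (le_normr_Rintegral measurableT fi)).
have -> : M = \int[m]_x (cst M x).
  rewrite Rintegral_cst// (_ : fine _ = 1) ?mulr1//.
  by rewrite -[RHS]/(fine 1%E); congr fine; exact: probability_setT.
apply: le_Rintegral => //; first exact: integrable_norm.
by apply: (@bounded_integrable (cst M) `|M|).
Qed.

End bounded_integrals.

Section integral_comparison.
Context {d} {T : measurableType d} {R : realType} (m : probability T R).

Lemma Rintegral_dist_le (h p : T -> R) (M e : R) (A : set T) : measurable A ->
  measurable_fun setT h -> measurable_fun setT p -> 0 <= e ->
  (forall x, `|h x| <= M) -> (forall x, `|p x| <= M) -> (forall x, A x -> `|h x - p x| <= e) ->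
  `|\int[m]_x h x - \int[m]_x p x| <= e + 2 * M * fine (m (~` A)).
Proof.
move=> mA mh mp e0 hM pM hp.
have M0 x : 0 <= M := le_trans (normr_ge0 _) (hM x).
have mAC : measurable (~` A) by exact: measurableC.
have ih := bounded_integrable m mh hM; have ip := bounded_integrable m mp pM.
rewrite -RintegralB//.
have mB : measurable_fun setT (fun x => h x - p x) by exact: measurable_funB.
have B2 x : `|h x - p x| <= 2 * M.
  by rewrite (le_trans (ler_normB _ _))// mulr2n mulrDl mul1r lerD.
have iB := bounded_integrable m mB B2.
apply: (le_trans (le_normr_Rintegral measurableT iB)).
have mi : measurable_fun setT (\1_(~` A) : T -> R) by exact: measurable_indic.
have i1 x : `|\1_(~` A) x| <= 1 :> R by rewrite indicE; case: (_ \in _); rewrite ?normr1 ?normr0.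
have ii := bounded_integrable m mi i1.
have mcst : measurable_fun setT (cst e : T -> R) by exact: measurable_cst.
have ie : m.-integrable setT (EFin \o cst e) by apply: (@bounded_integrable _ _ _ m (cst e) `|e|).
have iM : m.-integrable setT (EFin \o (fun x => 2 * M * \1_(~` A) x)).
  apply: (@bounded_integrable _ _ _ m _ `|2 * M|); first exact: measurable_funM.
  by move=> x; rewrite normrM ler_piMr.
have -> : e + 2 * M * fine (m (~` A)) = \int[m]_x (e + 2 * M * \1_(~` A) x).
  rewrite (@RintegralD _ _ _ _ _ (cst e))// RintegralZl// Rintegral_cst//.
  congr (_ + 2 * M * _); last by rewrite /Rintegral integral_indic// setIT.
  rewrite (_ : fine _ = 1) ?mulr1//.
  by rewrite -[RHS]/(fine 1%E); congr fine; exact: probability_setT.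
apply: le_Rintegral => //.
- exact: integrable_norm.
- have := integrableD measurableT ie iM; by apply: eq_integrable.
move=> x _; rewrite indicE; case: (boolP (x \in ~` A)) => [_|].
  by rewrite mulr1 -[leLHS]add0r lerD.
by rewrite mulr0 addr0 => /negP xA; apply: hp; apply: contrapT => nA; apply: xA; exact: mem_set.
Qed.

Lemma probability_tail (f : T -> R) (e : R) : measurable_fun setT f -> 0 < e ->
  exists2 L : R, 0 < L & fine (m [set x | L < f x]) <= e.
Proof.
move=> mf e0.
pose F n := [set x | f x <= n%:R].
have mF n : measurable (F n).
  by rewrite -[F n]setTI; apply: (measurable_fun_ler mf (measurable_cst _)).
have FT : \bigcup_n F n = setT.
  apply/seteqP; split=> // x _; exists (Num.truncn (f x)).+1 => //.
  exact/ltW/truncnS_gt.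
have := @nondecreasing_cvg_mu _ _ _ m F mF; rewrite FT => /(_ measurableT).
have mT : m [set: T] = 1%:E by exact: probability_setT.
move=> h; have /fine_cvgP[_ /cvgrPdist_le /(_ _ e0)] : m \o F @ \oo --> (1%:E : \bar R).
  rewrite -mT; apply: h => n p np; apply/subsetPset => x /= h; apply: (le_trans h).
  by rewrite ler_nat.
move=> /filter_ex[n /= hn]; exists n.+1%:R; first by rewrite ltr0n.
apply: le_trans hn.
have -> : 1 - fine (m (F n)) = fine (m (~` F n)).
  rewrite probability_setC// fineB//; last exact: fin_num_measure.
have mm : measurable [set x | n.+1%:R < f x].
  by rewrite -[X in measurable X]setTI; apply: (measurable_fun_ltr (measurable_cst _) mf).
apply: le_trans (ler_norm _); apply: fine_le; rewrite ?fin_num_measure//; first exact: measurableC.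
apply: le_measure; rewrite ?inE//; first exact: measurableC.
move=> x /= h1 h2; have := lt_le_trans h1 h2; rewrite ltr_nat => h3.
by move: h3; rewrite ltnNge leqnSn.
Qed.

End integral_comparison.

Section borel_measurability.
Context {R : realType}.

Lemma borel_continuous_measurable (S : ptopologicalType) (h : S -> R) :
  continuous h -> measurable_fun setT (h : borelType S -> R).
Proof.
move=> ch; apply: (measurability _ (RGenOInfty.measurableE R)) => //.
move=> _ [_ [x ->] <-]; rewrite setTI; apply: sub_sigma_algebra.
by move/continuousP: ch; apply; exact: rray_open.
Qed.

(* An open set is the union of the rational boxes that it contains. *)
Lemma measurable_row d (T : measurableType d) (k : nat) (phi : T -> borelType 'rV[R]_k) :
  (forall j, measurable_fun setT (fun w => (phi w : 'rV[R]_k) 0 j)) -> measurable_fun setT phi.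
Proof.
move=> mphi.
have rat_near (y z : R) : 0 < z -> exists q : rat, `|ratr q - y| < z.
  move=> z0; have [|q] := @rat_in_itvoo R y (y + z); first by rewrite ltrDl.
  rewrite in_itv/= => /andP[h1 h2]; exists q; rewrite ltr_norml; apply/andP; split; lra.
apply: (@measurability _ _ T (borelType 'rV[R]_k) setT phi (@open 'rV[R]_k) erefl).
move=> _ [U oU <-]; rewrite setTI.
pose box (q : 'rV[rat]_k * nat) : set 'rV[R]_k :=
  [set x | forall j, `|ratr (q.1 0 j) - x 0 j| < q.2.+1%:R^-1].
have -> : phi @^-1` U = \bigcup_(q in [set q | box q `<=` U]) phi @^-1` box q.
  apply/seteqP; split=> [w /= Uw|w [q /= qU] /qU//].
  have /nbhs_ballP[r /= r0 rU] : nbhs (phi w : 'rV[R]_k) U by exact: open_nbhs_nbhs.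
  pose n := Num.truncn (2 / r).
  have n0 : 0 < n.+1%:R^-1 :> R by rewrite invr_gt0.
  have nr : 2 / n.+1%:R <= r.
    by rewrite ler_pdivrMr// mulrC -ler_pdivrMr//; exact/ltW/truncnS_gt.
  have /choice[q qP] j : exists q : rat, `|ratr q - (phi w : 'rV[R]_k) 0 j| < n.+1%:R^-1.
    exact: rat_near.
  exists (\row_j q j, n); last by move=> j; rewrite mxE.
  move=> x xq; apply: rU; split=> // i j; rewrite /ball/= (ord1 i).
  have := qP j; have := xq j; rewrite /= mxE => h1 h2.
  have h3 := ler_distD (ratr (q j)) ((phi w : 'rV[R]_k) 0 j) (x 0 j).
  rewrite [X in _ <= X + _]distrC in h3.
  have -> : r = 2 / n.+1%:R + (r - 2 / n.+1%:R) by ring.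
  set z := n.+1%:R^-1 in n0 nr h1 h2 *.
  by lra.
rewrite [X in measurable X](_ : _ = \bigcup_(i in [set i | exists2 q, pickle q = i & box q `<=` U])
   (if unpickle i is Some q then phi @^-1` box q else set0)); last first.
  apply/seteqP; split=> [w [q qU wq]|w [i [q <- qU]]].
    by exists (pickle q); [exists q|rewrite pickleK].
  by rewrite pickleK => wq; exists q.
apply: bigcup_measurable => i _; case: (unpickle i) => [q|]; last exact: measurable0.
rewrite (_ : _ @^-1` _ = \bigcap_(j in [set: 'I_k]) [set w | `|ratr (q.1 0 j) - (phi w : 'rV[R]_k) 0 j| < q.2.+1%:R^-1]); last first.
  by apply/seteqP; split=> [w wq j _|w wq j]; [exact: wq|exact: (wq j I)].
apply: fin_bigcap_measurable => [|j _]; first exact: finite_finset.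
have m1 : measurable_fun setT (fun w => `|ratr (q.1 0 j) - (phi w : 'rV[R]_k) 0 j|).
  by apply: measurableT_comp => //; exact: measurable_funB.
rewrite -[X in measurable X]setTI.
exact: (measurable_fun_ltr m1 (measurable_cst _)).
Qed.

Lemma continuous_row_dot (k : nat) (t : 'rV[R]_k) : continuous (fun x : 'rV[R]_k => (x *m t^T) 0 0).
Proof.
have -> : (fun x : 'rV[R]_k => (x *m t^T) 0 0) = fun x : 'rV[R]_k => \sum_j x 0 j * t 0 j.
  by apply/funext => x; rewrite mxE; apply: eq_bigr => j _; rewrite mxE.
elim: (index_enum _) => [|j r IH] x.
  rewrite (_ : (fun y : 'rV[R]_k => _) = fun=> 0); first exact: cst_continuous.
  by apply/funext => y; rewrite big_nil.
rewrite (_ : (fun y : 'rV[R]_k => _) =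
    fun y : 'rV[R]_k => y 0 j * t 0 j + \sum_(l <- r) y 0 l * t 0 l); last first.
  by apply/funext => y; rewrite big_cons.
exact: (cvgD (cvgM (@coord_continuous _ _ _ 0 j x) (cvg_cst (t 0 j))) (IH x)).
Qed.

Lemma continuous_cos_row (k : nat) (t : 'rV[R]_k) (c : R) :
  continuous (fun x : 'rV[R]_k => cos ((x *m t^T) 0 0 + c)).
Proof.
move=> x; apply: (@continuous_comp _ _ _ (fun x : 'rV[R]_k => (x *m t^T) 0 0 + c) (@cos R)); last exact: continuous_cos.
exact: (cvgD (@continuous_row_dot k t x) (cvg_cst c)).
Qed.

Lemma trig_continuous (k : nat) (p : 'rV[R]_k -> R) : trig p -> continuous p.
Proof.
elim=> {p} [xi c|p q _ cp _ cq|a p _ cp] x; first exact: continuous_cos_row.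
  exact: (cvgD (cp x) (cq x)).
exact: (cvgM (cvg_cst a) (cp x)).
Qed.

Lemma trig_bounded (k : nat) (p : 'rV[R]_k -> R) : trig p -> exists M, forall x, `|p x| <= M.
Proof.
elim=> {p} [xi c|p q _ [M pM] _ [M' qM]|a p _ [M pM]].
- by exists 1 => x; exact: cos_max.
- by exists (M + M') => x; rewrite (le_trans (ler_normD _ _))// lerD.
- by exists (`|a| * M) => x; rewrite normrM ler_wpM2l.
Qed.

End borel_measurability.

Section normal_law.
Context {R : realType}.
Local Notation mu := (@lebesgue_measure R).
Local Notation RM := (measurableTypeR R).

(** The Radon-Nikodym derivative of the normal law agrees almost everywhere with the density. *)
Lemma integral_normal_prob (s : R) (f : RM -> R) (M : R) : s != 0 -> measurable_fun setT f ->
  (forall x, `|f x| <= M) ->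
  \int[normal_prob 0 s]_x f x = \int[mu]_x (f x * normal_pdf 0 s x).
Proof.
move=> s0 mf fM; rewrite /Rintegral; congr fine.
have fi : (normal_prob 0 s).-integrable setT (EFin \o f) by exact: bounded_integrable fM.
rewrite -(Radon_Nikodym_change_of_variables (normal_prob_dominates 0 s))//=.
under [RHS]eq_integral do rewrite EFinM.
have mfE : measurable_fun setT (EFin \o f) by exact/measurable_EFinP.
apply: ae_eq_integral => //.
- apply: emeasurable_funM => //; apply: (measurable_int mu).
  by apply: Radon_Nikodym_integrable; exact: normal_prob_dominates.
- by apply: emeasurable_funM => //; apply/measurable_EFinP; exact: measurable_normal_pdf.
- apply: ae_eqe_mul2l => /=.
  rewrite Radon_NikodymE//=; first exact: normal_prob_dominates.
  move=> dom; case: cid => /= h [h1 h2 h3].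
  apply: integral_ae_eq => //=.
  + by apply/measurable_EFinP; exact: measurable_normal_pdf.
  + by move=> E _ mE; rewrite -h3.
Qed.

Lemma integral_cos_normal_prob (s u c : R) : s != 0 ->
  \int[normal_prob 0 s]_x cos (u * x + c) = cos c * expR (- (u ^+ 2 * s ^+ 2) / 2).
Proof.
move=> s0; rewrite -Rintegral_cos_normal_pdf//; apply: (@integral_normal_prob _ _ 1) => //.
  apply: continuous_measurable_fun => x.
  apply: (@continuous_comp _ _ _ (fun x => u * x + c) (@cos R)); last exact: continuous_cos.
  by apply: cvgD; [apply: cvgM; [exact: cvg_cst|exact: cvg_id]|exact: cvg_cst].
by move=> x; exact: cos_max.
Qed.

End normal_law.

(** * Construction of Gaussian vectors *)

Section gaussian_vector.
Context {R : realType} {k : nat}.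
Local Notation RM := (measurableTypeR R).
Local Notation V := (borelType 'rV[R]_k).

Lemma Rintegral_dirac (h : V -> R) (x : V) : measurable_fun setT h ->
  \int[dirac x]_y h y = h x.
Proof.
move=> mh; rewrite /Rintegral integral_dirac//; last exact/measurable_EFinP.
by rewrite diracT mul1e.
Qed.

(** The law of the sum of [Z_v v] with independent standard normal [Z_v], built by adding one vector
    at a time. *)
Lemma gaussian_exists (vs : seq 'rV[R]_k) : exists g : probability V R, forall (t : 'rV[R]_k) (c : R),
  \int[g]_x cos (((x : 'rV[R]_k) *m t^T) 0 0 + c) =
  cos c * expR (- (\sum_(v <- vs) (v *m t^T) 0 0 ^+ 2) / 2).
Proof.
have mcos (t : 'rV[R]_k) c : measurable_fun setT (fun x : V => cos (((x : 'rV[R]_k) *m t^T) 0 0 + c)).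
  exact: (borel_continuous_measurable (@continuous_cos_row _ _ t c)).
elim: vs => [|v vs [g IH]].
  exists (dirac (0 : V)) => t c.
  by rewrite Rintegral_dirac// mul0mx mxE add0r big_nil oppr0 mul0r expR0 mulr1.
pose N01 : probability RM R := normal_prob 0 1.
pose phi (z : RM * V) : V := (z.2 : 'rV[R]_k) + z.1 *: v.
have mphi : measurable_fun setT phi.
  apply: measurable_row => j.
  have -> : (fun w => (phi w : 'rV[R]_k) 0 j) = fun w => (w.2 : 'rV[R]_k) 0 j + w.1 * v 0 j.
    by apply/funext => w; rewrite /phi !mxE.
  apply: measurable_funD; last first.
    by apply: measurable_funM => //; exact: measurable_fst.
  apply: (@measurableT_comp _ _ _ _ _ _ (fun x : V => (x : 'rV[R]_k) 0 j)); last exact: measurable_snd.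
  apply: borel_continuous_measurable; exact: coord_continuous.
pose Phi : {mfun (RM * V)%type >-> V} := HB.pack phi (isMeasurableFun.Build _ _ _ _ phi mphi).
exists (distribution (N01 \x g)%E Phi) => t c.
pose a := (v *m t^T) 0 0.
pose h (x : V) : R := cos (((x : 'rV[R]_k) *m t^T) 0 0 + c).
have h1 x : `|h x| <= 1 by exact: cos_max.
have mh : measurable_fun setT h by exact: mcos.
have mhphi : measurable_fun setT (fun z => h (phi z)) by exact: measurableT_comp.
have ihphi : (N01 \x g)%E.-integrable setT (EFin \o (fun z => h (phi z))).
  by apply: (@bounded_integrable _ _ _ _ _ (1)).
have e1 : (\int[distribution (N01 \x g)%E Phi]_x (h x)%:E = \int[(N01 \x g)%E]_z (h (phi z))%:E)%E.
  rewrite integral_pushforward//; exact/measurable_EFinP.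
have e2 : (\int[(N01 \x g)%E]_z (h (phi z))%:E = \int[g]_x (\int[N01]_z (h (phi (z, x)))%:E))%E.
  by have /esym := integral21_prod_meas1 ihphi; apply.
have e3 x : (\int[N01]_z (h (phi (z, x)))%:E = (h x * expR (- a ^+ 2 / 2))%:E)%E.
  have mz : measurable_fun setT (fun z : RM => h (phi (z, x))).
    by apply: (measurableT_comp mhphi); exact: measurable_pair2.
  have iz : N01.-integrable setT (EFin \o (fun z : RM => h (phi (z, x)))).
    by apply: (@bounded_integrable _ _ _ _ _ (1)).
  have fz : (\int[N01]_z (h (phi (z, x)))%:E)%E \is a fin_num by apply: integrable_fin_num.
  rewrite -(fineK fz); congr (_%:E).
  have := @integral_cos_normal_prob R 1 a (((x : 'rV[R]_k) *m t^T) 0 0 + c) (oner_neq0 _).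
  rewrite expr1n mulr1 => <-; rewrite /Rintegral; congr fine.
  apply: eq_integral => z _; congr (_%:E); rewrite /h /phi mulmxDl -scalemxAl !mxE /= -/a; congr cos.
  by rewrite /a !mxE; ring.
rewrite /Rintegral e1 e2.
under eq_integral do rewrite e3.
have -> : (\int[g]_x (h x * expR (- a ^+ 2 / 2))%:E)%E = ((\int[g]_x h x) * expR (- a ^+ 2 / 2))%:E.
  rewrite -RintegralZr//; last exact: (@bounded_integrable _ _ _ _ _ (1)).
  rewrite /Rintegral fineK//; apply: integrable_fin_num => //.
  apply: (@bounded_integrable _ _ _ _ _ (expR (- a ^+ 2 / 2))).
    by apply: measurable_funM.
  by move=> x; rewrite normrM (ger0_norm (expR_ge0 _)) ler_piMl ?expR_ge0.
rewrite /= IH -mulrA -expRD big_cons -/a; congr (_ * expR _).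
by rewrite -mulrDl -opprD addrC.
Qed.

(** Elimination by Schur complements: removing the square of the row of a positive diagonal entry
    preserves positivity and lowers the number of nonzero diagonal entries. *)
Lemma psd_sum_squares (S : 'M[R]_k) : S^T = S ->
  (forall t : 'rV[R]_k, 0 <= (t *m S *m t^T) 0 0) ->
  exists vs : seq 'rV[R]_k, forall t : 'rV[R]_k,
    (t *m S *m t^T) 0 0 = \sum_(v <- vs) (v *m t^T) 0 0 ^+ 2.
Proof.
have [n] := ubnP #|[pred i | S i i != 0]|; elim: n S => // n IH S.
rewrite ltnS => Sn Ssym Spsd.
pose b i (t : 'rV[R]_k) := (row i S *m t^T) 0 0.
pose E i : 'rV[R]_k := delta_mx 0 i.
have qexp i (t : 'rV[R]_k) s : ((t + s *: E i) *m S *m (t + s *: E i)^T) 0 0 =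
    (t *m S *m t^T) 0 0 + 2 * s * b i t + s ^+ 2 * S i i.
  have e1 : (t *m S *m (E i)^T) 0 0 = b i t.
    transitivity ((t *m S *m (E i)^T)^T 0 0); first by rewrite [RHS]mxE.
    by rewrite !trmx_mul trmxK Ssym mulmxA /E -rowE.
  have e2 : (E i *m S *m t^T) 0 0 = b i t by rewrite /E -rowE.
  have e3 : (E i *m S *m (E i)^T) 0 0 = S i i.
    by rewrite /E -rowE trmx_delta -colE !mxE.
  have aD (A B : 'M[R]_1) : (A + B) 0 0 = A 0 0 + B 0 0 by rewrite mxE.
  have aZ c (A : 'M[R]_1) : (c *: A) 0 0 = c * A 0 0 by rewrite mxE.
  rewrite linearD/= linearZ/= !mulmxDr !mulmxDl -!scalemxAr -!scalemxAl.
  rewrite !(aD, aZ) e1 e2 e3.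
  ring.
have [/forallP S0|] := boolP [forall i, S i i == 0].
  exists [::] => t; rewrite big_nil.
  (* With a zero diagonal the form is affine along [E i]; if its slope were nonzero, the chosen
     multiple would give the value -1. *)
  have b0 i : b i t = 0.
    apply/eqP; apply: contraT => bn0.
    have := Spsd (t + (- ((t *m S *m t^T) 0 0 + 1) / (2 * b i t)) *: E i).
    rewrite qexp (eqP (S0 i)) mulr0 addr0.
    have -> : 2 * (- ((t *m S *m t^T) 0 0 + 1) / (2 * b i t)) * b i t = - ((t *m S *m t^T) 0 0 + 1).
      by field.
    lra.
  rewrite -mulmxA mxE big1// => i _.
  have -> : (S *m t^T) i 0 = b i t by rewrite /b -row_mul [RHS]mxE.
  by rewrite b0 mulr0.
rewrite negb_forall => /existsP[i Si].
have Si0 : 0 < S i i.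
  rewrite lt_neqAle eq_sym Si/=; have := Spsd (0 + 1 *: E i).
  rewrite qexp mul0mx mul0mx mxE add0r /b trmx0 mulmx0 mxE mulr0 add0r expr1n mul1r//.
pose S' := S - (S i i)^-1 *: ((row i S)^T *m row i S).
have qS' (t : 'rV[R]_k) : (t *m S' *m t^T) 0 0 = (t *m S *m t^T) 0 0 - b i t ^+ 2 / S i i.
  have aB (A B : 'M[R]_1) : (A - B) 0 0 = A 0 0 - B 0 0 by rewrite mxE [in LHS]mxE.
  have aZ c (A : 'M[R]_1) : (c *: A) 0 0 = c * A 0 0 by rewrite mxE.
  have aM (A B : 'M[R]_1) : (A *m B) 0 0 = A 0 0 * B 0 0 by rewrite mxE big_ord1.
  rewrite /S' mulmxBr mulmxBl aB -scalemxAr -scalemxAl aZ mulrC; congr (_ - _ / _).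
  rewrite (mulmxA t) -(mulmxA (t *m _)) aM -/(b i t) expr2; congr (_ * _).
  transitivity ((t *m (row i S)^T)^T 0 0); first by rewrite [RHS]mxE.
  by rewrite trmx_mul trmxK.
have S'psd (t : 'rV[R]_k) : 0 <= (t *m S' *m t^T) 0 0.
  (* The Schur complement is the minimum of the form along the direction [E i], attained at this
     multiple. *)
  rewrite qS'; have := Spsd (t + (- b i t / S i i) *: E i); rewrite qexp.
  have -> : 2 * (- b i t / S i i) * b i t = - 2 * (b i t ^+ 2 / S i i) by ring.
  have -> : (- b i t / S i i) ^+ 2 * S i i = b i t ^+ 2 / S i i by field; rewrite gt_eqF.
  lra.
have S'sym : S'^T = S'.
  by rewrite /S' linearB/= linearZ/= Ssym trmx_mul trmxK.
have S'E j : S' j j = S j j - S i j ^+ 2 / S i i.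
  by rewrite !mxE big_ord1 !mxE expr2 mulrC.
have [|vs vsP] := IH S' _ S'sym S'psd.
  apply: leq_trans Sn; apply: proper_card; apply/properP; split.
    apply/fintype.subsetP => j; rewrite !inE; apply: contraNN => /eqP Sj.
    have := S'psd (E j); rewrite /E -rowE trmx_delta -colE !mxE big_ord1 !mxE Sj.
    have h : 0 <= S i j ^+ 2 / S i i by rewrite divr_ge0 ?sqr_ge0 ?ltW.
    rewrite expr2 mulrC in h; rewrite sub0r oppr_ge0 => h'.
    by rewrite oppr_eq0 eq_le h' h.
  exists i; rewrite !inE//= S'E expr2 mulfK ?subrr ?eqxx//.
exists ((Num.sqrt (S i i))^-1 *: row i S :: vs) => t.
have aZ c (A : 'M[R]_1) : (c *: A) 0 0 = c * A 0 0 by rewrite mxE.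
rewrite big_cons -vsP qS' -scalemxAl aZ -/(b i t) exprMn exprVn sqr_sqrtr ?ltW//.
by rewrite mulrC addrC subrK.
Qed.

End gaussian_vector.

(** * Laws on the line are determined by their cosine transforms *)

Section law_uniqueness.
Context {R : realType}.
Local Notation RM := (measurableTypeR R).

Lemma trig_row_integral (m1 m2 : probability RM R) (p : 'rV[R]_1 -> R) :
  (forall u c, \int[m1]_x cos (u * x + c) = \int[m2]_x cos (u * x + c)) -> trig p ->
  \int[m1]_x p (const_mx x) = \int[m2]_x p (const_mx x).
Proof.
move=> mE tp.
have cst_cont : continuous (const_mx : R -> 'rV[R]_1).
  move=> x U /nbhs_ballP[r /= r0 rU]; apply/nbhs_ballP; exists r => // y xy.
  by apply: rU; split=> // i j; rewrite !mxE.
have mp (q : 'rV[R]_1 -> R) : trig q -> measurable_fun setT (fun x : RM => q (const_mx x)).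
  move=> tq; apply: continuous_measurable_fun => x.
  by apply: (@continuous_comp _ _ _ (const_mx : R -> 'rV[R]_1) q); [exact: cst_cont|exact: trig_continuous].
have ip (m : probability RM R) (q : 'rV[R]_1 -> R) : trig q -> m.-integrable setT (EFin \o (fun x : RM => q (const_mx x))).
  by move=> tq; have [M qM] := trig_bounded tq; apply: (bounded_integrable m (mp q tq) (M := M)) => x; exact: qM.
elim: tp => {p} [xi c|p q tp IH tq IH'|a p tp IH].
- have e x : cos (((const_mx x : 'rV[R]_1) *m xi^T) 0 0 + c) = cos (xi 0 0 * x + c).
    by rewrite !mxE big_ord1 !mxE mulrC.
  by under eq_Rintegral do rewrite e; under [RHS]eq_Rintegral do rewrite e.
- by rewrite !RintegralD ?IH ?IH'//; exact: ip.
- by rewrite !RintegralZl ?IH//; exact: ip.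
Qed.

Lemma continuous_integral_eq (m1 m2 : probability RM R) (h : R -> R) (M : R) :
  (forall u c, \int[m1]_x cos (u * x + c) = \int[m2]_x cos (u * x + c)) ->
  continuous h -> (forall x, `|h x| <= M) -> \int[m1]_x h x = \int[m2]_x h x.
Proof.
move=> mE ch hM; have M0 : 0 <= M := le_trans (normr_ge0 _) (hM 0).
apply/eqP; rewrite -subr_eq0 -normr_le0; apply/ler_addgt0Pr => e e0; rewrite add0r.
pose e1 := e / (2 * (1 + 2 * M)).
have e10 : 0 < e1 by rewrite divr_gt0// mulr_gt0// ltr_wpDr// mulr_ge0.
have mabs : measurable_fun setT (fun x : RM => `|x|) by exact: measurableT_comp.
have [L1 L10 H1] := probability_tail m1 mabs e10.
have [L2 L20 H2] := probability_tail m2 mabs e10.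
pose L := Num.max L1 L2.
have L0 : 0 < L by rewrite lt_max L10.
pose A : set RM := [set x | `|x| <= L].
have mA : measurable A by rewrite -[A]setTI; apply: (measurable_fun_ler mabs (measurable_cst _)).
have mA' Li : measurable [set x : RM | Li < `|x|].
  by rewrite -[X in measurable X]setTI; apply: (measurable_fun_ltr (measurable_cst _) mabs).
have tail (m : probability RM R) Li : Li <= L -> fine (m [set x | Li < `|x|]) <= e1 -> fine (m (~` A)) <= e1.
  move=> LiL; apply: le_trans; apply: fine_le; rewrite ?fin_num_measure//; first exact: measurableC.
  apply: le_measure; rewrite ?inE//; first exact: measurableC.
  by move=> x /= /negP; rewrite -ltNge; exact: le_lt_trans.
have chr : continuous (fun x : 'rV[R]_1 => h (x 0 0)).
  by move=> x; apply: (@continuous_comp _ _ _ (fun x : 'rV[R]_1 => x 0 0) h); [exact: coord_continuous|exact: ch].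
have [p [tp pM ph]] := trig_approx chr (fun x => hM (x 0 0)) L0 e10.
have mh : measurable_fun setT (h : RM -> R) by exact: continuous_measurable_fun.
have mp : measurable_fun setT (fun x : RM => p (const_mx x)).
  apply: continuous_measurable_fun => x.
  apply: (@continuous_comp _ _ _ (const_mx : R -> 'rV[R]_1) p); last exact: trig_continuous.
  move=> U /nbhs_ballP[r /= r0 rU]; apply/nbhs_ballP; exists r => // y xy.
  by apply: rU; split=> // i j; rewrite !mxE.
have hp x : A x -> `|h x - p (const_mx x)| <= e1.
  move=> Ax; have := ph (const_mx x); rewrite mxE; apply => j; rewrite mxE//.
have d1 := Rintegral_dist_le m1 mA mh mp (ltW e10) hM (fun x => pM (const_mx x)) hp.
have d2 := Rintegral_dist_le m2 mA mh mp (ltW e10) hM (fun x => pM (const_mx x)) hp.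
have t1 : fine (m1 (~` A)) <= e1 by apply: tail H1; rewrite le_max lexx.
have t2 : fine (m2 (~` A)) <= e1 by apply: tail H2; rewrite le_max lexx orbT.
have ee : e = 2 * (e1 + 2 * M * e1).
  rewrite /e1; field; rewrite gt_eqF// ltr_wpDr// mulr_ge0//.
have b1 : 2 * M * fine (m1 (~` A)) <= 2 * M * e1 by rewrite ler_wpM2l// mulr_ge0.
have b2 : 2 * M * fine (m2 (~` A)) <= 2 * M * e1 by rewrite ler_wpM2l// mulr_ge0.
have pE := trig_row_integral mE tp.
rewrite pE in d1.
have := ler_distD (\int[m2]_x p (const_mx x)) (\int[m1]_x h x) (\int[m2]_x h x).
rewrite [X in _ <= _ + X]distrC; lra.
Qed.

(** Bounded continuous ramps converge to indicators of rays, and rays are stable under intersection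
    and generate the Borel sets. *)
Lemma law_unique (m1 m2 : probability RM R) :
  (forall u c, \int[m1]_x cos (u * x + c) = \int[m2]_x cos (u * x + c)) ->
  forall B : set RM, measurable B -> m1 B = m2 B.
Proof.
move=> mE.
have ray (a : R) : m1 `]a, +oo[%classic = m2 `]a, +oo[%classic.
  pose h n (x : R) : R := Num.min 1 (n%:R * Num.max 0 (x - a)).
  have ch n : continuous (h n).
    move=> x; rewrite /h.
    apply: (@continuous_min R R (fun=> 1) (fun x => n%:R * Num.max 0 (x - a)) x); first exact: cvg_cst.
    apply: cvgM; first exact: cvg_cst.
    apply: (@continuous_max R R (fun=> 0) (fun x => x - a) x); first exact: cvg_cst.
    by apply: cvgB; [exact: cvg_id|exact: cvg_cst].
  have h01 n x : 0 <= h n x <= 1.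
    by rewrite /h le_min ler01 ge_min lexx/= mulr_ge0// le_max lexx.
  have h1 n x : `|h n x| <= 1 by have /andP[h0 hh] := h01 n x; rewrite ger0_norm.
  have mh n : measurable_fun setT (h n : RM -> R) by exact: continuous_measurable_fun.
  have mray : measurable (`]a, +oo[%classic : set RM) by exact: measurable_itv.
  have cv (m : probability RM R) : (\int[m]_x (h n x)%:E)%E @[n --> \oo] --> m `]a, +oo[%classic.
    have -> : m `]a, +oo[%classic = (\int[m]_x (\1_(`]a, +oo[%classic : set RM) x)%:E)%E.
      by rewrite integral_indic// setIT.
    have [|||||_ _ //] := @dominated_convergence _ _ _ m setT measurableT (fun n x => (h n x)%:E)
       (fun x => (\1_(`]a, +oo[%classic : set RM) x)%:E) (cst 1%:E).
    - by move=> n; exact/measurable_EFinP.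
    - by apply/measurable_EFinP; exact: measurable_indic.
    - apply: aeW => x _; apply: cvg_near_cst; near=> n; congr (_%:E).
      rewrite /h indicE; have [xa|xa] := leP x a.
        rewrite memNset; last by rewrite /= in_itv/= andbT ltNge xa.
        rewrite (max_idPl _) ?subr_le0// mulr0; exact/min_idPr.
      rewrite mem_set; last by rewrite /= in_itv/= andbT.
      have xa0 : 0 < x - a by rewrite subr_gt0.
      rewrite (max_idPr (ltW xa0)); apply/min_idPl; rewrite -ler_pdivrMr// mul1r.
      near: n; exists (Num.truncn (x - a)^-1).+1 => // n /= hn.
      by apply: ltW; apply: (lt_le_trans (truncnS_gt _)); rewrite ler_nat.
    - apply: (@bounded_integrable _ _ _ m (cst 1) 1) => //.
      by move=> x; rewrite /= normr1.
    - by apply: aeW => x n _; rewrite lee_fin h1.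
  have hE n : (\int[m1]_x (h n x)%:E = \int[m2]_x (h n x)%:E)%E.
    have f1 : (\int[m1]_x (h n x)%:E)%E \is a fin_num.
      by apply: integrable_fin_num => //; exact: (bounded_integrable m1 (mh n) (M := 1)).
    have f2 : (\int[m2]_x (h n x)%:E)%E \is a fin_num.
      by apply: integrable_fin_num => //; exact: (bounded_integrable m2 (mh n) (M := 1)).
    by rewrite -(fineK f1) -(fineK f2); congr (_%:E); exact: continuous_integral_eq mE (ch n) (h1 n).
  have c1 := cv m1; have c2 := cv m2.
  rewrite (funext hE) in c1.
  exact: (cvg_unique _ c1 c2).
move=> B mB.
pose G : set (set RM) := [set A | exists x, A = `]x, +oo[%classic].
apply: (@g_sigma_algebra_measure_unique_trace _ R RM G setT measurableT _ _ m1 m2) => //.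
- by move=> _ [[x ->] _]; exact: measurable_itv.
- move=> _ _ [[x ->] _] [[y ->] _]; split=> //; exists (Num.max x y).
  apply/seteqP; split=> z /=; rewrite !in_itv/= !andbT gt_max.
    by move=> [-> ->].
  by move=> /andP[].
- exact: etrans (probability_setT m1) (esym (probability_setT m2)).
- by move=> _ [[x ->] _]; exact: ray.
- by apply: le_lt_trans (probability_le1 m1 measurableT) _; rewrite ltry.
- have -> : [set X | G X /\ X `<=` setT] = G by apply/seteqP; split=> [X []//|X GX]; split.
  by move: mB; rewrite [measurable]RGenOInfty.measurableE.
Unshelve. all: by end_near.
Qed.

End law_uniqueness.

Section gaussian_law.
Context {R : realType} {k : nat}.
Local Notation RM := (measurableTypeR R).
Local Notation V := (borelType 'rV[R]_k).

(** The laws of linear forms are identified by their cosine transforms; zero variance is the point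
    mass of [normal1]. *)
Lemma gaussian_law (S : 'M[R]_k) : S^T = S ->
  (forall t : 'rV[R]_k, 0 <= (t *m S *m t^T) 0 0) ->
  exists g : probability V R, is_gaussian 0 S g /\
    forall (t : 'rV[R]_k) (c : R), \int[g]_x cos (((x : 'rV[R]_k) *m t^T) 0 0 + c) =
      cos c * expR (- (t *m S *m t^T) 0 0 / 2).
Proof.
move=> Ssym Spsd; have [vs vsP] := psd_sum_squares Ssym Spsd.
have [g gP] := gaussian_exists vs; exists g; split; last by move=> t c; rewrite gP vsP.
split=> // t; split=> // B mB.
set v := (t *m S *m t^T) 0 0; rewrite mul0mx mxE.
pose phi (x : V) : RM := ((x : 'rV[R]_k) *m t^T) 0 0.
have mphi : measurable_fun setT phi := borel_continuous_measurable (@continuous_row_dot _ _ t).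
pose Phi : {mfun V >-> RM} := HB.pack phi (isMeasurableFun.Build _ _ _ _ phi mphi).
pose m1 : probability RM R := distribution g Phi.
have m1E u c : \int[m1]_x cos (u * x + c) = cos c * expR (- (u ^+ 2 * v) / 2).
  have mc : measurable_fun setT (fun x : RM => cos (u * x + c)).
    apply: continuous_measurable_fun => x.
    apply: (@continuous_comp _ _ _ (fun x => u * x + c) (@cos R)); last exact: continuous_cos.
    by apply: cvgD; [apply: cvgM; [exact: cvg_cst|exact: cvg_id]|exact: cvg_cst].
  have e1 : \int[m1]_x cos (u * x + c) = \int[g]_x cos (((x : 'rV[R]_k) *m (u *: t)^T) 0 0 + c).
    rewrite /Rintegral integral_pushforward//.
    - congr fine; apply: eq_integral => x _ /=; congr ((cos (_ + _))%:E).
      by rewrite linearZ/= -scalemxAr [RHS]mxE.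
    - exact/measurable_EFinP.
    - apply: (@bounded_integrable _ _ _ g (fun x => cos (u * phi x + c)) 1) => [|x]; last exact: cos_max.
      exact: (measurableT_comp mc mphi).
  have aZ a (D : 'M[R]_1) : (a *: D) 0 0 = a * D 0 0 by rewrite mxE.
  have vE : ((u *: t) *m S *m (u *: t)^T) 0 0 = u ^+ 2 * v.
    by rewrite linearZ/= -scalemxAr -!scalemxAl !aZ -/v mulrA -expr2.
  by rewrite e1 gP -vsP vE.
rewrite /normal1; case: eqVneq => [v0|v0].
  pose m2 : probability RM R := dirac (0 : RM).
  apply: (@law_unique R m1 m2) => // u c.
  rewrite m1E v0 mulr0 oppr0 mul0r expR0 mulr1 /Rintegral integral_dirac//.
    by rewrite diracT mul1e/= mulr0 add0r.
  apply/measurable_EFinP; apply: continuous_measurable_fun => x.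
  apply: (@continuous_comp _ _ _ (fun x => u * x + c) (@cos R)); last exact: continuous_cos.
  by apply: cvgD; [apply: cvgM; [exact: cvg_cst|exact: cvg_id]|exact: cvg_cst].
have s0 : Num.sqrt v != 0 by rewrite sqrtr_eq0 -ltNge lt_neqAle eq_sym v0 Spsd.
pose m2 : probability RM R := normal_prob 0 (Num.sqrt v).
apply: (@law_unique R m1 m2) => // u c.
by rewrite m1E integral_cos_normal_prob// sqr_sqrtr ?Spsd.
Qed.

End gaussian_law.

(* A random probability with finitely many values, each finitely supported:
   for the outcome b of weight ms b, the point X s has mass w b s. *)
Section weak_criterion.
Context {R : realType} {k : nat}.
Local Notation V := (borelType 'rV[R]_k).
Variables (B S : nat -> finType) (ms : forall N, B N -> R) (w : forall N, B N -> S N -> R).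
Variables (X : forall N, S N -> 'rV[R]_k) (g : probability V R).
Hypothesis ms0 : forall N b, 0 <= @ms N b.
Hypothesis w0 : forall N b s, 0 <= @w N b s.
Hypothesis w1 : forall N b, \sum_s @w N b s = 1.
Arguments ms : clear implicits.
Arguments w : clear implicits.
Arguments X : clear implicits.

(** Mass tending to zero, for events on a space that changes with [N]. *)
Definition negligibly (Q : forall N, B N -> bool) := forall eta : R, 0 < eta ->
  \forall N \near \oo, \sum_(b | Q N b) ms N b <= eta.

Definition point_mean N b (h : 'rV[R]_k -> R) : R := \sum_s w N b s * h (X N s).

Lemma negligibly_sub (Q Q' : forall N, B N -> bool) : (forall N b, Q N b -> Q' N b) ->
  negligibly Q' -> negligibly Q.
Proof.
move=> QQ' nQ' eta eta0; apply: filterS (nQ' eta eta0) => N; apply: le_trans.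
rewrite big_mkcond [leRHS]big_mkcond; apply: ler_sum => b _.
by case: ifP => [/QQ' ->//|_]; case: ifP.
Qed.

Lemma sum_or_le N (Q1 Q2 : pred (B N)) :
  \sum_(b | Q1 b || Q2 b) ms N b <= \sum_(b | Q1 b) ms N b + \sum_(b | Q2 b) ms N b.
Proof.
rewrite big_mkcond (big_mkcond Q1) (big_mkcond Q2) -big_split; apply: ler_sum => b _/=.
by case: (Q1 b); case: (Q2 b); rewrite /= ?addr0 ?add0r// lerDl.
Qed.

Lemma negligibly_or (Q1 Q2 : forall N, B N -> bool) : negligibly Q1 -> negligibly Q2 ->
  negligibly (fun N b => Q1 N b || Q2 N b).
Proof.
move=> n1 n2 eta eta0; have e2 : 0 < eta / 2 by rewrite divr_gt0.
near=> N; apply: (le_trans (sum_or_le _ _)); rewrite [leRHS]splitr; apply: lerD.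
  by near: N; exact: n1.
by near: N; exact: n2.
Unshelve. all: by end_near.
Qed.

Hypothesis cosP : forall (t : 'rV[R]_k) (c e : R), 0 < e ->
  negligibly (fun N b => e <= `|point_mean b (fun x => cos ((x *m t^T) 0 0 + c)) -
    \int[g]_x cos (((x : 'rV[R]_k) *m t^T) 0 0 + c)|).
Hypothesis tightP : forall de eta : R, 0 < de -> 0 < eta -> exists2 L, 0 < L &
  \forall N \near \oo,
  \sum_(b | de <= \sum_(s | [exists j, L < `|X N s 0 j|]) w N b s) ms N b <= eta.

Lemma trig_mean_cvg (p : 'rV[R]_k -> R) (e : R) : trig p -> 0 < e ->
  negligibly (fun N b => e <= `|point_mean b p - \int[g]_x p x|).
Proof.
have ip (q : 'rV[R]_k -> R) : trig q -> g.-integrable setT (EFin \o (q : V -> R)).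
  move=> tq; have [M qM] := trig_bounded tq.
  by apply: (@bounded_integrable _ _ _ g (q : V -> R) M) => //; exact: (borel_continuous_measurable (trig_continuous tq)).
move=> tp; elim: tp e => {p} [xi c|p q tp IH tq IH'|a p tp IH] e e0.
- exact: cosP.
- have e2 : 0 < e / 2 by rewrite divr_gt0.
  apply: negligibly_sub (negligibly_or (IH _ e2) (IH' _ e2)) => N b; apply: contraLR.
  rewrite negb_or -!ltNge => /andP[h1 h2].
  rewrite RintegralD//; [|exact: ip|exact: ip].
  have -> : point_mean b (fun x => p x + q x) = point_mean b p + point_mean b q.
    by rewrite /point_mean -big_split; apply: eq_bigr => s _; rewrite mulrDr.
  rewrite opprD addrACA (le_lt_trans (ler_normD _ _))// [ltRHS]splitr; exact: ltrD.
- have a1 : 0 < `|a| + 1 by rewrite ltr_wpDl.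
  have ea : 0 < e / (`|a| + 1) by rewrite divr_gt0.
  apply: negligibly_sub (IH _ ea) => N b; rewrite RintegralZl//; last exact: ip.
  have -> : point_mean b (fun x => a * p x) = a * point_mean b p.
    by rewrite /point_mean mulr_sumr; apply: eq_bigr => s _; rewrite mulrCA.
  rewrite -mulrBr normrM ler_pdivrMr// mulrC => /le_trans; apply.
  by rewrite ler_wpM2l// lerDl.
Qed.

Lemma point_mean_dist N b (h p : 'rV[R]_k -> R) (M e L : R) : 0 <= e ->
  (forall x, `|h x| <= M) -> (forall x, `|p x| <= M) ->
  (forall x : 'rV[R]_k, (forall j, `|x 0 j| <= L) -> `|h x - p x| <= e) ->
  `|@point_mean N b h - point_mean b p| <=
    e + 2 * M * \sum_(s | [exists j, L < `|X N s 0 j|]) w N b s.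
Proof.
move=> e0 hM pM hp; rewrite /point_mean -sumrB; apply: (le_trans (ler_norm_sum _ _ _)).
have {1}-> : e = \sum_s e * w N b s by rewrite -mulr_sumr w1 mulr1.
rewrite mulr_sumr [X in _ + X]big_mkcond -big_split.
apply: ler_sum => s _ /=; rewrite -mulrBr normrM (ger0_norm (w0 _ _)).
case: ifPn => [_|].
  rewrite -[leLHS]add0r; apply: lerD; first by rewrite mulr_ge0.
  rewrite mulrC ler_wpM2r// (le_trans (ler_normB _ _))// mulr2n mulrDl mul1r lerD//.
rewrite negb_exists => /forallP hL; rewrite addr0 mulrC ler_wpM2r//.
by apply: hp => j; rewrite leNgt hL.
Qed.

(** Up to [2 * M] times the mass outside a cube, [h] is replaced by a trigonometric polynomial with
    the same bound; that mass is controlled by [tightP] for the random laws and by a tail bound for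
    [g]. *)
Lemma bounded_continuous_mean_cvg (h : 'rV[R]_k -> R) (M e : R) : continuous h ->
  (forall x, `|h x| <= M) -> 0 < e ->
  negligibly (fun N b => e <= `|point_mean b h - \int[g]_x h x|).
Proof.
move=> ch hM e0 eta eta0; have M0 : 0 <= M := le_trans (normr_ge0 _) (hM 0).
(* So that [e = 8 (de + 2 M de)]: each of the two replacements costs an eighth of [e], and the
   trigonometric means differ by less than a half. *)
pose de := e / (8 * (1 + 2 * M)).
have de0 : 0 < de by rewrite divr_gt0// mulr_gt0// ltr_wpDr// mulr_ge0.
have e2 : 0 < eta / 2 by rewrite divr_gt0.
have [L1 L10 H1] := tightP de0 e2.
pose nx (x : V) : R := \sum_j `|(x : 'rV[R]_k) 0 j|.
have mcoord j : measurable_fun setT (fun x : V => `|(x : 'rV[R]_k) 0 j|).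
  by apply: measurableT_comp => //; apply: borel_continuous_measurable; exact: coord_continuous.
have mnx : measurable_fun setT nx by exact: measurable_sum.
have [L2 L20 H2] := probability_tail g mnx de0.
pose L := Num.max L1 L2; have L0 : 0 < L by rewrite lt_max L10.
have [p [tp pM hp]] := trig_approx ch hM L0 de0.
pose A : set V := [set x | forall j, `|(x : 'rV[R]_k) 0 j| <= L].
have mA : measurable A.
  have -> : A = \bigcap_(j in [set: 'I_k]) [set x : V | `|(x : 'rV[R]_k) 0 j| <= L].
    by apply/seteqP; split=> [x Ax j _|x Ax j]; [exact: Ax|exact: (Ax j I)].
  apply: fin_bigcap_measurable => [|j _]; first exact: finite_finset.
  by rewrite -[X in measurable X]setTI; exact: (measurable_fun_ler (mcoord j) (measurable_cst _)).
have mh : measurable_fun setT (h : V -> R) by exact: borel_continuous_measurable.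
have mp : measurable_fun setT (p : V -> R) by exact: (borel_continuous_measurable (trig_continuous tp)).
have dg := Rintegral_dist_le g mA mh mp (ltW de0) hM pM hp.
have tg : fine (g (~` A)) <= de.
  apply: le_trans H2; apply: fine_le; rewrite ?fin_num_measure//; first exact: measurableC.
    by rewrite -[X in measurable X]setTI; apply: (measurable_fun_ltr (measurable_cst _) mnx).
  apply: le_measure; rewrite ?inE//; first exact: measurableC.
    by rewrite -[X in measurable X]setTI; apply: (measurable_fun_ltr (measurable_cst _) mnx).
  move=> x /= /existsNP[j /negP]; rewrite -ltNge => xj.
  apply: (@le_lt_trans _ _ L); first by rewrite le_max lexx orbT.
  by apply: (lt_le_trans xj); rewrite /nx (bigD1 j)//= lerDl sumr_ge0.
have e4 : 0 < e / 2 by rewrite divr_gt0.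
have Hp := trig_mean_cvg tp e4.
near=> N.
have tN : \sum_(b | de <= \sum_(s | [exists j, L1 < `|X N s 0 j|]) w N b s) ms N b <= eta / 2 by near: N.
have pN : \sum_(b | e / 2 <= `|point_mean b p - \int[g]_x p x|) ms N b <= eta / 2 by near: N; exact: Hp.
rewrite [leRHS]splitr; apply: le_trans (lerD tN pN); apply: le_trans (sum_or_le _ _).
rewrite big_mkcond [leRHS]big_mkcond; apply: ler_sum => b _.
case: ifPn => [eb|_]; last by case: ifP.
suff -> : (de <= \sum_(s | [exists j, L1 < `|X N s 0 j|]) w N b s) ||
   (e / 2 <= `|point_mean b p - \int[g]_x p x|) by [].
apply: contraLR eb; rewrite negb_or -!ltNge => /andP[t1 t2].
have dm := point_mean_dist b (ltW de0) hM pM hp.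
have t3 : \sum_(s | [exists j, L < `|X N s 0 j|]) w N b s <= de.
  apply: le_trans (ltW t1); rewrite big_mkcond [leRHS]big_mkcond; apply: ler_sum => s _.
  case: ifPn => [/existsP[j sj]|_]; last by case: ifP.
  suff -> : [exists j, L1 < `|X N s 0 j|] by [].
  by apply/existsP; exists j; apply: le_lt_trans sj; rewrite le_max lexx.
have ee : e = 8 * (de + 2 * M * de).
  by rewrite /de; field; rewrite gt_eqF// ltr_wpDr// mulr_ge0.
have b1 : 2 * M * fine (g (~` A)) <= 2 * M * de by rewrite ler_wpM2l// mulr_ge0.
have b2 : 2 * M * \sum_(s | [exists j, L < `|X N s 0 j|]) w N b s <= 2 * M * de by rewrite ler_wpM2l// mulr_ge0.
have d1 := ler_distD (point_mean b p) (point_mean b h) (\int[g]_x h x).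
have d2 := ler_distD (\int[g]_x p x) (point_mean b p) (\int[g]_x h x).
rewrite [X in _ <= _ + X]distrC in d2.
have K0 : 0 <= 2 * M * de := mulr_ge0 (mulr_ge0 (ler0n _ 2) M0) (ltW de0).
lra.
Unshelve. all: by end_near.
Qed.

End weak_criterion.

(** * The Gibbs measure of a random graph *)

Section edge_tanh.
Context {R : realType}.

Definition tnh (y : R) := (expR y - expR (- y)) / (expR y + expR (- y)).

Lemma edge_factor (y c : R) : c = 1 \/ c = -1 -> expR (y * c) = ch y * (1 + tnh y * c).
Proof.
have h : expR y + expR (- y) != 0 by rewrite gt_eqF// addr_gt0// expR_gt0.
by rewrite /tnh /ch; case=> ->; rewrite ?mulr1 ?mulrN1; field.
Qed.

Lemma ch_gt0 (y : R) : 0 < ch y.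
Proof. by rewrite /ch divr_gt0// addr_gt0// expR_gt0. Qed.

Lemma tnh_ge0 (y : R) : 0 <= y -> 0 <= tnh y.
Proof.
move=> y0; apply: divr_ge0; last by rewrite addr_ge0 ?expR_ge0.
by rewrite subr_ge0 ler_expR; lra.
Qed.

(** After multiplication by [exp y] or [exp (- y)] only [exp (2 y)] or [exp (- 2 y)] remains, to
    which [1 + x <= exp x] applies. *)
Lemma tnh_dist (y : R) : 0 <= y <= 2^-1 -> `|tnh y - y| <= 2 * y ^+ 2.
Proof.
move=> /andP[y0 y1].
have E0 : 0 < expR y := expR_gt0 y.
have F0 : 0 < expR (- y) := expR_gt0 (- y).
have EF : expR y * expR (- y) = 1 := expRxMexpNx_1 y.
have E2 : 1 + 2 * y <= expR y ^+ 2.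
  by rewrite -expRM_natl; exact: expR_ge1Dx.
have F2 : 1 - 2 * y <= expR (- y) ^+ 2.
  by rewrite -expRM_natl mulrN; exact: expR_ge1Dx.
rewrite /tnh; set E := expR y in E0 EF E2 *; set F := expR (- y) in F0 EF F2 *.
have y20 := sqr_ge0 y.
have y30 : 0 <= y ^+ 3 by rewrite exprn_ge0.
rewrite ler_distl; apply/andP; split.
  rewrite ler_pdivlMr ?addr_gt0// -(ler_pM2l E0).
  have -> : E * (E - F) = E ^+ 2 - 1 by rewrite -EF; ring.
  have -> : E * ((y - 2 * y ^+ 2) * (E + F)) = (y - 2 * y ^+ 2) * (E ^+ 2 + 1) by rewrite -EF; ring.
  have h : 0 <= 1 - y + 2 * y ^+ 2 by lra.
  have := ler_wpM2l h E2.
  nra.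
rewrite ler_pdivrMr ?addr_gt0// -(ler_pM2l F0).
have -> : F * (E - F) = 1 - F ^+ 2 by rewrite -EF; ring.
have -> : F * ((y + 2 * y ^+ 2) * (E + F)) = (y + 2 * y ^+ 2) * (1 + F ^+ 2) by rewrite -EF; ring.
have h : 0 <= 1 + y + 2 * y ^+ 2 by lra.
have := ler_wpM2l h F2.
nra.
Qed.

Lemma tnh_le (y : R) : 0 <= y <= 2^-1 -> tnh y <= 2 * y.
Proof.
move=> hy; have := tnh_dist hy; move: hy => /andP[y0 y1]; rewrite ler_distl => /andP[_].
move/le_trans; apply; nra.
Qed.

End edge_tanh.

Section graph_encoding.
Context {R : realType} {N : nat}.
Local Notation I := (@pair_le N).

Lemma opair_subproof (i j : 'I_N) :
  ((if (i <= j)%N then (i, j) else (j, i)).1 <= (if (i <= j)%N then (i, j) else (j, i)).2)%N.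
Proof. by case: ifPn => //=; rewrite -ltnNge => /ltnW. Qed.

Definition opair (i j : 'I_N) : I := 
  exist (fun p : 'I_N * 'I_N => (p.1 <= p.2)%N) _ (opair_subproof i j).

Lemma opairC i j : opair i j = opair j i.
Proof.
apply: val_inj => /=; case: (ltngtP i j) => //= /val_inj -> //.
Qed.

Lemma opair_val (p : I) : opair (val p).1 (val p).2 = p.
Proof. by apply: val_inj; case: p => -[i j] /= ij; rewrite ij. Qed.

Definition graph_mx (b : {ffun I -> bool}) : 'M[bool]_N := \matrix_(i, j) b (opair i j).

Definition off_diag (M : 'M[R]_N) : 'M[R]_N := \matrix_(i, j) if i == j then 0 else M i j.

Definition edge_tanh (y : R) (p : I) : R := if (val p).1 == (val p).2 then 0 else tnh y.

(** The part of the Gibbs weight that does not see the spins: a loop contributes [exp (y / 2)], as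
    spins square to 1, and an edge that is present contributes [ch y]. It cancels in Gibbs
    averages. *)
Definition gibbs_const (y : R) (b : {ffun I -> bool}) : R :=
  expR (y / 2 * \sum_i (b (opair i i))%:R) *
  \prod_(p : I) (if ((val p).1 == (val p).2) || ~~ b p then 1 else ch y).

Lemma gibbs_const_gt0 y b : 0 < gibbs_const y b.
Proof.
rewrite mulr_gt0 ?expR_gt0//; apply: prodr_gt0 => p _.
by case: ifP => // _; exact: ch_gt0.
Qed.

Lemma gibbs_weightE (beta theta : R) b s :
  gibbs_weight beta theta (graph_mx b) s =
  gibbs_const (beta / (N%:R * theta)) b * graph_weight (edge_tanh (beta / (N%:R * theta))) b s.
Proof.
rewrite /gibbs_weight; set y := beta / (N%:R * theta).
pose C := off_diag (\matrix_(i, j) (y * (b (opair i j))%:R)).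
have Csym i j : C i j = C j i by rewrite !mxE eq_sym opairC.
have Cdiag i : C i i = 0 by rewrite !mxE eqxx.
have -> : beta / (2 * N%:R * theta) = y / 2 
  by rewrite /y -[RHS]mulrA -invfM (mulrC (_ * theta)) mulrA.
have -> : y / 2 * (\sum_i \sum_j (graph_mx b i j)%:R * spin (s i) * spin (s j)) =
    y / 2 * (\sum_i (b (opair i i))%:R) + 2^-1 * qform C (spins s).
  rewrite /qform !mulr_sumr -big_split.
  apply: eq_bigr => i _ /=; rewrite !mulr_sumr [LHS](bigD1 i)//= [in RHS](bigD1 i)//= Cdiag !mul0r mulr0 add0r.
  congr (_ + _).
    by rewrite mxE /spin; case: (s i); field.
  by apply: eq_bigr => j ij; rewrite !mxE eq_sym (negbTE ij) /spins; field.
rewrite expRD -(sum_bond _ Csym Cdiag) expR_sum /gibbs_const -[RHS]mulrA; congr (_ * _).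
rewrite /graph_weight -big_split; apply: eq_bigr => p _ /=.
rewrite !mxE /edge_tanh opair_val; case: eqP => [_|_] /=; first by rewrite !mul0r expR0; ring.
case: (b p); rewrite /= ?mulr1 ?mulr0 ?mul0r ?expR0 ?addr0 ?mulr1//.
exact: edge_factor (bond_pm s p).
Qed.

Lemma gibbs_mean (beta theta : R) b (h : {ffun 'I_N -> bool} -> R) :
  \sum_s gibbs beta theta (graph_mx b) s * h s =
  avg (fun s => h s * graph_weight (edge_tanh (beta / (N%:R * theta))) b s) /
  avg (graph_weight (edge_tanh (beta / (N%:R * theta))) b).
Proof.
rewrite /avg [((2 ^+ N)^-1 * _)^-1]invfM invrK mulrACA mulVf ?mul1r; last by rewrite expf_neq0// pnatr_eq0.
rewrite mulr_suml; apply: eq_bigr => s _; rewrite /gibbs gibbs_weightE.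
under eq_bigr do rewrite gibbs_weightE.
set y := beta / (N%:R * theta); have D0 := lt0r_neq0 (gibbs_const_gt0 y b).
by rewrite -mulr_sumr -mulf_div mulfV// mul1r mulrAC (mulrC (h s)).
Qed.

Lemma gibbs_ge0 (beta theta : R) (a : 'M[bool]_N) s : 0 <= gibbs beta theta a s.
Proof. by rewrite divr_ge0 ?expR_ge0// sumr_ge0// => t _; exact: expR_ge0. Qed.

Lemma gibbs_sum1 (beta theta : R) (a : 'M[bool]_N) : \sum_s gibbs beta theta a s = 1.
Proof.
rewrite -mulr_suml mulfV// gt_eqF//.
have s0 : {ffun 'I_N -> bool} := [ffun=> true].
rewrite (bigD1 s0)//= ltr_wpDr ?expR_gt0// sumr_ge0// => t _; exact: expR_ge0.
Qed.

End graph_encoding.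

(** * Size of the mean couplings and of the edge variances *)

Section edge_bounds.
Context {R : realType} {N : nat}.
Variables (W : R -> R -> R) (beta theta : R).
Hypothesis gW : graphon W.
Hypothesis N0 : (0 < N)%N.
Hypothesis b0 : 0 < beta.
Hypothesis th01 : 0 < theta <= 1.
Local Notation I := (@pair_le N).
Local Notation y := (beta / (N%:R * theta)).

Definition edge_prob (p : I) : R := theta * W (site (val p).1) (site (val p).2).

Definition mean_edge : 'M[R]_N := off_diag (tnh y *: (theta *: site_mx W N)).

(** Off the diagonal, the variance of [tnh y] times the edge variable. *)
Definition edge_var : 'M[R]_N := off_diag (\matrix_(i, j)
  (tnh y ^+ 2 * (theta * site_mx W N i j) - (tnh y * (theta * site_mx W N i j)) ^+ 2)).

Hypothesis y8 : y <= 8^-1.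

Let N00 : 0 < N%:R :> R. Proof. by rewrite ltr0n. Qed.

Let site_mx01 i j : 0 <= site_mx W N i j <= 1.
Proof. by rewrite mxE; case: gW => _ h _; apply: h; exact: site_in01. Qed.

Let site_mx_sym i j : site_mx W N i j = site_mx W N j i.
Proof. by rewrite !mxE; case: gW => _ _ h; apply: h; exact: site_in01. Qed.

Lemma edge_prob01 p : 0 <= edge_prob p <= 1.
Proof.
have := site_mx01 (val p).1 (val p).2; rewrite /edge_prob mxE; move: (W _ _) => x /andP[x0 x1].
have /andP[t0 t1] := th01.
by rewrite mulr_ge0 ?(ltW t0)//= mulr_ile1// ltW.
Qed.

Let y0 : 0 < y.
Proof. by have /andP[t0 t1] := th01; rewrite divr_gt0// mulr_gt0. Qed.

Let tt : 0 <= tnh y <= 2 * y.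
Proof. by rewrite tnh_ge0 ?(ltW y0)// tnh_le// (ltW y0)//=; apply: le_trans y8 _; lra. Qed.

Let ty : y * theta = beta / N%:R.
Proof. by have /andP[t0 t1] := th01; field; rewrite ?gt_eqF. Qed.

Lemma edge_tanh_ge0 (p : I) : 0 <= edge_tanh y p.
Proof. by rewrite /edge_tanh; case: ifP => // _; have /andP[] := tt. Qed.

Lemma mean_edge_sym i j : mean_edge i j = mean_edge j i.
Proof. by rewrite /mean_edge mxE [RHS]mxE eq_sym; case: ifP => // _; rewrite !mxE -!/(site_mx _ _ _ _) (_ : W _ _ = W (site j) (site i))//; have := site_mx_sym i j; rewrite !mxE. Qed.

Lemma mean_edge_diag i : mean_edge i i = 0.
Proof. by rewrite mxE eqxx. Qed.

Lemma mean_edge_bound i j : 0 <= mean_edge i j <= 2 * (beta / N%:R).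
Proof.
have bN : 0 <= 2 * (beta / N%:R) by rewrite mulr_ge0// divr_ge0// ltW.
rewrite mxE; case: ifP => [_|_]; first by rewrite lexx bN.
have /andP[t0 t1] := tt; have /andP[h0 h1] := th01; have := site_mx01 i j.
rewrite 2![in X in _ -> X]mxE; move: (site_mx W N i j) => x /andP[x0 x1].
have tx : 0 <= theta * x <= theta by rewrite mulr_ge0 ?(ltW h0)//= ler_piMr// ltW.
have /andP[x2 x3] := tx.
rewrite mulr_ge0//= -ty (mulrA 2).
by apply: ler_pM.
Qed.

Lemma mean_edgeE (p : I) : mean_edge (val p).1 (val p).2 = edge_tanh y p * edge_prob p.
Proof. by rewrite /edge_tanh mxE; case: ifP => _; rewrite ?mul0r// !mxE. Qed.

Lemma edge_varE (p : I) : edge_var (val p).1 (val p).2 =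
  edge_tanh y p ^+ 2 * edge_prob p - (edge_tanh y p * edge_prob p) ^+ 2.
Proof.
rewrite /edge_tanh mxE; case: ifP => _; last by rewrite !mxE.
by rewrite expr0n/= !mul0r expr0n/= subr0.
Qed.

Lemma edge_var_sym i j : edge_var i j = edge_var j i.
Proof. by rewrite /edge_var mxE [RHS]mxE eq_sym; case: ifP => // _; rewrite mxE [RHS]mxE site_mx_sym. Qed.

Lemma edge_var_diag i : edge_var i i = 0.
Proof. by rewrite mxE eqxx. Qed.

(** The variance is at most [(2 y)^2 theta], and [y theta = beta / N]; compared with the couplings,
    a factor [y] is gained. *)
Lemma edge_var_bound i j : 0 <= edge_var i j <= 4 * y * (beta / N%:R).
Proof.
have bN : 0 <= 4 * y * (beta / N%:R).
  by rewrite mulr_ge0 ?(mulr_ge0 _ (ltW y0))// divr_ge0// ltW.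
rewrite mxE; case: ifP => [_|_]; first by rewrite lexx bN.
rewrite mxE -ty; have /andP[t0 t1] := tt; have /andP[h0 h1] := th01; have := site_mx01 i j.
move: (site_mx W N i j) => x /andP[x0 x1].
have tx : 0 <= theta * x <= theta by rewrite mulr_ge0 ?(ltW h0)//= ler_piMr// ltW.
have /andP[x2 x3] := tx; have x4 : theta * x <= 1 := le_trans x3 h1.
move: (theta * x) x2 x3 x4 {tx} => z z0 zt z1.
have -> : tnh y ^+ 2 * z - (tnh y * z) ^+ 2 = tnh y ^+ 2 * (z * (1 - z)) by ring.
rewrite mulr_ge0 ?sqr_ge0//=; last by rewrite mulr_ge0// subr_ge0.
have -> : 4 * y * (y * theta) = (2 * y) ^+ 2 * theta by ring.
apply: ler_pM; rewrite ?sqr_ge0//; first by rewrite mulr_ge0// subr_ge0.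
  by rewrite ler_sqr ?nnegrE// mulr_ge0// ltW.
by apply: le_trans zt; rewrite ler_piMr// gerBl.
Qed.

(** The constant is 32 + 14: per pair [4 u r <= 32 y (beta / N)^2] and, by [y <= 1 / 8],
    [7 r^2 <= 14 y (beta / N)^2]. There are at most [N^2] pairs. *)
Lemma edge_error_sum :
  \sum_(p : I) (4 * (edge_tanh y p * edge_prob p) * edge_var (val p).1 (val p).2 +
     7 * edge_var (val p).1 (val p).2 ^+ 2) <= 46 * beta ^+ 2 * y.
Proof.
have yb0 : 0 <= y := ltW y0.
have bN0 : 0 <= beta / N%:R by rewrite divr_ge0// ltW.
apply: (@le_trans _ _ (\sum_(p : I) 46 * y * (beta / N%:R) ^+ 2)).
  apply: ler_sum => p _; rewrite -mean_edgeE.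
  have /andP[u0 u1] := mean_edge_bound (val p).1 (val p).2.
  have /andP[r0 r1] := edge_var_bound (val p).1 (val p).2.
  move: (mean_edge _ _) (edge_var _ _) u0 u1 r0 r1 => u r u0 u1 r0 r1.
  have a1 : u * r <= 2 * (beta / N%:R) * (4 * y * (beta / N%:R)) by apply: ler_pM.
  have a2 : r ^+ 2 <= (4 * y * (beta / N%:R)) ^+ 2 by rewrite ler_sqr ?nnegrE//; exact: le_trans r1.
  have a3 : y * (y * (beta / N%:R) ^+ 2) <= 8^-1 * (y * (beta / N%:R) ^+ 2).
    by rewrite ler_wpM2r// (mulr_ge0 yb0)// sqr_ge0.
  set B := beta / N%:R in a1 a2 a3 *; set Y := y in a1 a2 a3 *.
  have a4 : 4 * u * r <= 32 * Y * B ^+ 2 by rewrite -mulrA; apply: le_trans (ler_wpM2l _ a1) _ => //; rewrite expr2; lra.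
  have a5 : 7 * r ^+ 2 <= 112 * (Y * (Y * B ^+ 2)).
    by apply: le_trans (ler_wpM2l _ a2) _ => //; rewrite le_eqVlt; apply/orP; left; apply/eqP; ring.
  lra.
rewrite sumr_const -[leLHS]mulr_natr.
apply: (@le_trans _ _ (46 * y * (beta / N%:R) ^+ 2 * (N * N)%:R)).
  rewrite ler_wpM2l//; first by rewrite mulr_ge0 ?sqr_ge0// (mulr_ge0 _ yb0).
  rewrite ler_nat card_sig (leq_trans (max_card _))//.
  by rewrite card_prod card_ord.
rewrite natrM le_eqVlt; apply/orP; left; apply/eqP.
by have /andP[t0 _] := th01; field; rewrite ?gt_eqF.
Qed.

Hypothesis bN8 : beta / N%:R <= 8^-1.

Lemma mean_edge_quarter i j : 0 <= mean_edge i j <= 4^-1.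
Proof.
have /andP[h1 h2] := mean_edge_bound i j; rewrite h1/=; apply: le_trans h2 _.
apply: le_trans (ler_wpM2l _ bN8) _ => //; lra.
Qed.

Lemma edge_var_eighth i j : edge_var i j <= 8^-1.
Proof.
have /andP[_] := edge_var_bound i j; move/le_trans; apply.
have yb0 : 0 <= y := ltW y0.
have bN0 : 0 <= beta / N%:R by rewrite divr_ge0// ltW.
apply: (@le_trans _ _ (4 * 8^-1 * 8^-1)); last by lra.
by apply: ler_pM => //; [exact: mulr_ge0|rewrite ler_wpM2l].
Qed.

Local Notation C := (ising_coupling mean_edge).

Let U12 i j : 0 <= mean_edge i j <= 2^-1.
Proof.
have /andP[h1 h2] := mean_edge_quarter i j; rewrite h1/=; apply: le_trans h2 _; lra.
Qed.

Let bNy : beta / N%:R <= y.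
Proof. by have /andP[t0 t1] := th01; rewrite -ty ler_piMr// ltW. Qed.

(** The constant is 8 + 2: 8 for the inverse hyperbolic tangent against its argument, 2 for [tnh y]
    against [y]. *)
Lemma coupling_site_dist i j : i != j ->
  `|C i j - beta / N%:R * site_mx W N i j| <= 10 * y * (beta / N%:R).
Proof.
move=> ij; have bN0 : 0 <= beta / N%:R by rewrite divr_ge0// ltW.
have h1 := ising_coupling_bound U12 i j.
have /andP[u0 u1] := mean_edge_bound i j.
have h2 : 2 * mean_edge i j ^+ 2 <= 8 * y * (beta / N%:R).
  have : mean_edge i j ^+ 2 <= (2 * (beta / N%:R)) ^+ 2.
    by rewrite ler_sqr ?nnegrE//; exact: le_trans u1.
  have := ler_wpM2r bN0 bNy; set B := beta / N%:R; set Y := y => h hu.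
  apply: le_trans (ler_wpM2l _ hu) _ => //; rewrite expr2; lra.
have h3 : `|mean_edge i j - beta / N%:R * site_mx W N i j| <= 2 * y * (beta / N%:R).
  rewrite /mean_edge mxE (negbTE ij) 2!mxE -ty.
  have := site_mx01 i j; move: (site_mx W N i j) => x /andP[x0 x1].
  have /andP[t0 t1] := th01.
  have -> : tnh y * (theta * x) - y * theta * x = (tnh y - y) * (theta * x) by ring.
  have tx : 0 <= theta * x <= theta by rewrite mulr_ge0 ?(ltW t0)//= ler_piMr// ltW.
  have /andP[x2 x3] := tx.
  rewrite normrM (ger0_norm x2).
  have -> : 2 * y * (y * theta) = 2 * y ^+ 2 * theta by ring.
  apply: ler_pM => //; apply: tnh_dist; rewrite (ltW y0)/=; apply: le_trans y8 _; lra.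
have := ler_distD (mean_edge i j) (C i j) (beta / N%:R * site_mx W N i j).
lra.
Qed.

Lemma coupling_bound i j : `|C i j| <= 3 * beta / N%:R.
Proof.
have bN0 : 0 <= beta / N%:R by rewrite divr_ge0// ltW.
have [<-|ij] := eqVneq i j.
  rewrite ising_coupling_diag ?normr0; last exact: mean_edge_diag.
  by rewrite divr_ge0// mulr_ge0// ltW.
have := coupling_site_dist ij; have := site_mx01 i j.
move: (site_mx W N i j) => x /andP[x0 x1] h.
have xb : `|beta / N%:R * x| <= beta / N%:R.
  by rewrite ger0_norm; [rewrite ler_piMr|rewrite mulr_ge0].
have yb : 10 * y * (beta / N%:R) <= 10 * 8^-1 * (beta / N%:R) by rewrite ler_wpM2r// ler_wpM2l.
have := ler_distD (beta / N%:R * x) (C i j) 0; rewrite !subr0 => dd.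
have -> : 3 * beta / N%:R = 10 / 8 * (beta / N%:R) + beta / N%:R + 3 / 4 * (beta / N%:R) by field; rewrite gt_eqF.
apply: (le_trans dd); rewrite -[leLHS]addr0; apply: lerD; last by rewrite mulr_ge0.
by apply: lerD => //; exact: le_trans yb.
Qed.

(** Off the diagonal the entries differ by O(y / N). On it [C] vanishes while [W] may not; these [N]
    entries cost at most [beta^2 / N <= beta * y]. *)
Lemma frob_coupling_dist :
  frob (C - (beta / N%:R) *: site_mx W N) <= 100 * y ^+ 2 * beta ^+ 2 + beta * y.
Proof.
have bN0 : 0 <= beta / N%:R by rewrite divr_ge0// ltW.
have yb0 : 0 <= y := ltW y0.
apply: (@le_trans _ _ (\sum_(i < N) ((\sum_(j < N) (10 * y * (beta / N%:R)) ^+ 2) + (beta / N%:R) ^+ 2))).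
  apply: ler_sum => i _; rewrite (bigD1 i)//= [X in _ <= X + _](bigD1 i)//=.
  rewrite addrAC; apply: lerD; last first.
    apply: ler_sum => j ji; rewrite -(real_normK (num_real ((C - _) i j))) ler_sqr ?nnegrE//; last first.
      by rewrite mulr_ge0// mulr_ge0.
    by rewrite mxE [X in C i j + X]mxE [X in C i j - X]mxE; apply: coupling_site_dist; rewrite eq_sym.
  rewrite mxE [X in C i i + X]mxE [X in C i i - X]mxE ising_coupling_diag; last exact: mean_edge_diag.
  rewrite sub0r sqrrN -[leLHS]add0r; apply: lerD; first exact: sqr_ge0.
  have /andP[x0 x1] := site_mx01 i i.
  have h0 : 0 <= beta / N%:R * site_mx W N i i by rewrite mulr_ge0.
  by rewrite ler_sqr ?nnegrE// ler_piMr.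
rewrite sumr_const card_ord -[leLHS]mulr_natr sumr_const card_ord -[X in X + _]mulr_natr.
have n0 : N%:R != 0 :> R by rewrite gt_eqF.
have -> : ((10 * y * (beta / N%:R)) ^+ 2 * N%:R + (beta / N%:R) ^+ 2) * N%:R =
   100 * y ^+ 2 * beta ^+ 2 + beta * (beta / N%:R).
  by have /andP[t0 _] := th01; field; rewrite ?gt_eqF.
by rewrite lerD2l ler_wpM2l// ltW.
Qed.

End edge_bounds.

(** * Concentration and the limit of the conditional laws *)

Section quenched_limit.
Context {R : realType}.
Variables (W : R -> R -> R) (beta : R) (theta : nat -> R).
Hypothesis gW : graphon W.
Hypothesis rW : riemann_integrable2 W.
Hypothesis b0 : 0 < beta.
Hypothesis q1 : beta * opnorm W < 1.
Hypothesis th01 : forall N, (0 < N)%N -> 0 < theta N <= 1.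
Local Notation y N := (beta / (N%:R * theta N)).
Hypothesis ylim : forall e, 0 < e -> \forall N \near \oo, y N <= e.

Local Notation Gr N := {ffun @pair_le N -> bool}.
Local Notation pr N := (@edge_prob R N W (theta N)).
Local Notation ms := (fun N => bern_mass (pr N)).
Local Notation U N := (@mean_edge R N W beta (theta N)).
Local Notation C N := (ising_coupling (U N)).
Local Notation K N := (ising_const (U N)).
Local Notation gw N b := (graph_weight (@edge_tanh R N (y N)) b).

Lemma near_small_coupling : \forall N \near \oo,
  [/\ (0 < N)%N, y N <= 8^-1 & beta / N%:R <= 8^-1].
Proof.
near=> N.
have N0 : (0 < N)%N by near: N; exact: nbhs_infty_gt.
have yN : y N <= 8^-1 by near: N; apply: ylim.
split=> //; apply: le_trans yN.
have /andP[t0 t1] := th01 N0; have N00 : 0 < N%:R :> R by rewrite ltr0n.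
by rewrite ler_pM2l// lef_pV2 ?posrE ?mulr_gt0// ler_piMr// ltW.
Unshelve. all: by end_near.
Qed.

Lemma frob_coupling_limit (zeta : R) : 0 < zeta ->
  \forall N \near \oo, frob (C N - (beta / N%:R) *: site_mx W N) <= zeta ^+ 2.
Proof.
move=> z0.
pose c := 100 * beta ^+ 2 + beta.
have c0 : 0 < c by rewrite addr_gt0// mulr_gt0// exprn_gt0.
near=> N.
have [N0 y8 bN8] : [/\ (0 < N)%N, y N <= 8^-1 & beta / N%:R <= 8^-1].
  by near: N; exact: near_small_coupling.
have yz : y N <= zeta ^+ 2 / c.
  by near: N; apply: ylim; rewrite divr_gt0// exprn_gt0.
apply: (le_trans (frob_coupling_dist gW N0 b0 (th01 N0) y8 bN8)).
have y0 : 0 <= y N by have /andP[t0 _] := th01 N0; rewrite divr_ge0 ?mulr_ge0// ltW.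
have h : y N * c <= zeta ^+ 2 by rewrite -ler_pdivlMr.
apply: le_trans h; rewrite /c mulrDr (mulrC _ beta); apply: lerD => //.
have -> : 100 * y N ^+ 2 * beta ^+ 2 = y N * (y N * (100 * beta ^+ 2)) by ring.
rewrite ler_wpM2l// -[leRHS]mul1r ler_wpM2r//; first by rewrite mulr_ge0// sqr_ge0.
by apply: le_trans y8 _; lra.
Unshelve. all: by end_near.
Qed.

(** The range of [c] covers both the weight itself and the raised one. The exponent is
    [frob (c *: C N) / (4 * (1 - rho'))] with entries of [C N] at most [3 * beta / N]. *)
Lemma coupling_weight_le N (c rho rho' : R) : (0 < N)%N -> y N <= 8^-1 -> beta / N%:R <= 8^-1 ->
  0 <= c <= 2 -> c * rho <= rho' -> 0 <= rho' < 1 ->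
  (forall x, qform (C N) x <= rho * sqnorm x) ->
  avg (weight (c *: C N)) <= expR (9 * beta ^+ 2 / (1 - rho')).
Proof.
move=> N0 y8 bN8 /andP[c0 c2] cr r01 Cr; have /andP[r0 r1] := r01.
have sC i j : (c *: C N) i j = (c *: C N) j i.
  by rewrite mxE [RHS]mxE (@ising_coupling_sym _ _ (U N))//; exact: (mean_edge_sym beta (theta N) gW N0).
have dC i : (c *: C N) i i = 0.
  by rewrite mxE ising_coupling_diag ?mulr0//; exact: mean_edge_diag.
have qC x : qform (c *: C N) x <= rho' * sqnorm x.
  rewrite qformZ; apply: (le_trans (ler_wpM2l c0 (Cr x))).
  by rewrite mulrA ler_wpM2r// sumr_ge0// => i _; exact: sqr_ge0.
apply: (le_trans (avg_exp_qform sC _ r01 qC)) => [i|]; first by rewrite dC.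
rewrite ler_expR big1 ?mulr0 ?add0r; last by move=> i _; exact: dC.
have F9 := frob_entry_bound (coupling_bound gW N0 b0 (th01 N0) y8 bN8).
rewrite frobZ.
have c4 : c ^+ 2 <= 2 ^+ 2 by rewrite ler_sqr ?nnegrE.
have h : c ^+ 2 * frob (C N) <= 2 ^+ 2 * (3 * beta) ^+ 2.
  by apply: ler_pM; rewrite ?sqr_ge0// sumr_ge0// => i _; apply: sumr_ge0 => j _; exact: sqr_ge0.
rewrite ler_pdivrMr; last by rewrite mulr_gt0// subr_gt0.
have -> : 9 * beta ^+ 2 / (1 - rho') * (4 * (1 - rho')) = 2 ^+ 2 * (3 * beta) ^+ 2.
  by field; rewrite gt_eqF// subr_gt0.
exact: h.
Qed.

Lemma avg_coupling_weight_le : exists K0 : R, \forall N \near \oo, avg (weight (C N)) <= K0.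
Proof.
have [rho r01 rP] := qform_coupling_limit gW rW b0 q1 frob_coupling_limit.
exists (expR (9 * beta ^+ 2 / (1 - rho))); near=> N.
have [N0 y8 bN8] : [/\ (0 < N)%N, y N <= 8^-1 & beta / N%:R <= 8^-1].
  by near: N; exact: near_small_coupling.
rewrite -[C N]scale1r; apply: (@coupling_weight_le N 1 rho rho) => //; rewrite ?mul1r ?ler01 ?ler1n//.
by near: N.
Unshelve. all: by end_near.
Qed.

(** The exponent [n] depends only on the gap, through [(1 + 1 / (n + 1)) rho <= (1 + rho) / 2]; it
    is fixed before [N]. *)
Lemma tilted_weight_le : exists n (M1 : R), 0 < M1 /\ \forall N \near \oo,
  avg (weight ((1 + n.+1%:R^-1) *: C N)) <= M1.
Proof.
have [rho r01 rP] := qform_coupling_limit gW rW b0 q1 frob_coupling_limit.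
have /andP[r0 r1] := r01.
pose n := Num.bound (2 / (1 - rho)).
have d0 : 0 < (1 - rho) / 2 by rewrite divr_gt0// subr_gt0.
have nP : n.+1%:R^-1 <= (1 - rho) / 2.
  rewrite -[leRHS]invrK lef_pV2 ?posrE ?invr_gt0// invf_div.
  have h : 0 <= 2 / (1 - rho) by rewrite divr_ge0// subr_ge0 ltW.
  by have := archi_boundP h; rewrite -/n => /ltW/le_trans; apply; rewrite ler_nat.
exists n, (expR (9 * beta ^+ 2 / (1 - (1 + rho) / 2))); split; first exact: expR_gt0.
near=> N.
have [N0 y8 bN8] : [/\ (0 < N)%N, y N <= 8^-1 & beta / N%:R <= 8^-1].
  by near: N; exact: near_small_coupling.
have n0 : 0 <= n.+1%:R^-1 :> R by rewrite invr_ge0.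
apply: (@coupling_weight_le N _ rho) => //; last by near: N.
- by move: (n.+1%:R^-1) n0 nP => u; lra.
- by move: (n.+1%:R^-1) n0 nP => u; nra.
- by lra.
Unshelve. all: by end_near.
Qed.

(** Chebyshev with [replica_variance]. The constants are chosen in the order [n] and [M1], then [a]
    so that the first term is at most [z / 2], then [L], and [N] last. *)
Lemma partition_concentration (h : forall N, {ffun 'I_N -> bool} -> R) (e : R) :
  (forall N s, `|h N s| <= 1) -> 0 < e ->
  negligibly ms (fun N (b : Gr N) => e <= `|(K N)^-1 * avg (fun s => h N s * gw N b s) -
    avg (fun s => h N s * weight (C N) s)|).
Proof.
move=> h1 e0 eta eta0.
have [n [M1 [M10 MP]]] := tilted_weight_le.
pose z := eta * e ^+ 2.
have z0 : 0 < z by rewrite mulr_gt0// exprn_gt0.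
pose a := z / 2 / M1 ^+ 2.
have a0 : 0 < a by rewrite divr_gt0 ?exprn_gt0// divr_gt0.
(* So that [exp ka - 1 = (z / 2) a^(n + 1)]; half of [ka] is allotted to the choice of [L], half to
   the sum of the edge errors. *)
pose ka := ln (1 + z / 2 * a ^+ n.+1).
have ka0 : 0 < ka.
  by rewrite ln_gt0// ltrDl mulr_gt0 ?divr_gt0// exprn_gt0.
pose L := (Num.bound (4 * expR 1 / ka)).+1.
have LP : 2 * expR 1 / L%:R <= ka / 2.
  have hh : 0 <= 4 * expR 1 / ka by rewrite divr_ge0 ?mulr_ge0 ?expR_ge0// ltW.
  rewrite ler_pdivrMr//.
  have := archi_boundP hh; rewrite ltr_pdivrMr// => /ltW hb.
  have : (Num.bound (4 * expR 1 / ka))%:R <= L%:R :> R by rewrite ler_nat.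
  move/(ler_wpM2r (ltW ka0)); lra.
near=> N.
have [N0 y8 bN8] : [/\ (0 < N)%N, y N <= 8^-1 & beta / N%:R <= 8^-1].
  by near: N; exact: near_small_coupling.
have pr01 := edge_prob01 gW N0 (th01 N0).
have MN : avg (weight ((1 + n.+1%:R^-1) *: C N)) <= M1 by near: N.
have y0 : 0 <= y N by have /andP[t0 _] := th01 N0; rewrite divr_ge0 ?mulr_ge0// ltW.
have N00 : 0 < N%:R :> R by rewrite ltr0n.
have rrL (i j : 'I_N) : n.+2%:R * L%:R * `|edge_var W beta (theta N) i j| <= 2^-1 / N%:R.
  have /andP[r0 r1] := edge_var_bound gW N0 b0 (th01 N0) y8 i j.
  rewrite (ger0_norm r0); apply: (le_trans (ler_wpM2l _ r1)); first by rewrite mulr_ge0.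
  rewrite !mulrA ler_pM2r ?invr_gt0//.
  have : y N <= 2^-1 / (4 * n.+2%:R * L%:R * beta).
    by near: N; apply: ylim; rewrite divr_gt0// !mulr_gt0.
  rewrite ler_pdivlMr ?mulr_gt0//; congr (_ <= _); ring.
have V := replica_variance (@edge_tanh_ge0 R N beta (theta N) N0 b0 (th01 N0) y8) pr01 (mean_edge_sym beta (theta N) gW N0)
  (@mean_edge_diag R N W beta (theta N)) (mean_edge_quarter gW N0 b0 (th01 N0) y8 bN8)
  (@mean_edgeE R N W beta (theta N)) (@edge_varE R N W beta (theta N))
  (fun p => edge_var_eighth gW N0 b0 (th01 N0) y8 bN8 (val p).1 (val p).2)
  (edge_var_sym beta (theta N) gW N0) (@edge_var_diag R N W beta (theta N)) (edge_error_sum gW N0 b0 (th01 N0) y8) (h1 N) a0 MN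
  (ltn0Sn _ : (0 < L)%N) rrL.
apply: (le_trans (bexp_chebyshev pr01 _ _ e0)).
rewrite ler_pdivrMr ?exprn_gt0//; apply: (le_trans V); rewrite -/z [leRHS]splitr; apply: lerD.
  by rewrite /a divfK// expf_neq0// gt_eqF.
rewrite ler_pdivrMr ?exprn_gt0// lerBlDr [leRHS]addrC.
have h2 : 1 + 2 * expR 1 / L%:R <= expR (ka / 2).
  by apply: (le_trans (expR_ge1Dx _)); rewrite ler_expR.
have h3 : expR (n.+2%:R * (46 * beta ^+ 2 * y N)) <= expR (ka / 2).
  rewrite ler_expR.
  have : y N <= ka / 2 / (n.+2%:R * 46 * beta ^+ 2).
    by near: N; apply: ylim; rewrite divr_gt0 ?divr_gt0// mulr_gt0 ?exprn_gt0// mulr_gt0.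
  rewrite ler_pdivlMr; last by rewrite mulr_gt0 ?exprn_gt0// mulr_gt0.
  by congr (_ <= _); ring.
apply: (@le_trans _ _ (expR (ka / 2) * expR (ka / 2))).
  by apply: ler_pM => //; rewrite ?expR_ge0// addr_ge0// divr_ge0// mulr_ge0// expR_ge0.
rewrite -expRD -splitr /ka lnK//.
by rewrite posrE addr_gt0// mulr_gt0 ?divr_gt0// exprn_gt0.
Unshelve. all: by end_near.
Qed.

Lemma graph_weight_gt0 N b s : 0 < gw N b s.
Proof.
have := expR_gt0 (beta / (2 * N%:R * theta N) *
  \sum_(i < N) \sum_(j < N) (graph_mx b i j)%:R * spin (s i) * spin (s j)).
by have := gibbs_weightE beta (theta N) b s; rewrite /gibbs_weight => ->;
  rewrite pmulr_rgt0// gibbs_const_gt0.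
Qed.

Section linear_statistics.
Context {k : nat} (f : 'I_k -> R -> R).
Hypothesis rf : forall j, riemann_integrable (f j).

Local Notation w := (fun N (b : Gr N) => gibbs beta (theta N) (graph_mx b)).
Local Notation X := (fun N (s : {ffun 'I_N -> bool}) => stat_vector f s : 'rV[R]_k).
Local Notation F t N := (fun i : 'I_N => (\sum_a t 0 a * f a (site i)) / Num.sqrt N%:R).

Lemma stat_vector_dot (t : 'rV[R]_k) N (s : {ffun 'I_N -> bool}) :
  ((stat_vector f s : 'rV[R]_k) *m t^T) 0 0 = lin (F t N) s.
Proof.
rewrite mxE /lin; under [RHS]eq_bigr do rewrite mulrAC mulr_suml mulr_suml.
rewrite exchange_big; apply: eq_bigr => a _; rewrite !mxE.
rewrite mulr_sumr mulr_suml; apply: eq_bigr => i _; rewrite /spins; ring.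
Qed.

Lemma stat_vectorE N (s : {ffun 'I_N -> bool}) j :
  (stat_vector f s : 'rV[R]_k) 0 j = lin (fun i : 'I_N => f j (site i) / Num.sqrt N%:R) s.
Proof.
rewrite mxE /lin mulr_sumr; apply: eq_bigr => i _; rewrite /spins; ring.
Qed.

Lemma test_functions_bounded : exists2 M : R, 0 <= M &
  forall j x, `[0, 1]%classic x -> `|f j x| <= M.
Proof.
have [m mP] := choice (fun j => (rf j).1).
exists (\sum_j `|m j|); first by apply: sumr_ge0.
move=> j x hx; apply: (le_trans (mP j x hx)); rewrite (bigD1 j)//=.
by apply: (le_trans (ler_norm _)); rewrite lerDl sumr_ge0.
Qed.

Lemma sqrt_nat_small (c e : R) : 0 < e -> \forall N \near \oo, c / Num.sqrt N%:R <= e.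
Proof.
move=> e0; near=> N.
have N0 : (0 < N)%N by near: N; exact: nbhs_infty_gt.
have s0 : 0 < Num.sqrt N%:R :> R by rewrite sqrtr_gt0 ltr0n.
rewrite ler_pdivrMr// mulrC -ler_pdivrMr//.
apply: (le_trans (ler_norm _)); rewrite -sqrtr_sqr ler_sqrt ?ler0n//.
have h : 0 <= (c / e) ^+ 2 by exact: sqr_ge0.
apply: (le_trans (ltW (archi_boundP h))); rewrite ler_nat.
by near: N; exact: nbhs_infty_ge.
Unshelve. all: by end_near.
Qed.

Lemma expR_half_near (v e : R) : 0 <= v -> 0 < e -> exists2 de, 0 < de &
  forall x, `|x - v| <= de -> `|expR (- (x / 2)) - expR (- v / 2)| <= e.
Proof.
move=> v0 e0; exists (2 * ln (1 + e)); first by rewrite mulr_gt0// ln_gt0// ltrDl.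
move=> x xv; pose u := (v - x) / 2.
have -> : expR (- (x / 2)) = expR (- v / 2) * expR u.
  by rewrite -expRD; congr expR; rewrite /u; field.
rewrite -{2}(mulr1 (expR (- v / 2))) -mulrBr normrM ger0_norm ?expR_ge0//.
have ub : `|u| <= ln (1 + e).
  by rewrite /u normrM distrC (ger0_norm (_ : 0 <= 2^-1)) ?invr_ge0// ler_pdivrMr// mulrC.
have h : `|expR u - 1| <= e.
  apply: (@le_trans _ _ (expR (ln (1 + e)) - 1)); last first.
    by rewrite lnK ?posrE; [rewrite addrC addKr|rewrite addr_gt0].
  by apply: exp_dist_bound; rewrite ler_expR; move: ub; rewrite ler_norml => /andP[].
rewrite -[leRHS]mul1r; apply: ler_pM => //; rewrite ?expR_ge0//.
by rewrite -expR0 ler_expR mulNr oppr_le0 divr_ge0.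
Qed.

Lemma cos_weight_limit (t : 'rV[R]_k) (e : R) : 0 < e -> \forall N \near \oo,
  `|avg (fun s => cos (lin (F t N) s) * weight (C N) s) -
    expR (- (t *m limit_cov beta W f *m t^T) 0 0 / 2) * avg (weight (C N))| <= e.
Proof.
move=> e0; set v := (t *m _ *m _) 0 0.
have v0 : 0 <= v := limit_cov_psd gW rW b0 q1 rf t.
have [M1 M10 M1P] := test_functions_bounded.
pose M := \sum_a `|t 0 a| * M1.
have M0 : 0 <= M by apply: sumr_ge0 => a _; rewrite mulr_ge0.
have [rho r01 rP] := qform_coupling_limit gW rW b0 q1 frob_coupling_limit.
have [K0 K0P] := avg_coupling_weight_le.
pose e1 := e / 2 / (`|K0| + 1).
have k0 : 0 < `|K0| + 1 by rewrite ltr_wpDl.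
have e10 : 0 < e1 by rewrite divr_gt0// divr_gt0.
have [de de0 deP] := expR_half_near v0 e10.
have vP := limit_cov_form gW rW b0 q1 frob_coupling_limit rf t r01 de0 rP.
have e20 : 0 < e / 2 by rewrite divr_gt0.
have sP := sqrt_nat_small (3 * (mom_const rho ((3 * beta) ^+ 2) * (3 * beta) ^+ 2 + M ^+ 2 * K0) * (M / (1 - rho))) e20.
near=> N.
have [N0 y8 bN8] : [/\ (0 < N)%N, y N <= 8^-1 & beta / N%:R <= 8^-1].
  by near: N; exact: near_small_coupling.
have wK : avg (weight (C N)) <= K0 by near: N.
have vN : forall g : 'I_N -> R,
    (forall i, g i - \sum_j C N i j * g j = \sum_a t 0 a * f a (site i)) ->
    `|(\sum_i (\sum_a t 0 a * f a (site i)) * g i) / N%:R - v| <= de by near: N.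
have rN : forall x, qform (C N) x <= rho * sqnorm x by near: N.
have s0 : 0 < Num.sqrt N%:R :> R by rewrite sqrtr_gt0 ltr0n.
have sC i j : C N i j = C N j i.
  by apply: ising_coupling_sym; exact: (mean_edge_sym beta (theta N) gW N0).
have dC i : C N i i = 0 by apply: ising_coupling_diag; exact: mean_edge_diag.
have CB := coupling_bound gW N0 b0 (th01 N0) y8 bN8.
have /andP[r0 r1] := r01.
have [g gP] := solve_coupling (fun i : 'I_N => \sum_a t 0 a * f a (site i)) r1 rN.
have FM (i : 'I_N) : `|F t N i| <= M / Num.sqrt N%:R.
  rewrite normrM normfV (gtr0_norm s0) ler_pM2r ?invr_gt0//.
  apply: (le_trans (ler_norm_sum _ _ _)); apply: ler_sum => a _.
  by rewrite normrM ler_wpM2l// M1P//; exact: site_in01.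
(* Dividing [g] as well as [F] by [sqrt N] turns the discrete variance into the Riemann-sum form of
   [limit_cov_form]. *)
have gF (i : 'I_N) : (fun i => g i / Num.sqrt N%:R) i -
    \sum_j C N i j * (fun i => g i / Num.sqrt N%:R) j = F t N i.
  rewrite /= -gP mulrBl mulr_suml; congr (_ - _).
  by apply: eq_bigr => j _; rewrite mulrA.
have b30 : 0 < 3 * beta by rewrite mulr_gt0.
have cg := avg_cos_gauss N0 sC dC r01 rN (frob_entry_bound CB) b30 CB wK M0 FM gF.
have sN : 3 * (mom_const rho ((3 * beta) ^+ 2) * (3 * beta) ^+ 2 + M ^+ 2 * K0) *
  (M / (1 - rho)) / Num.sqrt N%:R <= e / 2 by near: N.
have {sN}cg := le_trans cg sN.
set E1 := expR (- (_ / 2)) in cg.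
have E1P : `|E1 - expR (- v / 2)| <= e1.
  apply: deP; apply: le_trans (vN g gP).
  rewrite le_eqVlt; apply/orP; left; apply/eqP; congr (`| _ - _ |).
  rewrite mulr_suml; apply: eq_bigr => i _.
  rewrite mulrACA -invfM -expr2 sqr_sqrtr ?ler0n//.
  by rewrite (mulrC (g i)).
have w0 : 0 <= avg (weight (C N)) := le_trans ler01 (avg_weight_ge1 sC dC).
have wE : `|E1 * avg (weight (C N)) - expR (- v / 2) * avg (weight (C N))| <= e / 2.
  rewrite -mulrBl normrM (ger0_norm w0).
  apply: (@le_trans _ _ (e1 * (`|K0| + 1))); last by rewrite /e1 divfK// gt_eqF.
  apply: ler_pM => //; apply: (le_trans wK); apply: (le_trans (ler_norm _)).
  by rewrite lerDl.
rewrite [leRHS]splitr; apply: le_trans (lerD cg wE).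
exact: ler_distD.
Unshelve. all: by end_near.
Qed.

(** The graph weight is even under the global spin flip, the sine is odd. *)
Lemma sin_graph_weight (G : forall N, 'I_N -> R) N (b : Gr N) :
  avg (fun s => sin (lin (G N) s) * gw N b s) = 0.
Proof.
pose neg (s : {ffun 'I_N -> bool}) : {ffun 'I_N -> bool} := [ffun i => ~~ s i].
have negI : injective neg.
  by move=> s u /ffunP h; apply/ffunP => i; move: (h i); rewrite !ffunE => /negb_inj.
have spN s i : spins (neg s) i = - spins s i :> R.
  by rewrite /spins /spin ffunE; case: (s i); rewrite ?opprK.
have h : avg (fun s => sin (lin (G N) s) * gw N b s) = - avg (fun s => sin (lin (G N) s) * gw N b s).
  rewrite -{1}(avg_bij _ negI) -mulN1r -avgZ; apply: eq_avg => s.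
  have -> : lin (G N) (neg s) = - lin (G N) s.
    by rewrite /lin -sumrN; apply: eq_bigr => i _; rewrite spN mulrN.
  rewrite sinN mulN1r mulNr; congr (- (_ * _)); apply: eq_bigr => p _.
  by rewrite /bond !spN mulrNN.
by move: h; set a := avg _ => h; lra.
Qed.

Lemma edge_prob01_all N (p : @pair_le N) : 0 <= pr N p <= 1.
Proof.
have N0 : (0 < N)%N by apply: leq_ltn_trans (ltn_ord (val p).1).
exact: edge_prob01 gW N0 (th01 N0) p.
Qed.

(** Outcomes of mass zero are discarded: on graphs of probability zero the conditional law of the
    spins is not prescribed. *)
Lemma negligibly_near (Q Q' : forall N, Gr N -> bool) :
  (\forall N \near \oo, forall b, bern_mass (pr N) b != 0 -> Q N b -> Q' N b) ->
  negligibly ms Q' -> negligibly ms Q.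
Proof.
move=> QQ' nQ' eta eta0; have h := nQ' eta eta0; near=> N.
have qN : forall b, bern_mass (pr N) b != 0 -> Q N b -> Q' N b by near: N.
have hN : \sum_(b | Q' N b) bern_mass (pr N) b <= eta by near: N.
apply: le_trans hN; rewrite big_mkcond [leRHS]big_mkcond; apply: ler_sum => b _.
have m0 : 0 <= bern_mass (pr N) b := bern_mass_ge0 (@edge_prob01_all N) b.
have [->|b1] := eqVneq (bern_mass (pr N) b) 0; first by rewrite !if_same.
by case: ifPn => [/(qN _ b1) ->//|_]; case: ifP.
Unshelve. all: by end_near.
Qed.

(** By the spin-flip symmetry only the even part of the shifted cosine survives. *)
Lemma point_mean_cos N (b : Gr N) (t : 'rV[R]_k) (c : R) :
  point_mean w X b (fun x => cos ((x *m t^T) 0 0 + c)) =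
  cos c * (avg (fun s => cos (lin (F t N) s) * gw N b s) / avg (gw N b)).
Proof.
rewrite /point_mean gibbs_mean mulrA; congr (_ / _).
have -> : cos c * avg (fun s => cos (lin (F t N) s) * gw N b s) =
   cos c * avg (fun s => cos (lin (F t N) s) * gw N b s) -
   sin c * avg (fun s => sin (lin (F t N) s) * gw N b s).
  by rewrite (sin_graph_weight (fun N => F t N)) mulr0 subr0.
rewrite -2!avgZ -avgB; apply: eq_avg => s.
rewrite (_ : ((X N s) *m t^T) 0 0 = lin (F t N) s); last exact: stat_vector_dot.
rewrite cosD; ring.
Qed.

Lemma scale_ratio (c x z : R) : c != 0 -> c^-1 * x / (c^-1 * z) = x / z.
Proof. by move=> c0; rewrite -mulf_div divff ?invr_eq0// mul1r. Qed.

(** Here [z1 > 1 / 2], and [|z - E * z1| < 3 * de] by passing through [m] and [E * m1]; hence the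
    6. *)
Lemma ratio_near (E m m1 z z1 de : R) : 0 <= E <= 1 -> 1 <= m1 -> de <= 2^-1 ->
  `|z - m| < de -> `|z1 - m1| < de -> `|m - E * m1| <= de -> `|z / z1 - E| < 6 * de.
Proof.
move=> /andP[E0 E1] m11 d2 h1 h2 h3.
have z12 : 2^-1 < z1 by move: h2; rewrite ltr_distl => /andP[h _]; lra.
have z10 : 0 < z1 by lra.
have -> : z / z1 - E = (z - E * z1) / z1 by field; rewrite gt_eqF.
rewrite normrM normfV (gtr0_norm z10) ltr_pdivrMr//.
have h4 : `|E * m1 - E * z1| <= de.
  rewrite -mulrBr normrM (ger0_norm E0) distrC -[leRHS]mul1r.
  by apply: ler_pM => //; exact: ltW.
have d0 : 0 < de := le_lt_trans (normr_ge0 _) h1.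
have : `|z - E * z1| < 3 * de.
  have a1 := ler_distD m z (E * z1); have a2 := ler_distD (E * m1) m (E * z1); lra.
move/lt_le_trans; apply; nra.
Qed.

(** Numerator and partition function concentrate together, so their ratio approaches that of their
    means, which tends to the Gaussian transform. *)
Lemma quenched_char_limit (g : probability (borelType 'rV[R]_k) R) :
  (forall (t : 'rV[R]_k) (c : R), \int[g]_x cos (((x : 'rV[R]_k) *m t^T) 0 0 + c) =
     cos c * expR (- (t *m limit_cov beta W f *m t^T) 0 0 / 2)) ->
  forall (t : 'rV[R]_k) (c e : R), 0 < e ->
  negligibly ms (fun N b => e <= `|point_mean w X b (fun x => cos ((x *m t^T) 0 0 + c)) -
    \int[g]_x cos (((x : 'rV[R]_k) *m t^T) 0 0 + c)|).
Proof.
move=> gP t c e e0; rewrite gP; set E := expR _.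
have E01 : 0 <= E <= 1.
  rewrite expR_ge0/= -expR0 ler_expR mulNr oppr_le0 divr_ge0//.
  exact: (limit_cov_psd gW rW b0 q1 rf t).
pose de := Num.min 2^-1 (e / 6).
have de0 : 0 < de by rewrite lt_min invr_gt0/= ltr0n/= divr_gt0.
have cosb N (s : {ffun 'I_N -> bool}) : `|cos (lin (F t N) s)| <= 1.
  by rewrite ler_norml cos_geN1 cos_le1.
have oneb N (s : {ffun 'I_N -> bool}) : `|1 : R| <= 1 by rewrite normr1.
have h1 := @partition_concentration (fun N s => cos (lin (F t N) s)) de cosb de0.
have h2 := @partition_concentration (fun N s => 1) de oneb de0.
have ms0 N (b : Gr N) : 0 <= bern_mass (pr N) b := bern_mass_ge0 (@edge_prob01_all N) b.
apply: negligibly_near (negligibly_or ms0 h1 h2).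
near=> N => b _; apply: contraLR; rewrite negb_or -!ltNge => /andP[c1 c2].
have wl : `|avg (fun s => cos (lin (F t N) s) * weight (C N) s) - E * avg (weight (C N))| <= de.
  by near: N; exact: cos_weight_limit.
have [N0 y8 bN8] : [/\ (0 < N)%N, y N <= 8^-1 & beta / N%:R <= 8^-1].
  by near: N; exact: near_small_coupling.
have sC i j : C N i j = C N j i.
  by apply: ising_coupling_sym; exact: (mean_edge_sym beta (theta N) gW N0).
have dC i : C N i i = 0 by apply: ising_coupling_diag; exact: mean_edge_diag.
have d2 : de <= 2^-1 by rewrite ge_min lexx.
have d6 : 6 * de <= e by rewrite mulrC -ler_pdivlMr// ge_min lexx orbT.
rewrite 2!(eq_avg (fun s => mul1r (_ s))) in c2.
have rn := ratio_near E01 (avg_weight_ge1 sC dC) d2 c1 c2 wl.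
rewrite point_mean_cos -mulrBr normrM.
apply: lt_le_trans d6; apply: le_lt_trans rn.
rewrite -[leRHS]mul1r; apply: ler_pM => //; first by rewrite ler_norml cos_geN1 cos_le1.
have K0 : K N != 0 by rewrite gt_eqF// expR_gt0.
by rewrite (scale_ratio (avg (fun s => cos (lin (F t N) s) * gw N b s)) (avg (gw N b)) K0).
Unshelve. all: by end_near.
Qed.

(** The graph mean of the rescaled second moments [Y] is bounded by [avg_lin_sqr]. Markov's
    inequality over graphs bounds [Y], and then, where the rescaled partition function exceeds 1/2,
    a second one over spins bounds the Gibbs tail. *)
Lemma quenched_tight (de eta : R) : 0 < de -> 0 < eta -> exists2 L : R, 0 < L &
  \forall N \near \oo,
  \sum_(b : Gr N | de <= \sum_(s | [exists j, L < `|X N s 0 j|]) w N b s) bern_mass (pr N) b <= eta.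
Proof.
move=> de0 eta0.
have [M M0 MP] := test_functions_bounded.
have [rho r01 rP] := qform_coupling_limit gW rW b0 q1 frob_coupling_limit.
pose G j N (i : 'I_N) : R := f j (site i) / Num.sqrt N%:R.
pose B := mom_const rho ((3 * beta) ^+ 2) * (M ^+ 2 + 1).
have /andP[r0 r1] := r01.
have B0 : 0 <= B by rewrite mulr_ge0 ?mom_const_ge0// addr_ge0// sqr_ge0.
pose Y N (b : Gr N) := \sum_j ((K N)^-1 * avg (fun s => lin (G j N) s ^+ 2 * gw N b s)).
have K0 N : 0 < K N by exact: expR_gt0.
have Y0 N (b : Gr N) : 0 <= Y N b.
  apply: sumr_ge0 => j _; rewrite mulr_ge0 ?invr_ge0 ?(ltW (K0 N))//.
  by apply: avg_ge0 => s; rewrite mulr_ge0 ?sqr_ge0// ltW// graph_weight_gt0.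
(* Chosen so that Markov's inequality for [Y] at the level [de * a / 2] gives [eta / 2]; the
   division by 2 there pays for a partition function of only 1/2. *)
pose a := 4 * (k%:R * B + 1) / (de * eta).
have a0 : 0 < a.
  by rewrite divr_gt0 ?mulr_gt0// ltr_wpDl// mulr_ge0.
exists (Num.sqrt a); first by rewrite sqrtr_gt0.
have oneb N (s : {ffun 'I_N -> bool}) : `|1 : R| <= 1 by rewrite normr1.
have h0 : 0 < 2^-1 :> R by [].
have e20 : 0 < eta / 2 by rewrite divr_gt0.
have h2 := @partition_concentration (fun N s => 1) 2^-1 oneb h0 (eta / 2) e20.
have ms0 N (b : Gr N) : 0 <= bern_mass (pr N) b := bern_mass_ge0 (@edge_prob01_all N) b.
near=> N.
have [N0 y8 bN8] : [/\ (0 < N)%N, y N <= 8^-1 & beta / N%:R <= 8^-1].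
  by near: N; exact: near_small_coupling.
have sC i j : C N i j = C N j i.
  by apply: ising_coupling_sym; exact: (mean_edge_sym beta (theta N) gW N0).
have dC i : C N i i = 0 by apply: ising_coupling_diag; exact: mean_edge_diag.
have rN : forall x, qform (C N) x <= rho * sqnorm x by near: N.
have CB := coupling_bound gW N0 b0 (th01 N0) y8 bN8.
have s0 : 0 < Num.sqrt N%:R :> R by rewrite sqrtr_gt0 ltr0n.
have GM j : sqnorm (G j N) <= M ^+ 2 + 1.
  apply: (@le_trans _ _ (\sum_(i < N) (M ^+ 2 / N%:R))).
    apply: ler_sum => i _; rewrite /G expr_div_n sqr_sqrtr ?ler0n// ler_pM2r ?invr_gt0 ?ltr0n//.
    rewrite -(real_normK (num_real (f j (site i)))) ler_sqr ?nnegrE//.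
    by apply: MP; exact: site_in01.
  by rewrite sumr_const card_ord -[leLHS]mulr_natr divfK ?pnatr_eq0 -?lt0n// lerDl.
have M10 : 0 < M ^+ 2 + 1 by rewrite ltr_wpDl ?sqr_ge0.
have EY : bexp (pr N) (Y N) <= k%:R * B.
  rewrite /bexp; under eq_bigr do rewrite mulr_sumr.
  rewrite exchange_big/=; apply: (@le_trans _ _ (\sum_(j < k) B)); last first.
    by rewrite sumr_const card_ord mulr_natl.
  apply: ler_sum => j _.
  have -> : \sum_b bern_mass (pr N) b * ((K N)^-1 * avg (fun s => lin (G j N) s ^+ 2 * gw N b s)) =
      (K N)^-1 * bexp (pr N) (fun b => avg (fun s => lin (G j N) s ^+ 2 * gw N b s)).
    by rewrite -bexpZ.
  rewrite bexp_graph_weight -avgZ.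
  rewrite (eq_avg (h := fun s => lin (G j N) s ^+ 2 * weight (C N) s)).
    exact: avg_lin_sqr sC dC r01 rN (frob_entry_bound CB) M10 (GM j).
  move=> s; have -> : mean_weight (fun p => edge_tanh (y N) p * pr N p) s = K N * weight (C N) s.
    rewrite -mean_weightE.
    - by apply: eq_bigr => p _; rewrite mean_edgeE.
    - exact: (mean_edge_sym beta (theta N) gW N0).
    - exact: mean_edge_diag.
    - move=> i i'; have /andP[u0 u1] := mean_edge_quarter gW N0 b0 (th01 N0) y8 bN8 i i'.
      by rewrite u0/=; apply: le_trans u1 _; lra.
  by rewrite mulrCA mulKf// gt_eqF.
have zN : \sum_(b : Gr N | 2^-1 <= `|(K N)^-1 * avg (fun s => 1 * gw N b s) -
  avg (fun s => 1 * weight (C N) s)|) bern_mass (pr N) b <= eta / 2 by near: N.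
have c0 : 0 < de * a / 2 by rewrite divr_gt0// mulr_gt0.
have mk := bexp_markov (@edge_prob01_all N) c0 (Y0 N).
have mk2 : \sum_(b | de * a / 2 <= Y N b) bern_mass (pr N) b <= eta / 2.
  apply: (le_trans mk); rewrite ler_pdivrMr//; apply: (le_trans EY).
  have -> : eta / 2 * (de * a / 2) = k%:R * B + 1 by rewrite /a; field; rewrite ?gt_eqF.
  by rewrite lerDl.
rewrite [leRHS]splitr; apply: le_trans (lerD zN mk2).
apply: le_trans (sum_or_le ms0 _ _).
rewrite big_mkcond [leRHS]big_mkcond; apply: ler_sum => b _.
case: ifPn => [eb|_]; last by case: ifP.
suff -> : (2^-1 <= `|(K N)^-1 * avg (fun s => 1 * gw N b s) -
  avg (fun s => 1 * weight (C N) s)|) || (de * a / 2 <= Y N b) by [].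
apply: contraLR eb; rewrite negb_or -!ltNge => /andP[t1 t2].
rewrite 2!(eq_avg (fun s => mul1r (_ s))) in t1.
have z1 : 2^-1 < (K N)^-1 * avg (gw N b).
  by move: t1 (avg_weight_ge1 sC dC); rewrite ltr_distl => /andP[h _]; lra.
have z0 : 0 < (K N)^-1 * avg (gw N b) by apply: lt_trans z1.
apply: (@le_lt_trans _ _ (Y N b / ((K N)^-1 * avg (gw N b)) / a)).
  rewrite /Y -mulr_sumr scale_ratio ?gt_eqF// -avg_sum.
  rewrite [X in X / a](_ : _ = \sum_s w N b s * (\sum_j lin (G j N) s ^+ 2)); last first.
    by rewrite gibbs_mean; congr (_ / _); apply: eq_avg => s; rewrite mulr_suml.
  rewrite mulr_suml big_mkcond; apply: ler_sum => s _.
  case: ifPn => [/existsP[j sj]|_]; last first.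
    rewrite divr_ge0 ?(ltW a0)// mulr_ge0 ?gibbs_ge0// sumr_ge0// => j _; exact: sqr_ge0.
  rewrite -mulrA -[leLHS]mulr1 ler_wpM2l ?gibbs_ge0// ler_pdivlMr// mul1r.
  rewrite (bigD1 j)//= -[leLHS]addr0 lerD//; last by rewrite sumr_ge0// => i _; exact: sqr_ge0.
  have <- : (X N s) 0 j = lin (G j N) s by exact: stat_vectorE.
  rewrite -(sqr_sqrtr (ltW a0)) -(real_normK (num_real ((X N s) 0 j))) ler_sqr ?nnegrE ?sqrtr_ge0//.
  exact: ltW.
rewrite ltr_pdivrMr// ltr_pdivrMr//; apply: (lt_trans t2).
by rewrite ltr_pM2l// mulr_gt0.
Unshelve. all: by end_near.
Qed.

Lemma quenched_limit (g : probability (borelType 'rV[R]_k) R) :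
  (forall (t : 'rV[R]_k) (c : R), \int[g]_x cos (((x : 'rV[R]_k) *m t^T) 0 0 + c) =
     cos c * expR (- (t *m limit_cov beta W f *m t^T) 0 0 / 2)) ->
  forall (h : 'rV[R]_k -> R) (M e : R), continuous h -> (forall x, `|h x| <= M) -> 0 < e ->
  negligibly ms (fun N b => e <= `|point_mean w X b h - \int[g]_x h x|).
Proof.
move=> gP h M e ch hM e0.
have ms0 N (b : Gr N) : 0 <= bern_mass (pr N) b := bern_mass_ge0 (@edge_prob01_all N) b.
apply: (bounded_continuous_mean_cvg ms0 _ _ (quenched_char_limit gP) quenched_tight ch hM e0).
- by move=> N b s; exact: gibbs_ge0.
- by move=> N b; exact: gibbs_sum1.
Qed.

End linear_statistics.

End quenched_limit.

(** * Conditional and unconditional laws *)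

Section finite_variables.
Context {d : measure_display} {T : measurableType d} {R : realType}.
Variables (m : probability T R) (I : finType) (Z : T -> I).
Hypothesis mZ : forall i, measurable [set w | Z w = i].

Lemma finite_preimage_bigcup (Q : pred I) :
  [set w | Q (Z w)] = \bigcup_(i in [set` Q]) [set w | Z w = i].
Proof.
apply/seteqP; split=> [w /= Qw|w [i /= Qi Zi]]; first by exists (Z w).
by rewrite /= Zi.
Qed.

Lemma finite_preimage_prob (Q : pred I) :
  m [set w | Q (Z w)] = (\sum_(i | Q i) m [set w | Z w = i])%E.
Proof.
rewrite finite_preimage_bigcup measure_fin_bigcup//; last by move=> i j _ _ [w [/= -> ->]].
by rewrite [RHS]bigfs ?index_enum_uniq// => i _; rewrite mem_index_enum.
Qed.

Lemma integral_finite_variable (phi : I -> R) :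
  \int[m]_w phi (Z w) = \sum_i phi i * fine (m [set w | Z w = i]).
Proof.
have ig i (c : R) : m.-integrable setT (fun w => (c * \1_[set w | Z w = i] w)%:E).
  apply: (@bounded_integrable _ _ _ m (fun w => c * \1_[set w | Z w = i] w) `|c|).
    by apply: measurable_funM => //; exact: measurable_indic.
  move=> w; rewrite normrM -[leRHS]mulr1 ler_wpM2l// indicE.
  by case: (w \in _); rewrite ?normr1 ?normr0.
rewrite /Rintegral.
have -> : (\int[m]_w (phi (Z w))%:E = \int[m]_w (\sum_i (phi i * \1_[set w | Z w = i] w)%:E))%E.
  apply: eq_integral => w _; rewrite sumEFin; congr EFin.
  rewrite (bigD1 (Z w))//= indicE mem_set// mulr1 big1 ?addr0// => i iZ.
  by rewrite indicE memNset ?mulr0//= => zi; rewrite zi eqxx in iZ.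
rewrite integral_sum//=.
have -> : (\sum_i \int[m]_x (phi i * \1_[set w | Z w = i] x)%:E =
    (\sum_i phi i * fine (m [set w | Z w = i]))%:E)%E; last by [].
rewrite -sumEFin; apply: eq_bigr => i _.
under eq_integral do rewrite EFinM.
rewrite integralZl//; last first.
  by have := ig i 1; apply: eq_integrable => // w _; rewrite mul1r.
rewrite integral_indic// setIT EFinM fineK//.
exact: fin_num_measure.
Qed.

End finite_variables.

Section graph_law.
Context {d : measure_display} {T : measurableType d} {R : realType}.
Variables (P : probability T R) (N : nat) (W : R -> R -> R) (theta : R).
Variable A : 'I_N -> 'I_N -> {RV P >-> bool}.
Hypothesis rg : random_graph W theta A.
Hypothesis pr01 : forall p : @pair_le N, 0 <= edge_prob W theta p <= 1.
Local Notation I := (@pair_le N).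

Definition edges (w : T) : {ffun I -> bool} := [ffun p => A (val p).1 (val p).2 w].

Lemma graph_mx_edges w : graph_mx (edges w) = \matrix_(i, j) A i j w.
Proof.
case: rg => sA _ _; apply/matrixP => i j; rewrite !mxE ffunE /=.
by case: ifP => //= _; rewrite sA.
Qed.

Lemma edges_level b : [set w | edges w = b] = graph_event A (graph_mx b).
Proof.
case: rg => sA _ _; apply/seteqP; split=> [w /= <- [i j]|w /= h].
  by rewrite graph_mx_edges mxE.
apply/ffunP => p; rewrite ffunE.
by have := h (val p); rewrite mxE opair_val.
Qed.

Lemma measurable_edges b : measurable [set w | edges w = b].
Proof. by rewrite edges_level; exact: measurable_graph_event. Qed.

Lemma graph_event_prob b :
  P (graph_event A (graph_mx b)) = (bern_mass (edge_prob W theta) b)%:E.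
Proof.
case: rg => sA iA dA.
rewrite -edges_level.
have -> : [set w | edges w = b] =
    \bigcap_(p in [set` [set: I]%SET]) ((fun p : I => A (val p).1 (val p).2) p @^-1` [set b p]).
  apply/seteqP; split=> [w /= <- p _|w /= h]; first by rewrite ffunE.
  by apply/ffunP => p; rewrite ffunE; apply: (h p); rewrite /= inE.
rewrite (iA [set: I]%SET (fun p => [set b p]))// /bern_mass -prodEFin.
apply: eq_big => [p|p _]; first by rewrite inE.
rewrite -[LHS]/(distribution P (A (val p).1 (val p).2) [set b p]) dA; last exact: (valP p).
by rewrite /bernoulli_prob pr01 fsbig_set1 /bernoulli_pmf.
Qed.

Lemma graph_prob (Q : pred {ffun I -> bool}) :
  P [set w | Q (edges w)] = (\sum_(b | Q b) bern_mass (edge_prob W theta) b)%:E.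
Proof.
rewrite (finite_preimage_prob P measurable_edges) -sumEFin; apply: eq_bigr => b _.
by rewrite edges_level graph_event_prob.
Qed.

Variables (beta : R) (sigma : 'I_N -> {RV P >-> bool}).
Hypothesis isg : ising_spins beta theta A sigma.
Variables (k : nat) (f : 'I_k -> R -> R).

Let spins_of w : {ffun 'I_N -> bool} := [ffun i => sigma i w].

Let spins_level s : [set w | spins_of w = s] = [set w | forall i, sigma i w = s i].
Proof.
apply/seteqP; split=> [w /= <- i|w /= h]; first by rewrite ffunE.
by apply/ffunP => i; rewrite ffunE.
Qed.

Let measurable_spins s : measurable [set w | spins_of w = s].
Proof. by rewrite spins_level; exact: measurable_level. Qed.

Lemma integral_stats_law (m : probability T R) (h : 'rV[R]_k -> R) (M : R) :
  continuous h -> (forall x, `|h x| <= M) ->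
  \int[distribution m (linear_stats f sigma)]_x h x =
  \sum_s h (stat_vector f s) * fine (m [set w | forall i, sigma i w = s i]).
Proof.
move=> ch hM; have mh : measurable_fun setT (h : borelType 'rV[R]_k -> R).
  exact: borel_continuous_measurable ch.
transitivity (\int[m]_w (h (stat_vector f (spins_of w)))).
  rewrite /Rintegral integral_distribution//; first exact/measurable_EFinP.
  apply: (@bounded_integrable _ _ _ m (fun w => h (linear_stats f sigma w)) M) => //.
  apply: (measurableT_comp mh); exact: (measurable_funPT (linear_stats f sigma)).
rewrite (integral_finite_variable m measurable_spins (fun s => h (stat_vector f s))).
by apply: eq_bigr => s _; rewrite spins_level.
Qed.

Lemma integral_stats_law_given_graph b (h : 'rV[R]_k -> R) (M : R) :
  continuous h -> (forall x, `|h x| <= M) -> bern_mass (edge_prob W theta) b != 0 ->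
  \int[distribution (given_graph A (graph_mx b)) (linear_stats f sigma)]_x h x =
  \sum_s gibbs beta theta (graph_mx b) s * h (stat_vector f s).
Proof.
move=> ch hM b0; rewrite (integral_stats_law _ ch hM); apply: eq_bigr => s _.
have nz : P (graph_event A (graph_mx b)) != 0%E by rewrite graph_event_prob eqe.
by rewrite (isg nz s) mulrC.
Qed.

(** Total probability over graphs; those of probability zero contribute nothing to either side. *)
Lemma spins_prob (s : {ffun 'I_N -> bool}) : fine (P [set w | forall i, sigma i w = s i]) =
  \sum_b bern_mass (edge_prob W theta) b * gibbs beta theta (graph_mx b) s.
Proof.
set E := [set w | _]; have mE : measurable E by exact: measurable_level.
have -> : P E = (\sum_b P (E `&` [set w | edges w = b]))%E.
  rewrite -[in LHS](setIT E).
  have -> : [set: T] = \bigcup_(b in [set` [pred b : {ffun I -> bool} | true]]) [set w | edges w = b].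
    by apply/seteqP; split=> // w _; exists (edges w).
  rewrite setI_bigcupr measure_fin_bigcup//.
  - by rewrite [RHS]bigfs ?index_enum_uniq// => i _; rewrite mem_index_enum.
  - by move=> i j _ _ [w [/= [_ ->] [_ ->]]].
  - by move=> b _; apply: measurableI => //; exact: measurable_edges.
have pb b : P (E `&` [set w | edges w = b]) =
    (bern_mass (edge_prob W theta) b * gibbs beta theta (graph_mx b) s)%:E.
  have [m0|m0] := eqVneq (bern_mass (edge_prob W theta) b) 0.
    rewrite m0 mul0r; apply/eqP; rewrite eq_le measure_ge0 andbT.
    have <- : P (graph_event A (graph_mx b)) = 0%:E by rewrite graph_event_prob m0.
    rewrite -edges_level; apply: le_measure; rewrite ?inE.
    - by apply: measurableI => //; exact: measurable_edges.
    - exact: measurable_edges.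
    - exact: subIsetr.
  have nz : P (graph_event A (graph_mx b)) != 0%E by rewrite graph_event_prob eqe.
  have fE : P (E `&` graph_event A (graph_mx b)) \is a fin_num.
    by apply: fin_num_measure; apply: measurableI => //; exact: measurable_graph_event.
  have := isg nz s; rewrite /given_graph /cond_prob /= /mnormalize /= /mrestr setTI.
  rewrite (negbTE nz) graph_event_prob /= -/E edges_level -(fineK fE) -EFinM => -[<-]; congr EFin.
  by rewrite mulrC divfK.
by under eq_bigr do rewrite pb; rewrite sumEFin.
Qed.

Lemma integral_stats_law_mean (h : 'rV[R]_k -> R) (M : R) :
  continuous h -> (forall x, `|h x| <= M) ->
  \int[distribution P (linear_stats f sigma)]_x h x =
  \sum_(b : {ffun I -> bool}) bern_mass (edge_prob W theta) b *
    \sum_s gibbs beta theta (graph_mx b) s * h (stat_vector f s).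
Proof.
move=> ch hM; rewrite (integral_stats_law _ ch hM).
under eq_bigr do rewrite spins_prob mulr_sumr.
rewrite exchange_big; apply: eq_bigr => b _; rewrite mulr_sumr; apply: eq_bigr => s _.
by ring.
Qed.

End graph_law.

(** * From test functions to open sets of laws *)

Section weak_neighborhoods.
Context {R : realType}.

Lemma ptws_cvg (I : Type) (F : set_system {ptws I -> R}) (f : {ptws I -> R}) : Filter F ->
  (forall i (e : R), 0 < e -> F [set g | `|f i - g i| < e]) -> F --> f.
Proof.
move=> FF Ff; apply/cvg_sup => i V; rewrite nbhsE => -[B [[V0 oO <-] /= Ofi] BV].
have /nbhs_ballP[e /= e0 eO] : nbhs (f i) V0 by exact: open_nbhs_nbhs.
apply: filterS (Ff i e e0) => g /= fg; apply: BV => /=; exact: eO.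
Qed.

Context {S : ptopologicalType}.
Variables (B : nat -> finType) (ms : forall N, B N -> R) (mu : forall N, B N -> wprob R S).
Variable g : wprob R S.
Arguments mu : clear implicits.
Hypothesis ms0 : forall N b, 0 <= @ms N b.
Hypothesis mug : forall (h : bcont R S) (e : R), 0 < e ->
  negligibly ms (fun N b => e <= `|\int[mu N b]_x sval h x - \int[g]_x sval h x|).

(** Sets that the random law leaves with negligible mass form a filter. Convergence of this filter
    on each bounded continuous function is convergence in the initial topology. *)
Lemma negligibly_open_compl (U : set (wprob R S)) : open U -> U g ->
  negligibly ms (fun N b => `[< ~ U (mu N b) >]).
Proof.
pose F : set_system (wprob R S) := [set V | negligibly ms (fun N b => `[< ~ V (mu N b) >])].
have FF : Filter F.
  split.
  - move=> eta eta0; near=> N; rewrite big_pred0 ?ltW// => b.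
    by apply/asboolP => h; exact: h.
  - move=> V1 V2 h1 h2; apply: (negligibly_sub ms0) (negligibly_or ms0 h1 h2) => N b /asboolP h.
    apply/orP; have [v1|v1] := pselect (V1 (mu N b)).
      by right; apply/asboolP => v2; exact: h.
    by left; apply/asboolP.
  - move=> V1 V2 V12; apply: (negligibly_sub ms0) => N b /asboolP h.
    by apply/asboolP => v1; apply: h; exact: V12.
move=> [V0 oO <-] /= Og.
have cv : @integral_bcont R S @ F --> (@integral_bcont R S g : {ptws _ -> R}).
  apply: ptws_cvg => h e e0.
  apply: (negligibly_sub ms0) (mug h e0) => N b /asboolP /= hh.
  by rewrite leNgt distrC; apply/negP => hl; apply: hh.
exact: (cv V0 (open_nbhs_nbhs (conj oO Og))).
Unshelve. all: by end_near.
Qed.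

End weak_neighborhoods.

Lemma bounded_fun_le (R : realType) (S : Type) (h : S -> R) : bounded_fun h ->
  exists M, forall x, `|h x| <= M.
Proof.
by case=> M [_ hM]; exists (M + 1) => x; apply: hM => //; rewrite ltrDl.
Qed.

Section coupling_vanishes.
Context {R : realType}.

(** Writing [N theta = N^(1/3) * (N^(2/3) theta)] bounds the mean degree below by [c N^(1/3)]. *)
Lemma inv_degree_limit (beta c : R) (theta : nat -> R) : 0 < beta -> 0 < c ->
  (forall N, (0 < N)%N -> 0 < theta N <= 1) ->
  (\forall N \near \oo, c <= N%:R `^ (2 / 3) * theta N) ->
  forall e : R, 0 < e -> \forall N \near \oo, beta / (N%:R * theta N) <= e.
Proof.
move=> b0 c0 th01 cP e e0; pose K := beta / (c * e).
have K0 : 0 < K by rewrite divr_gt0// mulr_gt0.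
near=> N.
have N0 : (0 < N)%N by near: N; exact: nbhs_infty_gt.
have N00 : 0 < N%:R :> R by rewrite ltr0n.
have /andP[t0 t1] := th01 N N0.
have cN : c <= N%:R `^ (2 / 3) * theta N by near: N.
have KN : K <= N%:R `^ (1 / 3).
  have K3 : K ^+ 3 <= N%:R.
    have h : 0 <= K ^+ 3 by rewrite exprn_ge0// ltW.
    apply: (le_trans (ltW (archi_boundP h))); rewrite ler_nat.
    by near: N; exact: nbhs_infty_ge.
  have -> : K = (K ^+ 3) `^ (1 / 3).
    by rewrite -powR_mulrn ?ltW// -powRrM (_ : 3%:R * (1 / 3) = 1 :> R) ?powRr1 ?ltW//; field.
  by rewrite ge0_ler_powR ?nnegrE ?exprn_ge0 ?(ltW K0)// ltW.
have -> : N%:R * theta N = N%:R `^ (1 / 3) * (N%:R `^ (2 / 3) * theta N).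
  rewrite mulrA -powRD; last by apply/implyP => _; rewrite gt_eqF.
  by rewrite (_ : 1 / 3 + 2 / 3 = 1 :> R) ?powRr1 ?ltW//; field.
rewrite ler_pdivrMr; last by rewrite mulr_gt0 ?powR_gt0// mulr_gt0 ?powR_gt0.
apply: (@le_trans _ _ (e * (K * c))).
  by rewrite le_eqVlt; apply/orP; left; apply/eqP; rewrite /K; field; rewrite !gt_eqF.
by rewrite ler_pM2l//; apply: ler_pM => //; exact: ltW.
Unshelve. all: by end_near.
Qed.

End coupling_vanishes.

Theorem mainTheorem1 (R : realType) (d : measure_display)
    (T : measurableType d) (P : probability T R)
    (W : R -> R -> R) (beta : R) (theta : nat -> R)
    (A : forall N : nat, 'I_N -> 'I_N -> {RV P >-> bool})
    (sigma : forall N : nat, 'I_N -> {RV P >-> bool})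
    (k : nat) (f : 'I_k -> R -> R) :
  graphon W ->
  0 < beta < (opnorm W)^-1 ->
  riemann_integrable2 W ->
  riemann_integrable (fun x => W x x) ->
  (0 < graphon_integral W)%E ->
  (forall N : nat, (0 < N)%N -> 0 < theta N <= 1) ->
  (exists2 c : R, 0 < c &
    \forall N \near \oo, c <= N%:R `^ (2 / 3) * theta N) ->
  (exists2 theta_lim : R, 0 <= theta_lim <= 1 & theta @ \oo --> theta_lim) ->
  (forall N : nat, (0 < N)%N -> random_graph W (theta N) (A N)) ->
  (forall N : nat, (0 < N)%N ->
    ising_spins beta (theta N) (A N) (sigma N)) ->
  (0 < k)%N ->
  (forall j, riemann_integrable (f j)) ->
  exists gamma : probability (borelType 'rV[R]_k) R,
    [/\ is_gaussian 0 (limit_cov beta W f) gamma,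
        cvg_weakly_in_probability P
          (fun N => stats_law_given_graph f (A N) (sigma N)) gamma &
        stats_law f (sigma N) @[N --> \oo] -->
          (gamma : wprob R 'rV[R]_k)].
Proof.
move=> gW /andP[b0 bW] rW _ _ th01 [c c0 cP] _ rg isg _ rf.
(* Inversion sends 0 to 0, so the condition on [beta] forces a positive norm. *)
have oW : 0 < opnorm W by rewrite -invr_gt0; exact: lt_trans bW.
have q1 : beta * opnorm W < 1 by rewrite -ltr_pdivlMr// mul1r.
have ylim := inv_degree_limit b0 c0 th01 cP.
have [g [gG gP]] := gaussian_law (limit_cov_sym gW rW b0 q1 rf) (limit_cov_psd gW rW b0 q1 rf).
have Q := quenched_limit gW rW b0 q1 th01 ylim rf gP.
pose Gr N := {ffun @pair_le N -> bool}.
pose pr N := @edge_prob R N W (theta N).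
pose ms N (b : Gr N) := bern_mass (pr N) b.
have pr01 N p : 0 <= pr N p <= 1 := edge_prob01_all gW th01 p.
have ms0 N b : 0 <= ms N b := bern_mass_ge0 (pr01 N) b.
have ms1 N : \sum_b ms N b = 1 by have := bexp_cst (pr N) 1; rewrite /bexp; under eq_bigr do rewrite mulr1.
exists g; split=> //.
- move=> U oU Ug.
  pose mu N (b : Gr N) : wprob R 'rV[R]_k :=
    distribution (given_graph (A N) (graph_mx b)) (linear_stats f (sigma N)).
  have mug (h : bcont R 'rV[R]_k) (e : R) : 0 < e ->
      negligibly ms (fun N b => e <= `|\int[mu N b]_x sval h x - \int[g]_x sval h x|).
    case: h => h [ch bh] /= e0; have [M hM] := bounded_fun_le bh.
    apply: (negligibly_near gW th01) (Q h M e ch hM e0).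
    near=> N => b mb.
    have N0 : (0 < N)%N by near: N; exact: nbhs_infty_gt.
    by rewrite /mu (integral_stats_law_given_graph (rg N N0) (pr01 N) (isg N N0) f ch hM mb).
  have nU := negligibly_open_compl ms0 mug oU Ug.
  (* The event depends on the graph alone, so its probability is a finite sum of Bernoulli
     masses. *)
  have PE N : (0 < N)%N -> P [set w | U (stats_law_given_graph f (A N) (sigma N) w)] =
      (\sum_(b | `[< U (mu N b) >]) ms N b)%:E.
    move=> N0; rewrite -(graph_prob (rg N N0) (pr01 N)); congr (P _).
    apply/seteqP; split=> w /=.
      by rewrite /stats_law_given_graph -(graph_mx_edges (rg N N0)) => h; apply/asboolP.
    by rewrite /stats_law_given_graph -(graph_mx_edges (rg N N0)) => /asboolP.
  apply/fine_cvgP; split.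
    near=> N; have N0 : (0 < N)%N by near: N; exact: nbhs_infty_gt.
    by rewrite PE.
  apply/cvgrPdist_le => eta eta0; near=> N.
  have N0 : (0 < N)%N by near: N; exact: nbhs_infty_gt.
  have UN : \sum_(b | `[< ~ U (mu N b) >]) ms N b <= eta by near: N; exact: nU.
  rewrite /= PE//= -(ms1 N) (bigID (fun b => `[< U (mu N b) >]))/= addrAC subrr add0r ger0_norm.
    by rewrite (eq_bigl (fun b => `[< ~ U (mu N b) >]))// => b; rewrite asbool_neg.
  by apply: sumr_ge0.
(* The unconditional law is a deterministic sequence, treated as a random one over a single outcome
   of mass 1. *)
- have sl (h : bcont R 'rV[R]_k) (e : R) : 0 < e -> negligibly (fun N (_ : unit) => 1 : R)
      (fun N _ => e <= `|\int[stats_law f (sigma N)]_x sval h x - \int[g]_x sval h x|).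
    case: h => h [ch bh] /= e0 eta eta0; have [M0 hM0] := bounded_fun_le bh.
    pose M := `|M0| + 1.
    have M1 : 0 < M by rewrite ltr_wpDl.
    have hM x : `|h x| <= M.
      by apply: (le_trans (hM0 x)); apply: (le_trans (ler_norm _)); rewrite lerDl.
    have mh : measurable_fun setT (h : borelType 'rV[R]_k -> R).
      exact: borel_continuous_measurable ch.
    have Ig : `|\int[g]_x h x| <= M by exact: norm_Rintegral_le.
    set J := \int[g]_x h x in Ig *.
    have e4 : 0 < e / 4 by rewrite divr_gt0.
    have e8 : 0 < e / (8 * M) by rewrite divr_gt0// mulr_gt0.
    have Qe := Q h M (e / 4) ch hM e4 (e / (8 * M)) e8.
    near=> N.
    have N0 : (0 < N)%N by near: N; exact: nbhs_infty_gt.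
    have QN : \sum_(b : Gr N | e / 4 <=
        `|\sum_s gibbs beta (theta N) (graph_mx b) s * h (stat_vector f s) - J|) ms N b <= e / (8 * M).
      by near: N; exact: Qe.
    pose pm (b : Gr N) := \sum_s gibbs beta (theta N) (graph_mx b) s * h (stat_vector f s).
    rewrite -[X in X <= _]/(\sum_(b | e / 4 <= `|pm b - J|) ms N b) in QN.
    rewrite big_pred0; first exact: ltW.
    move=> _; apply/negbTE; rewrite -ltNge.
    rewrite /stats_law (integral_stats_law_mean (rg N N0) (pr01 N) (isg N N0) f ch hM) -/(pm _).
    have -> : \sum_b ms N b * pm b - J = \sum_b ms N b * (pm b - J).
      under [RHS]eq_bigr do rewrite mulrBr.
      by rewrite sumrB -mulr_suml ms1 mul1r.
    have pM b : `|pm b| <= M.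
      apply: (le_trans (ler_norm_sum _ _ _)); rewrite -[leRHS]mul1r -(gibbs_sum1 beta (theta N) (graph_mx b)).
      rewrite mulr_suml; apply: ler_sum => s _; rewrite normrM ger0_norm ?gibbs_ge0//.
      by rewrite ler_wpM2l ?gibbs_ge0.
    (* Graphs whose conditional mean is within [e / 4] keep this bound under averaging; the others
       cost at most [2 * M] each and have small total mass. *)
    apply: (@le_lt_trans _ _ (e / 4 + 2 * M * \sum_(b | e / 4 <= `|pm b - J|) ms N b)).
      apply: (le_trans (ler_norm_sum _ _ _)).
      have e4E : \sum_b e / 4 * ms N b = e / 4 by rewrite -mulr_sumr ms1 mulr1.
      rewrite -[X in _ <= X + _]e4E mulr_sumr [X in _ <= _ + X]big_mkcond -big_split.
      apply: ler_sum => b _ /=; rewrite normrM ger0_norm ?ms0// [leLHS]mulrC.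
      case: ifPn => [eb|]; last by rewrite -ltNge addr0 => /ltW hb; rewrite ler_wpM2r ?ms0.
      rewrite -[leLHS]add0r; apply: lerD; first by rewrite mulr_ge0 ?ms0// ltW.
      rewrite ler_wpM2r ?ms0//; apply: (le_trans (ler_normB _ _)).
      by have := pM b; lra.
    apply: (@le_lt_trans _ _ (e / 4 + 2 * M * (e / (8 * M)))).
      by rewrite lerD2l ler_wpM2l// mulr_ge0// ltW.
    have -> : 2 * M * (e / (8 * M)) = e / 4 by field; rewrite gt_eqF.
    lra.
  move=> V; rewrite nbhsE => -[U [oU Ug] UV].
  have h2 : 0 < 2^-1 :> R by [].
  (* The single outcome has mass 1, so a bound by 1/2 excludes it: the law eventually lies in
     [U]. *)
  have := @negligibly_open_compl R 'rV[R]_k (fun=> unit) (fun N _ => 1 : R)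
    (fun N _ => stats_law f (sigma N)) g (fun _ _ => ler01) sl U oU Ug 2^-1 h2.
  apply: filterS => N /= hN; apply: UV; apply: contrapT => nU.
  move: hN; rewrite (bigD1 tt)/=; last exact/asboolP.
  rewrite big_pred0 ?addr0; last by move=> i; rewrite andbF.
  lra.
Unshelve. all: by end_near.
Qed.
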